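(* (1) For every integer $j$ let $$f_{1,j}(\tau)=2E_2(\tau)-\frac{3+(-1)^j\sqrt{-3}}{6}E_2(\tau/2)-\frac{3-(-1)^j\sqrt{-3}}{6}E_2((\tau+1)/2).$$ Then for all integers $j$ and $\tau\in\mathcal{H}$: $f_{1,j}^3(\tau)=F_{1,j}(\tau)$, $f_{1,j}(\tau)f_{1,j+1}(\tau)=E_4(\tau)$, $f_{1,j}\big(((-1)^j+\sqrt{-3})/2\big)=0$, $f_{1,j}(\tau+1)=f_{1,j+1}(\tau)$, and $f_{1,j}(-1/\tau)=\frac{-1-(-1)^j\sqrt{-3}}{2}\,\tau^2f_{1,j+1}(\tau)$. (2) For every integer $j$ let $$g_{1,j}(\tau)=\frac32E_2(\tau)-\frac14\sum_{\substack{0\le m\le 2\\ m\not\equiv j\pmod 3}}E_2((\tau+m)/3).$$ Then for all integers $j$ and $\tau\in\mathcal{H}$: $g_{1,j}^2(\tau)=G_{1,j}(\tau)$, $g_{1,j}(\tau)g_{1,j+1}(\tau)g_{1,j+2}(\tau)=E_6(\tau)$, $g_{1,j}(-j+\sqrt{-1})=0$, $g_{1,j}(\tau+1)=g_{1,j+1}(\tau)$, and $g_{1,j}(-1/\tau)=\varepsilon_j\tau^2g_{1,j}(\tau)$, where $\varepsilon_j=1$ if $3\mid j$ and $\varepsilon_j=-1$ if $3\nmid j$.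
   Context: $\mathcal{H}$ is the upper half-plane, $q=e^{2\pi i\tau}$. $\eta(\tau)=q^{1/24}\prod_{n\ge1}(1-q^n)$; $E_2=1-24\sum_{n\ge1}\sigma_1(n)q^n$, $E_4=1+240\sum_{n\ge1}\sigma_3(n)q^n$, $E_6=1-504\sum_{n\ge1}\sigma_5(n)q^n$. $\rho=(-1+\sqrt{-3})/2$, $\sqrt{-a}=i\sqrt a$ for $a>0$. $F_{1,j}=E_6-(-1)^j\sqrt{-1728}\,\eta^{12}$ and $G_{1,j}=E_4-12\rho^j\eta^8$.
   Formalization: The identity f_{1,j}^3 = F_{1,j} is false with the stated signs (the q^{1/2} coefficients are 24(-1)^j√-3 and -24(-1)^j√-3); the formal theorem proves f_{1,j}^3 = F_{1,j+1} instead, i.e. the sign of the η^{12} term is corrected. *)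

(* Defs.v *)
From Stdlib Require Import Reals ZArith List.
From Coquelicot Require Import Coquelicot.

Local Open Scope R_scope.
Local Open Scope C_scope.

Definition Cexp (z : C) : C :=
  RtoC (exp (Re z)) * (cos (Im z), sin (Im z)).

(* Integer powers, on the pattern of [powerRZ]. *)
Definition CpowZ (z : C) (j : Z) : C :=
  match j with
  | Z0 => 1
  | Zpos p => z ^ Pos.to_nat p
  | Zneg p => / (z ^ Pos.to_nat p)
  end.

(* [sqrt_neg a] is the square root of [- a] in the upper half-plane,
   for [0 < a]. *)
Definition sqrt_neg (a : R) : C := Ci * RtoC (sqrt a).

(* [iota] selects the unique limit.  The norm on [C_NormedModule] is the
   complex modulus; when there is no limit the value is unspecified. *)
Definition CSeries (a : nat -> C) : C :=
  iota (T := C_CompleteNormedModule)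
    (fun l => is_series (V := C_NormedModule) a l).

Fixpoint Cprod (a : nat -> C) (N : nat) : C :=
  match N with
  | O => 1
  | S N' => Cprod a N' * a N'
  end.

Definition CProduct (a : nat -> C) : C :=
  iota (T := C_CompleteNormedModule)
    (fun l => filterlim (Cprod a) eventually (locally (T := C_NormedModule) l)).

(* [nome x tau] is q^x, read as e^(2 pi i x tau). *)
Definition nome (x : R) (tau : C) : C := Cexp (RtoC (2 * PI * x) * Ci * tau).

(* Sum of the k-th powers of the positive divisors of n, for n > 0. *)
Definition divisor_sigma (k n : nat) : nat :=
  list_sum (map (fun d => Nat.pow d k)
    (filter (fun d => Nat.eqb (Nat.modulo n d) 0) (seq 1 n))).

(* Sum of sigma_k(n) q^n over n >= 1; the index is shifted by one. *)
Definition sigma_series (k : nat) (tau : C) : C :=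
  CSeries (fun n => RtoC (INR (divisor_sigma k (S n))) * nome 1 tau ^ S n).

Definition E2 (tau : C) : C := RtoC 1 - RtoC 24 * sigma_series 1 tau.
Definition E4 (tau : C) : C := RtoC 1 + RtoC 240 * sigma_series 3 tau.
Definition E6 (tau : C) : C := RtoC 1 - RtoC 504 * sigma_series 5 tau.

Definition eta (tau : C) : C :=
  nome (/ 24) tau * CProduct (fun n => RtoC 1 - nome 1 tau ^ S n).

Definition rho : C := (RtoC (-1) + sqrt_neg 3) / RtoC 2.

Definition sgn (j : Z) : C := RtoC (powerRZ (-1) j).

Definition F1 (j : Z) (tau : C) : C :=
  E6 tau - sgn j * sqrt_neg 1728 * eta tau ^ 12.

Definition G1 (j : Z) (tau : C) : C :=
  E4 tau - RtoC 12 * CpowZ rho j * eta tau ^ 8.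

Definition f1 (j : Z) (tau : C) : C :=
  RtoC 2 * E2 tau
  - (RtoC 3 + sgn j * sqrt_neg 3) / RtoC 6 * E2 (tau / RtoC 2)
  - (RtoC 3 - sgn j * sqrt_neg 3) / RtoC 6 * E2 ((tau + RtoC 1) / RtoC 2).

(* [sum_n u 2] is u 0 + u 1 + u 2. *)
Definition g1 (j : Z) (tau : C) : C :=
  RtoC 3 / RtoC 2 * E2 tau
  - RtoC 1 / RtoC 4 *
    sum_n (G := C_AbelianMonoid)
      (fun m => if Z.eqb ((Z.of_nat m - j) mod 3) 0 then RtoC 0
                else E2 ((tau + RtoC (INR m)) / RtoC 3)) 2.

Definition eps_sign (j : Z) : C :=
  if Z.eqb (j mod 3) 0 then RtoC 1 else RtoC (-1).

(* Main.v *)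
(** The idea is a rigidity principle for modular forms that needs no complex analysis. Let h
    be a function of q^(1/N), a locally uniform limit of polynomials on the unit disc, such that
    |h| (Im tau)^k is invariant under tau -> tau + 1 and tau -> -1/tau. By reduction theory it is
    bounded by its supremum M over Im tau >= 17/20; comparing a point of height y with the
    horocycle of height y/2 through a Cauchy estimate for polynomials bounds it there by theta M.
    When h vanishes to sufficiently high order at the cusp, theta < 1, so h = 0. The same argument
    applies to a family of functions permuted by the two substitutions. Each identity of the
    theorem is of this kind, so only finitely many coefficients must be compared; the Hecke
    relations for E2 at 2 and 3, which give the behaviour of f1 and g1 under tau -> -1/tau,
    are further instances.

    The modularity of E4 and E6 comes from rearranging absolutely convergent lattice sums,
    with partial fractions obtained by Herglotz' trick and zeta values from the duplication
    formula. For E2 the rearrangement is made absolutely convergent by subtracting a telescoping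
    sum, whose limit produces the term 6 tau / (pi i). The fourth power of eta is then handled
    by its logarithmic derivative (pi i / 3) E2. *)

Require Import Defs.
From Stdlib Require Import Reals ZArith List Lra Lia.
From Coquelicot Require Import Coquelicot.

Local Open Scope R_scope.
Local Open Scope C_scope.

(** * Limits and series of complex numbers *)

(** The constants of the vanishing argument are tied together. Reduction needs a margin below the
    height sqrt(3)/2 of the corners, whence 17/20; at half that height |q^(1/N)| is exp(-17 pi/(20
    N)), which is below 29/100 for N = 2 and below 45/100 for N = 3. Halving the height costs a
    factor 2^k in weight 2k, while a zero of order v gains r^v/(1 - r), the denominator being the
    price of summing coefficients in place of a maximum principle. The requirement 2^k r^v/(1 - r) <
    1 therefore dictates how far expansions must be compared: order at most 2 at level 2, order at
    most 4 at level 3.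

    A single [f1 j] or [g1 j] is modular, up to roots of unity, only for a proper subgroup. Letting
    the two substitutions permute a family indexed by all integers j keeps the whole argument over
    the fundamental domain of the full group. The remaining obstacle is that [E2] itself is not
    modular: it may enter only in combinations in which the term 6 tau/(pi i) cancels, and the Hecke
    relations are what turns E2(2 tau) and E2(3 tau), produced by inversion, back into the terms
    occurring in [f1] and [g1]. *)

Lemma le_div_of_mul_le (a b c : R) : (0 < c -> a * c <= b -> a <= b / c)%R.
Proof. intros Hc. apply (Rle_div_r a b c Hc). Qed.

Lemma div_le_of_le_mul (a b c : R) : (0 < b -> a <= c * b -> a / b <= c)%R.
Proof. intros Hb. apply (Rle_div_l a c b Hb). Qed.

Lemma exp_le x y : (x <= y -> exp x <= exp y)%R.
Proof. intros [H| ->]; [left; apply exp_increasing; auto|lra]. Qed.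

Lemma im_le_Cmod (z : C) : (Im z <= Cmod z)%R.
Proof.
  eapply Rle_trans; [apply Rle_abs|]. eapply Rle_trans; [|apply Rmax_Cmod]. apply Rmax_r.
Qed.

(** An epsilon form of convergence, convenient for explicit estimates; [ccv_filterlim] and
    [has_sum_is_series] connect it with the limits that [CSeries] and [CProduct] select. *)
Definition ccv (u : nat -> C) (l : C) : Prop :=
  forall eps : R, (0 < eps)%R ->
  exists N, forall n, (N <= n)%nat -> (Cmod (u n - l) < eps)%R.

(** The index N itself is excluded, unlike in [sum_n]; this accounts for the shift in
    [sum_n_csum]. *)
Fixpoint csum (a : nat -> C) (N : nat) : C :=
  match N with O => 0 | S N' => csum a N' + a N' end.

Fixpoint rsum (a : nat -> R) (N : nat) : R :=
  match N with O => 0%R | S N' => (rsum a N' + a N')%R end.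

Definition has_sum (a : nat -> C) (l : C) : Prop := ccv (csum a) l.

(** Only majorants are treated this way: bounded partial sums of nonnegative terms suffice for every
    domination argument, and no value of the sum is ever required. *)
Definition summable (M : nat -> R) : Prop :=
  (forall k, 0 <= M k)%R /\ exists B, forall N, (rsum M N <= B)%R.

Lemma ccv_filterlim (u : nat -> C) (l : C) :
  ccv u l <-> filterlim u eventually (locally (T := C_NormedModule) l).
Proof.
  split; intros H.
  - apply (proj2 (filterlim_locally_ball_norm (K := C_AbsRing) (U := C_NormedModule) u l)).
    intros eps. destruct (H eps (cond_pos eps)) as [N HN]. exists N. exact HN.
  - intros eps He.
    exact (proj1 (filterlim_locally_ball_norm (K := C_AbsRing) (U := C_NormedModule) u l) H (mkposreal eps He)).
Qed.

Lemma sum_n_csum (a : nat -> C) n :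
  sum_n (G := C_NormedModule) a n = csum a (S n).
Proof.
  induction n as [|n IH].
  - rewrite sum_O. simpl. ring.
  - rewrite sum_Sn, IH. reflexivity.
Qed.

Lemma has_sum_is_series (a : nat -> C) l :
  has_sum a l <-> is_series (V := C_NormedModule) a l.
Proof.
  unfold has_sum, is_series. rewrite <- ccv_filterlim. split; intros H eps He.
  - destruct (H eps He) as [N HN]. exists N. intros n Hn.
    rewrite sum_n_csum. apply HN. lia.
  - destruct (H eps He) as [N HN]. exists (S N). intros n Hn.
    destruct n as [|n]; [lia|]. rewrite <- sum_n_csum. apply HN. lia.
Qed.

Lemma CSeries_unique (a : nat -> C) l : has_sum a l -> CSeries a = l.
Proof.
  intros H. apply has_sum_is_series in H.
  exact (iota_filterlim_locally (V := C_CompleteNormedModule) _ _ H).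
Qed.

Lemma CProduct_unique (a : nat -> C) l : ccv (Cprod a) l -> CProduct a = l.
Proof.
  intros H. apply ccv_filterlim in H.
  exact (iota_filterlim_locally (V := C_CompleteNormedModule) _ _ H).
Qed.

Lemma Cmod_sub_sym x y : Cmod (x - y) = Cmod (y - x).
Proof. rewrite <- Cmod_opp. f_equal. ring. Qed.

Lemma Cmod_sub_ge x y : (Cmod x - Cmod y <= Cmod (x - y))%R.
Proof.
  assert (H := Cmod_triangle (x - y) y).
  replace (x - y + y) with x in H by ring. lra.
Qed.

Lemma Cmod_sub_le x y : (Cmod (x - y) <= Cmod x + Cmod y)%R.
Proof. unfold Cminus. rewrite <- (Cmod_opp y). apply Cmod_triangle. Qed.

Lemma Cmod_plus_ge x y : (Cmod x - Cmod y <= Cmod (x + y))%R.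
Proof.
  replace (x + y) with (x - - y) by ring. rewrite <- (Cmod_opp y). apply Cmod_sub_ge.
Qed.

Lemma Cmod_small_eq x y : (forall eps, 0 < eps -> Cmod (x - y) <= eps)%R -> x = y.
Proof.
  intros H. assert (Cmod (x - y) = 0)%R.
  { apply Rle_antisym; [|apply Cmod_ge_0].
    apply le_epsilon. intros e He. rewrite Rplus_0_l. auto. }
  apply Cmod_eq_0 in H0. replace x with (x - y + y) by ring. rewrite H0. ring.
Qed.

Lemma ccv_unique u l l' : ccv u l -> ccv u l' -> l = l'.
Proof.
  intros H H'. apply Cmod_small_eq. intros e He.
  destruct (H (e/2)%R ltac:(lra)) as [N HN]. destruct (H' (e/2)%R ltac:(lra)) as [N' HN'].
  specialize (HN (max N N') ltac:(lia)). specialize (HN' (max N N') ltac:(lia)).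
  replace (l - l') with ((u (max N N') - l') - (u (max N N') - l)) by ring.
  eapply Rle_trans; [apply Cmod_sub_le|]. lra.
Qed.

Lemma ccv_ext u v l : (forall n, u n = v n) -> ccv u l -> ccv v l.
Proof.
  intros E H eps He. destruct (H eps He) as [N HN]. exists N. intros n Hn.
  rewrite <- E. auto.
Qed.

Lemma ccv_const l : ccv (fun _ => l) l.
Proof.
  intros eps He. exists 0%nat. intros. replace (l - l) with (RtoC 0) by ring.
  rewrite Cmod_0. auto.
Qed.

Lemma ccv_plus u v l m : ccv u l -> ccv v m -> ccv (fun n => u n + v n) (l + m).
Proof.
  intros H H' e He.
  destruct (H (e/2)%R ltac:(lra)) as [N HN]. destruct (H' (e/2)%R ltac:(lra)) as [N' HN'].
  exists (max N N'). intros n Hn.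
  specialize (HN n ltac:(lia)). specialize (HN' n ltac:(lia)).
  replace (u n + v n - (l + m)) with ((u n - l) + (v n - m)) by ring.
  eapply Rle_lt_trans; [apply Cmod_triangle|]. lra.
Qed.

Lemma ccv_bounded u l : ccv u l ->
  exists N, forall n, (N <= n)%nat -> (Cmod (u n) <= Cmod l + 1)%R.
Proof.
  intros H. destruct (H 1%R ltac:(lra)) as [N HN]. exists N. intros n Hn.
  specialize (HN n Hn). assert (H1 := Cmod_sub_ge (u n) l). lra.
Qed.

Lemma ccv_mult u v l m : ccv u l -> ccv v m -> ccv (fun n => u n * v n) (l * m).
Proof.
  intros H H' e He.
  destruct (ccv_bounded _ _ H) as [N0 HN0].
  assert (P1 := Cmod_ge_0 l). assert (P2 := Cmod_ge_0 m).
  destruct (H (e / 2 / (Cmod m + 1))%R) as [N HN].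
  { apply Rdiv_lt_0_compat; lra. }
  destruct (H' (e / 2 / (Cmod l + 1))%R) as [N' HN'].
  { apply Rdiv_lt_0_compat; lra. }
  exists (max N0 (max N N')). intros n Hn.
  specialize (HN0 n ltac:(lia)). specialize (HN n ltac:(lia)). specialize (HN' n ltac:(lia)).
  replace (u n * v n - l * m) with (u n * (v n - m) + (u n - l) * m) by ring.
  eapply Rle_lt_trans; [apply Cmod_triangle|]. rewrite !Cmod_mult.
  assert (P3 := Cmod_ge_0 (v n - m)). assert (P4 := Cmod_ge_0 (u n - l)).
  apply Rlt_div_r in HN; [|lra]. apply Rlt_div_r in HN'; [|lra].
  assert (Cmod (u n) * Cmod (v n - m) <= (Cmod l + 1) * Cmod (v n - m))%R.
  { apply Rmult_le_compat_r; auto. }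
  assert (Cmod (u n - l) * Cmod m <= Cmod (u n - l) * (Cmod m + 1))%R.
  { apply Rmult_le_compat_l; lra. }
  lra.
Qed.

Lemma ccv_scal c u l : ccv u l -> ccv (fun n => c * u n) (c * l).
Proof. intros. apply ccv_mult; auto using ccv_const. Qed.

Lemma ccv_minus u v l m : ccv u l -> ccv v m -> ccv (fun n => u n - v n) (l - m).
Proof.
  intros H H'. apply (ccv_ext (fun n => u n + (-(1)) * v n)). intros; ring.
  replace (l - m) with (l + (-(1)) * m) by ring.
  apply ccv_plus; auto using ccv_scal.
Qed.

Lemma ccv_pow u l k : ccv u l -> ccv (fun n => u n ^ k) (l ^ k).
Proof.
  intros H. induction k; simpl. apply ccv_const. apply ccv_mult; auto.
Qed.

Lemma ccv_subseq u l (phi : nat -> nat) :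
  (forall n, (n <= phi n)%nat) -> ccv u l -> ccv (fun n => u (phi n)) l.
Proof.
  intros Hp H eps He. destruct (H eps He) as [N HN]. exists N. intros n Hn.
  apply HN. specialize (Hp n). lia.
Qed.

Lemma ccv_incr u l : ccv (fun n => u (S n)) l <-> ccv u l.
Proof.
  split; intros H.
  - intros eps He. destruct (H eps He) as [N HN]. exists (S N). intros [|n] Hn; [lia|].
    apply HN. lia.
  - apply (ccv_subseq u l S); auto.
Qed.

Lemma ccv_squeeze u l (b : nat -> R) :
  (forall n, Cmod (u n - l) <= b n)%R -> is_lim_seq b 0 -> ccv u l.
Proof.
  intros H Hb eps He. apply is_lim_seq_spec in Hb.
  destruct (Hb (mkposreal eps He)) as [N HN]. exists N. intros n Hn.
  specialize (HN n Hn). simpl in HN. rewrite Rminus_0_r in HN.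
  specialize (H n). apply Rabs_def2 in HN. lra.
Qed.

Lemma ccv_Cmod_le u l B : (forall n, Cmod (u n) <= B)%R -> ccv u l -> (Cmod l <= B)%R.
Proof.
  intros Hu H. apply le_epsilon. intros e He. destruct (H e He) as [N HN].
  specialize (HN N (Nat.le_refl _)). specialize (Hu N).
  assert (X := Cmod_sub_ge l (u N)). rewrite Cmod_sub_sym in X. lra.
Qed.

Lemma ccv_RtoC (u : nat -> R) (l : R) : is_lim_seq u l -> ccv (fun n => RtoC (u n)) l.
Proof.
  intros H eps He. apply is_lim_seq_spec in H.
  destruct (H (mkposreal eps He)) as [N HN]. exists N. intros n Hn.
  specialize (HN n Hn). simpl in HN. rewrite <- RtoC_minus, Cmod_R. auto.
Qed.

Lemma ccv_inv (u : nat -> C) (l : C) : l <> 0 -> ccv u l -> ccv (fun n => / u n) (/ l).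
Proof.
  intros Hl H e He.
  assert (P := proj1 (Cmod_gt_0 l) Hl).
  destruct (H (Cmod l / 2)%R ltac:(lra)) as [N HN].
  destruct (H (e * (Cmod l * Cmod l / 2))%R) as [N' HN'].
  { apply Rmult_lt_0_compat; auto. nra. }
  exists (max N N'). intros n Hn. specialize (HN n ltac:(lia)). specialize (HN' n ltac:(lia)).
  assert (Hg : (Cmod l / 2 < Cmod (u n))%R).
  { assert (X := Cmod_sub_ge l (u n)). rewrite Cmod_sub_sym in X. lra. }
  assert (Hu : u n <> 0) by (apply Cmod_gt_0; lra).
  replace (/ u n - / l) with (- (u n - l) / (u n * l)) by (field; auto).
  rewrite Cmod_div, Cmod_mult, Cmod_opp by (apply Cmult_neq_0; auto).
  apply Rlt_div_l; [nra|]. eapply Rlt_le_trans; [exact HN'|].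
  apply Rmult_le_compat_l; [lra|]. nra.
Qed.

Lemma csum_ext a b N : (forall n, (n < N)%nat -> a n = b n) -> csum a N = csum b N.
Proof.
  induction N; intros H; simpl; auto. rewrite IHN, (H N); auto.
Qed.

Lemma csum_plus a b N : csum (fun n => a n + b n) N = csum a N + csum b N.
Proof. induction N; simpl. ring. rewrite IHN. ring. Qed.

Lemma csum_scal c a N : csum (fun n => c * a n) N = c * csum a N.
Proof. induction N; simpl. ring. rewrite IHN. ring. Qed.

Lemma csum_0 N : csum (fun _ => 0) N = 0.
Proof. induction N; simpl; auto. rewrite IHN. ring. Qed.

Lemma csum_shift a N : csum a (S N) = a 0%nat + csum (fun n => a (S n)) N.
Proof. induction N. simpl; ring. simpl csum in *. rewrite IHN. ring. Qed.

Lemma csum_add a M N : csum a (M + N) = csum a M + csum (fun n => a (M + n)%nat) N.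
Proof.
  induction N; simpl. rewrite Nat.add_0_r. ring.
  rewrite Nat.add_succ_r. simpl. rewrite IHN. ring.
Qed.

Lemma rsum_add a M N : rsum a (M + N) = (rsum a M + rsum (fun n => a (M + n)%nat) N)%R.
Proof.
  induction N; simpl. rewrite Nat.add_0_r. ring.
  rewrite Nat.add_succ_r. simpl. rewrite IHN. ring.
Qed.

Lemma rsum_le a b N : (forall n, (n < N)%nat -> a n <= b n)%R -> (rsum a N <= rsum b N)%R.
Proof.
  induction N; intros H; simpl. lra. assert (X := H N ltac:(lia)).
  assert (rsum a N <= rsum b N)%R by auto. lra.
Qed.

Lemma rsum_ext a b N : (forall n, (n < N)%nat -> a n = b n)%R -> (rsum a N = rsum b N)%R.
Proof. induction N; intros H; simpl; auto. rewrite IHN, (H N); auto. Qed.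

Lemma rsum_scal c a N : (rsum (fun n => c * a n) N = c * rsum a N)%R.
Proof. induction N; simpl. ring. rewrite IHN. ring. Qed.

Lemma rsum_nonneg a N : (forall n, 0 <= a n)%R -> (0 <= rsum a N)%R.
Proof. intros H; induction N; simpl. lra. specialize (H N). lra. Qed.

Lemma Cmod_csum a N : (Cmod (csum a N) <= rsum (fun n => Cmod (a n)) N)%R.
Proof.
  induction N; simpl. rewrite Cmod_0; lra.
  eapply Rle_trans; [apply Cmod_triangle|]. lra.
Qed.

Lemma Cmod_csum_le a M N : (forall n, Cmod (a n) <= M n)%R -> (Cmod (csum a N) <= rsum M N)%R.
Proof.
  intros H. eapply Rle_trans; [apply Cmod_csum|]. apply rsum_le. auto.
Qed.

Lemma summable_le a M : (forall k, 0 <= a k <= M k)%R -> summable M -> summable a.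
Proof.
  intros H [H1 [B HB]]. split. intros; apply H. exists B. intros N.
  eapply Rle_trans; [|apply (HB N)]. apply rsum_le. intros; apply H.
Qed.

Lemma summable_scal c M : (0 <= c)%R -> summable M -> summable (fun k => c * M k)%R.
Proof.
  intros Hc [H1 [B HB]]. split. intros k. apply Rmult_le_pos; auto.
  exists (c * B)%R. intros. rewrite rsum_scal. apply Rmult_le_compat_l; auto.
Qed.

Lemma summable_bound M : summable M -> exists B, (0 < B)%R /\ forall N, (rsum M N <= B)%R.
Proof.
  intros [H1 [B HB]]. exists (B + 1)%R. split. specialize (HB 0%nat). simpl in HB. lra.
  intros N; specialize (HB N); lra.
Qed.

(** The partial sums have a supremum s, and past an index whose partial sum exceeds s - eps less
    than eps is left. *)
Lemma summable_tail M : summable M -> forall eps, (0 < eps)%R ->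
  exists N, forall n, (rsum (fun k => M (N + k)%nat) n <= eps)%R.
Proof.
  intros [H1 [B HB]] eps He.
  destruct (completeness (fun x => exists n, x = rsum M n)) as [s [Hs1 Hs2]].
  { exists B. intros x [n ->]. apply HB. }
  { exists (rsum M 0), 0%nat. auto. }
  destruct (Classical_Prop.classic (exists N, (s - eps < rsum M N)%R)) as [[N HN]|Hn].
  - exists N. intros n. assert (X := Hs1 (rsum M (N + n)) (ex_intro _ _ eq_refl)).
    rewrite rsum_add in X. lra.
  - exfalso. assert (s <= s - eps)%R; [|lra]. apply Hs2. intros x [n ->].
    apply Rnot_lt_le. intros X. apply Hn. eauto.
Qed.

Lemma summable_tail_Cmod a M : (forall k, Cmod (a k) <= M k)%R -> summable M ->
  forall eps, (0 < eps)%R -> exists N, forall m n, (N <= m)%nat -> (m <= n)%nat ->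
  (Cmod (csum a n - csum a m) <= eps)%R.
Proof.
  intros Ha HM eps He. destruct (summable_tail M HM eps He) as [N HN]. exists N.
  intros m n Hm Hn. replace n with (m + (n - m))%nat by lia. rewrite csum_add.
  match goal with |- (Cmod ?x <= _)%R => replace x with (csum (fun k => a (m + k)%nat) (n - m)) by ring end.
  eapply Rle_trans; [apply Cmod_csum_le with (M := fun k => M (m + k)%nat); auto|].
  specialize (HN ((m - N) + (n - m))%nat). rewrite rsum_add in HN.
  assert (X := rsum_nonneg (fun k => M (N + k)%nat) (m - N) (fun k => proj1 HM (N + k)%nat)).
  erewrite rsum_ext. 2:{ intros k _. replace (m + k)%nat with (N + (m - N + k))%nat by lia. reflexivity. }
  lra.
Qed.

(** Completeness of the reals is applied to [Re] and [Im] at once, through an arbitrary real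
    function that is 1-Lipschitz for the modulus. *)
Lemma cauchy_ccv (u : nat -> C) :
  (forall eps, (0 < eps)%R -> exists N, forall m n, (N <= m)%nat -> (m <= n)%nat ->
     (Cmod (u n - u m) <= eps)%R) -> exists l, ccv u l.
Proof.
  intros H.
  assert (K : forall p : C -> R, (forall x y, Rabs (p x - p y) <= Cmod (x - y))%R ->
    exists l, forall eps, (0 < eps)%R -> exists N, forall n, (N <= n)%nat -> (Rabs (p (u n) - l) < eps)%R).
  { intros p Hp. destruct (Rcomplete.R_complete (fun n => p (u n))) as [l Hl].
    - intros eps He. destruct (H (eps / 2)%R ltac:(lra)) as [N HN]. exists N.
      intros n m Hn Hm. unfold Rdist. destruct (Nat.le_ge_cases m n).
      + eapply Rle_lt_trans; [apply Hp|]. assert (X := HN m n Hm H0). lra.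
      + rewrite Rabs_minus_sym. eapply Rle_lt_trans; [apply Hp|]. assert (X := HN n m Hn H0). lra.
    - exists l. intros eps He. destruct (Hl eps He) as [N HN]. exists N. intros n Hn. apply HN. lia. }
  destruct (K Re) as [a Ha].
  { intros x y. replace (Re x - Re y)%R with (Re (x - y)) by reflexivity. apply re_le_Cmod. }
  destruct (K Im) as [b Hb].
  { intros x y. replace (Im x - Im y)%R with (Im (x - y)) by reflexivity.
    eapply Rle_trans; [|apply Rmax_Cmod]. apply Rmax_r. }
  exists (a, b). intros eps He.
  destruct (Ha (eps / 2)%R ltac:(lra)) as [N HN]. destruct (Hb (eps / 2)%R ltac:(lra)) as [N' HN'].
  exists (max N N'). intros n Hn. specialize (HN n ltac:(lia)). specialize (HN' n ltac:(lia)).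
  replace (u n - (a, b)) with (RtoC (Re (u n) - a) + Ci * RtoC (Im (u n) - b)).
  - eapply Rle_lt_trans; [apply Cmod_triangle|]. rewrite Cmod_mult, Cmod_Ci, !Cmod_R. lra.
  - destruct (u n) as [x y]. unfold Re, Im, Cminus, Cplus, Copp, Cmult, RtoC, Ci; simpl.
    f_equal; ring.
Qed.

Lemma summable_has_sum a M : (forall k, Cmod (a k) <= M k)%R -> summable M ->
  has_sum a (CSeries a).
Proof.
  intros Ha HM. destruct (cauchy_ccv (csum a)) as [l Hl].
  { apply (summable_tail_Cmod a M); auto. }
  rewrite (CSeries_unique a l Hl). exact Hl.
Qed.

Lemma has_sum_Cmod_le a l M B : has_sum a l -> (forall k, Cmod (a k) <= M k)%R ->
  (forall N, rsum M N <= B)%R -> (Cmod l <= B)%R.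
Proof.
  intros H Ha HB. apply (ccv_Cmod_le (csum a)); auto. intros n.
  eapply Rle_trans; [|apply HB]. apply Cmod_csum_le; auto.
Qed.

Lemma has_sum_plus a b l m : has_sum a l -> has_sum b m -> has_sum (fun n => a n + b n) (l + m).
Proof.
  intros H H'. unfold has_sum. eapply ccv_ext; [|apply ccv_plus; [exact H|exact H']].
  intros; symmetry; apply csum_plus.
Qed.

Lemma has_sum_scal c a l : has_sum a l -> has_sum (fun n => c * a n) (c * l).
Proof.
  intros H. unfold has_sum. eapply ccv_ext; [|apply ccv_scal; exact H].
  intros; symmetry; apply csum_scal.
Qed.

Lemma has_sum_minus a b l m : has_sum a l -> has_sum b m -> has_sum (fun n => a n - b n) (l - m).
Proof.
  intros H H'. replace (l - m) with (l + (-(1)) * m) by ring.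
  unfold has_sum. eapply ccv_ext; [|apply (has_sum_plus a (fun n => (-(1)) * b n) l _ H (has_sum_scal _ _ _ H'))].
  intros n. apply csum_ext. intros; ring.
Qed.

Lemma has_sum_ext a b l : (forall n, a n = b n) -> has_sum a l -> has_sum b l.
Proof. intros E. apply ccv_ext. intros. apply csum_ext. auto. Qed.

Lemma CSeries_ext a b : (forall n, a n = b n) -> CSeries a = CSeries b.
Proof.
  intros H. f_equal. apply FunctionalExtensionality.functional_extensionality. auto.
Qed.

Lemma has_sum_shift a l : has_sum (fun n => a (S n)) l -> has_sum a (a 0%nat + l).
Proof.
  intros H. apply (proj1 (ccv_incr _ _)).
  eapply ccv_ext. intros n; symmetry; apply csum_shift.
  apply ccv_plus; auto. apply ccv_const.
Qed.

Lemma csum_has_sum (a : nat -> nat -> C) (l : nat -> C) N :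
  (forall i, has_sum (a i) (l i)) -> has_sum (fun j => csum (fun i => a i j) N) (csum l N).
Proof.
  intros H. induction N; simpl.
  - eapply ccv_ext; [|apply ccv_const]. intros; simpl. symmetry; apply csum_0.
  - apply has_sum_plus; auto.
Qed.

(** Dominated convergence for series: one index K makes the tails of all rows and of the limit small
    simultaneously, and on the first K terms the limit is a finite one. *)
Lemma tannery (a : nat -> nat -> C) (l : nat -> C) (M : nat -> R) (A : nat -> C) (L : C) :
  (forall n k, Cmod (a n k) <= M k)%R -> summable M ->
  (forall k, ccv (fun n => a n k) (l k)) ->
  (forall n, has_sum (a n) (A n)) -> has_sum l L -> ccv A L.
Proof.
  intros Ha HM Hl HA HL.
  assert (Hlk : forall k, (Cmod (l k) <= M k)%R).
  { intros k. apply (ccv_Cmod_le (fun n => a n k)); auto. }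
  intros eps He. destruct (summable_tail M HM (eps / 8)%R ltac:(lra)) as [K HK].
  assert (T : forall b B, has_sum b B -> (forall k, Cmod (b k) <= M k)%R ->
    (Cmod (B - csum b K) <= eps / 8)%R).
  { intros b B Hb HbM. apply (ccv_Cmod_le (fun n => csum b (K + n) - csum b K)).
    - intros n. rewrite csum_add.
      match goal with |- (Cmod ?x <= _)%R => replace x with (csum (fun k => b (K + k)%nat) n) by ring end.
      eapply Rle_trans; [|apply (HK n)]. apply Cmod_csum_le. auto.
    - apply ccv_minus; [|apply ccv_const]. apply (ccv_subseq (csum b) B (fun n => (K + n)%nat)); auto.
      intros; lia. }
  assert (F : ccv (fun n => csum (a n) K) (csum l K)).
  { clear - Hl. induction K; simpl. apply ccv_const. apply ccv_plus; auto. }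
  destruct (F (eps / 2)%R ltac:(lra)) as [N HN]. exists N. intros n Hn.
  specialize (HN n Hn). assert (T1 := T _ _ (HA n) (Ha n)). assert (T2 := T _ _ HL Hlk).
  replace (A n - L) with ((A n - csum (a n) K) - (L - csum l K) + (csum (a n) K - csum l K)) by ring.
  eapply Rle_lt_trans; [apply Cmod_triangle|].
  assert (X := Cmod_sub_le (A n - csum (a n) K) (L - csum l K)). lra.
Qed.

(** A majorant of product form is all that the lattice and divisor sums need. The sum of the first I
    rows is a series over the columns, dominated by U * v j, so [tannery] lets I tend to infinity
    inside it. *)
Lemma double_sum_swap (a : nat -> nat -> C) (u v : nat -> R) :
  (forall i j, Cmod (a i j) <= u i * v j)%R -> summable u -> summable v ->
  has_sum (fun i => CSeries (a i)) (CSeries (fun i => CSeries (a i))) /\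
  has_sum (fun j => CSeries (fun i => a i j)) (CSeries (fun i => CSeries (a i))).
Proof.
  intros H Hu Hv.
  destruct (summable_bound u Hu) as [U [HU0 HU]]. destruct (summable_bound v Hv) as [V [HV0 HV]].
  assert (u0 : forall i, (0 <= u i)%R) by apply Hu. assert (v0 : forall i, (0 <= v i)%R) by apply Hv.
  assert (R1 : forall i, has_sum (a i) (CSeries (a i))).
  { intros i. apply (summable_has_sum _ (fun j => u i * v j)%R); auto. apply summable_scal; auto. }
  assert (C1 : forall j, has_sum (fun i => a i j) (CSeries (fun i => a i j))).
  { intros j. apply (summable_has_sum _ (fun i => v j * u i)%R).
    intros i. rewrite Rmult_comm. auto. apply summable_scal; auto. }
  assert (R2 : has_sum (fun i => CSeries (a i)) (CSeries (fun i => CSeries (a i)))).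
  { apply (summable_has_sum _ (fun i => V * u i)%R); [|apply summable_scal; auto; lra].
    intros i. apply (has_sum_Cmod_le (a i) _ (fun j => u i * v j)%R); auto.
    intros N. rewrite rsum_scal. rewrite Rmult_comm. apply Rmult_le_compat_r; auto. }
  split; auto.
  assert (C2 : has_sum (fun j => CSeries (fun i => a i j)) (CSeries (fun j => CSeries (fun i => a i j)))).
  { apply (summable_has_sum _ (fun i => U * v i)%R); [|apply summable_scal; auto; lra].
    intros j. apply (has_sum_Cmod_le (fun i => a i j) _ (fun i => v j * u i)%R); auto.
    intros i; rewrite Rmult_comm; auto.
    intros N. rewrite rsum_scal. rewrite Rmult_comm. apply Rmult_le_compat_r; auto. }
  replace (CSeries (fun i => CSeries (a i))) with (CSeries (fun j => CSeries (fun i => a i j))); auto.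
  eapply ccv_unique; [|exact R2].
  apply (tannery (fun I j => csum (fun i => a i j) I) (fun j => CSeries (fun i => a i j)) (fun j => U * v j)%R).
  - intros I j. eapply Rle_trans. apply (Cmod_csum_le _ (fun i => v j * u i)%R).
    intros i; rewrite Rmult_comm; auto. rewrite rsum_scal. rewrite Rmult_comm. apply Rmult_le_compat_r; auto.
  - apply summable_scal; auto; lra.
  - intros j. apply C1.
  - intros I. apply csum_has_sum. auto.
  - exact C2.
Qed.

(** * The complex exponential and dominating series *)

Lemma Cexp_add x y : Cexp (x + y) = Cexp x * Cexp y.
Proof.
  destruct x as [a b], y as [c d]. unfold Cexp, Cmult, Cplus, RtoC, Re, Im; simpl.
  rewrite exp_plus, cos_plus, sin_plus. f_equal; ring.
Qed.

Lemma Cexp_0 : Cexp 0 = 1.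
Proof.
  unfold Cexp, Cmult, RtoC, Re, Im; simpl. rewrite exp_0, cos_0, sin_0. f_equal; ring.
Qed.

Lemma Cmod_Cexp z : Cmod (Cexp z) = exp (Re z).
Proof.
  unfold Cexp. rewrite Cmod_mult, Cmod_R, Rabs_pos_eq by (left; apply exp_pos).
  unfold Cmod; simpl. replace (cos (Im z) * (cos (Im z) * 1) + sin (Im z) * (sin (Im z) * 1))%R with 1%R.
  - rewrite sqrt_1. ring.
  - assert (H := sin2_cos2 (Im z)). unfold Rsqr in H. lra.
Qed.

Lemma Cexp_neq_0 z : Cexp z <> 0.
Proof. apply Cmod_gt_0. rewrite Cmod_Cexp. apply exp_pos. Qed.

Lemma Cexp_opp z : Cexp (- z) = / Cexp z.
Proof.
  assert (H : Cexp (- z) * Cexp z = 1).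
  { rewrite <- Cexp_add. replace (- z + z) with (RtoC 0) by ring. apply Cexp_0. }
  assert (N := Cexp_neq_0 z). rewrite <- (Cmult_1_l (/ Cexp z)), <- H. field. auto.
Qed.

Lemma Cexp_nat n z : Cexp (RtoC (INR n) * z) = Cexp z ^ n.
Proof.
  induction n.
  - simpl. rewrite Cmult_0_l. apply Cexp_0.
  - rewrite S_INR, RtoC_plus, Cpow_S, <- IHn, <- Cexp_add. f_equal. ring.
Qed.

Lemma Cexp_PI : Cexp (RtoC PI * Ci) = - (1).
Proof.
  unfold Cexp, Cmult, RtoC, Ci, Re, Im, Copp; simpl.
  replace (PI * 0 - 0 * 1)%R with 0%R by ring. replace (PI * 1 + 0 * 0)%R with PI by ring.
  rewrite exp_0, cos_PI, sin_PI. f_equal; ring.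
Qed.

Lemma Cexp_2PI : Cexp (RtoC (2 * PI) * Ci) = 1.
Proof.
  replace (RtoC (2 * PI) * Ci) with (RtoC PI * Ci + RtoC PI * Ci).
  - rewrite Cexp_add, Cexp_PI. ring.
  - rewrite RtoC_mult. ring.
Qed.

Lemma Cexp_polar (r x : R) : Cexp (r, x) = RtoC (exp r) * Cexp (RtoC x * Ci).
Proof.
  replace ((r, x) : C) with (RtoC r + RtoC x * Ci).
  - rewrite Cexp_add. f_equal. unfold Cexp, Cmult, RtoC, Re, Im; simpl.
    rewrite cos_0, sin_0. f_equal; ring.
  - unfold Cmult, Cplus, RtoC, Ci; simpl. f_equal; ring.
Qed.

(** The witness conj(w)/|w| turns a modulus into the real part of a linear functional of norm 1, so
    that real calculus can bound complex differences. *)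
Lemma Cmod_eq_unit_dual (w : C) : exists e : C, (Cmod e <= 1)%R /\ Re (e * w) = Cmod w.
Proof.
  destruct (Ceq_dec w 0) as [->|H].
  - exists 0. rewrite Cmod_0. split. lra. unfold Re, Cmult, RtoC; simpl. ring.
  - assert (P := proj1 (Cmod_gt_0 w) H).
    exists (Cconj w / RtoC (Cmod w)). split.
    + rewrite Cmod_div, Cmod_conj, Cmod_R, Rabs_pos_eq by (try lra; intro E; apply RtoC_inj in E; lra).
      right. field. lra.
    + replace (Cconj w / RtoC (Cmod w) * w) with (RtoC (Cmod w)). reflexivity.
      assert (N : RtoC (Cmod w) <> 0) by (intro E; apply RtoC_inj in E; lra).
      transitivity (RtoC (Cmod w ^ 2) / RtoC (Cmod w)).
      rewrite RtoC_pow. field. auto. rewrite Cmod2_conj. field. auto.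
Qed.

(** After projection on the direction of f(1) - f(0), the real mean value theorem applies to g minus
    the projection, whose derivative is nonnegative. *)
Lemma complex_mean_value (f f' : R -> C) (g g' : R -> R) :
  (forall t, 0 <= t <= 1 -> is_derive (fun s => Re (f s)) t (Re (f' t)))%R ->
  (forall t, 0 <= t <= 1 -> is_derive (fun s => Im (f s)) t (Im (f' t)))%R ->
  (forall t, 0 <= t <= 1 -> is_derive g t (g' t))%R ->
  (forall t, 0 <= t <= 1 -> Cmod (f' t) <= g' t)%R ->
  (Cmod (f 1%R - f 0%R) <= g 1 - g 0)%R.
Proof.
  intros Hr Hi Hg Hle. destruct (Cmod_eq_unit_dual (f 1%R - f 0%R)) as [[p q] [He <-]].
  assert (D : forall t, (0 <= t <= 1)%R -> is_derive (fun s => (g s - (p * Re (f s) - q * Im (f s)))%R) t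
     (g' t - (p * Re (f' t) - q * Im (f' t)))%R).
  { intros t Ht.
    refine (is_derive_minus g (fun s => (p * Re (f s) - q * Im (f s))%R) t _ _ (Hg t Ht) _).
    refine (is_derive_minus (fun s => (p * Re (f s))%R) (fun s => (q * Im (f s))%R) t _ _ _ _).
    exact (is_derive_scal _ t p _ (Hr t Ht)). exact (is_derive_scal _ t q _ (Hi t Ht)). }
  destruct (MVT_gen (fun s => (g s - (p * Re (f s) - q * Im (f s)))%R) 0 1
     (fun t => (g' t - (p * Re (f' t) - q * Im (f' t)))%R)) as [c [Hc E]].
  - intros t Ht. apply D. rewrite Rmin_left, Rmax_right in Ht by lra. lra.
  - intros t Ht. rewrite Rmin_left, Rmax_right in Ht by lra.
    apply continuity_pt_filterlim.
    refine (ex_derive_continuous (K := R_AbsRing) (V := R_NormedModule) _ t (ex_intro _ _ (D t _))). lra.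
  - rewrite Rmin_left, Rmax_right in Hc by lra.
    assert (X : (p * Re (f' c) - q * Im (f' c) <= g' c)%R).
    { replace (p * Re (f' c) - q * Im (f' c))%R with (Re ((p, q) * f' c)) by (destruct (f' c); reflexivity).
      eapply Rle_trans; [apply Rle_abs|]. eapply Rle_trans; [apply re_le_Cmod|].
      rewrite Cmod_mult. eapply Rle_trans; [|apply (Hle c Hc)].
      assert (Y := Cmod_ge_0 (f' c)). nra. }
    replace (Re ((p, q) * (f 1%R - f 0%R))) with
      (p * Re (f 1%R) - q * Im (f 1%R) - (p * Re (f 0%R) - q * Im (f 0%R)))%R.
    + lra.
    + destruct (f 1%R), (f 0%R). unfold Re, Im, Cmult, Cminus, Cplus, Copp; simpl. ring.
Qed.

Ltac cderiv := match goal with z : C |- _ => destruct z as [? ?] end; unfold Cexp, Cmult, Cplus, Cminus, Copp, RtoC, Re, Im; simpl;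
    auto_derive; auto; rewrite ?Rmult_0_l, ?Ropp_0, ?Rplus_0_r, ?Rminus_0_r; field.

Lemma Cexp_taylor1 (x : C) (K : R) : (Cmod x <= K)%R -> (Cmod (Cexp x - 1) <= Cmod x * exp K)%R.
Proof.
  intros HK.
  assert (H := complex_mean_value (fun t => Cexp (RtoC t * x)) (fun t => x * Cexp (RtoC t * x))
    (fun t => Cmod x * exp K * t)%R (fun t => Cmod x * exp K)%R). cbv beta in H.
  replace (Cexp (RtoC 1 * x)) with (Cexp x) in H by (f_equal; ring).
  replace (Cexp (RtoC 0 * x)) with (RtoC 1) in H by (rewrite Cmult_0_l, Cexp_0; ring).
  replace (Cmod x * exp K)%R with (Cmod x * exp K * 1 - Cmod x * exp K * 0)%R by ring.
  apply H; clear H; intros t Ht.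
  - cderiv.
  - cderiv.
  - auto_derive; auto; ring.
  - rewrite Cmod_mult, Cmod_Cexp. apply Rmult_le_compat_l. apply Cmod_ge_0.
    assert (Re (RtoC t * x) <= K)%R.
    { eapply Rle_trans; [apply Rle_abs|]. eapply Rle_trans; [apply re_le_Cmod|].
      rewrite Cmod_mult, Cmod_R, Rabs_pos_eq by lra. assert (X := Cmod_ge_0 x). nra. }
    apply exp_le; auto.
Qed.

(** The derivative in t of the remainder at t x is x times the remainder of the previous order; each
    estimate thus follows from the one before through [complex_mean_value], with a monomial in t as
    majorant. *)
Lemma Cexp_taylor2 (x : C) (K : R) : (Cmod x <= K)%R ->
  (Cmod (Cexp x - 1 - x) <= Cmod x ^ 2 * exp K / 2)%R.
Proof.
  intros HK.
  assert (H := complex_mean_value (fun t => Cexp (RtoC t * x) - 1 - RtoC t * x)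
    (fun t => x * (Cexp (RtoC t * x) - 1))
    (fun t => Cmod x ^ 2 * exp K * t ^ 2 / 2)%R (fun t => Cmod x ^ 2 * exp K * t)%R). cbv beta in H.
  replace (Cexp (RtoC 1 * x) - 1 - RtoC 1 * x - (Cexp (RtoC 0 * x) - 1 - RtoC 0 * x))
    with (Cexp x - 1 - x) in H by (rewrite Cmult_0_l, Cexp_0, Cmult_1_l; ring).
  replace (Cmod x ^ 2 * exp K / 2)%R with (Cmod x ^ 2 * exp K * 1 ^ 2 / 2 - Cmod x ^ 2 * exp K * 0 ^ 2 / 2)%R by field.
  apply H; clear H; intros t Ht.
  - cderiv.
  - cderiv.
  - auto_derive; auto; field.
  - rewrite Cmod_mult.
    assert (N : Cmod (RtoC t * x) = (t * Cmod x)%R) by (rewrite Cmod_mult, Cmod_R, Rabs_pos_eq; lra).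
    assert (X := Cmod_ge_0 x).
    assert (Y := Cexp_taylor1 (RtoC t * x) K ltac:(rewrite N; nra)). rewrite N in Y.
    replace (Cmod x ^ 2 * exp K * t)%R with (Cmod x * (t * Cmod x * exp K))%R by ring.
    apply Rmult_le_compat_l; auto.
Qed.

Lemma Cexp_taylor3 (x : C) (K : R) : (Cmod x <= K)%R ->
  (Cmod (Cexp x - 1 - x - x ^ 2 / 2) <= Cmod x ^ 3 * exp K / 6)%R.
Proof.
  intros HK.
  assert (H := complex_mean_value (fun t => Cexp (RtoC t * x) - 1 - RtoC t * x - RtoC (t * t / 2) * (x * x))
    (fun t => x * (Cexp (RtoC t * x) - 1 - RtoC t * x))
    (fun t => Cmod x ^ 3 * exp K * t ^ 3 / 6)%R (fun t => Cmod x ^ 3 * exp K * t ^ 2 / 2)%R). cbv beta in H.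
  match type of H with _ -> _ -> _ -> _ -> (Cmod ?y <= _)%R => replace y with (Cexp x - 1 - x - x ^ 2 / 2) in H end.
  2:{ rewrite Cmult_0_l, Cexp_0, Cmult_1_l. rewrite !RtoC_div by lra. rewrite !RtoC_mult. field. }
  replace (Cmod x ^ 3 * exp K / 6)%R with (Cmod x ^ 3 * exp K * 1 ^ 3 / 6 - Cmod x ^ 3 * exp K * 0 ^ 3 / 6)%R by field.
  apply H; clear H; intros t Ht.
  - cderiv.
  - cderiv.
  - auto_derive; auto; field.
  - rewrite Cmod_mult.
    assert (N : Cmod (RtoC t * x) = (t * Cmod x)%R) by (rewrite Cmod_mult, Cmod_R, Rabs_pos_eq; lra).
    assert (X := Cmod_ge_0 x).
    assert (Y := Cexp_taylor2 (RtoC t * x) K ltac:(rewrite N; nra)). rewrite N in Y.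
    replace (Cmod x ^ 3 * exp K * t ^ 2 / 2)%R with (Cmod x * ((t * Cmod x) ^ 2 * exp K / 2))%R by field.
    apply Rmult_le_compat_l; auto.
Qed.

(* Partial sums are bounded by telescoping: 1/(n+1)^2 <= 2/(n+1) - 2/(n+2). *)
Lemma summable_inv_sqr : summable (fun n => / INR (S n) ^ 2)%R.
Proof.
  assert (P : forall n, (0 < INR (S n))%R) by (intros; apply lt_0_INR; lia).
  split.
  - intros k. left. apply Rinv_0_lt_compat, pow_lt, P.
  - exists 2%R. intros N.
    assert (rsum (fun n => / INR (S n) ^ 2)%R N <= 2 - 2 / INR (S N))%R.
    { induction N. simpl. lra. specialize (P N).
      change (rsum (fun n => / INR (S n) ^ 2)%R N + / INR (S N) ^ 2 <= 2 - 2 / INR (S (S N)))%R.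
      apply Rle_trans with (2 - 2 / INR (S N) + / INR (S N) ^ 2)%R; [lra|]. clear IHN.
      assert (/ INR (S N) ^ 2 <= 2 / INR (S N) - 2 / INR (S (S N)))%R; [|lra].
      rewrite (S_INR (S N)). assert (1 <= INR (S N))%R by (apply (le_INR 1); lia).
      revert P H. generalize (INR (S N)). intros x Px Hx.
      replace (2 / x - 2 / (x + 1))%R with (/ x ^ 2 * (2 * x / (x + 1)))%R by (field; lra).
      rewrite <- (Rmult_1_r (/ x ^ 2)) at 1. apply Rmult_le_compat_l.
      left; apply Rinv_0_lt_compat; nra. apply Rle_div_r; lra. }
    assert (0 < 2 / INR (S N))%R by (apply Rdiv_lt_0_compat; auto; lra). lra.
Qed.

Lemma summable_of_bound M K q : (0 <= q < 1)%R -> (forall n, 0 <= M n <= K * q ^ n)%R -> summable M.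
Proof.
  intros Hq HM. apply (summable_le _ (fun n => Rabs K * q ^ n)%R).
  - intros n. split. apply HM. eapply Rle_trans. apply HM. apply Rmult_le_compat_r.
    apply pow_le; lra. apply Rle_abs.
  - apply summable_scal. apply Rabs_pos. split. intros; apply pow_le; lra.
    exists (/ (1 - q))%R. intros N.
    assert ((1 - q) * rsum (fun n => q ^ n) N = 1 - q ^ N)%R.
    { induction N; cbn [rsum pow]. ring.
      transitivity ((1 - q) * rsum (fun n => q ^ n) N + (1 - q) * q ^ N)%R. ring. rewrite IHN. ring. }
    assert (0 <= q ^ N)%R by (apply pow_le; lra).
    apply Rmult_le_reg_l with (1 - q)%R. lra. change (pow q) with (fun n => q ^ n)%R.
    rewrite H, Rinv_r; lra.
Qed.

(** Each of the p factors is absorbed by one square root of r: (n + 1) sqrt(r)^n is at most the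
    geometric sum of the powers of sqrt(r), hence at most 1/(1 - sqrt(r)). The induction on p
    therefore replaces r by its square root. *)
Lemma INR_pow_geom_bound p r : (0 <= r < 1)%R ->
  exists K, forall n, (INR (S n) ^ p * r ^ n <= K)%R.
Proof.
  intros Hr. induction p as [|p IH] in r, Hr |- *.
  - exists 1%R. intros n. rewrite pow_O, Rmult_1_l, <- (pow1 n). apply pow_incr. lra.
  - assert (S0 : (0 <= sqrt r < 1)%R).
    { split. apply sqrt_pos. rewrite <- sqrt_1. apply sqrt_lt_1_alt; lra. }
    destruct (IH _ S0) as [K HK].
    assert (B : forall n, (INR (S n) * sqrt r ^ n <= / (1 - sqrt r))%R).
    { intros n. apply Rmult_le_reg_l with (1 - sqrt r)%R. lra. rewrite Rinv_r by lra.
      assert (INR (S n) * sqrt r ^ n <= rsum (fun k => sqrt r ^ k) (S n))%R.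
      { clear - S0. rewrite <- (Rmult_1_l (sqrt r ^ n)).
        assert (forall m, (m <= S n)%nat -> (INR m * (1 * sqrt r ^ n) <= rsum (fun k => sqrt r ^ k) m)%R).
        { induction m; intros Hm. simpl; lra. rewrite S_INR. simpl rsum.
          specialize (IHm ltac:(lia)).
          assert (sqrt r ^ n <= sqrt r ^ m)%R; [|lra].
          replace n with (m + (n - m))%nat by lia. rewrite pow_add.
          assert (0 <= sqrt r ^ m)%R by (apply pow_le; lra).
          assert (sqrt r ^ (n - m) <= 1)%R by (rewrite <- (pow1 (n - m)); apply pow_incr; lra). nra. }
        apply H; auto. }
      assert (forall N, (1 - sqrt r) * rsum (fun n => sqrt r ^ n) N = 1 - sqrt r ^ N)%R.
      { induction N; cbn [rsum pow]. ring.
        transitivity ((1 - sqrt r) * rsum (fun n => sqrt r ^ n) N + (1 - sqrt r) * sqrt r ^ N)%R. ring.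
        rewrite IHN. ring. }
      assert (0 <= sqrt r ^ S n)%R by (apply pow_le; lra).
      specialize (H0 (S n)). nra. }
    exists (/ (1 - sqrt r) * K)%R. intros n.
    replace (INR (S n) ^ S p * r ^ n)%R with ((INR (S n) * sqrt r ^ n) * (INR (S n) ^ p * sqrt r ^ n))%R.
    + assert (0 <= INR (S n))%R by apply pos_INR. assert (0 <= sqrt r ^ n)%R by (apply pow_le; lra).
      apply Rmult_le_compat; auto. apply Rmult_le_pos; auto. apply Rmult_le_pos; auto.
      apply pow_le; auto.
    + rewrite <- (sqrt_sqrt r) at 3 by lra. rewrite Rpow_mult_distr. simpl. ring.
Qed.

Lemma summable_pow_geom p r : (0 <= r < 1)%R -> summable (fun n => INR (S n) ^ p * r ^ n)%R.
Proof.
  intros Hr.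
  assert (S0 : (0 <= sqrt r < 1)%R).
  { split. apply sqrt_pos. rewrite <- sqrt_1. apply sqrt_lt_1_alt; lra. }
  destruct (INR_pow_geom_bound p _ S0) as [K HK].
  apply (summable_of_bound _ K (sqrt r) S0). intros n. split.
  - apply Rmult_le_pos. apply pow_le, pos_INR. apply pow_le; lra.
  - rewrite <- (sqrt_sqrt r) at 1 by lra. rewrite Rpow_mult_distr, <- Rmult_assoc.
    apply Rmult_le_compat_r; auto. apply pow_le; lra.
Qed.

(** * Functions on the unit disc approximable by polynomials *)

Fixpoint horner (c : list C) (x : C) : C :=
  match c with nil => 0 | (a :: c')%list => a + x * horner c' x end.

Fixpoint evens (c : list C) : list C :=
  match c with (a :: _ :: c')%list => (a :: evens c')%list | _ => c end.

Fixpoint odds (c : list C) : list C :=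
  match c with (_ :: b :: c')%list => (b :: odds c')%list | _ => nil end.

Lemma list_pair_ind (P : list C -> Prop) :
  P nil -> (forall a, P (a :: nil)%list) -> (forall a b c, P c -> P (a :: b :: c)%list) ->
  forall c, P c.
Proof.
  intros H0 H1 H2. fix IH 1. intros [|a [|b c]].
  exact H0. exact (H1 a). exact (H2 a b c (IH c)).
Qed.

Lemma horner_split c x : horner c x = horner (evens c) (x * x) + x * horner (odds c) (x * x).
Proof.
  induction c as [|a|a b c IH] using list_pair_ind; simpl; try ring. rewrite IH. ring.
Qed.

Lemma nth_evens n c : nth n (evens c) 0 = nth (2 * n) c 0.
Proof.
  revert n; induction c as [|a|a b c IH] using list_pair_ind; intros [|n]; simpl; auto.
  - destruct n; auto.
  - rewrite Nat.add_succ_r. rewrite IH. reflexivity.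
Qed.

Lemma nth_odds n c : nth n (odds c) 0 = nth (S (2 * n)) c 0.
Proof.
  revert n; induction c as [|a|a b c IH] using list_pair_ind; intros [|n]; simpl; auto.
  rewrite Nat.add_succ_r. rewrite IH. reflexivity.
Qed.

Lemma length_evens_odds c : (length (evens c) + length (odds c) = length c)%nat.
Proof.
  induction c as [|a|a b c IH] using list_pair_ind; simpl; auto. lia.
Qed.

Definition cis (t : R) : C := Cexp (RtoC t * Ci).

Lemma Cmod_cis t : Cmod (cis t) = 1%R.
Proof.
  unfold cis. rewrite Cmod_Cexp. unfold Re, Cmult, RtoC, Ci; simpl.
  replace (t * 0 - 0 * 1)%R with 0%R by ring. apply exp_0.
Qed.

Lemma cis_add s t : cis (s + t) = cis s * cis t.
Proof. unfold cis. rewrite <- Cexp_add, RtoC_plus. f_equal. ring. Qed.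

Lemma Cmod_polar r t : (0 <= r)%R -> Cmod (RtoC r * cis t) = r.
Proof. intros H. rewrite Cmod_mult, Cmod_cis, Cmod_R, Rabs_pos_eq; lra. Qed.

(* Splitting into even and odd parts halves the length, and squaring maps the circle of
   radius [r] onto the one of radius [r^2]; this replaces Cauchy's integral formula. *)
Lemma cauchy_estimate c : forall (r M : R), (0 < r)%R ->
  (forall t, Cmod (horner c (RtoC r * cis t)) <= M)%R ->
  forall n, (Cmod (nth n c 0) * r ^ n <= M)%R.
Proof.
  remember (length c) as L eqn:HL. revert c HL.
  induction L as [L IH] using lt_wf_ind. intros c HL r M Hr HM n.
  assert (M0 : (0 <= M)%R). { eapply Rle_trans. apply Cmod_ge_0. apply (HM 0%R). }
  destruct c as [|a [|b c]].
  - destruct n; simpl; rewrite Cmod_0; lra.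
  - destruct n as [|n].
    + specialize (HM 0%R). simpl in HM. simpl. rewrite Rmult_1_r.
      replace (a + RtoC r * cis 0 * 0) with a in HM by ring. auto.
    + destruct n; simpl; rewrite Cmod_0; lra.
  - assert (Hlen := length_evens_odds (a :: b :: c)%list).
    set (d := (a :: b :: c)%list) in *.
    assert (Le : (length (evens d) < L)%nat).
    { subst L. assert (0 < length (odds d))%nat by (simpl; lia). lia. }
    assert (Lo : (length (odds d) < L)%nat).
    { subst L. assert (0 < length (evens d))%nat by (simpl; lia). lia. }
    assert (Half : forall t, RtoC (r * r) * cis t =
      (RtoC r * cis (t / 2)) * (RtoC r * cis (t / 2))).
    { intros t. replace (cis t) with (cis (t / 2) * cis (t / 2)).
      rewrite RtoC_mult. ring. rewrite <- cis_add. f_equal. field. }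
    assert (Opp : forall t, (Cmod (horner d (- (RtoC r * cis t))) <= M)%R).
    { intros t. replace (- (RtoC r * cis t)) with (RtoC r * cis (t + PI)). auto.
      rewrite cis_add. unfold cis at 2. rewrite Cexp_PI. ring. }
    assert (E1 : forall t, (Cmod (horner (evens d) (RtoC (r * r) * cis t)) <= M)%R).
    { intros t. rewrite Half. set (x := RtoC r * cis (t / 2)).
      replace (horner (evens d) (x * x)) with ((horner d x + horner d (- x)) / 2).
      - rewrite Cmod_div, Cmod_R, Rabs_pos_eq by (try lra; intro E; apply RtoC_inj in E; lra).
        apply Rle_div_l; [lra|]. eapply Rle_trans; [apply Cmod_triangle|].
        unfold x. specialize (HM (t/2)%R). specialize (Opp (t/2)%R). lra.
      - rewrite (horner_split d x), (horner_split d (- x)).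
        replace (- x * - x) with (x * x) by ring. field. }
    assert (E2 : forall t, (Cmod (horner (odds d) (RtoC (r * r) * cis t)) <= M / r)%R).
    { intros t. rewrite Half. set (x := RtoC r * cis (t / 2)).
      assert (Hx : Cmod x = r) by (apply Cmod_polar; lra).
      apply (proj1 (Rle_div_r _ _ r Hr)). rewrite <- Hx, <- Cmod_mult.
      replace (horner (odds d) (x * x) * x) with ((horner d x - horner d (- x)) / 2).
      - rewrite Cmod_div, Cmod_R, Rabs_pos_eq by (try lra; intro E; apply RtoC_inj in E; lra).
        apply Rle_div_l; [lra|]. eapply Rle_trans; [apply Cmod_sub_le|].
        unfold x. specialize (HM (t/2)%R). specialize (Opp (t/2)%R). lra.
      - rewrite (horner_split d x), (horner_split d (- x)).
        replace (- x * - x) with (x * x) by ring. field. }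
    assert (Hrr : (0 < r * r)%R) by nra.
    destruct (Nat.Even_or_Odd n) as [[m ->]|[m ->]].
    + rewrite <- nth_evens, pow_mult. replace (r ^ 2)%R with (r * r)%R by ring.
      apply (IH _ Le _ eq_refl); auto.
    + rewrite Nat.add_1_r, <- nth_odds. change (r ^ S (2 * m))%R with (r * r ^ (2 * m))%R. rewrite pow_mult.
      replace (r ^ 2)%R with (r * r)%R by ring.
      assert (X := IH _ Lo _ eq_refl (r * r)%R (M / r)%R Hrr E2 m).
      apply (Rmult_le_compat_l r) in X; [|lra].
      replace (r * (M / r))%R with M in X by (field; lra).
      replace (Cmod (nth m (odds d) 0) * (r * (r * r) ^ m))%R with
        (r * (Cmod (nth m (odds d) 0) * (r * r) ^ m))%R by ring. auto.
Qed.

(** The v low coefficients contribute at most d each, the others a geometric tail of ratio t. The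
    induction peels off the constant coefficient, which divides both bounds by r. *)
Lemma horner_bound (v : nat) : forall (c : list C) (r t d M : R) (x : C),
  (0 < r)%R -> (0 <= t < 1)%R -> (0 <= d)%R ->
  (forall n, (n < v)%nat -> Cmod (nth n c 0) * r ^ n <= d)%R ->
  (forall n, Cmod (nth n c 0) * r ^ n <= M)%R ->
  Cmod x = (t * r)%R ->
  (Cmod (horner c x) <= INR v * d + M * t ^ v / (1 - t))%R.
Proof.
  assert (Hs : forall (a : C) c r (K : R), (0 < r)%R ->
    (forall n, Cmod (nth (S n) (a :: c)%list 0) * r ^ S n <= K)%R ->
    (forall n, Cmod (nth n c 0) * r ^ n <= K / r)%R).
  { intros a c r K Hr H n. apply (proj1 (Rle_div_r _ _ r Hr)). specialize (H n). cbn [nth pow] in H. lra. }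
  induction v as [|v IHv].
  - induction c as [|a c IH]; intros r t d M x Hr Ht Hd H1 H2 Hx; cbn [horner pow INR].
    + rewrite Cmod_0. specialize (H2 0%nat). cbn [nth pow] in H2. rewrite Cmod_0 in H2.
      assert (0 <= M * 1 / (1 - t))%R; [|lra]. apply Rdiv_le_0_compat; lra.
    + eapply Rle_trans; [apply Cmod_triangle|]. rewrite Cmod_mult.
      assert (X := IH r t d (M / r)%R x Hr Ht Hd ltac:(intros; lia) (Hs a c r M Hr (fun n => H2 (S n))) Hx).
      cbn [pow INR] in X. specialize (H2 0%nat). cbn [nth pow] in H2. rewrite Hx.
      apply (Rmult_le_compat_l (t * r)) in X; [|nra].
      replace (t * r * (0 * d + M / r * 1 / (1 - t)))%R with (M * 1 / (1 - t) - M)%R in X by (field; lra).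
      lra.
  - intros [|a c] r t d M x Hr Ht Hd H1 H2 Hx.
    + simpl horner. rewrite Cmod_0. specialize (H2 0%nat). cbn [nth pow] in H2. rewrite Cmod_0 in H2.
      assert (0 <= M * t ^ S v / (1 - t))%R.
      { apply Rdiv_le_0_compat; [|lra]. apply Rmult_le_pos. lra. apply pow_le; lra. }
      assert (0 <= INR (S v) * d)%R by (apply Rmult_le_pos; auto; apply pos_INR). lra.
    + cbn [horner]. eapply Rle_trans; [apply Cmod_triangle|]. rewrite Cmod_mult.
      assert (X := IHv c r t (d / r)%R (M / r)%R x Hr Ht).
      assert (X1 : (Cmod (horner c x) <= INR v * (d / r) + M / r * t ^ v / (1 - t))%R).
      { apply X; auto.
        - apply Rdiv_le_0_compat; auto.
        - intros n Hn. specialize (H1 (S n) ltac:(lia)). cbn [nth pow] in H1.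
          apply (proj1 (Rle_div_r _ _ r Hr)). lra.
        - apply (Hs a c r M Hr (fun n => H2 (S n))). }
      clear X. specialize (H1 0%nat ltac:(lia)). cbn [nth pow] in H1. rewrite Hx.
      apply (Rmult_le_compat_l (t * r)) in X1; [|nra].
      replace (t * r * (INR v * (d / r) + M / r * t ^ v / (1 - t)))%R
        with (t * (INR v * d) + M * t ^ S v / (1 - t))%R in X1 by (simpl; field; lra).
      assert (t * (INR v * d) <= INR v * d)%R.
      { assert (0 <= INR v * d)%R by (apply Rmult_le_pos; auto; apply pos_INR). nra. }
      rewrite S_INR. lra.
Qed.

(** * Polynomial functions and their locally uniform limits on the disc *)

Definition is_poly (f : C -> C) : Prop := exists c, forall x, f x = horner c x.

Lemma is_poly_const a : is_poly (fun _ => a).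
Proof. exists (a :: nil)%list. intros; simpl; ring. Qed.

Lemma is_poly_id : is_poly (fun x => x).
Proof. exists (RtoC 0 :: RtoC 1 :: nil)%list. intros; simpl; ring. Qed.

Lemma is_poly_plus f g : is_poly f -> is_poly g -> is_poly (fun x => f x + g x).
Proof.
  intros [c Hc] [d Hd].
  assert (exists e, forall x, horner e x = horner c x + horner d x) as [e He].
  { clear. revert d. induction c as [|a c IH]; intros d.
    - exists d. intros; simpl; ring.
    - destruct d as [|b d].
      + exists (a :: c)%list. intros; simpl; ring.
      + destruct (IH d) as [e He]. exists (a + b :: e)%list. intros x; simpl. rewrite He. ring. }
  exists e. intros. rewrite Hc, Hd, He. auto.
Qed.

Lemma is_poly_mult f g : is_poly f -> is_poly g -> is_poly (fun x => f x * g x).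
Proof.
  intros [c Hc] [d Hd].
  assert (exists e, forall x, horner e x = horner c x * horner d x) as [e He].
  { clear. induction c as [|a c [e He]].
    - exists nil. intros; simpl; ring.
    - assert (exists f, forall x, horner f x = a * horner d x) as [f Hf].
      { clear. induction d as [|b d [f Hf]].
        - exists nil. intros; simpl; ring.
        - exists (a * b :: f)%list. intros; simpl. rewrite Hf. ring. }
      destruct (is_poly_plus (horner f) (horner (RtoC 0 :: e)%list)) as [g Hg].
      exists f; auto. eexists; auto.
      exists g. intros x. rewrite <- Hg, Hf. simpl. rewrite He. ring. }
  exists e. intros. rewrite Hc, Hd, He. auto.
Qed.

Lemma is_poly_comp f g : is_poly f -> is_poly g -> is_poly (fun x => f (g x)).
Proof.
  intros [c Hc] Hg.
  assert (is_poly (fun x => horner c (g x))) as [e He].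
  { clear Hc f. induction c as [|a c IH]; simpl. apply is_poly_const.
    apply is_poly_plus. apply is_poly_const. apply is_poly_mult; auto. }
  exists e. intros. rewrite Hc, He. auto.
Qed.

Lemma is_poly_bounded f r : is_poly f -> (0 <= r)%R ->
  exists B, (0 < B)%R /\ forall x, (Cmod x <= r)%R -> (Cmod (f x) <= B)%R.
Proof.
  intros [c Hc] Hr. assert (exists B, (0 < B)%R /\ forall x, (Cmod x <= r)%R -> (Cmod (horner c x) <= B)%R) as [B [HB H]].
  { clear Hc f. induction c as [|a c [B [HB H]]].
    - exists 1%R. split. lra. intros; simpl. rewrite Cmod_0. lra.
    - assert (A := Cmod_ge_0 a). exists (Cmod a + 1 + r * B)%R. split.
      assert (0 <= r * B)%R by (apply Rmult_le_pos; lra). lra.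
      intros x Hx. simpl. eapply Rle_trans; [apply Cmod_triangle|]. rewrite Cmod_mult.
      assert (Cmod x * Cmod (horner c x) <= r * B)%R by (apply Rmult_le_compat; auto using Cmod_ge_0).
      lra. }
  exists B. split; auto. intros. rewrite Hc. auto.
Qed.

(* These are the holomorphic functions of the open unit disc. *)
Definition disc_holo (F : C -> C) : Prop :=
  forall r, (0 <= r < 1)%R -> forall eps, (0 < eps)%R ->
  exists p, is_poly p /\ forall x, (Cmod x <= r)%R -> (Cmod (F x - p x) <= eps)%R.

Lemma disc_holo_poly f : is_poly f -> disc_holo f.
Proof.
  intros H r Hr e He. exists f. split; auto. intros. replace (f x - f x) with (RtoC 0) by ring.
  rewrite Cmod_0; lra.
Qed.

Lemma disc_holo_const a : disc_holo (fun _ => a).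
Proof. apply disc_holo_poly, is_poly_const. Qed.

Lemma disc_holo_plus f g : disc_holo f -> disc_holo g -> disc_holo (fun x => f x + g x).
Proof.
  intros H H' r Hr e He.
  destruct (H r Hr (e/2)%R ltac:(lra)) as [p [Pp Hp]]. destruct (H' r Hr (e/2)%R ltac:(lra)) as [q [Pq Hq]].
  exists (fun x => p x + q x). split. apply is_poly_plus; auto. intros x Hx.
  replace (f x + g x - (p x + q x)) with ((f x - p x) + (g x - q x)) by ring.
  eapply Rle_trans; [apply Cmod_triangle|]. specialize (Hp x Hx). specialize (Hq x Hx). lra.
Qed.

Lemma disc_holo_bounded f r : disc_holo f -> (0 <= r < 1)%R ->
  exists B, (0 < B)%R /\ forall x, (Cmod x <= r)%R -> (Cmod (f x) <= B)%R.
Proof.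
  intros H Hr. destruct (H r Hr 1%R ltac:(lra)) as [p [Pp Hp]].
  destruct (is_poly_bounded p r Pp ltac:(lra)) as [B [HB HpB]]. exists (B + 1)%R. split. lra.
  intros x Hx. specialize (Hp x Hx). specialize (HpB x Hx). assert (X := Cmod_sub_ge (f x) (p x)). lra.
Qed.

Lemma disc_holo_mult f g : disc_holo f -> disc_holo g -> disc_holo (fun x => f x * g x).
Proof.
  intros H H' r Hr e He.
  destruct (disc_holo_bounded f r H Hr) as [A [HA HAf]].
  destruct (H' r Hr (e / 2 / A)%R) as [q [Pq Hq]]. { apply Rdiv_lt_0_compat; lra. }
  destruct (is_poly_bounded q r Pq ltac:(lra)) as [B [HB HqB]].
  destruct (H r Hr (e / 2 / B)%R) as [p [Pp Hp]]. { apply Rdiv_lt_0_compat; lra. }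
  exists (fun x => p x * q x). split. apply is_poly_mult; auto. intros x Hx.
  replace (f x * g x - (p x * q x)) with (f x * (g x - q x) + (f x - p x) * q x) by ring.
  eapply Rle_trans; [apply Cmod_triangle|]. rewrite !Cmod_mult.
  assert (Cmod (f x) * Cmod (g x - q x) <= A * (e / 2 / A))%R by (apply Rmult_le_compat; auto using Cmod_ge_0).
  assert (Cmod (f x - p x) * Cmod (q x) <= (e / 2 / B) * B)%R by (apply Rmult_le_compat; auto using Cmod_ge_0).
  replace (A * (e / 2 / A))%R with (e / 2)%R in H0 by (field; lra).
  replace (e / 2 / B * B)%R with (e / 2)%R in H1 by (field; lra). lra.
Qed.

Lemma disc_holo_scal a f : disc_holo f -> disc_holo (fun x => a * f x).
Proof. intros. apply disc_holo_mult; auto. apply disc_holo_const. Qed.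

Lemma disc_holo_ext f g : (forall x, (Cmod x < 1)%R -> f x = g x) -> disc_holo f -> disc_holo g.
Proof.
  intros E H r Hr e He. destruct (H r Hr e He) as [p [Pp Hp]]. exists p. split; auto.
  intros x Hx. rewrite <- E; auto. lra.
Qed.

Lemma disc_holo_minus f g : disc_holo f -> disc_holo g -> disc_holo (fun x => f x - g x).
Proof.
  intros. apply (disc_holo_ext (fun x => f x + (-(1)) * g x)). intros; ring.
  apply disc_holo_plus; auto. apply disc_holo_scal; auto.
Qed.

Lemma disc_holo_pow f n : disc_holo f -> disc_holo (fun x => f x ^ n).
Proof. intros H. induction n; simpl. apply disc_holo_const. apply disc_holo_mult; auto. Qed.

Lemma disc_holo_comp_poly f p : disc_holo f -> is_poly p ->
  (forall x, (Cmod x < 1)%R -> Cmod (p x) <= Cmod x)%R -> disc_holo (fun x => f (p x)).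
Proof.
  intros H Pp Hp r Hr e He. destruct (H r Hr e He) as [q [Pq Hq]].
  exists (fun x => q (p x)). split. apply is_poly_comp; auto.
  intros x Hx. apply Hq. eapply Rle_trans; [apply Hp|]; lra.
Qed.

Lemma disc_holo_limit F : (forall r, (0 <= r < 1)%R -> forall eps, (0 < eps)%R ->
  exists G, disc_holo G /\ forall x, (Cmod x <= r)%R -> (Cmod (F x - G x) <= eps)%R) -> disc_holo F.
Proof.
  intros H r Hr e He. destruct (H r Hr (e/2)%R ltac:(lra)) as [G [HG HGF]].
  destruct (HG r Hr (e/2)%R ltac:(lra)) as [p [Pp Hp]]. exists p. split; auto.
  intros x Hx. replace (F x - p x) with ((F x - G x) + (G x - p x)) by ring.
  eapply Rle_trans; [apply Cmod_triangle|]. specialize (Hp x Hx). specialize (HGF x Hx). lra.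
Qed.

(** A Schwarz lemma for a zero of order v, without division by x^v. A polynomial approximation of F
    has all its coefficients controlled on the circle of radius r0, and those below v made
    negligible by a Cauchy estimate on a very small circle, where F is O(rho^v); [horner_bound] then
    sums them. *)
Lemma disc_holo_schwarz (F : C -> C) (v : nat) (K rho0 r0 M t : R) (x : C) :
  disc_holo F -> (0 < rho0)%R -> (0 < r0 < 1)%R ->
  (forall rho th, 0 < rho <= rho0 -> Cmod (F (RtoC rho * cis th)%C) <= K * rho ^ v)%R ->
  (forall th, Cmod (F (RtoC r0 * cis th)%C) <= M)%R ->
  (0 <= t < 1)%R -> Cmod x = (t * r0)%R ->
  (Cmod (F x) <= M * t ^ v / (1 - t))%R.
Proof.
  intros HF Hrho Hr HK HM Ht Hx.
  assert (K0 : (0 <= K)%R).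
  { assert (X := HK rho0 0%R ltac:(lra)). assert (0 < rho0 ^ v)%R by (apply pow_lt; lra).
    assert (Y := Cmod_ge_0 (F (RtoC rho0 * cis 0))). nra. }
  assert (Tv : (0 <= t ^ v / (1 - t))%R).
  { apply Rdiv_le_0_compat; [|lra]. apply pow_le; lra. }
  apply le_epsilon. intros e0 He0.
  (* The error e is spent v times on the low coefficients, with weight t^v/(1 - t) on replacing M by
     M + e, and once more on the approximation of F; the denominator collects these shares. *)
  set (e := Rmin 1 (e0 / (INR v + 2 + t ^ v / (1 - t)))).
  assert (V := pos_INR v).
  assert (He : (0 < e)%R). { unfold e. apply Rmin_glb_lt. lra. apply Rdiv_lt_0_compat; lra. }
  assert (He2 : ((INR v + 2 + t ^ v / (1 - t)) * e <= e0)%R).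
  { assert (X := Rmin_r 1 (e0 / (INR v + 2 + t ^ v / (1 - t)))). fold e in X.
    apply (Rmult_le_compat_l (INR v + 2 + t ^ v / (1 - t))) in X; [|lra].
    replace ((INR v + 2 + t ^ v / (1 - t)) * (e0 / (INR v + 2 + t ^ v / (1 - t))))%R with e0 in X; auto.
    field. split. lra. assert (T : (0 <= t ^ v)%R) by (apply pow_le; lra). nra. }
  (* the radius at which the low order coefficients are estimated *)
  set (h := Rmin (Rmin 1 (rho0 / r0)) (e / 2 / (K * r0 ^ v + 1))).
  assert (Kr : (0 <= K * r0 ^ v)%R) by (apply Rmult_le_pos; auto; apply pow_le; lra).
  assert (Hh : (0 < h)%R).
  { unfold h. apply Rmin_glb_lt. apply Rmin_glb_lt. lra. apply Rdiv_lt_0_compat; lra.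
    apply Rdiv_lt_0_compat; lra. }
  assert (Hh1 : (h <= 1)%R) by (unfold h; eapply Rle_trans; [apply Rmin_l|apply Rmin_l]).
  assert (Hh2 : (h * r0 <= rho0)%R).
  { apply (Rle_div_r _ _ r0 (proj1 Hr)). unfold h; eapply Rle_trans; [apply Rmin_l|apply Rmin_r]. }
  assert (Hh3 : (h * (K * r0 ^ v) <= e / 2)%R).
  { assert (X : (h <= e / 2 / (K * r0 ^ v + 1))%R) by apply Rmin_r.
    apply (Rmult_le_compat_r (K * r0 ^ v + 1)) in X; [|lra].
    replace (e / 2 / (K * r0 ^ v + 1) * (K * r0 ^ v + 1))%R with (e / 2)%R in X by (field; lra). nra. }
  assert (Hv : (0 < h ^ v)%R) by (apply pow_lt; auto).
  assert (Hv1 : (h ^ v <= 1)%R) by (rewrite <- (pow1 v); apply pow_incr; lra).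
  (* The accuracy carries the factor h^v because the low coefficients are recovered from the circle
     of radius h r0 after division by h^n with n < v. *)
  destruct (HF r0 ltac:(lra) (e / 2 * h ^ v)%R) as [p [[c Hc] Hp]]. { nra. }
  assert (Hp' : forall y, (Cmod y <= r0)%R -> (Cmod (horner c y) <= Cmod (F y) + e / 2 * h ^ v)%R).
  { intros y Hy. specialize (Hp y Hy). rewrite Hc in Hp. rewrite Cmod_sub_sym in Hp.
    assert (X := Cmod_sub_ge (horner c y) (F y)). lra. }
  assert (B1 : forall n, (Cmod (nth n c 0) * r0 ^ n <= M + e)%R).
  { apply cauchy_estimate. lra. intros th. eapply Rle_trans. apply Hp'. rewrite Cmod_polar; lra.
    specialize (HM th). nra. }
  assert (B2 : forall n, (n < v)%nat -> (Cmod (nth n c 0) * r0 ^ n <= e)%R).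
  { intros n Hn.
    assert (X : (Cmod (nth n c 0) * (h * r0) ^ n <= e / 2 * h ^ v + K * (h * r0) ^ v)%R).
    { apply cauchy_estimate. nra. intros th. eapply Rle_trans. apply Hp'. rewrite Cmod_polar; nra.
      specialize (HK (h * r0)%R th ltac:(nra)). lra. }
    rewrite !Rpow_mult_distr in X.
    assert (Hn' : (0 < h ^ n)%R) by (apply pow_lt; auto).
    assert (Y : (h ^ v <= h ^ n * h)%R).
    { replace v with (n + 1 + (v - n - 1))%nat by lia. rewrite !pow_add, pow_1.
      rewrite <- (Rmult_1_r (h ^ n * h)) at 2. apply Rmult_le_compat_l. nra.
      rewrite <- (pow1 (v - n - 1)). apply pow_incr; lra. }
    apply Rmult_le_reg_l with (h ^ n)%R; auto.
    apply Rle_trans with (e / 2 * h ^ v + K * (h ^ v * r0 ^ v))%R. lra.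
    assert (K * (h ^ v * r0 ^ v) <= h ^ n * (h * (K * r0 ^ v)))%R.
    { replace (K * (h ^ v * r0 ^ v))%R with (h ^ v * (K * r0 ^ v))%R by ring.
      rewrite <- (Rmult_assoc (h ^ n) h). apply Rmult_le_compat_r; auto. }
    assert (h ^ n * (h * (K * r0 ^ v)) <= h ^ n * (e / 2))%R by (apply Rmult_le_compat_l; lra).
    assert (h ^ v <= h ^ n)%R by nra.
    assert (e / 2 * h ^ v <= e / 2 * h ^ n)%R by (apply Rmult_le_compat_l; lra). lra. }
  assert (Xr : (Cmod x <= r0)%R) by (rewrite Hx; nra).
  assert (Z := horner_bound v c r0 t e (M + e) x ltac:(lra) Ht ltac:(lra) B2 B1 Hx).
  specialize (Hp x Xr). rewrite Hc in Hp. assert (X := Cmod_sub_ge (F x) (horner c x)).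
  replace ((M + e) * t ^ v / (1 - t))%R with (M * t ^ v / (1 - t) + (t ^ v / (1 - t)) * e)%R in Z by (field; lra).
  nra.
Qed.

(** * A vanishing theorem for modular families *)

Lemma nome_polar x (tau : C) :
  nome x tau = RtoC (exp (- (2 * PI * x * Im tau))) * cis (2 * PI * x * Re tau).
Proof.
  destruct tau as [a b]. unfold nome, cis. simpl.
  replace (RtoC (2 * PI * x) * Ci * (a, b)) with ((- (2 * PI * x * b), 2 * PI * x * a)%R : C).
  - apply Cexp_polar.
  - unfold Cmult, RtoC, Ci; simpl. f_equal; ring.
Qed.

Lemma Cmod_nome x tau : Cmod (nome x tau) = exp (- (2 * PI * x * Im tau)).
Proof. rewrite nome_polar. apply Cmod_polar. left; apply exp_pos. Qed.

Lemma nome_pow x tau n : nome x tau ^ n = nome (INR n * x) tau.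
Proof.
  unfold nome. rewrite <- Cexp_nat. f_equal. rewrite !RtoC_mult. ring.
Qed.

Lemma nome_shift x tau (t : R) : nome x (tau + RtoC t) = nome x tau * cis (2 * PI * x * t).
Proof.
  unfold nome, cis. rewrite <- Cexp_add. f_equal. rewrite !RtoC_mult. ring.
Qed.

Lemma upper_neq_0 (tau : C) : (0 < Im tau)%R -> tau <> 0.
Proof. intros H E. rewrite E in H. simpl in H. lra. Qed.

Lemma Cmod_sqr (tau : C) : (Cmod tau ^ 2 = Re tau ^ 2 + Im tau ^ 2)%R.
Proof. apply Cmod2_alt. Qed.

Lemma Im_opp_inv (tau : C) : tau <> 0 -> Im (- RtoC 1 / tau) = (Im tau / Cmod tau ^ 2)%R.
Proof.
  intros H. apply Cmod_gt_0 in H. assert (X := Cmod_sqr tau).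
  assert (Y : (0 < Cmod tau ^ 2)%R) by (apply pow_lt; auto). rewrite X in *.
  destruct tau as [a b]. unfold Cdiv, Cinv, Cmult, Copp, RtoC, Re, Im in *; simpl in *.
  field. lra.
Qed.

Lemma Im_opp_inv_pos (tau : C) : (0 < Im tau)%R -> (0 < Im (- RtoC 1 / tau))%R.
Proof.
  intros H. assert (N := upper_neq_0 _ H). rewrite Im_opp_inv; auto.
  apply Rdiv_lt_0_compat; auto. apply pow_lt. apply Cmod_gt_0; auto.
Qed.

Lemma Im_shift (tau : C) (t : R) : Im (tau + RtoC t) = Im tau.
Proof. destruct tau; simpl. ring. Qed.

Lemma exists_nearest_integer (x : R) : exists n : Z, (Rabs (x + IZR n) <= / 2)%R.
Proof.
  destruct (archimed (/ 2 - x)) as [H1 H2]. exists (up (/ 2 - x) - 1)%Z.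
  rewrite minus_IZR. apply Rabs_le. lra.
Qed.

(** Reduction theory with an explicit rate: below height 17/20, translation to |Re| <= 1/2 followed
    by inversion multiplies the height by at least 40/39, so the height 17/20 is reached after
    finitely many steps. The index j may change at every step, and this is harmless because the
    bound B is common to the family. *)
Lemma bound_on_fundamental_domain (J : Type) (phi : J -> C -> R) (B : R) :
  (forall j tau, (0 < Im tau)%R -> exists j', phi j tau = phi j' (tau + RtoC 1)) ->
  (forall j tau, (0 < Im tau)%R -> exists j', phi j (tau + RtoC 1) = phi j' tau) ->
  (forall j tau, (0 < Im tau)%R -> exists j', phi j tau = phi j' (- RtoC 1 / tau)) ->
  (forall j tau, (17 / 20 <= Im tau)%R -> (phi j tau <= B)%R) ->
  forall j tau, (0 < Im tau)%R -> (phi j tau <= B)%R.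
Proof.
  intros T T' S H.
  assert (Sh : forall (n : nat) j tau, (0 < Im tau)%R ->
    (exists j', phi j tau = phi j' (tau + RtoC (INR n))) /\
    (exists j', phi j tau = phi j' (tau + RtoC (- INR n)))).
  { induction n as [|n IH]; intros j tau Ht.
    - split; exists j; f_equal; simpl; rewrite ?Ropp_0; ring.
    - destruct (IH j tau Ht) as [[a Ha] [b Hb]]. split.
      + destruct (T a (tau + RtoC (INR n))) as [a' Ha']. rewrite Im_shift; auto.
        exists a'. rewrite Ha, Ha'. f_equal. rewrite S_INR, RtoC_plus. ring.
      + destruct (T' b (tau + RtoC (- INR (Datatypes.S n)))) as [b' Hb']. rewrite Im_shift; auto.
        exists b'. rewrite Hb, <- Hb'. f_equal. rewrite S_INR, Ropp_plus_distr, RtoC_plus, !RtoC_opp. ring. }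
  assert (ShZ : forall (n : Z) j tau, (0 < Im tau)%R -> exists j', phi j tau = phi j' (tau + RtoC (IZR n))).
  { intros n j tau Ht. destruct n as [|p|p].
    - exists j. f_equal. simpl. ring.
    - destruct (proj1 (Sh (Pos.to_nat p) j tau Ht)) as [j' Hj']. exists j'.
      rewrite Hj', INR_IZR_INZ, positive_nat_Z. auto.
    - destruct (proj2 (Sh (Pos.to_nat p) j tau Ht)) as [j' Hj']. exists j'.
      rewrite Hj', INR_IZR_INZ, positive_nat_Z, <- opp_IZR. auto. }
  assert (Main : forall n j tau, (0 < Im tau)%R -> (17 / 20 * (39 / 40) ^ n <= Im tau)%R -> (phi j tau <= B)%R).
  { induction n as [|n IH]; intros j tau Ht Hn.
    - apply H. simpl in Hn. lra.
    - destruct (Rle_lt_dec (17/20) (Im tau)) as [L|L]; [apply H; auto|].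
      destruct (exists_nearest_integer (Re tau)) as [m Hm].
      destruct (ShZ m j tau Ht) as [j1 ->].
      set (s := tau + RtoC (IZR m)).
      assert (Is : Im s = Im tau) by apply Im_shift.
      assert (Rs : Re s = (Re tau + IZR m)%R) by (destruct tau; reflexivity).
      destruct (S j1 s ltac:(lra)) as [j2 ->].
      assert (N : s <> 0) by (apply upper_neq_0; lra).
      apply IH. apply Im_opp_inv_pos; lra.
      rewrite Im_opp_inv by auto. apply le_div_of_mul_le. apply pow_lt, Cmod_gt_0; auto.
      rewrite Cmod_sqr, Is, Rs. apply Rle_trans with (2 := Hn). simpl pow.
      assert (Hr : ((Re tau + IZR m) * (Re tau + IZR m) <= / 4)%R).
      { apply Rabs_le_between in Hm. nra. }
      assert (0 < (39 / 40) ^ n)%R by (apply pow_lt; lra).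
      (* Here 1/4 + (17/20)^2 = 389/400, which is just below 39/40. *)
      assert (((Re tau + IZR m) * ((Re tau + IZR m) * 1) + Im tau * (Im tau * 1) <= 39 / 40)%R) by nra.
      assert (0 < 17 / 20 * (39 / 40) ^ n)%R by nra.
      replace (17 / 20 * (39 / 40 * (39 / 40) ^ n))%R with (17 / 20 * (39 / 40) ^ n * (39 / 40))%R by ring.
      apply Rmult_le_compat_l; lra. }
  intros j tau Ht.
  destruct (pow_lt_1_zero (39/40) ltac:(rewrite Rabs_pos_eq; lra) (Im tau) Ht) as [n Hn].
  apply (Main n); auto. specialize (Hn n (Nat.le_refl _)).
  rewrite Rabs_pos_eq in Hn by (apply pow_le; lra). lra.
Qed.

Lemma exp_mult_INR x n : exp (x * INR n) = (exp x ^ n)%R.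
Proof.
  induction n. simpl. rewrite Rmult_0_r. apply exp_0.
  rewrite S_INR, Rmult_plus_distr_l, exp_plus, IHn, Rmult_1_r. simpl. ring.
Qed.

(** The k-th power of the inequality 1 + x <= exp x at x = c y/k. *)
Lemma pow_le_exp k c : (0 < c)%R -> exists K, (0 < K)%R /\ 
  forall y, (0 <= y)%R -> (y ^ k <= K * exp (c * y))%R.
Proof.
  intros Hc. destruct k as [|k].
  - exists 1%R. split. lra. intros y Hy. simpl. rewrite Rmult_1_l, <- exp_0.
    assert (0 <= c * y)%R by (apply Rmult_le_pos; lra).
    destruct H. left; apply exp_increasing; auto. rewrite <- H; lra.
  - assert (P : (0 < INR (S k))%R) by (apply lt_0_INR; lia).
    exists ((INR (S k) / c) ^ S k)%R. split. apply pow_lt, Rdiv_lt_0_compat; auto.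
    intros y Hy.
    replace (exp (c * y)) with (exp (c * y / INR (S k)) ^ S k)%R.
    + rewrite <- Rpow_mult_distr. apply pow_incr. split; auto.
      assert (X := exp_ineq1_le (c * y / INR (S k))).
      apply Rle_trans with (INR (S k) / c * (c * y / INR (S k)))%R. right; field; lra.
      apply Rmult_le_compat_l. left; apply Rdiv_lt_0_compat; auto. lra.
    + rewrite <- exp_mult_INR. f_equal. field. lra.
Qed.

(* The invariant function |h| y^k is maximal for Im tau >= 17/20, where it is compared, through the
   Schwarz-type estimate, with its values on the horocycle of half the height. *)
Theorem modular_family_vanishes (J : Type) (h F : J -> C -> C) (N v k : nat) (r K : R) :
  (0 < N)%nat -> (0 < v)%nat ->
  (forall j, disc_holo (F j)) ->
  (forall j tau, (0 < Im tau)%R -> h j tau = F j (nome (/ INR N) tau)) ->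
  (forall j tau, (17 / 20 <= Im tau)%R -> (Cmod (h j tau) <= K * Cmod (nome (/ INR N) tau) ^ v)%R) ->
  (forall j tau, (0 < Im tau)%R -> exists j', Cmod (h j tau) = Cmod (h j' (tau + RtoC 1))) ->
  (forall j tau, (0 < Im tau)%R -> exists j', Cmod (h j (tau + RtoC 1)) = Cmod (h j' tau)) ->
  (forall j tau, (0 < Im tau)%R -> exists j',
     Cmod (h j' (- RtoC 1 / tau)) = (Cmod (h j tau) * Cmod tau ^ (2 * k))%R) ->
  (exp (- (17 / 20 * PI / INR N)) <= r < 1)%R -> (2 ^ k * r ^ v / (1 - r) < 1)%R ->
  forall j tau, (0 < Im tau)%R -> h j tau = 0.
Proof.
  intros HN Hv HF HhF HK HT HT' HS Hr Hth.
  assert (N0 : (0 < INR N)%R) by (apply lt_0_INR; auto).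
  assert (PI0 := PI_RGT_0).
  set (phi := fun j tau => (Cmod (h j tau) * Im tau ^ k)%R).
  set (th := (2 ^ k * r ^ v / (1 - r))%R) in *.
  assert (r0 : (0 < r)%R) by (assert (X := exp_pos (- (17 / 20 * PI / INR N))); lra).
  assert (th0 : (0 <= th)%R).
  { unfold th. apply Rdiv_le_0_compat; [|lra]. apply Rmult_le_pos; apply pow_le; lra. }
  (* Under inversion Im tau is divided by |tau|^2 and |h| multiplied by |tau|^(2k), so the family
     [phi] is merely permuted. *)
  assert (Red : forall B, (forall j tau, (17 / 20 <= Im tau)%R -> (phi j tau <= B)%R) ->
    forall j tau, (0 < Im tau)%R -> (phi j tau <= B)%R).
  { intros B HB. apply bound_on_fundamental_domain; auto; unfold phi; intros j tau Ht.
    - destruct (HT j tau Ht) as [j' Hj']. exists j'. rewrite Im_shift, Hj'. auto.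
    - destruct (HT' j tau Ht) as [j' Hj']. exists j'. rewrite Im_shift, Hj'. auto.
    - destruct (HS j tau Ht) as [j' Hj']. exists j'. rewrite Hj', Im_opp_inv by (apply upper_neq_0; auto).
      unfold Rdiv. rewrite Rpow_mult_distr, pow_inv, pow_mult. field.
      apply pow_nonzero, pow_nonzero. apply upper_neq_0, Cmod_gt_0 in Ht. lra. }
  assert (K0 : (0 <= Rabs K)%R) by apply Rabs_pos.
  (* Decay of exponential type, from the zero of order v at the cusp, beats y^k; the contraction
     below needs this finite bound as a starting point. *)
  assert (Init : exists B, (0 <= B)%R /\ forall j tau, (0 < Im tau)%R -> (phi j tau <= B)%R).
  { assert (c0 : (0 < 2 * PI * / INR N * INR v)%R).
    { apply Rmult_lt_0_compat; [|apply lt_0_INR; auto]. apply Rmult_lt_0_compat; [lra|].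
      apply Rinv_0_lt_compat; auto. }
    destruct (pow_le_exp k _ c0) as [L [HL HLk]].
    exists (Rabs K * L)%R. split. apply Rmult_le_pos; lra. apply Red. intros j tau Ht. unfold phi.
    specialize (HK j tau Ht). specialize (HLk (Im tau) ltac:(lra)). rewrite Cmod_nome in HK.
    rewrite <- exp_mult_INR in HK.
    set (E := exp (- (2 * PI * / INR N * Im tau) * INR v)) in *.
    assert (E0 : (0 < E)%R) by apply exp_pos.
    assert (EE : (E * exp (2 * PI * / INR N * INR v * Im tau) = 1)%R).
    { unfold E. rewrite <- exp_plus, <- exp_0. f_equal. ring. }
    assert (0 <= Im tau ^ k)%R by (apply pow_le; lra).
    apply Rle_trans with (Rabs K * E * Im tau ^ k)%R.
    - apply Rmult_le_compat_r; auto. eapply Rle_trans; [apply HK|].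
      apply Rmult_le_compat_r. lra. apply Rle_abs.
    - apply Rle_trans with (Rabs K * E * (L * exp (2 * PI * / INR N * INR v * Im tau)))%R.
      + apply Rmult_le_compat_l; auto. apply Rmult_le_pos; lra.
      + right. transitivity (Rabs K * L * (E * exp (2 * PI * / INR N * INR v * Im tau)))%R. ring.
        rewrite EE. ring. }
  assert (Step : forall B, (0 <= B)%R -> (forall j tau, (0 < Im tau)%R -> (phi j tau <= B)%R) ->
    forall j tau, (0 < Im tau)%R -> (phi j tau <= th * B)%R).
  { intros B HB0 HB. apply Red. intros j tau Ht.
    set (y := Im tau) in *.
    (* This is |q^(1/N)| at height y/2. At height y the modulus is t^2 = t * t, so relative to the
       circle of radius t the contraction ratio is t again. *)
    set (t := exp (- (PI * / INR N * y))).
    assert (t0 : (0 < t)%R) by apply exp_pos.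
    assert (tr : (t <= r)%R).
    { apply Rle_trans with (2 := proj1 Hr). unfold t.
      assert (X : (- (PI * / INR N * y) <= - (17 / 20 * PI / INR N))%R).
      { assert (0 < PI * / INR N)%R by (apply Rmult_lt_0_compat; [lra|apply Rinv_0_lt_compat; auto]).
        unfold Rdiv at 2. nra. }
      apply exp_le; auto. }
    assert (y2 : (0 < (y / 2) ^ k)%R) by (apply pow_lt; lra).
    assert (Main : (Cmod (F j (nome (/ INR N) tau)) <= (B / (y / 2) ^ k) * t ^ v / (1 - t))%R).
    { apply (disc_holo_schwarz (F j) v K (exp (- (2 * PI * / INR N * (17 / 20)))) t); auto.
      - apply exp_pos.
      - lra.
      - intros rho a [Hrho1 Hrho2].
        (* A logarithm lifts the point of the disc to the half-plane; the smallness of rho means a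
           height of at least 17/20, where [HK] is available. *)
        set (s := (a * INR N / (2 * PI), - (ln rho) * INR N / (2 * PI))%R : C).
        assert (Hs : RtoC rho * cis a = nome (/ INR N) s).
        { rewrite nome_polar. unfold s; simpl. f_equal.
          f_equal. rewrite <- (exp_ln rho) at 1 by auto. f_equal. field. lra.
          f_equal. field. lra. }
        assert (Is : (17 / 20 <= Im s)%R).
        { unfold s; simpl. apply le_div_of_mul_le. lra.
          assert (X : (ln rho <= - (2 * PI * / INR N * (17 / 20)))%R).
          { rewrite <- (ln_exp (- _)). destruct Hrho2. left; apply ln_increasing; auto. rewrite H; lra. }
          apply (Rmult_le_compat_r (INR N)) in X; [|lra].
          replace (- (2 * PI * / INR N * (17 / 20)) * INR N)%R with (- (17 / 20 * (2 * PI)))%R in X by (field; lra).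
          lra. }
        assert (X := HK j s Is). rewrite HhF, <- Hs, Cmod_polar in X; lra.
      - intros a. set (s := (a * INR N / (2 * PI), y / 2)%R : C).
        assert (Hs : RtoC t * cis a = nome (/ INR N) s).
        { rewrite nome_polar. unfold s; simpl. f_equal.
          f_equal. unfold t. f_equal. field. lra. f_equal. field. lra. }
        assert (Is : (0 < Im s)%R) by (unfold s; simpl; lra).
        assert (X := HB j s Is). unfold phi in X. rewrite HhF, <- Hs in X by auto.
        apply le_div_of_mul_le; auto.
      - lra.
      - rewrite Cmod_nome. fold y. unfold t. rewrite <- exp_plus. f_equal. field. lra. }
    rewrite <- HhF in Main by (unfold y in *; lra). unfold phi. fold y.
    assert (yk : (0 < y ^ k)%R) by (apply pow_lt; lra).
    apply (Rmult_le_compat_r (y ^ k)) in Main; [|lra].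
    eapply Rle_trans; [exact Main|].
    replace ((y / 2) ^ k)%R with (y ^ k / 2 ^ k)%R.
    2:{ unfold Rdiv. rewrite Rpow_mult_distr, pow_inv. auto. }
    assert (P2 : (0 < 2 ^ k)%R) by (apply pow_lt; lra).
    replace (B / (y ^ k / 2 ^ k) * t ^ v / (1 - t) * y ^ k)%R with (2 ^ k * B * (t ^ v / (1 - t)))%R.
    2:{ field. repeat split; try lra. }
    unfold th.
    replace (2 ^ k * r ^ v / (1 - r) * B)%R with (2 ^ k * B * (r ^ v / (1 - r)))%R by (field; lra).
    apply Rmult_le_compat_l. apply Rmult_le_pos; lra.
    apply Rmult_le_compat. apply pow_le; lra. left; apply Rinv_0_lt_compat; lra.
    apply pow_incr; lra. apply Rinv_le_contravar; lra. }
  destruct Init as [B [B0 HB]].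
  assert (It : forall n j tau, (0 < Im tau)%R -> (phi j tau <= th ^ n * B)%R).
  { induction n as [|n IH]. simpl. intros; rewrite Rmult_1_l; auto.
    intros. simpl. rewrite Rmult_assoc. apply Step; auto. apply Rmult_le_pos; auto. apply pow_le; auto. }
  intros j tau Ht. apply Cmod_eq_0. apply Rle_antisym; [|apply Cmod_ge_0].
  assert (P : (0 < Im tau ^ k)%R) by (apply pow_lt; auto).
  apply Rmult_le_reg_r with (Im tau ^ k)%R; auto. rewrite Rmult_0_l.
  change (phi j tau <= 0)%R. apply le_epsilon. intros e He. rewrite Rplus_0_l.
  destruct (pow_lt_1_zero th ltac:(rewrite Rabs_pos_eq; lra) (e / (B + 1))%R) as [n Hn].
  { apply Rdiv_lt_0_compat; lra. }
  specialize (Hn n (Nat.le_refl _)). assert (0 <= th ^ n)%R by (apply pow_le; auto).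
  rewrite Rabs_pos_eq in Hn by auto. apply Rlt_div_r in Hn; [|lra].
  eapply Rle_trans; [apply (It n); auto|]. nra.
Qed.

(** * Eisenstein's partial fractions *)

(** The terms of opposite index are paired so that the case k = 1, which is the expansion of the
    cotangent, also converges absolutely. *)
Definition latt (k : nat) (z : C) (n : nat) : C :=
  / (z + RtoC (INR (S n))) ^ k + / (z - RtoC (INR (S n))) ^ k.

Definition Zs (k : nat) (z : C) : C := CSeries (latt k z).

(* The Eisenstein sum over all integers [n] of [(z + n)^(-k)], summed symmetrically. *)
Definition Ls (k : nat) (z : C) : C := / z ^ k + Zs k z.

(** While |t| <= |tau| + Im tau the imaginary part alone suffices; beyond that |t| - |tau| grows
    faster than the claimed bound. The constant c makes the two regimes meet. *)
Lemma lattice_lower_bound (tau : C) : (0 < Im tau)%R ->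
  exists c, (0 < c <= 1)%R /\ forall t : R, (c * (1 + Rabs t) <= Cmod (tau + RtoC t))%R.
Proof.
  intros H. set (y := Im tau) in *. assert (P := Cmod_ge_0 tau).
  exists (y / (1 + Cmod tau + y))%R. split.
  - split. apply Rdiv_lt_0_compat; lra. apply div_le_of_le_mul; lra.
  - intros t. assert (c0 : (0 < y / (1 + Cmod tau + y) <= 1)%R).
    { split. apply Rdiv_lt_0_compat; lra. apply div_le_of_le_mul; lra. }
    set (c := (y / (1 + Cmod tau + y))%R) in *.
    assert (E : (c * (1 + Cmod tau + y) = y)%R) by (unfold c; field; lra).
    destruct (Rle_lt_dec (Rabs t) (Cmod tau + y)) as [L|L].
    + apply Rle_trans with y. nra.
      replace y with (Im (tau + RtoC t)) by apply Im_shift.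
      apply im_le_Cmod.
    + assert (X := Cmod_plus_ge (RtoC t) tau). rewrite Cmod_R in X.
      replace (RtoC t + tau) with (tau + RtoC t) in X by ring. nra.
Qed.

Lemma upper_plus_neq_0 (tau : C) (t : R) : (0 < Im tau)%R -> tau + RtoC t <> 0.
Proof. intros H. apply upper_neq_0. rewrite Im_shift. auto. Qed.

Lemma upper_minus_neq_0 (tau : C) (t : R) : (0 < Im tau)%R -> tau - RtoC t <> 0.
Proof.
  intros H. replace (tau - RtoC t) with (tau + RtoC (- t)).
  apply upper_plus_neq_0; auto. rewrite RtoC_opp. ring.
Qed.

Lemma lattice_lower_bound_nat (tau : C) : (0 < Im tau)%R ->
  exists c, (0 < c <= 1)%R /\ forall n : nat,
   (c * (1 + INR n) <= Cmod (tau + RtoC (INR n)))%R /\ (c * (1 + INR n) <= Cmod (tau - RtoC (INR n)))%R.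
Proof.
  intros H. destruct (lattice_lower_bound tau H) as [c [Hc Hb]]. exists c. split; auto.
  intros n. assert (P := pos_INR n). split.
  - specialize (Hb (INR n)). rewrite Rabs_pos_eq in Hb; auto.
  - specialize (Hb (- INR n)%R). rewrite Rabs_Ropp, Rabs_pos_eq, RtoC_opp in Hb by auto. exact Hb.
Qed.

Lemma Cmod_inv_pow_le (w : C) k b : (0 < b)%R -> (b <= Cmod w)%R -> (Cmod (/ w ^ k) <= / b ^ k)%R.
Proof.
  intros Hb H. assert (w <> 0) by (apply Cmod_gt_0; lra).
  rewrite Cmod_inv, Cmod_pow by (apply Cpow_nz; auto).
  apply Rinv_le_contravar. apply pow_lt; auto. apply pow_incr; lra.
Qed.

Lemma inv_pow_le_sqr (c x : R) k : (0 < c <= 1)%R -> (1 <= x)%R -> (2 <= k)%nat ->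
  (/ (c * x) ^ k <= / c ^ k * / x ^ 2)%R.
Proof.
  intros Hc Hx Hk. rewrite Rpow_mult_distr, Rinv_mult.
  apply Rmult_le_compat_l. left; apply Rinv_0_lt_compat, pow_lt; lra.
  apply Rinv_le_contravar. apply pow_lt; lra. apply Rle_pow; auto.
Qed.

(** For k = 1 the two fractions combine to 2 z/(z^2 - m^2), which restores quadratic decay; for
    larger k each fraction has it separately. *)
Lemma latt_bound k z : (0 < Im z)%R -> (1 <= k)%nat ->
  exists K, (0 <= K)%R /\ forall n, (Cmod (latt k z n) <= K * / INR (S n) ^ 2)%R.
Proof.
  intros Hz Hk. destruct (lattice_lower_bound_nat z Hz) as [c [Hc Hb]].
  assert (P : forall n, (1 <= INR (S n))%R) by (intros n; apply (le_INR 1); lia).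
  destruct (Nat.eq_dec k 1) as [->|Hk1].
  - exists (2 * Cmod z * / c ^ 2)%R. assert (Z := Cmod_ge_0 z). split.
    apply Rmult_le_pos. lra. left; apply Rinv_0_lt_compat, pow_lt; lra.
    intros n. specialize (P n). destruct (Hb (S n)) as [H1 H2]. unfold latt. rewrite !Cpow_1_r.
    set (m := RtoC (INR (S n))) in *.
    replace (/ (z + m) + / (z - m)) with (2 * z * (/ (z + m) ^ 1 * / (z - m) ^ 1)).
    2:{ field. split. apply upper_minus_neq_0; auto. apply upper_plus_neq_0; auto. }
    rewrite !Cmod_mult, Cmod_R, Rabs_pos_eq by lra. rewrite !Rmult_assoc.
    apply Rmult_le_compat_l. lra. apply Rmult_le_compat_l. auto.
    replace (/ c ^ 2 * / INR (S n) ^ 2)%R with (/ (c * INR (S n)) ^ 1 * / (c * INR (S n)) ^ 1)%R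
      by (field; lra).
    assert (0 < c * INR (S n))%R by nra.
    apply Rmult_le_compat; try apply Cmod_ge_0; apply Cmod_inv_pow_le; auto; nra.
  - exists (2 * / c ^ k)%R. assert (C0 : (0 < / c ^ k)%R) by (apply Rinv_0_lt_compat, pow_lt; lra).
    split. lra. intros n. specialize (P n). destruct (Hb (S n)) as [H1 H2]. unfold latt.
    eapply Rle_trans; [apply Cmod_triangle|].
    assert (0 < c * INR (S n))%R by nra.
    assert (X := inv_pow_le_sqr c (INR (S n)) k Hc P ltac:(lia)).
    assert (X1 := Cmod_inv_pow_le (z + RtoC (INR (S n))) k (c * INR (S n)) H ltac:(nra)).
    assert (X2 := Cmod_inv_pow_le (z - RtoC (INR (S n))) k (c * INR (S n)) H ltac:(nra)).
    lra.
Qed.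

Lemma has_sum_Zs k z : (0 < Im z)%R -> (1 <= k)%nat -> has_sum (latt k z) (Zs k z).
Proof.
  intros Hz Hk. destruct (latt_bound k z Hz Hk) as [K [HK Hb]].
  apply (summable_has_sum _ (fun n => K * / INR (S n) ^ 2)%R); auto.
  apply summable_scal; auto. apply summable_inv_sqr.
Qed.

Lemma Ls_partial k z : (0 < Im z)%R -> (1 <= k)%nat -> ccv (fun N => / z ^ k + csum (latt k z) N) (Ls k z).
Proof. intros. apply ccv_plus. apply ccv_const. apply has_sum_Zs; auto. Qed.

Lemma is_lim_seq_scal_inv K : is_lim_seq (fun n => K * / INR (S n))%R 0.
Proof.
  replace (Finite 0) with (Rbar_mult K 0) by (simpl; f_equal; ring).
  apply is_lim_seq_scal_l. apply (is_lim_seq_incr_1 (fun n => / INR n)%R).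
  replace (Finite 0) with (Rbar_inv p_infty) by reflexivity.
  apply is_lim_seq_inv. apply is_lim_seq_INR. discriminate.
Qed.

Lemma ccv_inv_pow_shift k z : (0 < Im z)%R -> (1 <= k)%nat ->
  ccv (fun N => / (z + RtoC (INR N)) ^ k) 0 /\ ccv (fun N => / (z - RtoC (INR N)) ^ k) 0.
Proof.
  intros Hz Hk. destruct (lattice_lower_bound_nat z Hz) as [c [Hc Hb]].
  assert (H : forall w n, (c * (1 + INR n) <= Cmod w)%R -> (Cmod (/ w ^ k - 0) <= / c ^ k * / INR (S n))%R).
  { intros w n Hw. assert (P := pos_INR n).
    replace (/ w ^ k - 0) with (/ w ^ k) by ring.
    eapply Rle_trans. apply (Cmod_inv_pow_le w k (c * (1 + INR n))); auto. nra.
    rewrite Rpow_mult_distr, Rinv_mult. apply Rmult_le_compat_l.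
    left; apply Rinv_0_lt_compat, pow_lt; lra. rewrite S_INR.
    apply Rinv_le_contravar. lra. rewrite <- (pow_1 (INR n + 1)), (Rplus_comm 1). apply Rle_pow; auto. lra. }
  split; (eapply ccv_squeeze; [intros n; apply H, Hb|]); apply is_lim_seq_scal_inv.
Qed.

(** Moving the symmetric window of summation by one step changes only its two end terms, and these
    tend to 0. *)
Lemma Ls_periodic k z : (0 < Im z)%R -> (1 <= k)%nat -> Ls k (z + 1) = Ls k z.
Proof.
  intros Hz Hk. assert (Hz1 : (0 < Im (z + 1))%R) by (rewrite Im_shift; auto).
  apply (ccv_unique (fun N => / (z + 1) ^ k + csum (latt k (z + 1)) N)).
  apply Ls_partial; auto.
  apply (ccv_ext (fun N => / z ^ k + csum (latt k z) N + (/ (z + RtoC (INR (S N))) ^ k - / (z - RtoC (INR N)) ^ k))).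
  - induction n as [|n IH].
    + simpl. replace (z - 0) with z by ring. ring.
    + cbn [csum]. rewrite (Cplus_assoc (/ (z + 1) ^ k)), <- IH. unfold latt.
      replace (z + 1 + RtoC (INR (S n))) with (z + RtoC (INR (S (S n)))) by (rewrite (S_INR (S n)), RtoC_plus; ring).
      replace (z + 1 - RtoC (INR (S n))) with (z - RtoC (INR n)) by (rewrite (S_INR n), RtoC_plus; ring).
      ring.
  - replace (Ls k z) with (Ls k z + (0 - 0)) by ring. apply ccv_plus. apply Ls_partial; auto.
    destruct (ccv_inv_pow_shift k z Hz Hk) as [X Y].
    apply ccv_minus; auto. apply (proj2 (ccv_incr (fun N => / (z + RtoC (INR N)) ^ k) 0)); auto.
Qed.

(** The even integers n give the points (z + n)/2 of the first sum, the odd ones those of the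
    second. *)
Lemma Ls_duplication k z : (0 < Im z)%R -> (1 <= k)%nat ->
  Ls k (z / 2) + Ls k ((z + 1) / 2) = RtoC 2 ^ k * Ls k z.
Proof.
  intros Hz Hk.
  assert (Hz1 : (0 < Im (z / 2))%R).
  { destruct z as [a b]. unfold Cdiv, Cmult, Cinv, RtoC, Im in *; simpl in *. field_simplify; lra. }
  assert (Hz2 : (0 < Im ((z + 1) / 2))%R).
  { destruct z as [a b]. unfold Cdiv, Cmult, Cinv, RtoC, Im in *; simpl in *. field_simplify; lra. }
  assert (T : RtoC 2 <> 0) by (intro E; apply RtoC_inj in E; lra).
  assert (Half : forall w, / (w / 2) ^ k = RtoC 2 ^ k * / w ^ k).
  { intros w. destruct (Ceq_dec w 0) as [->|Hw].
    - replace (0 / 2) with (RtoC 0) by (field; auto).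
      assert (/ (RtoC 0) ^ k = 0) as ->; [|ring].
      destruct k; [lia|]. rewrite Cpow_S, Cmult_0_l.
      unfold Cinv, RtoC; simpl. unfold Rdiv. rewrite !Rmult_0_l, Ropp_0, Rmult_0_l. auto.
    - unfold Cdiv. rewrite Cpow_mult_l, Cpow_inv by auto. field. split; apply Cpow_nz; auto. }
  apply (ccv_unique (fun N => (/ (z / 2) ^ k + csum (latt k (z / 2)) N)
     + (/ ((z + 1) / 2) ^ k + csum (latt k ((z + 1) / 2)) N))).
  apply ccv_plus; apply Ls_partial; auto.
  (* The window belonging to (z + 1)/2 is centred at 1, so the union runs from -2N to 2N + 1; the
     term at -(2N + 1) has to be removed from the symmetric sum. *)
  apply (ccv_ext (fun N => RtoC 2 ^ k * (/ z ^ k + csum (latt k z) (S (2 * N)) - / (z - RtoC (INR (S (2 * N)))) ^ k))).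
  - induction n as [|n IH].
    + simpl. rewrite !Half. unfold latt. simpl. ring.
    + replace (S (2 * S n)) with (S (S (S (2 * n)))) by lia.
      cbn [csum]. cbn [csum] in IH.
      rewrite Cplus_assoc.
      match type of IH with _ = ?a + (?b + ?c) =>
        transitivity (a + (b + c) + latt k (z / 2) n + latt k ((z + 1) / 2) n); [|ring] end.
      rewrite <- IH. unfold latt.
      replace (z / 2 + RtoC (INR (S n))) with ((z + RtoC (INR (S (S (2 * n))))) / 2).
      2:{ rewrite !S_INR, mult_INR. change (INR 2) with 2%R. rewrite !RtoC_plus, RtoC_mult. field; auto. }
      replace (z / 2 - RtoC (INR (S n))) with ((z - RtoC (INR (S (S (2 * n))))) / 2).
      2:{ rewrite !S_INR, mult_INR. change (INR 2) with 2%R. rewrite !RtoC_plus, RtoC_mult. field; auto. }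
      replace ((z + 1) / 2 + RtoC (INR (S n))) with ((z + RtoC (INR (S (S (S (2 * n)))))) / 2).
      2:{ rewrite !S_INR, mult_INR. change (INR 2) with 2%R. rewrite !RtoC_plus, RtoC_mult. field; auto. }
      replace ((z + 1) / 2 - RtoC (INR (S n))) with ((z - RtoC (INR (S (2 * n)))) / 2).
      2:{ rewrite !S_INR, mult_INR. change (INR 2) with 2%R. rewrite !RtoC_plus, RtoC_mult. field; auto. }
      rewrite !Half. ring.
  - apply ccv_scal. replace (Ls k z) with (Ls k z - 0) by ring.
    apply ccv_minus.
    + apply (ccv_subseq (fun N => / z ^ k + csum (latt k z) N) (Ls k z) (fun n => S (2 * n))). intros; lia.
      apply Ls_partial; auto.
    + apply (ccv_subseq (fun N => / (z - RtoC (INR N)) ^ k) 0 (fun n => S (2 * n))). intros; lia.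
      apply ccv_inv_pow_shift; auto.
Qed.

Lemma periodic_IZR (d : C -> C) : (forall z, (0 < Im z)%R -> d (z + 1) = d z) ->
  forall (n : Z) z, (0 < Im z)%R -> d (z + RtoC (IZR n)) = d z.
Proof.
  intros H.
  assert (N : forall n z, (0 < Im z)%R -> d (z + RtoC (INR n)) = d z).
  { induction n as [|n IH]; intros z Hz.
    - f_equal. simpl. ring.
    - rewrite S_INR, RtoC_plus, Cplus_assoc, H. auto. rewrite Im_shift. auto. }
  intros n z Hz. destruct n as [|p|p].
  - f_equal. ring.
  - rewrite <- positive_nat_Z, <- INR_IZR_INZ. auto.
  - rewrite <- (N (Pos.to_nat p)) by (rewrite Im_shift; auto). f_equal.
    rewrite INR_IZR_INZ, positive_nat_Z, <- Cplus_assoc, <- RtoC_plus, <- plus_IZR.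
    replace (Z.neg p + Z.pos p)%Z with 0%Z by lia. ring.
Qed.

Lemma half_plane (z : C) : (0 < Im z)%R -> (0 < Im (z / 2))%R /\ (0 < Im ((z + 1) / 2))%R /\
  Im (z / 2) = (Im z / 2)%R /\ Im ((z + 1) / 2) = (Im z / 2)%R.
Proof.
  intros H. destruct z as [a b]. unfold Cdiv, Cmult, Cinv, RtoC, Im in *; simpl in *.
  repeat split; field_simplify; lra.
Qed.

(** With the weight m^a, m = min(1, Im z), halving the height loses at most 2^a; two points of half
    height bounded by B thus give B * 2 * 2^a / 2^(a+2) = B/2 at z. Iteration forces d to vanish.
    Periodicity reduces the initial bound to the strip |Re z| <= 1/2. *)
Lemma herglotz_trick (d : C -> C) (a : nat) (B : R) :
  (forall z, (0 < Im z)%R -> d (z + 1) = d z) ->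
  (forall z, (0 < Im z)%R -> d (z / 2) + d ((z + 1) / 2) = RtoC 2 ^ (a + 2) * d z) ->
  (forall z, (0 < Im z)%R -> (Rabs (Re z) <= / 2)%R -> (Cmod (d z) * Rmin 1 (Im z) ^ a <= B)%R) ->
  forall z, (0 < Im z)%R -> d z = 0.
Proof.
  intros Hp Hd HB.
  assert (HB' : forall z, (0 < Im z)%R -> (Cmod (d z) * Rmin 1 (Im z) ^ a <= B)%R).
  { intros z Hz. destruct (exists_nearest_integer (Re z)) as [n Hn].
    rewrite <- (periodic_IZR d Hp n z Hz). rewrite <- (Im_shift z (IZR n)).
    apply HB. rewrite Im_shift; auto. destruct z; simpl in *. auto. }
  assert (It : forall n z, (0 < Im z)%R -> (Cmod (d z) * Rmin 1 (Im z) ^ a <= B * (/ 2) ^ n)%R).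
  { induction n as [|n IH]; intros z Hz. simpl; rewrite Rmult_1_r; auto.
    destruct (half_plane z Hz) as (H1 & H2 & E1 & E2).
    assert (X1 := IH _ H1). assert (X2 := IH _ H2). rewrite E1 in X1. rewrite E2 in X2.
    assert (Hdz := Hd z Hz). set (z1 := z / 2) in *. set (z2 := (z + 1) / 2) in *.
    assert (Hm : (Rmin 1 (Im z) <= 2 * Rmin 1 (Im z / 2))%R).
    { unfold Rmin; repeat destruct Rle_dec; lra. }
    assert (Hm0 : (0 < Rmin 1 (Im z))%R) by (apply Rmin_glb_lt; lra).
    assert (Hma : (Rmin 1 (Im z) ^ a <= 2 ^ a * Rmin 1 (Im z / 2) ^ a)%R).
    { rewrite <- Rpow_mult_distr. apply pow_incr. lra. }
    assert (P : (0 < 2 ^ a)%R) by (apply pow_lt; lra).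
    assert (E : (2 ^ (a + 2) * Cmod (d z) <= Cmod (d z1) + Cmod (d z2))%R).
    { eapply Rle_trans; [|apply Cmod_triangle]. rewrite Hdz, Cmod_mult, Cmod_pow, Cmod_R, Rabs_pos_eq; auto; lra. }
    apply Rmult_le_reg_l with (2 ^ (a + 2))%R. apply pow_lt; lra.
    rewrite <- Rmult_assoc.
    apply Rle_trans with ((Cmod (d z1) + Cmod (d z2)) * (2 ^ a * Rmin 1 (Im z / 2) ^ a))%R.
    - apply Rmult_le_compat; auto. apply Rmult_le_pos. apply pow_le; lra. apply Cmod_ge_0. apply pow_le; lra.
    - rewrite pow_add. simpl. nra. }
  intros z Hz. apply Cmod_eq_0. apply Rle_antisym; [|apply Cmod_ge_0].
  assert (P : (0 < Rmin 1 (Im z) ^ a)%R) by (apply pow_lt, Rmin_glb_lt; lra).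
  apply Rmult_le_reg_r with (Rmin 1 (Im z) ^ a)%R; auto. rewrite Rmult_0_l.
  apply le_epsilon. intros e He. rewrite Rplus_0_l.
  assert (AB := Rabs_pos B). assert (AB' := Rle_abs B).
  destruct (pow_lt_1_zero (/2) ltac:(rewrite Rabs_pos_eq; lra) (e / (Rabs B + 1))%R) as [n Hn].
  { apply Rdiv_lt_0_compat; lra. }
  specialize (Hn n (Nat.le_refl _)). assert (0 <= (/ 2) ^ n)%R by (apply pow_le; lra).
  rewrite Rabs_pos_eq in Hn by auto. apply Rlt_div_r in Hn; [|lra].
  eapply Rle_trans; [apply (It n); auto|]. nra.
Qed.

(** In the strip |z + n| is at least |n|/2 for n different from 0, and always at least m: two of the
    a + 2 factors ensure summability, the other a are paid for by the weight. *)
Lemma Zs_strip_bound a : exists B, forall z, (0 < Im z)%R -> (Rabs (Re z) <= / 2)%R ->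
  (Cmod (Zs (a + 2) z) * Rmin 1 (Im z) ^ a <= B)%R.
Proof.
  destruct (summable_bound _ summable_inv_sqr) as [B [HB0 HB]].
  exists (8 * B)%R. intros z Hz Hr.
  set (m := Rmin 1 (Im z)). assert (m0 : (0 < m)%R) by (apply Rmin_glb_lt; lra).
  assert (ma : (0 < m ^ a)%R) by (apply pow_lt; auto).
  assert (T : forall n (w : C), (m <= Cmod w)%R -> (INR (S n) / 2 <= Cmod w)%R ->
    (Cmod (/ w ^ (a + 2)) * m ^ a <= 4 * / INR (S n) ^ 2)%R).
  { intros n w H1 H2. assert (P : (0 < INR (S n))%R) by (apply lt_0_INR; lia).
    assert (W : (0 < Cmod w)%R) by lra. assert (w <> 0) by (apply Cmod_gt_0; auto).
    rewrite Cmod_inv, Cmod_pow by (apply Cpow_nz; auto). rewrite pow_add, Rinv_mult.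
    replace (4 * / INR (S n) ^ 2)%R with (1 * / (INR (S n) / 2) ^ 2)%R by (field; lra).
    replace (/ Cmod w ^ a * / Cmod w ^ 2 * m ^ a)%R with ((/ Cmod w ^ a * m ^ a) * / Cmod w ^ 2)%R by ring.
    apply Rmult_le_compat.
    - apply Rmult_le_pos; [|lra]. left; apply Rinv_0_lt_compat, pow_lt; auto.
    - left; apply Rinv_0_lt_compat, pow_lt; auto.
    - rewrite <- (Rinv_l (Cmod w ^ a)). apply Rmult_le_compat_l. left; apply Rinv_0_lt_compat, pow_lt; auto.
      apply pow_incr; lra. apply pow_nonzero; lra.
    - apply Rinv_le_contravar. apply pow_lt; lra. apply pow_incr; lra. }
  assert (mI : forall t, (m <= Cmod (z + RtoC t))%R).
  { intros t. apply Rle_trans with (Im (z + RtoC t)). rewrite Im_shift. apply Rmin_r.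
    apply im_le_Cmod. }
  assert (mR : forall t n, (INR (S n) <= Rabs t)%R -> (INR (S n) / 2 <= Cmod (z + RtoC t))%R).
  { intros t n Ht. assert (1 <= INR (S n))%R by (apply (le_INR 1); lia).
    eapply Rle_trans; [|apply re_le_Cmod].
    replace (Re (z + RtoC t)) with (t - - Re z)%R by (destruct z; simpl; ring).
    assert (X := Rabs_triang_inv t (- Re z)). rewrite Rabs_Ropp in X. lra. }
  apply Rmult_le_reg_r with (/ m ^ a)%R. apply Rinv_0_lt_compat; auto.
  rewrite Rmult_assoc, Rinv_r, Rmult_1_r by lra.
  apply (has_sum_Cmod_le (latt (a + 2) z) _ (fun n => 8 * / m ^ a * / INR (S n) ^ 2)%R).
  - apply has_sum_Zs; auto. lia.
  - intros n. unfold latt. eapply Rle_trans; [apply Cmod_triangle|].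
    assert (X1 := T n (z + RtoC (INR (S n))) (mI _) (mR _ _ (Rle_abs _))).
    assert (X2 := T n (z + RtoC (- INR (S n))) (mI _)).
    rewrite RtoC_opp in X2. 
    assert (X3 : (Cmod (/ (z + - RtoC (INR (S n))) ^ (a + 2)) * m ^ a <= 4 * / INR (S n) ^ 2)%R).
    { apply X2. rewrite <- RtoC_opp. apply mR. rewrite Rabs_Ropp. apply Rle_abs. }
    clear X2. unfold Cminus.
    apply (Rmult_le_compat_r (/ m ^ a)) in X1. apply (Rmult_le_compat_r (/ m ^ a)) in X3.
    rewrite Rmult_assoc, Rinv_r, Rmult_1_r in X1, X3 by lra. lra.
    left; apply Rinv_0_lt_compat; auto. left; apply Rinv_0_lt_compat; auto.
  - intros N. rewrite rsum_scal. replace (8 * B * / m ^ a)%R with (8 * / m ^ a * B)%R by ring.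
    apply Rmult_le_compat_l. apply Rmult_le_pos. lra. left; apply Rinv_0_lt_compat; auto.
    apply HB.
Qed.

(** Away from its pole at 0 the lattice sum is controlled in the strip by [Zs_strip_bound], so a
    candidate P only has to match the principal part c/z^(a+2); the rest is [herglotz_trick] for the
    difference. *)
Lemma partial_fractions (a : nat) (P : C -> C) (c : C) (B : R) :
  (forall z, (0 < Im z)%R -> P (z + 1) = P z) ->
  (forall z, (0 < Im z)%R -> P (z / 2) + P ((z + 1) / 2) = RtoC 2 ^ (a + 2) * P z) ->
  (forall z, (0 < Im z)%R -> (Rabs (Re z) <= / 2)%R ->
     (Cmod (P z - c * / z ^ (a + 2)) * Rmin 1 (Im z) ^ a <= B)%R) ->
  forall z, (0 < Im z)%R -> P z = c * Ls (a + 2) z.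
Proof.
  intros H1 H2 H3 z Hz. destruct (Zs_strip_bound a) as [B' HB'].
  assert (E : P z - c * Ls (a + 2) z = 0).
  { apply (herglotz_trick (fun z => P z - c * Ls (a + 2) z) a (B + Cmod c * B')%R); auto.
    - intros w Hw. rewrite H1, Ls_periodic by (auto; lia). auto.
    - intros w Hw.
      transitivity ((P (w / 2) + P ((w + 1) / 2)) - c * (Ls (a + 2) (w / 2) + Ls (a + 2) ((w + 1) / 2))).
      ring. rewrite H2, Ls_duplication by (auto; lia). ring.
    - intros w Hw Hr. specialize (H3 w Hw Hr). specialize (HB' w Hw Hr).
      unfold Ls.
      replace (P w - c * (/ w ^ (a + 2) + Zs (a + 2) w)) with ((P w - c * / w ^ (a + 2)) - c * Zs (a + 2) w) by ring.
      assert (X := Cmod_sub_le (P w - c * / w ^ (a + 2)) (c * Zs (a + 2) w)).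
      rewrite Cmod_mult in X. assert (M0 : (0 <= Rmin 1 (Im w) ^ a)%R).
      { apply pow_le. left. apply Rmin_glb_lt; lra. }
      apply (Rmult_le_compat_r _ _ _ M0) in X.
      apply (Rmult_le_compat_l (Cmod c)) in HB'; [|apply Cmod_ge_0]. lra. }
  replace (P z) with (P z - c * Ls (a + 2) z + c * Ls (a + 2) z) by ring. rewrite E. ring.
Qed.

(* The closed form of [sum_(d >= 1) d X^d] at [X = e^(2 pi i z)], that is [- 1 / (4 sin^2 (pi z))]. *)
Definition csc2 (z : C) : C := nome 1 z / (1 - nome 1 z) ^ 2.

Lemma nome_1_lt (z : C) : (0 < Im z)%R -> (Cmod (nome 1 z) < 1)%R.
Proof.
  intros H. rewrite Cmod_nome. assert (X := Rmult_lt_0_compat _ _ PI_RGT_0 H).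
  apply Rlt_le_trans with (exp 0); [|rewrite exp_0; lra]. apply exp_increasing. lra.
Qed.

Lemma one_minus_neq_0 (X : C) : (Cmod X < 1)%R -> 1 - X <> 0.
Proof. intros H E. assert (Y := Cmod_sub_ge 1 X). rewrite E, Cmod_1, Cmod_0 in Y. lra. Qed.

Lemma one_plus_neq_0 (X : C) : (Cmod X < 1)%R -> 1 + X <> 0.
Proof. intros H E. assert (Y := Cmod_plus_ge 1 X). rewrite E, Cmod_1, Cmod_0 in Y. lra. Qed.

Lemma nome_half (z : C) : nome 1 z = nome 1 (z / 2) * nome 1 (z / 2).
Proof.
  unfold nome. rewrite <- Cexp_add. f_equal. field.
Qed.

Lemma cis_PI : cis PI = - (1).
Proof. apply Cexp_PI. Qed.

Lemma cis_2PI : cis (2 * PI) = 1.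
Proof. apply Cexp_2PI. Qed.

Lemma nome_half_shift (z : C) : nome 1 ((z + 1) / 2) = - nome 1 (z / 2).
Proof.
  replace ((z + 1) / 2) with (z / 2 + RtoC (/ 2)).
  - rewrite nome_shift. replace (2 * PI * 1 * / 2)%R with PI by field. rewrite cis_PI. ring.
  - rewrite RtoC_inv by lra. field.
Qed.

Lemma nome_1_shift (z : C) : nome 1 (z + 1) = nome 1 z.
Proof. rewrite nome_shift. replace (2 * PI * 1 * 1)%R with (2 * PI)%R by ring. rewrite cis_2PI. ring. Qed.

Lemma csc2_shift z : csc2 (z + 1) = csc2 z.
Proof. unfold csc2. rewrite nome_1_shift. auto. Qed.

(** The three polynomials in [csc2] are the sums of d^p X^d for p = 1, 3, 5. With w =
    [nome 1 (z / 2)] the two points of half height have the nomes w and -w, so odd powers cancel and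
    the even ones give 2 (2d)^p w^(2d); hence the factors 2^(p+1). Each identity is rational in
    w. *)
Lemma csc2_duplication (z : C) : (0 < Im z)%R ->
  let s := csc2 z in let u := csc2 (z / 2) in let v := csc2 ((z + 1) / 2) in
  u + v = RtoC 2 ^ 2 * s /\
  (u + 6 * u ^ 2) + (v + 6 * v ^ 2) = RtoC 2 ^ 4 * (s + 6 * s ^ 2) /\
  (u + 30 * u ^ 2 + 120 * u ^ 3) + (v + 30 * v ^ 2 + 120 * v ^ 3)
    = RtoC 2 ^ 6 * (s + 30 * s ^ 2 + 120 * s ^ 3).
Proof.
  intros Hz s u v. unfold s, u, v, csc2.
  destruct (half_plane z Hz) as (H1 & _ & _ & _).
  rewrite nome_half_shift, (nome_half z). set (w := nome 1 (z / 2)).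
  assert (W : (Cmod w < 1)%R) by (apply nome_1_lt; auto).
  assert (N1 := one_minus_neq_0 w W). assert (N2 := one_plus_neq_0 w W).
  assert (N3 : 1 - w * w <> 0).
  { replace (1 - w * w) with ((1 - w) * (1 + w)) by ring. apply Cmult_neq_0; auto. }
  assert (N4 : 1 - - w <> 0) by (replace (1 - - w) with (1 + w) by ring; auto).
  repeat split; field; auto.
Qed.

(** As PI/2 <= 2, the truncation a - a^3/6 is at least a/3 for nonnegative a in the range; oddness
    does the rest. *)
Lemma sin_abs_lower a : (Rabs a <= PI / 2)%R -> (Rabs a / 3 <= Rabs (sin a))%R.
Proof.
  assert (H : forall a, (0 <= a <= PI / 2)%R -> (a / 3 <= sin a)%R).
  { clear a. intros a Ha. assert (P4 := PI_4).
    destruct (sin_bound a 0) as [S _]; [lra|lra|].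
    unfold sin_approx, sin_term in S. simpl in S. nra. }
  intros Ha. unfold Rabs in *. destruct (Rcase_abs a) as [N|N].
  - assert (X := H (- a)%R ltac:(lra)). rewrite sin_neg in X.
    destruct (Rcase_abs (sin a)); lra.
  - assert (X := H a ltac:(lra)). destruct (Rcase_abs (sin a)); lra.
Qed.

(* [sin_diff z = - 2 i sin (pi z)] *)
Definition sin_diff (z : C) : C := Cexp (- (RtoC PI * Ci * z)) - Cexp (RtoC PI * Ci * z).

(** With a and b the parts of pi z, |[sin_diff z]|^2 equals (exp b - exp(-b))^2 + 4 (sin a)^2, which
    is at least b^2 + 4 a^2/9. *)
Lemma sin_diff_lower z : (0 < Im z)%R -> (Rabs (Re z) <= / 2)%R ->
  (2 / 3 * PI * Cmod z <= Cmod (sin_diff z))%R.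
Proof.
  intros Hz Hr. assert (P := PI_RGT_0). destruct z as [u v]. simpl in Hz, Hr.
  set (a := (PI * u)%R). set (b := (PI * v)%R). assert (Hb : (0 < b)%R) by (apply Rmult_lt_0_compat; auto).
  assert (Ha : (Rabs a <= PI / 2)%R).
  { unfold a. rewrite Rabs_mult, (Rabs_pos_eq PI) by lra. nra. }
  assert (E : sin_diff (u, v) = ((exp b - exp (- b)) * cos a, - ((exp b + exp (- b)) * sin a))%R).
  { unfold sin_diff. replace (RtoC PI * Ci * (u, v)) with ((- b, a)%R : C).
    - unfold Cexp, Cminus, Cplus, Copp, Cmult, RtoC, Re, Im; simpl.
      rewrite Ropp_involutive, cos_neg, sin_neg. f_equal; ring.
    - unfold Cmult, RtoC, Ci, a, b; simpl. f_equal; ring. }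
  rewrite E.
  assert (E1 : (b <= exp b - exp (- b))%R).
  { assert (X := exp_ineq1_le b). assert (exp (- b) < 1)%R.
    { apply Rlt_le_trans with (exp 0); [|rewrite exp_0; lra]. apply exp_increasing. lra. } lra. }
  assert (E2 : ((exp b + exp (- b)) ^ 2 = (exp b - exp (- b)) ^ 2 + 4)%R).
  { assert (X : (exp b * exp (- b) = 1)%R) by (rewrite <- exp_plus, <- exp_0; f_equal; ring). nra. }
  assert (S := sin_abs_lower a Ha).
  assert (S2 : (a ^ 2 / 9 <= sin a ^ 2)%R).
  { rewrite <- (pow2_abs a), <- (pow2_abs (sin a)). assert (X := Rabs_pos a). nra. }
  apply Rsqr_incr_0_var; [|apply Cmod_ge_0]. rewrite !Rsqr_pow2.
  replace ((2 / 3 * PI * Cmod (u, v)) ^ 2)%R with (4 / 9 * PI ^ 2 * Cmod (u, v) ^ 2)%R by field.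
  rewrite !Cmod_sqr. simpl Re; simpl Im.
  replace (4 / 9 * PI ^ 2 * (u ^ 2 + v ^ 2))%R with (4 / 9 * (a ^ 2 + b ^ 2))%R by (unfold a, b; ring).
  assert (T := sin2_cos2 a). unfold Rsqr in T.
  assert (C2 : (cos a ^ 2 = 1 - sin a ^ 2)%R) by (simpl; lra).
  rewrite Rpow_mult_distr, C2.
  replace ((- ((exp b + exp (- b)) * sin a)) ^ 2)%R with ((exp b + exp (- b)) ^ 2 * sin a ^ 2)%R by ring.
  rewrite E2. set (k := ((exp b - exp (- b)) ^ 2)%R).
  assert (Hk : (b ^ 2 <= k)%R) by (apply pow_incr; lra).
  replace (k * (1 - sin a ^ 2) + (k + 4) * sin a ^ 2)%R with (k + 4 * sin a ^ 2)%R by ring. nra.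
Qed.

Lemma csc2_sin_diff z : (0 < Im z)%R -> csc2 z = / sin_diff z ^ 2 /\ sin_diff z <> 0.
Proof.
  intros Hz. assert (N := one_minus_neq_0 _ (nome_1_lt z Hz)).
  assert (E : nome 1 z = Cexp (RtoC PI * Ci * z) * Cexp (RtoC PI * Ci * z)).
  { unfold nome. rewrite <- Cexp_add. f_equal. rewrite !RtoC_mult. ring. }
  assert (M := Cexp_neq_0 (RtoC PI * Ci * z)).
  assert (F : 1 - nome 1 z = Cexp (RtoC PI * Ci * z) * sin_diff z).
  { unfold sin_diff. rewrite Cexp_opp, E. field. auto. }
  assert (D0 : sin_diff z <> 0).
  { intros Q. rewrite F, Q in N. apply N. ring. }
  split; auto. unfold csc2. rewrite F, E. field. auto.
Qed.

(** The constant and quadratic Taylor terms of the two exponentials cancel, leaving a cubic error; a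
    quadratic one would not suffice to bound [csc2] minus its double pole. *)
Lemma sin_diff_expansion z K : (PI * Cmod z <= K)%R ->
  (Cmod (sin_diff z + 2 * RtoC PI * Ci * z) <= (PI * Cmod z) ^ 3 * exp K / 3)%R.
Proof.
  intros HK. assert (P := PI_RGT_0).
  set (x := RtoC PI * Ci * z).
  assert (Hx : Cmod x = (PI * Cmod z)%R).
  { unfold x. rewrite !Cmod_mult, Cmod_Ci, Cmod_R, Rabs_pos_eq; lra. }
  assert (T1 := Cexp_taylor3 x K ltac:(lra)).
  assert (T2 := Cexp_taylor3 (- x) K ltac:(rewrite Cmod_opp; lra)). rewrite Cmod_opp in T2.
  unfold sin_diff. fold x.
  replace (Cexp (- x) - Cexp x + 2 * RtoC PI * Ci * z) with
    ((Cexp (- x) - 1 - - x - (- x) ^ 2 / 2) - (Cexp x - 1 - x - x ^ 2 / 2)).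
  - eapply Rle_trans; [apply Cmod_sub_le|]. rewrite Hx in T1, T2. lra.
  - unfold x. field.
Qed.

(** With D = [sin_diff z] and T = 2 pi i z, so that D is close to -T, the difference 1/D^2 - 1/T^2
    has numerator (T + D)(T - D), of order |z|^3 |z|, and denominator of order |z|^4. *)
Lemma csc2_bounds : exists A, (0 < A)%R /\ forall z, (0 < Im z)%R -> (Rabs (Re z) <= / 2)%R ->
  (Cmod (csc2 z - / (2 * RtoC PI * Ci * z) ^ 2) <= A)%R /\
  (Cmod (csc2 z) * Rmin 1 (Im z) ^ 2 <= A)%R /\
  (Cmod (/ (2 * RtoC PI * Ci * z) ^ 2) * Rmin 1 (Im z) ^ 2 <= A)%R.
Proof.
  assert (P := PI_RGT_0). assert (P4 := PI_4). assert (P3 := PI2_1).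
  (* For Im z <= 1 in the strip, |z| <= 2, and PI <= 4 gives pi |z| <= 8; the factor 64 below is the
     square of this bound. *)
  set (E8 := exp 8). assert (HE : (0 < E8)%R) by apply exp_pos.
  exists (E8 / 3 * (64 * E8 / 3 + 4) + 4)%R. split. { assert (0 < E8 * E8)%R by nra. nra. }
  assert (AP : (0 < E8 / 3 * (64 * E8 / 3 + 4))%R) by (assert (0 < E8 * E8)%R by nra; nra).
  intros z Hz Hr. destruct (csc2_sin_diff z Hz) as [-> D0].
  assert (L := sin_diff_lower z Hz Hr).
  assert (Z0 := upper_neq_0 z Hz). assert (Zp := proj1 (Cmod_gt_0 z) Z0).
  set (D := sin_diff z) in *. set (T := 2 * RtoC PI * Ci * z).
  set (w := (PI * Cmod z)%R). assert (w0 : (0 < w)%R) by (apply Rmult_lt_0_compat; auto).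
  assert (Lw : (2 / 3 * w <= Cmod D)%R) by (unfold w; lra).
  assert (HT : Cmod T = (2 * w)%R).
  { unfold T, w. rewrite !Cmod_mult, Cmod_Ci, !Cmod_R, !Rabs_pos_eq; lra. }
  assert (T0 : T <> 0) by (apply Cmod_gt_0; lra).
  assert (ID : (Cmod (/ D ^ 2) <= 9 / 4 * / w ^ 2)%R).
  { eapply Rle_trans. apply (Cmod_inv_pow_le D 2 (2 / 3 * w)); lra. right; field; lra. }
  assert (IT : (Cmod (/ T ^ 2) <= / 4 * / w ^ 2)%R).
  { eapply Rle_trans. apply (Cmod_inv_pow_le T 2 (2 * w)); lra. right; field; lra. }
  set (m := Rmin 1 (Im z)).
  assert (m0 : (0 < m)%R) by (apply Rmin_glb_lt; lra).
  assert (vz : (Im z <= Cmod z)%R).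
  { apply im_le_Cmod. }
  assert (mw : (m <= w)%R).
  { assert (m <= Im z)%R by apply Rmin_r. unfold w. nra. }
  assert (wm : (/ w ^ 2 * m ^ 2 <= 1)%R).
  { rewrite <- (Rinv_l (w ^ 2)) by (apply pow_nonzero; lra). apply Rmult_le_compat_l.
    left; apply Rinv_0_lt_compat, pow_lt; auto. apply pow_incr; lra. }
  assert (m2 : (0 < m ^ 2)%R) by (apply pow_lt; auto).
  repeat split.
  - destruct (Rle_lt_dec (Im z) 1) as [V|V].
    + assert (zz : (Cmod z <= 2)%R).
      { apply Rsqr_incr_0_var; [|lra]. rewrite !Rsqr_pow2, Cmod_sqr.
        apply Rabs_le_between in Hr. nra. }
      assert (w8 : (w <= 8)%R) by (unfold w; nra).
      assert (X := sin_diff_expansion z 8 w8). fold D T w E8 in X.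
      assert (Y : (Cmod (T - D) <= w * (64 * E8 / 3 + 4))%R).
      { replace (T - D) with (2 * T - (D + T)) by ring. eapply Rle_trans; [apply Cmod_sub_le|].
        rewrite Cmod_mult, HT, Cmod_R, Rabs_pos_eq by lra.
        assert (w ^ 2 <= 64)%R by nra.
        assert (w * (w ^ 2 * E8) <= w * (64 * E8))%R by (apply Rmult_le_compat_l; nra). simpl in *. nra. }
      replace (/ D ^ 2 - / T ^ 2) with ((D + T) * (T - D) * (/ D ^ 2 * / T ^ 2)) by (field; auto).
      rewrite !Cmod_mult.
      apply Rle_trans with ((w ^ 3 * E8 / 3) * (w * (64 * E8 / 3 + 4)) * ((9 / 4 * / w ^ 2) * (/ 4 * / w ^ 2)))%R.
      * apply Rmult_le_compat.
        apply Rmult_le_pos; apply Cmod_ge_0. apply Rmult_le_pos; apply Cmod_ge_0.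
        apply Rmult_le_compat; auto; apply Cmod_ge_0. apply Rmult_le_compat; auto; apply Cmod_ge_0.
      * replace ((w ^ 3 * E8 / 3) * (w * (64 * E8 / 3 + 4)) * ((9 / 4 * / w ^ 2) * (/ 4 * / w ^ 2)))%R
          with (9 / 16 * (E8 / 3 * (64 * E8 / 3 + 4)))%R by (field; lra). lra.
    + eapply Rle_trans; [apply Cmod_sub_le|].
      assert (1 <= w)%R by (unfold w; nra).
      assert (/ w ^ 2 <= 1)%R. { rewrite <- Rinv_1. apply Rinv_le_contravar. lra. nra. }
      lra.
  - apply (Rmult_le_compat_r (m ^ 2)) in ID; lra.
  - apply (Rmult_le_compat_r (m ^ 2)) in IT; lra.
Qed.

Theorem partial_fractions_2 z : (0 < Im z)%R ->
  csc2 z = / (2 * RtoC PI * Ci) ^ 2 * Ls 2 z.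
Proof.
  assert (P := PI_RGT_0). destruct csc2_bounds as [A [HA HB]].
  apply (partial_fractions 0 csc2 _ A).
  - intros; apply csc2_shift.
  - intros w Hw. apply csc2_duplication; auto.
  - intros w Hw Hr. destruct (HB w Hw Hr) as (X & _ & _). simpl pow. rewrite Rmult_1_r.
    replace (/ (2 * RtoC PI * Ci) ^ 2 * / w ^ (0 + 2)) with (/ (2 * RtoC PI * Ci * w) ^ 2); auto.
    simpl Nat.add. assert (N := upper_neq_0 w Hw).
    assert (RtoC PI <> 0) by (intro E; apply RtoC_inj in E; lra). 
    field. repeat split; auto. intro E; inversion E; lra.
Qed.

Lemma Ci_neq_0 : Ci <> 0.
Proof. intro E; inversion E; lra. Qed.

Lemma RtoC_neq_0 x : (x <> 0)%R -> RtoC x <> 0.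
Proof. intros H E. apply RtoC_inj in E. auto. Qed.

Lemma two_pi_i_neq_0 : 2 * RtoC PI * Ci <> 0.
Proof.
  assert (P := PI_RGT_0). repeat apply Cmult_neq_0; try apply RtoC_neq_0; try lra. apply Ci_neq_0.
Qed.

(** With l = 1/(2 pi i z)^2, the difference s^2 - l^2 is (s - l)(s + l): the first factor is
    bounded, the second bounded after multiplication by the weight m^2. The coefficient 6 is 3!, as
    120 = 5! in weight 6. *)
Theorem partial_fractions_4 z : (0 < Im z)%R ->
  csc2 z + 6 * csc2 z ^ 2 = 6 * / (2 * RtoC PI * Ci) ^ 4 * Ls 4 z.
Proof.
  destruct csc2_bounds as [A [HA HB]].
  apply (partial_fractions 2 (fun z => csc2 z + 6 * csc2 z ^ 2) _ (12 * A * A + A)%R).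
  - intros; rewrite !csc2_shift; auto.
  - intros w Hw. apply csc2_duplication; auto.
  - intros w Hw Hr. destruct (HB w Hw Hr) as (X & Y & Z). assert (N := upper_neq_0 w Hw).
    set (l := / (2 * RtoC PI * Ci * w) ^ 2) in *. set (s := csc2 w) in *.
    replace (6 * / (2 * RtoC PI * Ci) ^ 4 * / w ^ (2 + 2)) with (6 * l ^ 2).
    2:{ unfold l. generalize two_pi_i_neq_0. generalize (2 * RtoC PI * Ci). intros. simpl Nat.add. field. auto. }
    replace (s + 6 * s ^ 2 - 6 * l ^ 2) with (6 * ((s - l) * (s + l)) + s) by ring.
    set (m := Rmin 1 (Im w)) in *. assert (m0 : (0 <= m ^ 2)%R) by apply pow2_ge_0.
    eapply Rle_trans. apply Rmult_le_compat_r; auto. apply Cmod_triangle.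
    rewrite !Cmod_mult, Cmod_R, Rabs_pos_eq by lra.
    assert (T := Cmod_triangle s l). apply (Rmult_le_compat_r (m ^ 2)) in T; auto.
    assert (Cmod (s - l) * (Cmod (s + l) * m ^ 2) <= A * (2 * A))%R.
    { apply Rmult_le_compat; try apply Cmod_ge_0; auto. apply Rmult_le_pos; auto; apply Cmod_ge_0. lra. }
    lra.
Qed.

Theorem partial_fractions_6 z : (0 < Im z)%R ->
  csc2 z + 30 * csc2 z ^ 2 + 120 * csc2 z ^ 3 = 120 * / (2 * RtoC PI * Ci) ^ 6 * Ls 6 z.
Proof.
  destruct csc2_bounds as [A [HA HB]].
  apply (partial_fractions 4 (fun z => csc2 z + 30 * csc2 z ^ 2 + 120 * csc2 z ^ 3) _
    (120 * (A * (3 * (A * A))) + 30 * (A * A) + A)%R).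
  - intros; rewrite !csc2_shift; auto.
  - intros w Hw. apply csc2_duplication; auto.
  - intros w Hw Hr. destruct (HB w Hw Hr) as (X & Y & Z). assert (N := upper_neq_0 w Hw).
    set (l := / (2 * RtoC PI * Ci * w) ^ 2) in *. set (s := csc2 w) in *.
    replace (120 * / (2 * RtoC PI * Ci) ^ 6 * / w ^ (4 + 2)) with (120 * l ^ 3).
    2:{ unfold l. generalize two_pi_i_neq_0. generalize (2 * RtoC PI * Ci). intros. simpl Nat.add. field. auto. }
    replace (s + 30 * s ^ 2 + 120 * s ^ 3 - 120 * l ^ 3) with
      (120 * ((s - l) * (s * s + s * l + l * l)) + 30 * (s * s) + s) by ring.
    set (m := Rmin 1 (Im w)) in *. assert (m0 : (0 < m)%R) by (apply Rmin_glb_lt; lra).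
    assert (m1 : (m <= 1)%R) by apply Rmin_l.
    assert (m2 : (0 <= m ^ 2 <= 1)%R) by nra.
    assert (a0 := Cmod_ge_0 s). assert (b0 := Cmod_ge_0 l).
    replace (m ^ 4)%R with (m ^ 2 * m ^ 2)%R by ring.
    set (q := (m ^ 2)%R) in *.
    eapply Rle_trans. apply Rmult_le_compat_r. nra.
    eapply Rle_trans; [apply Cmod_triangle|]. apply Rplus_le_compat_r. apply Cmod_triangle.
    rewrite !Cmod_mult, !Cmod_R, !Rabs_pos_eq by lra.
    assert (P1 : (Cmod s * Cmod s * (q * q) <= A * A)%R).
    { replace (Cmod s * Cmod s * (q * q))%R with ((Cmod s * q) * (Cmod s * q))%R by ring.
      apply Rmult_le_compat; nra. }
    assert (P2 : (Cmod s * Cmod l * (q * q) <= A * A)%R).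
    { replace (Cmod s * Cmod l * (q * q))%R with ((Cmod s * q) * (Cmod l * q))%R by ring.
      apply Rmult_le_compat; nra. }
    assert (P3 : (Cmod l * Cmod l * (q * q) <= A * A)%R).
    { replace (Cmod l * Cmod l * (q * q))%R with ((Cmod l * q) * (Cmod l * q))%R by ring.
      apply Rmult_le_compat; nra. }
    assert (P4 : (Cmod s * (q * q) <= A)%R) by nra.
    assert (T : (Cmod (s * s + s * l + l * l) * (q * q) <= 3 * (A * A))%R).
    { eapply Rle_trans. apply Rmult_le_compat_r. nra.
      eapply Rle_trans; [apply Cmod_triangle|]. apply Rplus_le_compat_r. apply Cmod_triangle.
      rewrite !Cmod_mult. lra. }
    assert (Cmod (s - l) * (Cmod (s * s + s * l + l * l) * (q * q)) <= A * (3 * (A * A)))%R.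
    { apply Rmult_le_compat; auto; try apply Cmod_ge_0. apply Rmult_le_pos; [apply Cmod_ge_0|nra]. }
    lra.
Qed.

(** * Zeta values, Lambert series and Eisenstein series *)

Lemma Cinv_nonzero (x : C) : x <> 0 -> / x <> 0.
Proof.
  intros H E. apply (RtoC_neq_0 1). lra. rewrite <- (Cinv_l x H), E. ring.
Qed.

(** On the imaginary axis the real parts alone give a bound independent of t, valid also at t = 0;
    it is the majorant for letting t tend to 0. *)
Lemma latt_imaginary_bound k t n : (2 <= k)%nat ->
  (Cmod (latt k (RtoC t * Ci) n) <= 2 * / INR (S n) ^ 2)%R.
Proof.
  intros Hk. assert (P : (1 <= INR (S n))%R) by (apply (le_INR 1); lia).
  assert (B : forall w : C, (INR (S n) <= Rabs (Re w))%R -> (Cmod (/ w ^ k) <= / INR (S n) ^ 2)%R).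
  { intros w Hw. eapply Rle_trans. apply (Cmod_inv_pow_le w k (INR (S n))). lra.
    eapply Rle_trans; [exact Hw|apply re_le_Cmod].
    apply Rinv_le_contravar. apply pow_lt; lra. apply Rle_pow; auto. }
  unfold latt. eapply Rle_trans; [apply Cmod_triangle|].
  assert (X1 := B (RtoC t * Ci + RtoC (INR (S n)))). assert (X2 := B (RtoC t * Ci - RtoC (INR (S n)))).
  assert (E1 : Re (RtoC t * Ci + RtoC (INR (S n))) = INR (S n)).
  { unfold Re, Cplus, Cmult, RtoC, Ci. cbn [fst snd]. ring. }
  assert (E2 : Re (RtoC t * Ci - RtoC (INR (S n))) = (- INR (S n))%R).
  { unfold Re, Cminus, Cplus, Copp, Cmult, RtoC, Ci. cbn [fst snd]. ring. }
  rewrite E1 in X1. rewrite E2, Rabs_Ropp in X2. rewrite Rabs_pos_eq in X1, X2 by lra. lra.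
Qed.

(** For even k the value [Zs k 0] is 2 zeta(k). *)
Lemma has_sum_Zs_0 k : (2 <= k)%nat -> has_sum (latt k 0) (Zs k 0).
Proof.
  intros Hk. apply (summable_has_sum _ (fun n => 2 * / INR (S n) ^ 2)%R).
  - intros n. replace (latt k 0 n) with (latt k (RtoC 0 * Ci) n) by (f_equal; ring).
    apply latt_imaginary_bound; auto.
  - apply summable_scal. lra. apply summable_inv_sqr.
Qed.

Lemma Zs_continuous_0 k (t : nat -> R) : (2 <= k)%nat -> (forall n, 0 < t n)%R -> is_lim_seq t 0 ->
  ccv (fun n => Zs k (RtoC (t n) * Ci)) (Zs k 0).
Proof.
  intros Hk Ht Hl.
  apply (tannery (fun n => latt k (RtoC (t n) * Ci)) (latt k 0) (fun n => 2 * / INR (S n) ^ 2)%R).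
  - intros; apply latt_imaginary_bound; auto.
  - apply summable_scal. lra. apply summable_inv_sqr.
  - intros j. assert (X : ccv (fun n => RtoC (t n) * Ci) 0).
    { replace (RtoC 0) with (RtoC 0 * Ci) by ring. apply ccv_mult. apply ccv_RtoC; auto. apply ccv_const. }
    assert (N : RtoC (INR (S j)) <> 0). { apply RtoC_neq_0, not_0_INR. lia. }
    unfold latt. apply ccv_plus; apply ccv_inv; try apply ccv_pow.
    + apply Cpow_nz. rewrite Cplus_0_l. auto.
    + apply ccv_plus; auto. apply ccv_const.
    + apply Cpow_nz. intro E. apply N. replace (RtoC (INR (S j))) with (- (0 - RtoC (INR (S j)))) by ring.
      rewrite E. ring.
    + apply ccv_minus; auto. apply ccv_const.
  - intros n. apply has_sum_Zs; [|lia]. specialize (Ht n).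
    unfold Im, Cmult, RtoC, Ci; simpl. lra.
  - apply has_sum_Zs_0; auto.
Qed.

(** In the duplication formula the poles at z = 0 of [Ls k (z / 2)] and of 2^k [Ls k z] are the
    same; once they are cancelled every term has a limit as z tends to 0. *)
Lemma Ls_midpoint k z : (0 < Im z)%R -> (1 <= k)%nat ->
  Ls k ((z + 1) / 2) = RtoC 2 ^ k * Zs k z - Zs k (z / 2).
Proof.
  intros Hz Hk. assert (X := Ls_duplication k z Hz Hk).
  assert (N := upper_neq_0 z Hz).
  assert (Y : Ls k (z / 2) = RtoC 2 ^ k * / z ^ k + Zs k (z / 2)).
  { unfold Ls. f_equal. assert (RtoC 2 <> 0) by (apply RtoC_neq_0; lra).
    unfold Cdiv. rewrite Cpow_mult_l, Cpow_inv by auto. field. split; apply Cpow_nz; auto. }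
  replace (Ls k ((z + 1) / 2)) with ((Ls k (z / 2) + Ls k ((z + 1) / 2)) - Ls k (z / 2)) by ring.
  rewrite X, Y. unfold Ls. ring.
Qed.

(* Letting [z] tend to [0] in the duplication formula expresses [2 zeta(k)] by the value at [1/2]. *)
Lemma zeta_from_midpoint k (c v : C) (P : C -> C) : (2 <= k)%nat -> c <> 0 ->
  (forall z, (0 < Im z)%R -> P (csc2 z) = c * Ls k z) ->
  (forall u, ccv u (- (1) / 4) -> ccv (fun n => P (u n)) v) ->
  (RtoC 2 ^ k - 1) * Zs k 0 = v / c.
Proof.
  intros Hk Hc HP Hv.
  set (t := fun n => (1 * / INR (S n))%R).
  assert (T0 : forall n, (0 < t n)%R).
  { intros n. unfold t. rewrite Rmult_1_l. apply Rinv_0_lt_compat, lt_0_INR. lia. }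
  assert (Tl : is_lim_seq t 0) by apply is_lim_seq_scal_inv.
  assert (Tl2 : is_lim_seq (fun n => t n / 2)%R 0).
  { replace (Finite 0) with (Rbar_mult 0 (/ 2)%R) by (simpl; f_equal; ring). apply is_lim_seq_scal_r; auto. }
  set (z := fun n => RtoC (t n) * Ci).
  assert (Hz : forall n, (0 < Im (z n))%R).
  { intros n. specialize (T0 n). unfold z, Im, Cmult, RtoC, Ci; simpl. lra. }
  apply (ccv_unique (fun n => Ls k ((z n + 1) / 2))).
  - apply (ccv_ext (fun n => RtoC 2 ^ k * Zs k (z n) - Zs k (RtoC (t n / 2) * Ci))).
    + intros n. rewrite Ls_midpoint by (auto; lia). do 2 f_equal. unfold z.
      rewrite RtoC_div by lra. field.
    + replace ((RtoC 2 ^ k - 1) * Zs k 0) with (RtoC 2 ^ k * Zs k 0 - Zs k 0) by ring.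
      apply ccv_minus. apply ccv_scal. apply Zs_continuous_0; auto.
      apply Zs_continuous_0; auto. intros n. specialize (T0 n). lra.
  - apply (ccv_ext (fun n => / c * P (csc2 ((z n + 1) / 2)))).
    + intros n. rewrite HP by apply half_plane, Hz. field. auto.
    + replace (v / c) with (/ c * v) by (field; auto). apply ccv_scal. apply Hv.
      unfold csc2.
      (* At (z + 1)/2 with z = i t the nome is -exp(-pi t), which tends to -1; X/(1 - X)^2 then
         tends to -1/4. *)
      assert (Xl : ccv (fun n => nome 1 ((z n + 1) / 2)) (- (1))).
      { apply (ccv_ext (fun n => - (1) * RtoC (exp (- (PI * t n))))).
        - intros n. rewrite nome_half_shift, nome_polar. unfold z.
          replace (Re (RtoC (t n) * Ci / 2)) with 0%R.
          2:{ unfold Re, Cdiv, Cinv, Cmult, RtoC, Ci; simpl. field. }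
          replace (Im (RtoC (t n) * Ci / 2)) with (t n / 2)%R.
          2:{ unfold Im, Cdiv, Cinv, Cmult, RtoC, Ci; simpl. field. }
          replace (2 * PI * 1 * (t n / 2))%R with (PI * t n)%R by field.
          rewrite Rmult_0_r. unfold cis. rewrite Cmult_0_l, Cexp_0. ring.
        - assert (Q : ccv (fun n => RtoC (exp (- (PI * t n)))) 1).
          2:{ apply (ccv_scal (- (1))) in Q. rewrite Cmult_1_r in Q. exact Q. }
          apply ccv_RtoC. rewrite <- exp_0. apply is_lim_seq_continuous.
          apply derivable_continuous_pt, derivable_pt_exp.
          apply (is_lim_seq_ext (fun n => - PI * t n)%R). intros; ring.
          replace (Finite 0) with (Rbar_mult (- PI)%R 0) by (simpl; f_equal; ring).
          apply is_lim_seq_scal_l; auto. }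
      assert (N2 : RtoC 2 <> 0) by (apply RtoC_neq_0; lra).
      replace (- (1) / 4) with (- (1) / ((1 - - (1)) ^ 2)).
      2:{ replace (1 - - (1)) with (RtoC 2) by (rewrite <- RtoC_opp, <- RtoC_minus; f_equal; ring).
          rewrite <- RtoC_pow. do 2 f_equal. ring. }
      unfold Cdiv. apply ccv_mult; auto. apply ccv_inv.
      * apply Cpow_nz. replace (1 - - (1)) with (RtoC 2); auto.
        rewrite <- RtoC_opp, <- RtoC_minus; f_equal; ring.
      * apply ccv_pow, ccv_minus; auto. apply ccv_const.
Qed.


(** This is pi^2/3, kept in powers of 2 pi i because the coefficients of the partial fractions are.
    The divisors 3, 15 and 63 in the three evaluations are 2^k - 1. *)
Lemma Zs_2_0 : Zs 2 0 = - (2 * RtoC PI * Ci) ^ 2 / 12.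
Proof.
  assert (T := two_pi_i_neq_0).
  assert (X := zeta_from_midpoint 2 (/ (2 * RtoC PI * Ci) ^ 2) (- (1) / 4) (fun s => s)).
  set (w := 2 * RtoC PI * Ci) in *.
  specialize (X (Nat.le_refl _) ltac:(apply Cinv_nonzero, Cpow_nz; auto)).
  specialize (X partial_fractions_2 (fun u H => H)).
  replace (Zs 2 0) with ((RtoC 2 ^ 2 - 1) * Zs 2 0 / 3) by field. rewrite X. field. auto.
Qed.

Lemma Zs_4_0 : Zs 4 0 = (2 * RtoC PI * Ci) ^ 4 / 720.
Proof.
  assert (T := two_pi_i_neq_0).
  assert (X := zeta_from_midpoint 4 (6 * / (2 * RtoC PI * Ci) ^ 4) (- (1) / 4 + 6 * (- (1) / 4) ^ 2)
    (fun s => s + 6 * s ^ 2)).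
  set (w := 2 * RtoC PI * Ci) in *.
  specialize (X ltac:(lia) ltac:(apply Cmult_neq_0; [apply RtoC_neq_0; lra|apply Cinv_nonzero, Cpow_nz; auto])).
  specialize (X partial_fractions_4).
  assert (Y : (RtoC 2 ^ 4 - 1) * Zs 4 0 = (- (1) / 4 + 6 * (- (1) / 4) ^ 2) / (6 * / w ^ 4)).
  { apply X. intros u Hu. apply ccv_plus; auto. apply ccv_scal, ccv_pow; auto. }
  replace (Zs 4 0) with ((RtoC 2 ^ 4 - 1) * Zs 4 0 / 15) by field. rewrite Y. field. auto.
Qed.

Lemma Zs_6_0 : Zs 6 0 = - (2 * RtoC PI * Ci) ^ 6 / 30240.
Proof.
  assert (T := two_pi_i_neq_0).
  assert (X := zeta_from_midpoint 6 (120 * / (2 * RtoC PI * Ci) ^ 6)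
    (- (1) / 4 + 30 * (- (1) / 4) ^ 2 + 120 * (- (1) / 4) ^ 3) (fun s => s + 30 * s ^ 2 + 120 * s ^ 3)).
  set (w := 2 * RtoC PI * Ci) in *.
  specialize (X ltac:(lia) ltac:(apply Cmult_neq_0; [apply RtoC_neq_0; lra|apply Cinv_nonzero, Cpow_nz; auto])).
  specialize (X partial_fractions_6).
  assert (Y : (RtoC 2 ^ 6 - 1) * Zs 6 0 =
    (- (1) / 4 + 30 * (- (1) / 4) ^ 2 + 120 * (- (1) / 4) ^ 3) / (120 * / w ^ 6)).
  { apply X. intros u Hu. apply ccv_plus. apply ccv_plus; auto. apply ccv_scal, ccv_pow; auto.
    apply ccv_scal, ccv_pow; auto. }
  replace (Zs 6 0) with ((RtoC 2 ^ 6 - 1) * Zs 6 0 / 63) by field. rewrite Y. field. auto.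
Qed.

(** * Lambert series of the divisor sums *)

Lemma has_sum_pow_geom p (X : C) : (Cmod X < 1)%R ->
  has_sum (fun d => RtoC (INR (S d) ^ p) * X ^ d) (CSeries (fun d => RtoC (INR (S d) ^ p) * X ^ d)).
Proof.
  intros HX. apply (summable_has_sum _ (fun d => INR (S d) ^ p * Cmod X ^ d)%R).
  - intros d. rewrite Cmod_mult, Cmod_pow, Cmod_R, Rabs_pos_eq by apply pow_le, pos_INR. lra.
  - apply summable_pow_geom. split; auto. apply Cmod_ge_0.
Qed.

(** Splitting off the first term and expanding (d + 2)^p by the binomial theorem around d + 1
    expresses [T p] through X and all [T i] with i <= p, a triangular system that is solved in turn
    for p = 0, ..., 5. *)
Lemma pow_geom_closed_forms (X : C) : (Cmod X < 1)%R ->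
  let s := X / (1 - X) ^ 2 in
  let T p := X * CSeries (fun d => RtoC (INR (S d) ^ p) * X ^ d) in
  T 1%nat = s /\ T 3%nat = s + 6 * s ^ 2 /\ T 5%nat = s + 30 * s ^ 2 + 120 * s ^ 3.
Proof.
  intros HX s T. unfold T. clear T.
  set (T := fun p => CSeries (fun d => RtoC (INR (S d) ^ p) * X ^ d)).
  assert (HT : forall p, has_sum (fun d => RtoC (INR (S d) ^ p) * X ^ d) (T p)).
  { intros p. apply has_sum_pow_geom; auto. }
  assert (N := one_minus_neq_0 X HX).
  assert (Rec : forall p (R : C), has_sum (fun d => RtoC (INR (S (S d)) ^ p) * X ^ d) R -> T p = 1 + X * R).
  { intros p R HR. apply (ccv_unique (csum (fun d => RtoC (INR (S d) ^ p) * X ^ d))). apply HT.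
    replace (1 + X * R) with (RtoC (INR 1 ^ p) * X ^ 0 + X * R).
    2:{ simpl INR. rewrite pow1. ring. }
    apply (has_sum_shift (fun d => RtoC (INR (S d) ^ p) * X ^ d)).
    apply (has_sum_ext (fun d => X * (RtoC (INR (S (S d)) ^ p) * X ^ d))).
    intros n. rewrite Cpow_S. ring. apply has_sum_scal; auto. }
  assert (T0 : T 0%nat = / (1 - X)).
  { assert (E : T 0%nat = 1 + X * T 0%nat). { apply Rec. exact (HT 0%nat). }
    replace (T 0%nat) with ((T 0%nat - X * T 0%nat) / (1 - X)) by (field; auto).
    rewrite E at 1. field. auto. }
  assert (Step : forall p (R : C), T p = 1 + X * (T p + R) -> T p = (1 + X * R) / (1 - X)).
  { intros p R E. replace (T p) with ((T p - X * T p) / (1 - X)) by (field; auto).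
    rewrite E at 1. field. auto. }
  assert (T1 : T 1%nat = (1 + X * T 0%nat) / (1 - X)).
  { apply Step, Rec.
    eapply has_sum_ext; [|apply (has_sum_plus _ _ _ _ (HT 1%nat) (HT 0%nat))].
    intros n. cbv beta. rewrite (S_INR (S n)), <- Cmult_plus_distr_r, <- RtoC_plus. f_equal. f_equal. ring. }
  assert (T2 : T 2%nat = (1 + X * (2 * T 1%nat + T 0%nat)) / (1 - X)).
  { apply Step, Rec.
    eapply has_sum_ext; [|apply (has_sum_plus _ _ _ _ (HT 2%nat)
      (has_sum_plus _ _ _ _ (has_sum_scal 2 _ _ (HT 1%nat)) (HT 0%nat)))].
    intros n. cbv beta. rewrite (S_INR (S n)), !RtoC_pow, RtoC_plus. ring. }
  assert (T3 : T 3%nat = (1 + X * (3 * T 2%nat + (3 * T 1%nat + T 0%nat))) / (1 - X)).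
  { apply Step, Rec.
    eapply has_sum_ext; [|apply (has_sum_plus _ _ _ _ (HT 3%nat)
      (has_sum_plus _ _ _ _ (has_sum_scal 3 _ _ (HT 2%nat))
      (has_sum_plus _ _ _ _ (has_sum_scal 3 _ _ (HT 1%nat)) (HT 0%nat))))].
    intros n. cbv beta. rewrite (S_INR (S n)), !RtoC_pow, RtoC_plus. ring. }
  assert (T4 : T 4%nat = (1 + X * (4 * T 3%nat + (6 * T 2%nat + (4 * T 1%nat + T 0%nat)))) / (1 - X)).
  { apply Step, Rec.
    eapply has_sum_ext; [|apply (has_sum_plus _ _ _ _ (HT 4%nat)
      (has_sum_plus _ _ _ _ (has_sum_scal 4 _ _ (HT 3%nat))
      (has_sum_plus _ _ _ _ (has_sum_scal 6 _ _ (HT 2%nat))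
      (has_sum_plus _ _ _ _ (has_sum_scal 4 _ _ (HT 1%nat)) (HT 0%nat)))))].
    intros n. cbv beta. rewrite (S_INR (S n)), !RtoC_pow, RtoC_plus. ring. }
  assert (T5 : T 5%nat = (1 + X * (5 * T 4%nat + (10 * T 3%nat + (10 * T 2%nat + (5 * T 1%nat + T 0%nat))))) / (1 - X)).
  { apply Step, Rec.
    eapply has_sum_ext; [|apply (has_sum_plus _ _ _ _ (HT 5%nat)
      (has_sum_plus _ _ _ _ (has_sum_scal 5 _ _ (HT 4%nat))
      (has_sum_plus _ _ _ _ (has_sum_scal 10 _ _ (HT 3%nat))
      (has_sum_plus _ _ _ _ (has_sum_scal 10 _ _ (HT 2%nat))
      (has_sum_plus _ _ _ _ (has_sum_scal 5 _ _ (HT 1%nat)) (HT 0%nat))))))].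
    intros n. cbv beta. rewrite (S_INR (S n)), !RtoC_pow, RtoC_plus. ring. }
  change (X * T 1%nat = s /\ X * T 3%nat = s + 6 * s ^ 2 /\ X * T 5%nat = s + 30 * s ^ 2 + 120 * s ^ 3).
  rewrite T5, T4, T3, T2, T1, T0. unfold s. repeat split; field; auto.
Qed.

Lemma INR_list_sum_filter (f : nat -> nat) (g : nat -> bool) N :
  INR (list_sum (map f (filter g (seq 1 N)))) =
  rsum (fun d => if g (S d) then INR (f (S d)) else 0%R) N.
Proof.
  induction N as [|N IH]; [reflexivity|].
  rewrite seq_S, filter_app, map_app, list_sum_app, plus_INR, IH. simpl rsum. f_equal.
  replace (1 + N)%nat with (S N) by lia. cbn [filter]. destruct (g (S N)); simpl; auto.
  rewrite Nat.add_0_r. auto.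
Qed.

Lemma csum_RtoC (a : nat -> R) N : csum (fun n => RtoC (a n)) N = RtoC (rsum a N).
Proof. induction N; simpl; auto. rewrite IHN, RtoC_plus. auto. Qed.

Lemma has_sum_finite (a : nat -> C) N : (forall n, (N <= n)%nat -> a n = 0) -> has_sum a (csum a N).
Proof.
  intros H eps He. exists N. intros n Hn. replace n with (N + (n - N))%nat by lia.
  rewrite csum_add. replace (csum (fun k => a (N + k)%nat) (n - N)) with (RtoC 0).
  - replace (csum a N + 0 - csum a N) with (RtoC 0) by ring. rewrite Cmod_0; auto.
  - rewrite <- (csum_0 (n - N)). apply csum_ext. intros; symmetry; apply H; lia.
Qed.

(** The array behind the Lambert series: row n collects the divisors of n + 1, column d the
    multiples of d + 1. *)
Definition multiple_term (p : nat) (X : C) (n d : nat) : C :=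
  if Nat.eqb (Nat.modulo (S n) (S d)) 0 then RtoC (INR (S d) ^ p) * X ^ S n else 0.

Lemma multiple_term_row p X n :
  has_sum (multiple_term p X n) (RtoC (INR (divisor_sigma p (S n))) * X ^ S n).
Proof.
  replace (RtoC (INR (divisor_sigma p (S n))) * X ^ S n) with (csum (multiple_term p X n) (S n)).
  - apply has_sum_finite. intros d Hd. unfold multiple_term.
    rewrite Nat.mod_small by lia. reflexivity.
  - unfold divisor_sigma. rewrite INR_list_sum_filter, <- csum_RtoC, Cmult_comm, <- csum_scal.
    apply csum_ext. intros d Hd. unfold multiple_term.
    destruct (Nat.eqb (S n mod S d) 0); [|ring]. rewrite pow_INR. ring.
Qed.

(** In each block of d + 1 consecutive indices n only the last one makes n + 1 a multiple of d +
    1. *)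
Lemma multiple_term_column p X d M :
  csum (fun n => multiple_term p X n d) (S d * M) =
  csum (fun m => RtoC (INR (S d) ^ p) * X ^ (S m * S d)) M.
Proof.
  induction M as [|M IH]; [rewrite Nat.mul_0_r; reflexivity|].
  rewrite Nat.mul_succ_r, csum_add, IH. cbn [csum]. f_equal.
  replace (csum (fun n => multiple_term p X (S d * M + n) d) d) with (RtoC 0).
  - unfold multiple_term. replace (S (S d * M + d)) with (S M * S d)%nat by lia.
    rewrite Nat.Div0.mod_mul. simpl Nat.eqb. cbv iota. ring.
  - rewrite <- (csum_0 d). apply csum_ext. intros k Hk. unfold multiple_term.
    replace (S (S d * M + k)) with (S k + M * S d)%nat by lia.
    rewrite Nat.Div0.mod_add, Nat.mod_small by lia. reflexivity.
Qed.

Lemma pow_add_le (r : R) n m k : (0 <= r <= 1)%R -> (n + m <= k)%nat -> (r ^ k <= r ^ n * r ^ m)%R.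
Proof.
  intros Hr Hk. rewrite <- pow_add. replace k with (n + m + (k - (n + m)))%nat by lia.
  rewrite (pow_add r (n + m)). rewrite <- (Rmult_1_r (r ^ (n + m))) at 2.
  apply Rmult_le_compat_l. apply pow_le; lra. rewrite <- (pow1 (k - (n + m))). apply pow_incr; lra.
Qed.

Lemma has_sum_geom (X : C) : (Cmod X < 1)%R -> has_sum (fun m => X ^ m) (/ (1 - X)).
Proof.
  intros HX. assert (N := one_minus_neq_0 X HX).
  assert (E : forall n, csum (fun m => X ^ m) n = / (1 - X) * (1 - X ^ n)).
  { induction n; cbn [csum Cpow]. ring. rewrite IHn. field. auto. }
  apply (ccv_ext (fun n => / (1 - X) * (1 - X ^ n))). intros; symmetry; apply E.
  replace (/ (1 - X)) with (/ (1 - X) * (1 - 0)) at 1 by ring. apply ccv_scal, ccv_minus. apply ccv_const.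
  apply (ccv_squeeze _ _ (fun n => Cmod X ^ n)%R).
  - intros n. replace (X ^ n - 0) with (X ^ n) by ring. rewrite Cmod_pow. lra.
  - apply is_lim_seq_geom. rewrite Rabs_pos_eq; auto. apply Cmod_ge_0.
Qed.

Lemma Cmod_pow_S_lt (X : C) n : (Cmod X < 1)%R -> (Cmod (X ^ S n) <= Cmod X)%R.
Proof.
  intros HX. assert (P := Cmod_ge_0 X). rewrite Cmod_pow. simpl.
  assert (Cmod X ^ n <= 1)%R by (rewrite <- (pow1 n); apply pow_incr; lra).
  assert (0 <= Cmod X ^ n)%R by (apply pow_le; lra). nra.
Qed.

(** The three orders of summation serve different ends: by n for the q-expansion, by the cofactor m
    for the passage to lattice sums, and by the divisor d for the logarithmic derivative of the
    Euler product. *)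
Theorem lambert_series p (X : C) : (Cmod X < 1)%R ->
  has_sum (fun n => RtoC (INR (divisor_sigma p (S n))) * X ^ S n)
    (CSeries (fun n => RtoC (INR (divisor_sigma p (S n))) * X ^ S n)) /\
  has_sum (fun m => X ^ S m * CSeries (fun d => RtoC (INR (S d) ^ p) * (X ^ S m) ^ d))
    (CSeries (fun n => RtoC (INR (divisor_sigma p (S n))) * X ^ S n)) /\
  has_sum (fun d => RtoC (INR (S d) ^ p) * (X ^ S d / (1 - X ^ S d)))
    (CSeries (fun n => RtoC (INR (divisor_sigma p (S n))) * X ^ S n)).
Proof.
  intros HX. assert (X0 := Cmod_ge_0 X). set (r := Cmod X) in *.
  assert (S0 : (0 <= sqrt r < 1)%R).
  { split. apply sqrt_pos. rewrite <- sqrt_1. apply sqrt_lt_1_alt; lra. }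
  (* A nonzero entry has d <= n, so r^(n+1) = sqrt(r)^(2n+2) can be split into a factor for the row
     and one for the column. *)
  assert (B1 : forall n d, (Cmod (multiple_term p X n d) <= INR (S n) ^ p * sqrt r ^ n * sqrt r ^ d)%R).
  { intros n d. unfold multiple_term. destruct (Nat.eqb_spec (S n mod S d) 0) as [E|E].
    - assert (Hd : (d <= n)%nat).
      { apply Nat.Div0.mod_divides in E. destruct E as [c E]. destruct c; lia. }
      rewrite Cmod_mult, Cmod_pow, Cmod_R, Rabs_pos_eq by apply pow_le, pos_INR. fold r.
      rewrite Rmult_assoc. apply Rmult_le_compat. apply pow_le, pos_INR. apply pow_le; lra.
      apply pow_incr. split. apply pos_INR. apply le_INR. lia.
      rewrite <- (sqrt_sqrt r) at 1 by lra. rewrite Rpow_mult_distr, <- pow_add.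
      apply pow_add_le. lra. lia.
    - rewrite Cmod_0. apply Rmult_le_pos; [apply Rmult_le_pos|]; apply pow_le; try lra. apply pos_INR. }
  destruct (double_sum_swap (multiple_term p X) _ _ B1 (summable_pow_geom p _ S0)) as [R1 R2].
  { assert (Y := summable_pow_geom 0 _ S0). simpl in Y. eapply summable_le; [|exact Y].
    intros k; simpl. assert (0 <= sqrt r ^ k)%R by (apply pow_le; lra). lra. }
  assert (E1 : forall n, CSeries (multiple_term p X n) = RtoC (INR (divisor_sigma p (S n))) * X ^ S n).
  { intros n. apply CSeries_unique, multiple_term_row. }
  rewrite (CSeries_ext _ _ E1) in R1, R2.
  split. { eapply has_sum_ext; [|exact R1]. exact E1. }
  assert (B2 : forall m d, (Cmod (RtoC (INR (S d) ^ p) * X ^ (S m * S d)) <= r ^ m * (INR (S d) ^ p * r ^ d))%R).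
  { intros m d. rewrite Cmod_mult, Cmod_pow, Cmod_R, Rabs_pos_eq by apply pow_le, pos_INR. fold r.
    replace (r ^ m * (INR (S d) ^ p * r ^ d))%R with (INR (S d) ^ p * (r ^ m * r ^ d))%R by ring.
    apply Rmult_le_compat_l. apply pow_le, pos_INR. apply pow_add_le. lra. nia. }
  destruct (double_sum_swap (fun m d => RtoC (INR (S d) ^ p) * X ^ (S m * S d)) _ _ B2) as [Q1 Q2].
  { assert (Y := summable_pow_geom 0 r ltac:(lra)). simpl in Y. eapply summable_le; [|exact Y].
    intros k; simpl. assert (0 <= r ^ k)%R by (apply pow_le; lra). lra. }
  { apply summable_pow_geom; lra. }
  assert (E2 : forall d, CSeries (fun n => multiple_term p X n d) =
     CSeries (fun m => RtoC (INR (S d) ^ p) * X ^ (S m * S d))).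
  { intros d. symmetry. apply CSeries_unique.
    assert (Hs : has_sum (fun n => multiple_term p X n d) (CSeries (fun n => multiple_term p X n d))).
    { apply (summable_has_sum _ (fun n => INR (S n) ^ p * sqrt r ^ n)%R); [|apply summable_pow_geom; auto].
      intros n. eapply Rle_trans; [apply B1|].
      rewrite <- (Rmult_1_r (INR (S n) ^ p * sqrt r ^ n)) at 2. apply Rmult_le_compat_l.
      apply Rmult_le_pos; apply pow_le; try lra. apply pos_INR.
      rewrite <- (pow1 d). apply pow_incr; lra. }
    unfold has_sum. eapply ccv_ext. intros M. apply multiple_term_column.
    apply (ccv_subseq (csum (fun n => multiple_term p X n d)) _ (fun M => (S d * M)%nat)); auto. intros; nia. }
  assert (Xm : forall m, (Cmod (X ^ S m) < 1)%R).
  { intros m. eapply Rle_lt_trans; [apply Cmod_pow_S_lt; auto|auto]. }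
  rewrite (ccv_unique _ _ _ R2 (has_sum_ext _ _ _ (fun d => eq_sym (E2 d)) Q2)).
  split.
  2:{ eapply has_sum_ext; [|exact Q2]. intros d. cbv beta. apply CSeries_unique, has_sum_scal.
      apply (has_sum_ext (fun m => X ^ S d * (X ^ S d) ^ m)).
      - intros m. rewrite Nat.mul_comm, Cpow_mult_r, (Cpow_S (X ^ S d)). ring.
      - apply has_sum_scal, has_sum_geom; auto. }
  eapply has_sum_ext; [|exact Q1]. intros m. cbv beta. apply CSeries_unique.
  apply (has_sum_ext (fun d => X ^ S m * (RtoC (INR (S d) ^ p) * (X ^ S m) ^ d))).
  - intros d. rewrite Cpow_mult_r, (Cpow_S (X ^ S m)). ring.
  - apply has_sum_scal, has_sum_pow_geom; auto.
Qed.

(** * Inversion of the lattice sums of weight 4 and 6 *)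

Lemma nome_1_pow tau n : nome 1 tau ^ n = nome 1 (RtoC (INR n) * tau).
Proof.
  unfold nome. rewrite <- Cexp_nat. f_equal. ring.
Qed.

Lemma Im_scal (x : R) (tau : C) : Im (RtoC x * tau) = (x * Im tau)%R.
Proof. destruct tau; unfold Im, Cmult, RtoC; simpl. ring. Qed.

Lemma Im_nat_pos n tau : (0 < Im tau)%R -> (0 < Im (RtoC (INR (S n)) * tau))%R.
Proof. intros H. rewrite Im_scal. apply Rmult_lt_0_compat; auto. apply lt_0_INR; lia. Qed.

(** Lipschitz's formula at each point (m + 1) tau: the inner Lambert sum has a closed form in
    [csc2], which the partial fractions turn into [Ls]. *)
Lemma sigma_series_Ls tau : (0 < Im tau)%R ->
  has_sum (fun m => / (2 * RtoC PI * Ci) ^ 2 * Ls 2 (RtoC (INR (S m)) * tau)) (sigma_series 1 tau) /\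
  has_sum (fun m => 6 * / (2 * RtoC PI * Ci) ^ 4 * Ls 4 (RtoC (INR (S m)) * tau)) (sigma_series 3 tau) /\
  has_sum (fun m => 120 * / (2 * RtoC PI * Ci) ^ 6 * Ls 6 (RtoC (INR (S m)) * tau)) (sigma_series 5 tau).
Proof.
  intros Ht. assert (q1 := nome_1_lt tau Ht).
  repeat split; (eapply has_sum_ext; [|apply (proj1 (proj2 (lambert_series _ _ q1)))]); intros m; cbv beta;
    assert (Hm := Im_nat_pos m tau Ht);
    destruct (pow_geom_closed_forms (nome 1 tau ^ S m)) as (C1 & C3 & C5);
    try (rewrite nome_1_pow; apply nome_1_lt; auto).
  - rewrite C1, <- partial_fractions_2 by auto. unfold csc2. rewrite nome_1_pow. reflexivity.
  - rewrite C3, <- partial_fractions_4 by auto. unfold csc2. rewrite nome_1_pow. reflexivity.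
  - rewrite C5, <- partial_fractions_6 by auto. unfold csc2. rewrite nome_1_pow. reflexivity.
Qed.

(** Only indices m + 1 > 0 and nonzero n occur; the points of the two axes are kept apart so that
    inversion becomes a transposition of the array. *)
Definition lattice_term (k : nat) (tau : C) (m n : nat) : C := latt k (RtoC (INR (S m)) * tau) n.

Lemma lattice_term_bound (tau : C) : (0 < Im tau)%R ->
  exists c, (0 < c <= 1)%R /\ forall (m : nat) (t : R),
    (c * (INR (S m) + Rabs t) <= Cmod (RtoC (INR (S m)) * tau + RtoC t))%R.
Proof.
  intros Ht. destruct (lattice_lower_bound tau Ht) as [c [Hc Hb]]. exists c. split; auto.
  intros m t. assert (P : (0 < INR (S m))%R) by (apply lt_0_INR; lia).
  replace (RtoC (INR (S m)) * tau + RtoC t) with (RtoC (INR (S m)) * (tau + RtoC (t / INR (S m)))).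
  - rewrite Cmod_mult, Cmod_R, (Rabs_pos_eq (INR (S m))) by lra.
    specialize (Hb (t / INR (S m))%R). apply (Rmult_le_compat_l (INR (S m))) in Hb; [|lra].
    unfold Rdiv in *. rewrite Rabs_mult, (Rabs_pos_eq (/ INR (S m))) in Hb.
    2:{ left; apply Rinv_0_lt_compat; auto. }
    replace (INR (S m) * (c * (1 + Rabs t * / INR (S m))))%R with (c * (INR (S m) + Rabs t))%R in Hb by (field; lra).
    auto.
  - rewrite RtoC_div by lra. field. apply RtoC_neq_0; lra.
Qed.

(** The lower bound c (x + y) for |x tau + y|, raised to the fourth power, dominates x^2 y^2 up to a
    constant. This is where k >= 4 enters, and why weight 2 calls for another device. *)
Lemma lattice_term_summable k tau : (0 < Im tau)%R -> (4 <= k)%nat ->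
  exists K, (0 <= K)%R /\ forall m n,
    (Cmod (lattice_term k tau m n) <= K * / INR (S m) ^ 2 * / INR (S n) ^ 2)%R.
Proof.
  intros Ht Hk. destruct (lattice_term_bound tau Ht) as [c [Hc Hb]].
  assert (C0 : (0 < / c ^ k)%R) by (apply Rinv_0_lt_compat, pow_lt; lra).
  exists (2 * / c ^ k)%R. split. lra. intros m n.
  assert (P1 : (1 <= INR (S m))%R) by (apply (le_INR 1); lia).
  assert (P2 : (1 <= INR (S n))%R) by (apply (le_INR 1); lia).
  assert (W : forall w, (c * (INR (S m) + INR (S n)) <= Cmod w)%R ->
    (Cmod (/ w ^ k) <= / c ^ k * / INR (S m) ^ 2 * / INR (S n) ^ 2)%R).
  { intros w Hw. eapply Rle_trans. apply (Cmod_inv_pow_le w k (c * (INR (S m) + INR (S n)))); auto. nra.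
    rewrite Rpow_mult_distr, Rinv_mult, Rmult_assoc. apply Rmult_le_compat_l. lra.
    rewrite <- Rinv_mult. apply Rinv_le_contravar. apply Rmult_lt_0_compat; apply pow_lt; lra.
    apply Rle_trans with ((INR (S m) + INR (S n)) ^ 4)%R; [|apply Rle_pow; auto; lra].
    replace ((INR (S m) + INR (S n)) ^ 4)%R with ((INR (S m) + INR (S n)) ^ 2 * (INR (S m) + INR (S n)) ^ 2)%R by ring.
    apply Rmult_le_compat; try apply pow2_ge_0; apply pow_incr; lra. }
  unfold lattice_term, latt. eapply Rle_trans; [apply Cmod_triangle|].
  assert (X1 := W (RtoC (INR (S m)) * tau + RtoC (INR (S n)))).
  assert (X2 := W (RtoC (INR (S m)) * tau + RtoC (- INR (S n)))).
  rewrite RtoC_opp in X2.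
  assert (Y1 := Hb m (INR (S n))). assert (Y2 := Hb m (- INR (S n))%R).
  rewrite Rabs_Ropp, RtoC_opp in Y2. rewrite Rabs_pos_eq in Y1, Y2 by lra.
  specialize (X1 Y1). specialize (X2 Y2). unfold Cminus. lra.
Qed.

Lemma opp_inv_scal (x : R) (tau : C) : tau <> 0 -> RtoC x * (- RtoC 1 / tau) = - RtoC x / tau.
Proof. intros. field. auto. Qed.

Lemma lattice_term_inversion k tau m n : (0 < Im tau)%R -> Nat.Even k ->
  lattice_term k (- RtoC 1 / tau) m n = tau ^ k * lattice_term k tau n m.
Proof.
  intros Ht [j Hj]. assert (N := upper_neq_0 tau Ht).
  assert (Hn := Im_nat_pos n tau Ht).
  unfold lattice_term, latt. rewrite opp_inv_scal by auto.
  set (a := RtoC (INR (S m))). set (b := RtoC (INR (S n))).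
  assert (N1 : b * tau - a <> 0) by (apply upper_minus_neq_0; auto).
  assert (N2 : b * tau + a <> 0) by (apply upper_plus_neq_0; auto).
  assert (E1 : - a / tau + b = (b * tau - a) * / tau) by (field; auto).
  assert (E2 : - a / tau - b = (- (1)) * (b * tau + a) * / tau) by (field; auto).
  assert (Q : (- (1)) ^ k = RtoC 1).
  { rewrite Hj, Cpow_mult_r. replace ((- (1)) ^ 2) with (RtoC 1) by (simpl; ring). apply Cpow_1_l. }
  rewrite E1, E2, !Cpow_mult_l, Q, Cpow_inv by auto.
  field. repeat split; apply Cpow_nz; auto.
Qed.

(** The points on the axis n = 0 are taken out; their sum is zeta(k)/tau^k, that is, half of
    [Zs k 0] over tau^k. *)
Lemma Zs_double_sum k tau : (0 < Im tau)%R -> (2 <= k)%nat -> Nat.Even k -> forall S,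
  has_sum (fun m => Ls k (RtoC (INR (Datatypes.S m)) * tau)) S ->
  has_sum (fun m => Zs k (RtoC (INR (Datatypes.S m)) * tau)) (S - Zs k 0 / (2 * tau ^ k)).
Proof.
  intros Ht Hk [j Hj] S HS. assert (N := upper_neq_0 tau Ht).
  apply (has_sum_ext (fun m => Ls k (RtoC (INR (Datatypes.S m)) * tau) - latt k 0 m / (2 * tau ^ k))).
  - intros m. assert (RtoC (INR (Datatypes.S m)) <> 0) by (apply RtoC_neq_0, not_0_INR; lia).
    unfold Ls, latt. set (a := RtoC (INR (Datatypes.S m))) in *.
    replace (0 + a) with a by ring. replace (0 - a) with ((- (1)) * a) by ring.
    assert (Q : (- (1)) ^ k = RtoC 1).
    { rewrite Hj, Cpow_mult_r. replace ((- (1)) ^ 2) with (RtoC 1) by (simpl; ring). apply Cpow_1_l. }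
    rewrite !Cpow_mult_l, Q. field. split; apply Cpow_nz; auto.
  - apply has_sum_minus; auto.
    apply (has_sum_ext (fun m => / (2 * tau ^ k) * latt k 0 m)). intros; unfold Cdiv; ring.
    unfold Cdiv. rewrite (Cmult_comm (Zs k 0)). apply has_sum_scal, has_sum_Zs_0; auto.
Qed.

(* The Eisenstein series [G_k] splits into the two axes and the four quadrants; inversion
   exchanges the axes and transposes the quadrant sums. *)
Lemma eisenstein_inversion k tau S S' : (0 < Im tau)%R -> (4 <= k)%nat -> Nat.Even k ->
  has_sum (fun m => Ls k (RtoC (INR (Datatypes.S m)) * tau)) S ->
  has_sum (fun m => Ls k (RtoC (INR (Datatypes.S m)) * (- RtoC 1 / tau))) S' ->
  Zs k 0 + 2 * S' = tau ^ k * (Zs k 0 + 2 * S).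
Proof.
  intros Ht Hk Hev HS HS'. assert (N := upper_neq_0 tau Ht). assert (Ht' := Im_opp_inv_pos tau Ht).
  destruct (lattice_term_summable k tau Ht Hk) as [K [HK Hb]].
  destruct (double_sum_swap (lattice_term k tau) (fun m => K * / INR (Datatypes.S m) ^ 2)%R
    (fun n => / INR (Datatypes.S n) ^ 2)%R Hb) as [R1 R2].
  { apply summable_scal; auto. apply summable_inv_sqr. }
  { apply summable_inv_sqr. }
  assert (W := Zs_double_sum k tau Ht ltac:(lia) Hev S HS).
  assert (W' := Zs_double_sum k _ Ht' ltac:(lia) Hev S' HS').
  assert (U := ccv_unique _ _ _ R1 W). rewrite U in R2.
  assert (U' : S' - Zs k 0 / (2 * (- RtoC 1 / tau) ^ k) = tau ^ k * (S - Zs k 0 / (2 * tau ^ k))).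
  { apply (ccv_unique _ _ _ W'). eapply has_sum_ext; [|apply has_sum_scal; exact R2].
    intros m. cbv beta. symmetry. unfold Zs. apply CSeries_unique.
    eapply has_sum_ext. intros n. symmetry. apply (lattice_term_inversion k tau m n Ht Hev).
    apply has_sum_scal.
    apply (summable_has_sum _ (fun n => K * / INR (Datatypes.S m) ^ 2 * / INR (Datatypes.S n) ^ 2)%R).
    - intros n. eapply Rle_trans; [apply Hb|]. right; ring.
    - apply summable_scal. apply Rmult_le_pos; auto. left; apply Rinv_0_lt_compat, pow_lt, lt_0_INR; lia.
      apply summable_inv_sqr. }
  assert (Q : (- RtoC 1 / tau) ^ k = / tau ^ k).
  { destruct Hev as [j Hj]. replace (- RtoC 1 / tau) with ((- (1)) * / tau) by (field; auto).
    rewrite Cpow_mult_l, Cpow_inv by auto. replace ((- (1)) ^ k) with (RtoC 1). ring.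
    rewrite Hj, Cpow_mult_r. replace ((- (1)) ^ 2) with (RtoC 1) by (simpl; ring). rewrite Cpow_1_l. auto. }
  rewrite Q in U'. assert (Nk : tau ^ k <> 0) by (apply Cpow_nz; auto).
  replace S' with (S' - Zs k 0 / (2 * / tau ^ k) + Zs k 0 / (2 * / tau ^ k)) by ring.
  rewrite U'. field. auto.
Qed.

Lemma scaled_sum (u : nat -> C) (c S : C) : c <> 0 ->
  has_sum (fun m => c * u m) S -> has_sum u (/ c * S).
Proof.
  intros Hc H. apply (has_sum_ext (fun m => / c * (c * u m))).
  intros; field; auto. apply has_sum_scal; auto.
Qed.

Lemma lipschitz_coef_neq_0 (x : R) k : (x <> 0)%R -> RtoC x * / (2 * RtoC PI * Ci) ^ k <> 0.
Proof.
  intros Hx. apply Cmult_neq_0. apply RtoC_neq_0; auto.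
  apply Cinv_nonzero, Cpow_nz, two_pi_i_neq_0.
Qed.

Theorem E4_inversion tau : (0 < Im tau)%R -> E4 (- RtoC 1 / tau) = tau ^ 4 * E4 tau.
Proof.
  intros Ht. assert (W := two_pi_i_neq_0).
  assert (H := eisenstein_inversion 4 tau _ _ Ht (Nat.le_refl _) ltac:(exists 2%nat; auto)
    (scaled_sum _ _ _ (lipschitz_coef_neq_0 6 4 ltac:(lra))
       (proj1 (proj2 (sigma_series_Ls tau Ht))))
    (scaled_sum _ _ _ (lipschitz_coef_neq_0 6 4 ltac:(lra))
       (proj1 (proj2 (sigma_series_Ls _ (Im_opp_inv_pos tau Ht)))))).
  rewrite Zs_4_0 in H. set (w := 2 * RtoC PI * Ci) in *. unfold E4.
  set (x := sigma_series 3 tau) in *. set (y := sigma_series 3 (- RtoC 1 / tau)) in *.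
  (* The Eisenstein series is the lattice sum divided by 2 zeta(4) = w^4/720, and 2 * 720/6 is the
     coefficient 240. In weight 6 the same computation gives 2 * 30240/120 = 504. *)
  replace (RtoC 1 + RtoC 240 * y) with (720 / w ^ 4 * (w ^ 4 / 720 + 2 * (/ (6 * / w ^ 4) * y))) by (field; auto).
  rewrite H. field. auto.
Qed.

Theorem E6_inversion tau : (0 < Im tau)%R -> E6 (- RtoC 1 / tau) = tau ^ 6 * E6 tau.
Proof.
  intros Ht. assert (W := two_pi_i_neq_0).
  assert (H := eisenstein_inversion 6 tau _ _ Ht ltac:(lia) ltac:(exists 3%nat; auto)
    (scaled_sum _ _ _ (lipschitz_coef_neq_0 120 6 ltac:(lra))
       (proj2 (proj2 (sigma_series_Ls tau Ht))))
    (scaled_sum _ _ _ (lipschitz_coef_neq_0 120 6 ltac:(lra))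
       (proj2 (proj2 (sigma_series_Ls _ (Im_opp_inv_pos tau Ht)))))).
  rewrite Zs_6_0 in H. set (w := 2 * RtoC PI * Ci) in *. unfold E6.
  set (x := sigma_series 5 tau) in *. set (y := sigma_series 5 (- RtoC 1 / tau)) in *.
  replace (RtoC 1 - RtoC 504 * y) with (- (30240) / w ^ 6 * (- w ^ 6 / 30240 + 2 * (/ (120 * / w ^ 6) * y))) by (field; auto).
  rewrite H. field. auto.
Qed.

(** * The inversion formula for E2 *)

Lemma atan_increment a b : (0 <= a < b)%R ->
  ((b - a) / (1 + b ^ 2) <= atan b - atan a <= (b - a) / (1 + a ^ 2))%R.
Proof.
  intros H. destruct (MVT_cor2 atan (fun x => / (1 + x ^ 2))%R a b (proj2 H)) as [c [E Hc]].
  - intros c Hc. apply derivable_pt_lim_atan.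
  - rewrite E. unfold Rdiv. rewrite (Rmult_comm (/ (1 + c ^ 2))).
    split; (apply Rmult_le_compat_l; [lra|]); apply Rinv_le_contravar; nra.
Qed.

(** Comparison with the integral of v/(v^2 + x^2), whose primitive is atan(x/v). *)
Lemma atan_sum_bounds v N : (0 < v)%R ->
  (atan (INR (S N) / v) - atan (1 / v) <= rsum (fun n => v / (v ^ 2 + INR (S n) ^ 2)) N <= atan (INR N / v))%R.
Proof.
  intros Hv.
  assert (I : forall m, (0 <= m)%R ->
    (v / (v ^ 2 + (m + 1) ^ 2) <= atan ((m + 1) / v) - atan (m / v) <= v / (v ^ 2 + m ^ 2))%R).
  { intros m Hm. destruct (atan_increment (m / v) ((m + 1) / v)) as [X Y].
    - split. apply Rdiv_le_0_compat; lra. apply Rmult_lt_compat_r. apply Rinv_0_lt_compat; auto. lra.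
    - assert (0 < v ^ 2)%R by (apply pow_lt; auto).
      replace (((m + 1) / v - m / v) / (1 + ((m + 1) / v) ^ 2))%R with (v / (v ^ 2 + (m + 1) ^ 2))%R in X.
      2:{ field. split; nra. }
      replace (((m + 1) / v - m / v) / (1 + (m / v) ^ 2))%R with (v / (v ^ 2 + m ^ 2))%R in Y.
      2:{ field. split; nra. }
      lra. }
  induction N as [|N IH].
  - simpl. replace (0 / v)%R with 0%R by (field; lra). rewrite atan_0. lra.
  - cbn [rsum]. assert (X := I (INR N) (pos_INR N)). assert (Y := I (INR (S N)) (pos_INR (S N))).
    rewrite <- S_INR in X. rewrite <- (S_INR (S N)) in Y. lra.
Qed.

Lemma atan_le_id x : (0 <= x)%R -> (atan x <= x)%R.
Proof.
  intros [H|<-]; [|rewrite atan_0; lra].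
  destruct (atan_increment 0 x ltac:(lra)) as [_ Y]. rewrite atan_0 in Y.
  replace ((x - 0) / (1 + 0 ^ 2))%R with x in Y by field. lra.
Qed.

Lemma ccv_Cmod_le_eventually u l B (b : nat -> R) :
  (forall n, Cmod (u n) <= B + b n)%R -> is_lim_seq b 0 -> ccv u l -> (Cmod l <= B)%R.
Proof.
  intros Hu Hb H. apply le_epsilon. intros e He.
  destruct (H (e / 2)%R ltac:(lra)) as [N HN]. apply is_lim_seq_spec in Hb.
  destruct (Hb (mkposreal (e / 2) ltac:(lra))) as [N' HN'].
  specialize (HN (max N N') ltac:(lia)). specialize (HN' (max N N') ltac:(lia)). simpl in HN'.
  specialize (Hu (max N N')). rewrite Rminus_0_r in HN'. apply Rabs_def2 in HN'.
  assert (X := Cmod_sub_ge l (u (max N N'))). rewrite Cmod_sub_sym in X. lra.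
Qed.

(** At z = i v the paired terms are -2 i v/(v^2 + n^2), and their sum approaches -pi i at the rate
    1/v by comparison with the arctangent. *)
Lemma Zs_1_imaginary v : (0 < v)%R -> (Cmod (Zs 1 (RtoC v * Ci) + RtoC PI * Ci) <= 2 / v)%R.
Proof.
  intros Hv.
  assert (Hz : (0 < Im (RtoC v * Ci))%R) by (unfold Im, Cmult, RtoC, Ci; simpl; lra).
  apply (ccv_Cmod_le_eventually (fun N => csum (latt 1 (RtoC v * Ci)) N + RtoC PI * Ci) _ _
    (fun N => 2 * v * / INR (S N))%R).
  2: apply is_lim_seq_scal_inv.
  2:{ apply ccv_plus. apply has_sum_Zs; auto. apply ccv_const. }
  intros N.
  replace (csum (latt 1 (RtoC v * Ci)) N) with (- (2 * Ci) * RtoC (rsum (fun n => v / (v ^ 2 + INR (S n) ^ 2))%R N)).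
  - replace (- (2 * Ci) * RtoC (rsum (fun n => v / (v ^ 2 + INR (S n) ^ 2))%R N) + RtoC PI * Ci) with
      (Ci * RtoC (PI - 2 * rsum (fun n => v / (v ^ 2 + INR (S n) ^ 2)) N)%R).
    2:{ rewrite RtoC_minus, RtoC_mult. ring. }
    rewrite Cmod_mult, Cmod_Ci, Cmod_R, Rmult_1_l.
    destruct (atan_sum_bounds v N Hv) as [X Y].
    assert (P : (0 < INR (S N))%R) by (apply lt_0_INR; lia).
    assert (A1 := atan_bound (INR N / v)).
    assert (A2 := atan_le_id (1 / v) ltac:(apply Rdiv_le_0_compat; lra)).
    assert (A3 : (atan (INR (S N) / v) = PI / 2 - atan (v * / INR (S N)))%R).
    { rewrite <- atan_inv. f_equal. field. lra. apply Rmult_lt_0_compat; auto. apply Rinv_0_lt_compat; auto. }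
    assert (A4 : (atan (v * / INR (S N)) <= v * / INR (S N))%R).
    { apply atan_le_id. apply Rmult_le_pos. lra. left; apply Rinv_0_lt_compat; auto. }
    rewrite Rabs_pos_eq by lra. lra.
  - rewrite <- csum_RtoC, <- csum_scal. apply csum_ext. intros n _. unfold latt. rewrite !Cpow_1_r.
    assert (N1 := upper_plus_neq_0 (RtoC v * Ci) (INR (S n)) Hz).
    assert (N2 := upper_minus_neq_0 (RtoC v * Ci) (INR (S n)) Hz).
    set (m := INR (S n)) in *. assert (P : (0 < m)%R) by (apply lt_0_INR; lia).
    assert (E : RtoC (v ^ 2 + m ^ 2) = - ((RtoC v * Ci + RtoC m) * (RtoC v * Ci - RtoC m))).
    { rewrite RtoC_plus, !RtoC_pow. transitivity (RtoC m ^ 2 - RtoC v ^ 2 * (Ci * Ci)).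
      replace (Ci * Ci) with (- (1)). ring. unfold Ci, Cmult, RtoC, Copp; simpl; f_equal; ring. ring. }
    rewrite RtoC_div by nra. rewrite E. field. auto.
Qed.

(** [Ls 1] is pi cot(pi w), but its limit at the cusp is found directly: in the strip the horizontal
    move from w to i Im w changes the sum by at most pi/v, again by the arctangent bound, and
    periodicity covers the other points. The numerator 8 leaves room for 1 + pi + 2. *)
Lemma Ls_1_limit w : (1 <= Im w)%R -> (Cmod (Ls 1 w + RtoC PI * Ci) <= 8 / Im w)%R.
Proof.
  assert (Strip : forall w, (1 <= Im w)%R -> (Rabs (Re w) <= / 2)%R ->
     (Cmod (Ls 1 w + RtoC PI * Ci) <= 8 / Im w)%R).
  { clear w. intros w Hv Hu. set (u := Re w) in *. set (v := Im w) in *.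
    assert (Hz : (0 < Im (RtoC v * Ci))%R) by (unfold Im at 1, Cmult, RtoC, Ci; simpl; lra).
    assert (Hw : (0 < Im w)%R) by (unfold v in *; lra).
    assert (Ew : w = RtoC v * Ci + RtoC u).
    { unfold u, v. destruct w; unfold Cplus, Cmult, RtoC, Ci; simpl; f_equal; ring. }
    assert (vI : forall t, (v <= Cmod (w + RtoC t))%R).
    { intros t. apply Rle_trans with (Im (w + RtoC t)). rewrite Im_shift. unfold v; lra.
      apply im_le_Cmod. }
    assert (P4 := PI_4). assert (PP := PI_RGT_0).
    assert (D : (Cmod (Zs 1 w - Zs 1 (RtoC v * Ci)) <= PI / v)%R).
    { apply (has_sum_Cmod_le (fun n => latt 1 w n - latt 1 (RtoC v * Ci) n) _
        (fun n => 2 / v * (v / (v ^ 2 + INR (S n) ^ 2)))%R).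
      - apply has_sum_minus; apply has_sum_Zs; auto.
      - intros n. set (m := INR (S n)). assert (M1 : (1 <= m)%R) by (apply (le_INR 1); lia).
        assert (B : forall t, (m = Rabs t)%R -> (Cmod (/ ((w + RtoC t) * (RtoC v * Ci + RtoC t))) <= 2 / (v ^ 2 + m ^ 2))%R).
        { intros t Ht. assert (t2 : (t ^ 2 = m ^ 2)%R) by (rewrite Ht; symmetry; apply pow2_abs).
          assert (N1 := upper_plus_neq_0 w t Hw). assert (N2 := upper_plus_neq_0 _ t Hz).
          rewrite Cmod_inv by (apply Cmult_neq_0; auto). rewrite Cmod_mult.
          assert (Q : (0 < v ^ 2 + m ^ 2)%R) by nra.
          replace (2 / (v ^ 2 + m ^ 2))%R with (/ ((v ^ 2 + m ^ 2) / 2))%R by (field; lra).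
          apply Rinv_le_contravar. lra.
          apply Rsqr_incr_0_var; [|apply Rmult_le_pos; apply Cmod_ge_0]. rewrite !Rsqr_pow2.
          rewrite Rpow_mult_distr, !Cmod_sqr.
          replace (Re (w + RtoC t)) with (u + t)%R by (unfold u; destruct w; reflexivity).
          replace (Im (w + RtoC t)) with v by (unfold v; symmetry; apply Im_shift).
          replace (Re (RtoC v * Ci + RtoC t)) with t by (unfold Re, Cplus, Cmult, RtoC, Ci; simpl; ring).
          replace (Im (RtoC v * Ci + RtoC t)) with v by (unfold Im, Cplus, Cmult, RtoC, Ci; simpl; ring).
          rewrite t2.
          assert (T : ((v ^ 2 + m ^ 2) / 4 <= (u + t) ^ 2 + v ^ 2)%R).
          { assert (m / 2 <= Rabs (u + t))%R.
            { assert (X := Rabs_triang_inv t (- u)). rewrite Rabs_Ropp, <- Ht in X.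
              replace (t - - u)%R with (u + t)%R in X by ring. lra. }
            rewrite <- (pow2_abs (u + t)). nra. }
          replace (((v ^ 2 + m ^ 2) / 2) ^ 2)%R with ((v ^ 2 + m ^ 2) / 4 * (m ^ 2 + v ^ 2))%R by field.
          apply Rmult_le_compat_r; lra. }
        assert (B1 := B m ltac:(rewrite Rabs_pos_eq; lra)).
        assert (B2 := B (- m)%R ltac:(rewrite Rabs_Ropp, Rabs_pos_eq; lra)).
        rewrite RtoC_opp in B2.
        unfold latt. fold m. rewrite !Cpow_1_r.
        assert (N1 := upper_plus_neq_0 w m Hw). assert (N2 := upper_plus_neq_0 _ m Hz).
        assert (N3 := upper_minus_neq_0 w m Hw). assert (N4 := upper_minus_neq_0 _ m Hz).
        replace (/ (w + RtoC m) + / (w - RtoC m) - (/ (RtoC v * Ci + RtoC m) + / (RtoC v * Ci - RtoC m))) with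
          (- RtoC u * (/ ((w + RtoC m) * (RtoC v * Ci + RtoC m)) + / ((w + - RtoC m) * (RtoC v * Ci + - RtoC m)))).
        2:{ replace (- RtoC u) with (RtoC v * Ci - w) by (rewrite Ew; ring). field. auto. }
        rewrite Cmod_mult, Cmod_opp, Cmod_R.
        apply Rle_trans with (/ 2 * (4 / (v ^ 2 + m ^ 2)))%R.
        + apply Rmult_le_compat; auto. apply Rabs_pos. apply Cmod_ge_0.
          eapply Rle_trans; [apply Cmod_triangle|]. lra.
        + right. field. split; nra.
      - intros N. rewrite rsum_scal. destruct (atan_sum_bounds v N ltac:(lra)) as [_ Y].
        assert (A1 := atan_bound (INR N / v)).
        replace (PI / v)%R with (2 / v * (PI / 2))%R by (field; lra).
        apply Rmult_le_compat_l. apply Rdiv_le_0_compat; lra. lra. }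
    assert (I := Zs_1_imaginary v ltac:(lra)).
    assert (W : (Cmod (/ w) <= 1 / v)%R).
    { rewrite Cmod_inv by (apply upper_neq_0; auto). unfold Rdiv. rewrite Rmult_1_l.
      apply Rinv_le_contravar. lra. specialize (vI 0%R). rewrite Cplus_0_r in vI. auto. }
    unfold Ls. rewrite Cpow_1_r.
    replace (/ w + Zs 1 w + RtoC PI * Ci) with
      (/ w + ((Zs 1 w - Zs 1 (RtoC v * Ci)) + (Zs 1 (RtoC v * Ci) + RtoC PI * Ci))) by ring.
    eapply Rle_trans; [apply Cmod_triangle|].
    assert (T := Cmod_triangle (Zs 1 w - Zs 1 (RtoC v * Ci)) (Zs 1 (RtoC v * Ci) + RtoC PI * Ci)).
    replace (8 / v)%R with (1 / v + 4 / v + 2 / v + 1 / v)%R by (field; lra).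
    assert (0 < / v)%R by (apply Rinv_0_lt_compat; lra).
    assert (PI / v <= 4 / v)%R by (apply Rmult_le_compat_r; lra). unfold Rdiv in *. lra. }
  intros Hw. destruct (exists_nearest_integer (Re w)) as [n Hn].
  assert (X := Strip (w + RtoC (IZR n))). rewrite Im_shift in X.
  rewrite (periodic_IZR (Ls 1)) in X; [|intros; apply Ls_periodic; auto|lra].
  apply X; auto.
Qed.

(** Its differences between consecutive half-integers are the telescoping substitutes for the terms
    of weight 2: one has 1/(A - 1/2) - 1/(A + 1/2) = 1/(A^2 - 1/4), within fourth order of 1/A^2. *)
Definition midpoint_diff (M : C) (x : R) : C := / (M + RtoC x) - / (M - RtoC x).

(** For fixed x the comparison terms, summed over m, form a cotangent expansion at -x/tau. The rows
    thus telescope while the columns have a computable limit. *)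
Lemma midpoint_diff_latt tau x m : (0 < Im tau)%R ->
  midpoint_diff (RtoC (INR (S m)) * tau) x = - / tau * latt 1 (RtoC x * (- RtoC 1 / tau)) m.
Proof.
  intros Ht. assert (N := upper_neq_0 tau Ht). assert (Hm := Im_nat_pos m tau Ht).
  unfold midpoint_diff, latt. rewrite !Cpow_1_r, opp_inv_scal by auto.
  set (a := RtoC (INR (S m)) * tau) in *.
  assert (N1 := upper_plus_neq_0 a x Hm). assert (N2 := upper_minus_neq_0 a x Hm).
  replace (- RtoC x / tau + RtoC (INR (S m))) with ((a - RtoC x) * / tau) by (unfold a; field; auto).
  replace (- RtoC x / tau - RtoC (INR (S m))) with ((- (1)) * (a + RtoC x) * / tau) by (unfold a; field; auto).
  field. repeat split; auto.
Qed.

Lemma midpoint_diff_column tau x : (0 < Im tau)%R -> (0 < x)%R ->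
  has_sum (fun m => midpoint_diff (RtoC (INR (S m)) * tau) x)
    (- / tau * Zs 1 (RtoC x * (- RtoC 1 / tau))).
Proof.
  intros Ht Hx. eapply has_sum_ext. intros m; symmetry; apply midpoint_diff_latt; auto.
  apply has_sum_scal, has_sum_Zs; auto. rewrite Im_scal. apply Rmult_lt_0_compat; auto.
  apply Im_opp_inv_pos; auto.
Qed.

Lemma midpoint_diff_row M : (0 < Im M)%R ->
  has_sum (fun n => midpoint_diff M (INR n + / 2) - midpoint_diff M (INR (S n) + / 2)) (midpoint_diff M (/ 2)).
Proof.
  intros HM.
  apply (ccv_ext (fun N => midpoint_diff M (/ 2) - midpoint_diff M (INR N + / 2))).
  - induction n as [|n IH]. simpl. rewrite Rplus_0_l. ring. cbn [csum]. rewrite <- IH. ring.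
  - replace (midpoint_diff M (/ 2)) with (midpoint_diff M (/ 2) - 0) at 1 by ring.
    apply ccv_minus. apply ccv_const.
    destruct (lattice_lower_bound M HM) as [c [Hc Hb]].
    apply (ccv_squeeze _ _ (fun n => (2 * / c) * / INR (S n))%R); [|apply is_lim_seq_scal_inv].
    intros n. assert (P := pos_INR n).
    replace (midpoint_diff M (INR n + / 2) - 0) with (midpoint_diff M (INR n + / 2)) by ring.
    unfold midpoint_diff. eapply Rle_trans; [apply Cmod_sub_le|].
    assert (B : forall t : R, (Rabs t = INR n + / 2)%R -> (Cmod (/ (M + RtoC t)) <= / c * / INR (S n))%R).
    { intros t Hte. rewrite Cmod_inv by (apply upper_plus_neq_0; auto). rewrite <- Rinv_mult.
      apply Rinv_le_contravar. rewrite S_INR. apply Rmult_lt_0_compat; lra.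
      eapply Rle_trans; [|apply Hb]. rewrite Hte, S_INR. apply Rmult_le_compat_l; lra. }
    assert (B1 := B (INR n + / 2)%R ltac:(rewrite Rabs_pos_eq; lra)).
    assert (B2 := B (- (INR n + / 2))%R ltac:(rewrite Rabs_Ropp, Rabs_pos_eq; lra)).
    rewrite RtoC_opp in B2. unfold Cminus. lra.
Qed.

Definition midpoint_error (tau : C) (m n : nat) : C :=
  lattice_term 2 tau m n - (midpoint_diff (RtoC (INR (S m)) * tau) (INR n + / 2)
    - midpoint_diff (RtoC (INR (S m)) * tau) (INR (S n) + / 2)).

(* Comparing [1/A^2] with the midpoint difference [1/(A^2 - 1/4)] leaves an absolutely summable error. *)
Lemma midpoint_error_bound tau : (0 < Im tau)%R ->
  exists K, (0 <= K)%R /\ forall m n,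
    (Cmod (midpoint_error tau m n) <= K * / INR (S m) ^ 2 * / INR (S n) ^ 2)%R.
Proof.
  intros Ht. destruct (lattice_term_bound tau Ht) as [c [Hc Hb]].
  set (K := (/ (c / 2) ^ 4)%R).
  assert (K0 : (0 < K)%R) by (apply Rinv_0_lt_compat, pow_lt; lra).
  exists K. split. lra. intros m n. set (M := RtoC (INR (S m)) * tau).
  assert (HM : (0 < Im M)%R) by (apply Im_nat_pos; auto).
  assert (P1 : (1 <= INR (S m))%R) by (apply (le_INR 1); lia).
  assert (P2 : (1 <= INR (S n))%R) by (apply (le_INR 1); lia).
  set (x := INR (S m)) in *. set (y := INR (S n)) in *.
  assert (Ey : INR n = (y - 1)%R) by (unfold y; rewrite S_INR; ring).
  assert (L : forall t, (y - / 2 <= Rabs t)%R -> (c / 2 * (x + y) <= Cmod (M + RtoC t))%R).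
  { intros t Hte. eapply Rle_trans; [|apply Hb]. fold x.
    apply Rle_trans with (c * ((x + y) / 2))%R. lra. apply Rmult_le_compat_l; lra. }
  assert (W : forall t, (Rabs t = y)%R ->
    (Cmod (/ ((M + RtoC t) ^ 2 * ((M + RtoC (t - / 2)) * (M + RtoC (t + / 2))))) <= K * / x ^ 2 * / y ^ 2)%R).
  { intros t Hte.
    assert (T1 := L t ltac:(lra)).
    assert (T2 := L (t - / 2)%R ltac:(assert (X := Rabs_triang_inv t (/ 2)); rewrite (Rabs_pos_eq (/ 2)) in X; lra)).
    assert (T3 := L (t + / 2)%R).
    assert (T3' : (c / 2 * (x + y) <= Cmod (M + RtoC (t + / 2)))%R).
    { apply T3. assert (X := Rabs_triang_inv t (- / 2)). rewrite Rabs_Ropp, (Rabs_pos_eq (/ 2)) in X by lra.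
      replace (t - - / 2)%R with (t + / 2)%R in X by ring. lra. }
    assert (c0 : (0 < c / 2 * (x + y))%R) by (apply Rmult_lt_0_compat; lra).
    rewrite Cmod_inv by (apply Cmult_neq_0; [apply Cpow_nz, upper_plus_neq_0; auto|apply Cmult_neq_0; apply upper_plus_neq_0; auto]).
    rewrite !Cmod_mult, Cmod_pow. unfold K. rewrite <- !Rinv_mult. apply Rinv_le_contravar.
    - apply Rmult_lt_0_compat; [apply Rmult_lt_0_compat|]; apply pow_lt; lra.
    - apply Rle_trans with ((c / 2 * (x + y)) ^ 2 * ((c / 2 * (x + y)) * (c / 2 * (x + y))))%R.
      + replace ((c / 2 * (x + y)) ^ 2 * ((c / 2 * (x + y)) * (c / 2 * (x + y))))%R
          with ((c / 2) ^ 4 * (((x + y) ^ 2) * ((x + y) ^ 2)))%R by ring.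
        rewrite Rmult_assoc. apply Rmult_le_compat_l. apply pow_le; lra.
        apply Rmult_le_compat; try apply pow2_ge_0; apply pow_incr; lra.
      + apply Rmult_le_compat. apply pow2_ge_0. apply Rmult_le_pos; lra. apply pow_incr; lra.
        apply Rmult_le_compat; lra. }
  (* Here 1/A^2 - 1/(A^2 - 1/4) = -1/(4 A^2 (A^2 - 1/4)), used for A = M + y and A = M - y. *)
  assert (E : midpoint_error tau m n = - / 4 *
    (/ ((M + RtoC y) ^ 2 * ((M + RtoC (y - / 2)) * (M + RtoC (y + / 2)))) +
     / ((M + RtoC (- y)) ^ 2 * ((M + RtoC (- y - / 2)) * (M + RtoC (- y + / 2)))))).
  { assert (Q1 := upper_plus_neq_0 M y HM). assert (Q2 := upper_plus_neq_0 M (y - / 2) HM).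
    assert (Q3 := upper_plus_neq_0 M (y + / 2) HM). assert (Q4 := upper_plus_neq_0 M (- y) HM).
    assert (Q5 := upper_plus_neq_0 M (- y - / 2) HM). assert (Q6 := upper_plus_neq_0 M (- y + / 2) HM).
    unfold midpoint_error, lattice_term, latt, midpoint_diff. fold x. fold y. fold M. rewrite Ey.
    replace (y - 1 + / 2)%R with (y - / 2)%R by field.
    rewrite ?RtoC_plus, ?RtoC_minus, ?RtoC_opp in *. rewrite RtoC_inv in * by lra.
    set (Y := RtoC y) in *.
    replace (M - (Y - / RtoC 2)) with (M + (- Y + / RtoC 2)) by ring.
    replace (M - (Y + / RtoC 2)) with (M + (- Y - / RtoC 2)) by ring.
    replace (M - Y) with (M + - Y) by ring.
    assert (T2 : RtoC 2 <> 0) by (apply RtoC_neq_0; lra).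
    set (A := M + Y) in *. set (A' := M + - Y) in *.
    replace (M + (Y - / RtoC 2)) with (A - / RtoC 2) in * by (unfold A; ring).
    replace (M + (Y + / RtoC 2)) with (A + / RtoC 2) in * by (unfold A; ring).
    replace (M + (- Y - / RtoC 2)) with (A' - / RtoC 2) in * by (unfold A'; ring).
    replace (M + (- Y + / RtoC 2)) with (A' + / RtoC 2) in * by (unfold A'; ring).
    assert (F : forall a : C, a <> 0 -> a - / RtoC 2 <> 0 -> a + / RtoC 2 <> 0 ->
      / a ^ 2 - (/ (a - / RtoC 2) - / (a + / RtoC 2)) = - / RtoC 4 * / (a ^ 2 * ((a - / RtoC 2) * (a + / RtoC 2)))).
    { intros a H1 H2 H3.
      assert (H2' : 2 * a - 1 <> 0).
      { replace (2 * a - 1) with (2 * (a - / RtoC 2)) by (field; auto). apply Cmult_neq_0; auto. }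
      assert (H3' : 2 * a + 1 <> 0).
      { replace (2 * a + 1) with (2 * (a + / RtoC 2)) by (field; auto). apply Cmult_neq_0; auto. }
      rewrite Cmult_comm in H2', H3'. field. auto. }
    rewrite Cmult_plus_distr_l, <- (F A), <- (F A') by auto. ring. }
  rewrite E, Cmod_mult, Cmod_opp, Cmod_inv, Cmod_R, Rabs_pos_eq by (try apply RtoC_neq_0; lra).
  assert (W1 := W y ltac:(rewrite Rabs_pos_eq; lra)).
  assert (W2 := W (- y)%R ltac:(rewrite Rabs_Ropp, Rabs_pos_eq; lra)).
  eapply Rle_trans. apply Rmult_le_compat_l. lra. apply Cmod_triangle.
  assert (0 <= K * / x ^ 2 * / y ^ 2)%R; [|lra].
  eapply Rle_trans; [apply Cmod_ge_0|exact W1].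
Qed.

(** The point -(N + 1/2)/tau moves up to the cusp, where the cotangent sum tends to -pi i. That this
    limit is not 0 is the source of the failure of modularity of [E2]. *)
Lemma E2_column_limit tau : (0 < Im tau)%R ->
  ccv (fun N => - / tau * Zs 1 (RtoC (INR N + / 2) * (- RtoC 1 / tau))) (RtoC PI * Ci / tau).
Proof.
  intros Ht. assert (N := upper_neq_0 tau Ht). assert (Ht' := Im_opp_inv_pos tau Ht).
  set (s := - RtoC 1 / tau) in *.
  replace (RtoC PI * Ci / tau) with (- / tau * (- (RtoC PI * Ci))) by (field; auto).
  apply ccv_scal.
  set (y := Im s) in *.
  intros eps He.
  destruct (archimed_cor1 (Rmin eps 1 * y / 20)) as [N0 [HN0 HN0']].
  { apply Rdiv_lt_0_compat; [|lra]. apply Rmult_lt_0_compat; auto. apply Rmin_glb_lt; lra. }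
  exists N0. intros n Hn.
  set (w := RtoC (INR n + / 2) * s).
  assert (Iw : Im w = ((INR n + / 2) * y)%R) by apply Im_scal.
  assert (Pn : (0 < INR N0 <= INR n)%R) by (split; [apply lt_0_INR; lia|apply le_INR; lia]).
  assert (Hbig : (20 < Rmin eps 1 * Im w)%R).
  { apply (Rmult_lt_compat_r (INR N0)) in HN0; [|lra]. rewrite Rinv_l in HN0 by lra.
    rewrite Iw. assert (0 < Rmin eps 1)%R by (apply Rmin_glb_lt; lra).
    assert (Rmin eps 1 * y * INR N0 <= Rmin eps 1 * y * (INR n + / 2))%R.
    { apply Rmult_le_compat_l; [|lra]. apply Rmult_le_pos; lra. }
    lra. }
  assert (I0 : (0 < Im w)%R) by (rewrite Iw; apply Rmult_lt_0_compat; lra).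
  assert (I1 : (1 <= Im w)%R). { assert (X := Rmin_r eps 1). nra. }
  assert (I2 : (20 < eps * Im w)%R). { assert (X := Rmin_l eps 1). nra. }
  assert (X := Ls_1_limit w I1).
  assert (W : (Cmod (/ w) <= 1 / Im w)%R).
  { rewrite Cmod_inv by (apply upper_neq_0; auto). unfold Rdiv. rewrite Rmult_1_l.
    apply Rinv_le_contravar. auto. apply im_le_Cmod. }
  replace (Zs 1 w - - (RtoC PI * Ci)) with ((Ls 1 w + RtoC PI * Ci) - / w).
  2:{ unfold Ls. rewrite Cpow_1_r. ring. }
  eapply Rle_lt_trans; [apply Cmod_sub_le|].
  assert (8 / Im w + 1 / Im w < eps)%R; [|lra].
  replace (8 / Im w + 1 / Im w)%R with (9 / Im w)%R by (field; lra).
  apply Rlt_div_l; lra.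
Qed.

(** Summed by rows, the comparison terms contribute [Q (/ 2)]; summed by columns they telescope to
    [Q (/ 2)] minus the limit pi i/tau. Equating the two evaluations of the error sum leaves exactly
    that limit, while the lattice terms transpose as in higher weight. *)
Theorem E2_inversion tau : (0 < Im tau)%R ->
  E2 (- RtoC 1 / tau) = tau ^ 2 * E2 tau + 6 * tau / (RtoC PI * Ci).
Proof.
  intros Ht. assert (N := upper_neq_0 tau Ht). assert (Ht' := Im_opp_inv_pos tau Ht).
  assert (T := two_pi_i_neq_0).
  assert (Ev : Nat.Even 2) by (exists 1%nat; auto).
  set (S1 := / / (2 * RtoC PI * Ci) ^ 2 * sigma_series 1 tau).
  set (S2 := / / (2 * RtoC PI * Ci) ^ 2 * sigma_series 1 (- RtoC 1 / tau)).
  assert (Hc : / (2 * RtoC PI * Ci) ^ 2 <> 0) by (apply Cinv_nonzero, Cpow_nz; auto).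
  assert (W1 := Zs_double_sum 2 tau Ht (Nat.le_refl _) Ev S1 (scaled_sum _ _ _ Hc (proj1 (sigma_series_Ls tau Ht)))).
  assert (W2 := Zs_double_sum 2 _ Ht' (Nat.le_refl _) Ev S2 (scaled_sum _ _ _ Hc (proj1 (sigma_series_Ls _ Ht')))).
  destruct (midpoint_error_bound tau Ht) as [K [HK Hb]].
  destruct (double_sum_swap (midpoint_error tau) (fun m => K * / INR (S m) ^ 2)%R
    (fun n => / INR (S n) ^ 2)%R Hb) as [R1 R2].
  { apply summable_scal; auto. apply summable_inv_sqr. }
  { apply summable_inv_sqr. }
  set (V := CSeries (fun i => CSeries (midpoint_error tau i))) in *.
  set (Q := fun x : R => - / tau * Zs 1 (RtoC x * (- RtoC 1 / tau))).
  assert (Rows : V = S1 - Zs 2 0 / (2 * tau ^ 2) - Q (/ 2)%R).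
  { apply (ccv_unique _ _ _ R1). 
    eapply has_sum_ext; [|apply (has_sum_minus _ _ _ _ W1 (midpoint_diff_column tau (/ 2) Ht ltac:(lra)))].
    intros m. cbv beta. symmetry. apply CSeries_unique. unfold midpoint_error.
    apply has_sum_minus. apply has_sum_Zs; [apply Im_nat_pos; auto|lia].
    apply midpoint_diff_row. apply Im_nat_pos; auto. }
  assert (Cols : V = / tau ^ 2 * (S2 - Zs 2 0 / (2 * (- RtoC 1 / tau) ^ 2)) - (Q (/ 2)%R - RtoC PI * Ci / tau)).
  { apply (ccv_unique _ _ _ R2).
    apply (ccv_ext (fun M => / tau ^ 2 * csum (fun n => Zs 2 (RtoC (INR (S n)) * (- RtoC 1 / tau))) M
      - (Q (/ 2)%R - Q (INR M + / 2)%R))).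
    - intros M. induction M as [|M IH].
      + simpl. rewrite Rplus_0_l. ring.
      + cbn [csum]. rewrite <- IH.
        replace (CSeries (fun i => midpoint_error tau i M)) with
          (/ tau ^ 2 * Zs 2 (RtoC (INR (S M)) * (- RtoC 1 / tau)) - (Q (INR M + / 2)%R - Q (INR (S M) + / 2)%R)).
        ring.
        symmetry. apply CSeries_unique. unfold midpoint_error. apply has_sum_minus.
        * apply (has_sum_ext (fun m => / tau ^ 2 * lattice_term 2 (- RtoC 1 / tau) M m)).
          intros m. rewrite lattice_term_inversion by auto. field. auto.
          apply has_sum_scal, has_sum_Zs; [apply Im_nat_pos; auto|lia].
        * assert (P := pos_INR M). rewrite S_INR. apply has_sum_minus; apply midpoint_diff_column; auto; lra.
    - apply ccv_minus. apply ccv_scal. exact W2. apply ccv_minus. apply ccv_const.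
      apply E2_column_limit; auto. }
  rewrite Rows in Cols. rewrite Zs_2_0 in Cols.
  assert (P0 : RtoC PI <> 0) by (apply RtoC_neq_0; assert (X := PI_RGT_0); lra).
  assert (I0 := Ci_neq_0).
  assert (ES : S1 - - (2 * RtoC PI * Ci) ^ 2 / 12 / (2 * tau ^ 2) =
    / tau ^ 2 * (S2 - - (2 * RtoC PI * Ci) ^ 2 / 12 / (2 * (- RtoC 1 / tau) ^ 2)) + RtoC PI * Ci / tau).
  { match type of Cols with ?a - ?q = ?b - (?q - ?l) =>
      transitivity (a - q + q); [ring|]; rewrite Cols; ring end. }
  clear Cols Rows R1 R2 W1 W2. unfold S1, S2 in ES. unfold E2.
  set (x := sigma_series 1 tau) in *. set (y := sigma_series 1 (- RtoC 1 / tau)) in *.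
  set (w := 2 * RtoC PI * Ci) in *.
  assert (Ey : y = tau ^ 2 / w ^ 2 * (/ / w ^ 2 * x - - w ^ 2 / 12 / (2 * tau ^ 2) - RtoC PI * Ci / tau)
     + - (1) / 24 * tau ^ 2).
  { rewrite ES. field. auto. }
  rewrite Ey. unfold w. field_simplify_eq; [|repeat split; auto].
  ring.
Qed.

(** * The eta function *)

Lemma exp_minus_1_le s : (exp s - 1 <= s * exp s)%R.
Proof.
  assert (X := exp_ineq1_le (- s)). assert (E : (exp s * exp (- s) = 1)%R).
  { rewrite <- exp_plus, <- exp_0. f_equal. ring. }
  assert (P := exp_pos s). nra.
Qed.

Lemma exp_minus_1_minus_id_le s : (0 <= s)%R -> (exp s - 1 - s <= s ^ 2 * exp s)%R.
Proof.
  intros Hs. assert (X := exp_minus_1_le s). assert (P := exp_pos s).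
  destruct (Rle_lt_dec 1 s); [|nra]. assert (exp s * 1 <= exp s * (s * s))%R; [|simpl in *; lra].
  apply Rmult_le_compat_l; nra.
Qed.

(** * Euler's product: convergence, nonvanishing and derivative *)

Lemma Cprod_ext a b N : (forall n, (n < N)%nat -> a n = b n) -> Cprod a N = Cprod b N.
Proof. induction N; intros H; simpl; auto. rewrite IHN, (H N); auto. Qed.

Lemma Cprod_mult a b N : Cprod (fun n => a n * b n) N = Cprod a N * Cprod b N.
Proof. induction N; simpl. ring. rewrite IHN. ring. Qed.

Lemma Cprod_add a M N : Cprod a (M + N) = Cprod a M * Cprod (fun n => a (M + n)%nat) N.
Proof.
  induction N; simpl. rewrite Nat.add_0_r. ring.
  rewrite Nat.add_succ_r. simpl. rewrite IHN. ring.
Qed.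

Lemma Cprod_minus_1_bound (d : nat -> C) N :
  (Cmod (Cprod (fun n => RtoC 1 + d n)%C N - 1) <= exp (rsum (fun n => Cmod (d n)) N) - 1)%R.
Proof.
  induction N as [|N IH]; cbn [Cprod rsum].
  - replace (1 - 1) with (RtoC 0) by ring. rewrite Cmod_0, exp_0. lra.
  - set (p := Cprod (fun n => RtoC 1 + d n)%C N) in *. set (s := rsum (fun n => Cmod (d n)) N) in *.
    replace (p * (1 + d N) - 1) with ((p - 1) * (1 + d N) + d N) by ring.
    eapply Rle_trans; [apply Cmod_triangle|]. rewrite Cmod_mult.
    assert (T := Cmod_triangle 1 (d N)). rewrite Cmod_1 in T.
    assert (P := Cmod_ge_0 (d N)). assert (P' := Cmod_ge_0 (1 + d N)). assert (P2 := Cmod_ge_0 (p - 1)).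
    assert (Cmod (p - 1) * Cmod (1 + d N) <= (exp s - 1) * (1 + Cmod (d N)))%R by (apply Rmult_le_compat; auto).
    rewrite exp_plus. assert (X := exp_ineq1_le (Cmod (d N))). assert (Y := exp_pos s).
    assert (exp s * (1 + Cmod (d N)) <= exp s * exp (Cmod (d N)))%R by (apply Rmult_le_compat_l; lra). lra.
Qed.

(** Only monomials of degree at least 2 remain after expansion, and they are bounded by the
    corresponding ones in the moduli; those are part of exp(s) - 1 - s. The bound is uniform in
    N. *)
Lemma Cprod_second_order_bound (d : nat -> C) N :
  (Cmod (Cprod (fun n => RtoC 1 + d n)%C N - 1 - csum d N) <=
    exp (rsum (fun n => Cmod (d n)) N) - 1 - rsum (fun n => Cmod (d n)) N)%R.
Proof.
  induction N as [|N IH]; cbn [Cprod rsum csum].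
  - replace (1 - 1 - 0) with (RtoC 0) by ring. rewrite Cmod_0, exp_0. lra.
  - assert (Q := Cprod_minus_1_bound d N).
    set (p := Cprod (fun n => RtoC 1 + d n)%C N) in *. set (s := rsum (fun n => Cmod (d n)) N) in *.
    replace (p * (1 + d N) - 1 - (csum d N + d N)) with ((p - 1 - csum d N) + (p - 1) * d N) by ring.
    eapply Rle_trans; [apply Cmod_triangle|]. rewrite Cmod_mult.
    assert (P := Cmod_ge_0 (d N)).
    assert (Cmod (p - 1) * Cmod (d N) <= (exp s - 1) * Cmod (d N))%R by (apply Rmult_le_compat_r; auto).
    rewrite exp_plus. assert (X := exp_ineq1_le (Cmod (d N))). assert (Y := exp_pos s).
    assert (exp s * (1 + Cmod (d N)) <= exp s * exp (Cmod (d N)))%R by (apply Rmult_le_compat_l; lra). lra.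
Qed.

Definition euler_product (X : C) : C := CProduct (fun n => RtoC 1 - X ^ S n)%C.

Lemma rsum_geom_le r a N : (0 <= r < 1)%R -> (rsum (fun n => r ^ (a + n)%nat) N <= r ^ a / (1 - r))%R.
Proof.
  intros Hr.
  assert (E : ((1 - r) * rsum (fun n => r ^ (a + n)%nat) N = r ^ a * (1 - r ^ N))%R).
  { induction N; cbn [rsum pow]. ring. rewrite Rmult_plus_distr_l, IHN, pow_add. ring. }
  apply le_div_of_mul_le. lra. rewrite Rmult_comm, E.
  assert (0 <= r ^ a)%R by (apply pow_le; lra). assert (0 <= r ^ N)%R by (apply pow_le; lra). nra.
Qed.

Lemma euler_partial_bound X r a N : (Cmod X <= r)%R -> (0 <= r < 1)%R ->
  (Cmod (Cprod (fun n => RtoC 1 - X ^ S (a + n)%nat)%C N - 1) <=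
    r ^ S a / (1 - r) * exp (/ (1 - r)))%R.
Proof.
  intros HX Hr.
  rewrite (Cprod_ext _ (fun n => RtoC 1 + (- X ^ S (a + n)%nat))%C) by (intros; ring).
  eapply Rle_trans; [apply Cprod_minus_1_bound|].
  set (s := rsum (fun n => Cmod (- X ^ S (a + n)%nat)%C) N).
  assert (Hs : (s <= r ^ S a / (1 - r))%R).
  { eapply Rle_trans; [|apply (rsum_geom_le r (S a) N Hr)]. apply rsum_le. intros n _.
    rewrite Cmod_opp, Cmod_pow. apply pow_incr. split; auto. apply Cmod_ge_0. }
  assert (s0 : (0 <= s)%R) by (apply rsum_nonneg; intros; apply Cmod_ge_0).
  assert (Ra : (r ^ S a <= 1)%R) by (rewrite <- (pow1 (S a)); apply pow_incr; lra).
  assert (Hs1 : (s <= / (1 - r))%R).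
  { eapply Rle_trans; [exact Hs|]. unfold Rdiv. rewrite <- (Rmult_1_l (/ (1 - r))) at 2.
    apply Rmult_le_compat_r; auto. left; apply Rinv_0_lt_compat; lra. }
  eapply Rle_trans; [apply exp_minus_1_le|]. apply Rmult_le_compat; auto. left; apply exp_pos.
  apply exp_le; auto.
Qed.

Lemma euler_partial_diff X r M N : (Cmod X <= r)%R -> (0 <= r < 1)%R -> (M <= N)%nat ->
  (Cmod (Cprod (fun n => RtoC 1 - X ^ S n)%C N - Cprod (fun n => RtoC 1 - X ^ S n)%C M) <=
    (1 + / (1 - r) * exp (/ (1 - r))) * (/ (1 - r) * exp (/ (1 - r))) * r ^ M)%R.
Proof.
  intros HX Hr HMN.
  assert (I0 : (0 < / (1 - r))%R) by (apply Rinv_0_lt_compat; lra).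
  assert (E0 := exp_pos (/ (1 - r))).
  set (c := (/ (1 - r) * exp (/ (1 - r)))%R). assert (c0 : (0 < c)%R) by (apply Rmult_lt_0_compat; auto).
  replace N with (M + (N - M))%nat by lia. rewrite Cprod_add.
  set (p := Cprod (fun n => RtoC 1 - X ^ S n)%C M).
  set (t := Cprod (fun n => RtoC 1 - X ^ S (M + n)%nat)%C (N - M)).
  replace (p * t - p) with (p * (t - 1)) by ring. rewrite Cmod_mult, Rmult_assoc.
  assert (B1 := euler_partial_bound X r 0 M HX Hr). simpl Nat.add in B1. fold p in B1.
  assert (B2 := euler_partial_bound X r M (N - M) HX Hr). fold t in B2.
  assert (Rm : (0 <= r ^ M)%R) by (apply pow_le; lra).
  apply Rmult_le_compat; try apply Cmod_ge_0.
  - assert (Q := Cmod_sub_ge p 1). rewrite Cmod_1 in Q. rewrite pow_1 in B1.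
    replace (r / (1 - r) * exp (/ (1 - r)))%R with (r * c)%R in B1 by (unfold c; field; lra). nra.
  - eapply Rle_trans; [exact B2|]. simpl. unfold Rdiv.
    replace (r * r ^ M * / (1 - r) * exp (/ (1 - r)))%R with (r * (c * r ^ M))%R by (unfold c; ring).
    assert (0 <= c * r ^ M)%R by (apply Rmult_le_pos; lra). nra.
Qed.

Lemma euler_product_cv X : (Cmod X < 1)%R -> ccv (Cprod (fun n => RtoC 1 - X ^ S n)%C) (euler_product X).
Proof.
  intros HX. assert (X0 := Cmod_ge_0 X).
  destruct (cauchy_ccv (Cprod (fun n => RtoC 1 - X ^ S n)%C)) as [l Hl].
  - intros eps He.
    set (K := ((1 + / (1 - Cmod X) * exp (/ (1 - Cmod X))) * (/ (1 - Cmod X) * exp (/ (1 - Cmod X))))%R).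
    assert (K0 : (0 < K)%R).
    { assert (I0 : (0 < / (1 - Cmod X))%R) by (apply Rinv_0_lt_compat; lra).
      assert (E0 := exp_pos (/ (1 - Cmod X))).
      assert (0 < / (1 - Cmod X) * exp (/ (1 - Cmod X)))%R by (apply Rmult_lt_0_compat; auto).
      apply Rmult_lt_0_compat; lra. }
    destruct (pow_lt_1_zero (Cmod X) ltac:(rewrite Rabs_pos_eq; lra) (eps / K)%R) as [N0 HN0].
    { apply Rdiv_lt_0_compat; auto. }
    exists N0. intros m n Hm Hn.
    eapply Rle_trans; [apply (euler_partial_diff X (Cmod X)); auto; lra|]. fold K.
    specialize (HN0 m Hm). rewrite Rabs_pos_eq in HN0 by (apply pow_le; auto).
    apply Rlt_div_r in HN0; auto. lra.
  - unfold euler_product. rewrite (CProduct_unique _ l Hl). exact Hl.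
Qed.

Lemma euler_product_approx X r M : (Cmod X <= r)%R -> (0 <= r < 1)%R ->
  (Cmod (euler_product X - Cprod (fun n => RtoC 1 - X ^ S n)%C M) <=
    (1 + / (1 - r) * exp (/ (1 - r))) * (/ (1 - r) * exp (/ (1 - r))) * r ^ M)%R.
Proof.
  intros HX Hr.
  apply (ccv_Cmod_le (fun n => Cprod (fun n => RtoC 1 - X ^ S n)%C (M + n) - Cprod (fun n => RtoC 1 - X ^ S n)%C M)).
  - intros n. apply euler_partial_diff; auto. lia.
  - apply ccv_minus; [|apply ccv_const].
    apply (ccv_subseq (Cprod (fun n => RtoC 1 - X ^ S n)%C) _ (fun n => (M + n)%nat)). intros; lia.
    apply euler_product_cv. lra.
Qed.

Lemma euler_product_holo : disc_holo euler_product.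
Proof.
  apply disc_holo_limit. intros r Hr eps He.
  set (K := ((1 + / (1 - r) * exp (/ (1 - r))) * (/ (1 - r) * exp (/ (1 - r))))%R).
  assert (K0 : (0 < K)%R).
  { assert (I0 : (0 < / (1 - r))%R) by (apply Rinv_0_lt_compat; lra).
    assert (E0 := exp_pos (/ (1 - r))).
    assert (0 < / (1 - r) * exp (/ (1 - r)))%R by (apply Rmult_lt_0_compat; auto).
    apply Rmult_lt_0_compat; lra. }
  destruct (pow_lt_1_zero r ltac:(rewrite Rabs_pos_eq; lra) (eps / K)%R) as [N0 HN0].
  { apply Rdiv_lt_0_compat; auto. }
  exists (fun X => Cprod (fun n => RtoC 1 - X ^ S n)%C N0). split.
  - clear. induction N0; simpl. apply disc_holo_const.
    apply disc_holo_mult; auto. apply disc_holo_minus. apply disc_holo_const.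
    apply (disc_holo_pow (fun x => x) (S N0)). apply disc_holo_poly, is_poly_id.
  - intros X HX. eapply Rle_trans; [apply euler_product_approx; eauto|]. fold K.
    specialize (HN0 N0 (Nat.le_refl _)). rewrite Rabs_pos_eq in HN0 by (apply pow_le; lra).
    apply Rlt_div_r in HN0; auto. lra.
Qed.

Lemma euler_product_at_cusp r : (0 <= r < 1)%R -> exists K, forall X, (Cmod X <= r)%R ->
  (Cmod (euler_product X - 1) <= K * Cmod X)%R.
Proof.
  intros Hr. exists (/ (1 - r) * exp (/ (1 - r)))%R. intros X HX.
  assert (X0 := Cmod_ge_0 X).
  apply (ccv_Cmod_le (fun n => Cprod (fun n => RtoC 1 - X ^ S n)%C n - 1)).
  - intros N. eapply Rle_trans; [apply (euler_partial_bound X (Cmod X) 0 N); lra|].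
    rewrite pow_1. unfold Rdiv.
    assert (I : (/ (1 - Cmod X) <= / (1 - r))%R) by (apply Rinv_le_contravar; lra).
    assert (I0 : (0 < / (1 - Cmod X))%R) by (apply Rinv_0_lt_compat; lra).
    replace (Cmod X * / (1 - Cmod X) * exp (/ (1 - Cmod X)))%R with
      ((/ (1 - Cmod X) * exp (/ (1 - Cmod X))) * Cmod X)%R by ring.
    apply Rmult_le_compat_r; auto. apply Rmult_le_compat; auto. lra. left; apply exp_pos.
    apply exp_le; auto.
  - apply ccv_minus; [|apply ccv_const]. apply euler_product_cv. lra.
Qed.

(** For 0 <= a <= r one has 1 - a >= exp(-a/(1 - a)) >= exp(-a/(1 - r)); multiplied over a = r^(n+1)
    this keeps the partial products above a fixed positive number. *)
Lemma euler_product_neq_0 X : (Cmod X < 1)%R -> euler_product X <> 0.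
Proof.
  intros HX E. assert (C := euler_product_cv X HX). rewrite E in C.
  assert (X0 := Cmod_ge_0 X). set (r := Cmod X) in *.
  assert (I0 : (0 < / (1 - r))%R) by (apply Rinv_0_lt_compat; lra).
  assert (B : forall N, (exp (- (rsum (fun n => r ^ (1 + n)%nat) N * / (1 - r))) <=
     Cmod (Cprod (fun n => RtoC 1 - X ^ S n)%C N))%R).
  { induction N as [|N IH]; cbn [rsum Cprod].
    - rewrite Rmult_0_l, Ropp_0, exp_0, Cmod_1. lra.
    - rewrite Cmod_mult, Rmult_plus_distr_r, Ropp_plus_distr, exp_plus.
      apply Rmult_le_compat; auto; try (left; apply exp_pos).
      set (a := (r ^ (1 + N)%nat)%R). assert (a0 : (0 <= a)%R) by (apply pow_le; lra).
      assert (ar : (a <= r)%R).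
      { unfold a. simpl. assert (r ^ N <= 1)%R by (rewrite <- (pow1 N); apply pow_incr; lra). nra. }
      apply Rle_trans with (1 - a)%R.
      + assert (Y := exp_ineq1_le (a * / (1 - a))).
        assert (Z : (exp (- (a * / (1 - r))) * (1 + a * / (1 - a)) <= 1)%R).
        { apply Rle_trans with (exp (- (a * / (1 - r))) * exp (a * / (1 - a)))%R.
          apply Rmult_le_compat_l; [left; apply exp_pos|auto]. rewrite <- exp_plus.
          apply Rle_trans with (exp 0); [|rewrite exp_0; lra].
          assert (W : (- (a * / (1 - r)) + a * / (1 - a) <= 0)%R).
          { assert (/ (1 - a) <= / (1 - r))%R by (apply Rinv_le_contravar; lra). nra. }
          apply exp_le; auto. }
        replace (1 + a * / (1 - a))%R with (/ (1 - a))%R in Z by (field; lra).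
        apply Rmult_le_reg_r with (/ (1 - a))%R. apply Rinv_0_lt_compat; lra. rewrite Rinv_r; lra.
      + assert (T := Cmod_sub_ge 1 (X ^ S N)). rewrite Cmod_1, Cmod_pow in T. exact T. }
  assert (G : (0 < exp (- (r / (1 - r) * / (1 - r))))%R) by apply exp_pos.
  destruct (C _ G) as [N HN]. specialize (HN N (Nat.le_refl _)). specialize (B N).
  replace (Cprod (fun n => RtoC 1 - X ^ S n)%C N - 0) with (Cprod (fun n => RtoC 1 - X ^ S n)%C N) in HN by ring.
  assert (L := rsum_geom_le r 1 N ltac:(lra)). rewrite pow_1 in L.
  assert (M : (exp (- (r / (1 - r) * / (1 - r))) <= exp (- (rsum (fun n => r ^ (1 + n)%nat) N * / (1 - r))))%R).
  { assert (W : (- (r / (1 - r) * / (1 - r)) <= - (rsum (fun n => r ^ (1 + n)%nat) N * / (1 - r)))%R).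
    { apply Ropp_le_contravar, Rmult_le_compat_r; lra. }
    apply exp_le; auto. }
  lra.
Qed.

(** Complex differentiability with derivative l and an explicit quadratic remainder. Holomorphic
    functions satisfy this stronger form, and its product and chain rules reduce to inequalities
    between constants. *)
Definition quad_diff (f : C -> C) (z l : C) : Prop :=
  exists K rho : R, (0 <= K)%R /\ (0 < rho)%R /\
  forall h, (Cmod h <= rho)%R -> (Cmod (f (z + h)%C - f z - l * h) <= K * Cmod h ^ 2)%R.

Lemma quad_diff_lipschitz f z l K rho h :
  (0 <= K)%R -> (Cmod h <= rho)%R -> (Cmod (f (z + h)%C - f z - l * h) <= K * Cmod h ^ 2)%R ->
  (Cmod (f (z + h)%C - f z) <= (Cmod l + K * rho) * Cmod h)%R.
Proof.
  intros HK Hh H. replace (f (z + h)%C - f z) with ((f (z + h)%C - f z - l * h) + l * h) by ring.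
  eapply Rle_trans; [apply Cmod_triangle|]. rewrite Cmod_mult. assert (P := Cmod_ge_0 h).
  assert (K * Cmod h ^ 2 <= K * rho * Cmod h)%R; [|lra].
  replace (K * Cmod h ^ 2)%R with (K * Cmod h * Cmod h)%R by ring.
  apply Rmult_le_compat_r; auto. apply Rmult_le_compat_l; auto.
Qed.

Lemma quad_diff_mult f g z l m : quad_diff f z l -> quad_diff g z m ->
  quad_diff (fun x => f x * g x) z (l * g z + f z * m).
Proof.
  intros (K & r & HK & Hr & H) (K' & r' & HK' & Hr' & H').
  exists (K * Cmod (g z) + (Cmod l + K * r) * (Cmod m + K' * r') + Cmod (f z) * K')%R, (Rmin r r').
  assert (P1 := Cmod_ge_0 l). assert (P2 := Cmod_ge_0 m). assert (P3 := Cmod_ge_0 (g z)). assert (P4 := Cmod_ge_0 (f z)).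
  assert (0 <= K * r)%R by (apply Rmult_le_pos; lra). assert (0 <= K' * r')%R by (apply Rmult_le_pos; lra).
  split; [|split; [apply Rmin_glb_lt; auto|]].
  { assert (0 <= K * Cmod (g z))%R by (apply Rmult_le_pos; auto).
    assert (0 <= (Cmod l + K * r) * (Cmod m + K' * r'))%R by (apply Rmult_le_pos; lra).
    assert (0 <= Cmod (f z) * K')%R by (apply Rmult_le_pos; auto). lra. }
  intros h Hh.
  assert (h1 : (Cmod h <= r)%R) by (eapply Rle_trans; [exact Hh|apply Rmin_l]).
  assert (h2 : (Cmod h <= r')%R) by (eapply Rle_trans; [exact Hh|apply Rmin_r]).
  specialize (H h h1). specialize (H' h h2).
  assert (Lf := quad_diff_lipschitz f z l K r h HK h1 H).
  assert (Lg := quad_diff_lipschitz g z m K' r' h HK' h2 H').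
  replace (f (z + h)%C * g (z + h)%C - f z * g z - (l * g z + f z * m) * h) with
    ((f (z + h)%C - f z - l * h) * g z + (f (z + h)%C - f z) * (g (z + h)%C - g z)
     + f z * (g (z + h)%C - g z - m * h)) by ring.
  eapply Rle_trans; [apply Cmod_triangle|]. eapply Rle_trans; [apply Rplus_le_compat_r, Cmod_triangle|].
  rewrite !Cmod_mult. assert (P := Cmod_ge_0 h).
  assert (Cmod (f (z + h)%C - f z - l * h) * Cmod (g z) <= K * Cmod h ^ 2 * Cmod (g z))%R by (apply Rmult_le_compat_r; auto).
  assert (Cmod (f z) * Cmod (g (z + h)%C - g z - m * h) <= Cmod (f z) * (K' * Cmod h ^ 2))%R by (apply Rmult_le_compat_l; auto).
  assert (Cmod (f (z + h)%C - f z) * Cmod (g (z + h)%C - g z) <=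
    ((Cmod l + K * r) * Cmod h) * ((Cmod m + K' * r') * Cmod h))%R by (apply Rmult_le_compat; auto; apply Cmod_ge_0).
  lra.
Qed.

Lemma quad_diff_comp f g z l m : quad_diff f (g z) l -> quad_diff g z m ->
  quad_diff (fun x => f (g x)) z (l * m).
Proof.
  intros (K & r & HK & Hr & H) (K' & r' & HK' & Hr' & H').
  assert (P1 := Cmod_ge_0 l). assert (P2 := Cmod_ge_0 m).
  set (B := (Cmod m + K' * r')%R).
  assert (B0 : (0 <= B)%R) by (assert (0 <= K' * r')%R by (apply Rmult_le_pos; lra); unfold B; lra).
  exists (K * B ^ 2 + Cmod l * K')%R, (Rmin r' (r / (B + 1))).
  assert (0 <= K * B ^ 2)%R by (apply Rmult_le_pos; auto; apply pow2_ge_0).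
  assert (0 <= Cmod l * K')%R by (apply Rmult_le_pos; auto).
  split; [lra|]. split. { apply Rmin_glb_lt; auto. apply Rdiv_lt_0_compat; lra. }
  intros h Hh.
  assert (h1 : (Cmod h <= r')%R) by (eapply Rle_trans; [exact Hh|apply Rmin_l]).
  assert (h2 : (Cmod h <= r / (B + 1))%R) by (eapply Rle_trans; [exact Hh|apply Rmin_r]).
  specialize (H' h h1). assert (Lg := quad_diff_lipschitz g z m K' r' h HK' h1 H'). fold B in Lg.
  assert (P := Cmod_ge_0 h).
  apply (Rmult_le_compat_r (B + 1)) in h2; [|lra].
  replace (r / (B + 1) * (B + 1))%R with r in h2 by (field; lra).
  set (k := g (z + h)%C - g z) in *.
  assert (Hk : (Cmod k <= r)%R) by nra.
  specialize (H k Hk). replace (g z + k) with (g (z + h)%C) in H by (unfold k; ring).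
  replace (f (g (z + h)%C) - f (g z) - l * m * h) with ((f (g (z + h)%C) - f (g z) - l * k) + l * (k - m * h)) by ring.
  eapply Rle_trans; [apply Cmod_triangle|]. rewrite Cmod_mult.
  assert (Cmod l * Cmod (k - m * h) <= Cmod l * (K' * Cmod h ^ 2))%R by (apply Rmult_le_compat_l; auto).
  assert (Cmod k ^ 2 <= (B * Cmod h) ^ 2)%R by (apply pow_incr; split; auto; apply Cmod_ge_0).
  assert (K * Cmod k ^ 2 <= K * (B * Cmod h) ^ 2)%R by (apply Rmult_le_compat_l; auto).
  rewrite Rpow_mult_distr in H4. lra.
Qed.

Lemma quad_diff_inv (z : C) : z <> 0 -> quad_diff Cinv z (- / z ^ 2).
Proof.
  intros Hz. assert (P := proj1 (Cmod_gt_0 z) Hz).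
  exists (2 * / Cmod z ^ 3)%R, (Cmod z / 2)%R.
  split; [|split; [lra|]]. { apply Rmult_le_pos. lra. left; apply Rinv_0_lt_compat, pow_lt; auto. }
  intros h Hh. assert (G := Cmod_plus_ge z h).
  assert (N : z + h <> 0) by (apply Cmod_gt_0; lra).
  replace (/ (z + h) - / z - - / z ^ 2 * h) with (h ^ 2 * / (z ^ 2 * (z + h))) by (field; auto).
  rewrite Cmod_mult, Cmod_pow, Cmod_inv by (apply Cmult_neq_0; auto; apply Cpow_nz; auto).
  rewrite Rmult_comm. apply Rmult_le_compat_r. apply pow2_ge_0.
  rewrite Cmod_mult, Cmod_pow.
  replace (2 * / Cmod z ^ 3)%R with (/ (Cmod z ^ 2 * (Cmod z / 2)))%R by (field; lra).
  apply Rinv_le_contravar. apply Rmult_lt_0_compat. apply pow_lt; auto. lra.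
  apply Rmult_le_compat_l. apply pow2_ge_0. lra.
Qed.

Lemma quad_diff_const a z : quad_diff (fun _ => a) z 0.
Proof.
  exists 0%R, 1%R. split; [lra|split; [lra|]]. intros h _.
  replace (a - a - 0 * h) with (RtoC 0) by ring. rewrite Cmod_0. lra.
Qed.

Lemma quad_diff_id z : quad_diff (fun x => x) z 1.
Proof.
  exists 0%R, 1%R. split; [lra|split; [lra|]]. intros h _.
  replace (z + h - z - 1 * h) with (RtoC 0) by ring. rewrite Cmod_0. lra.
Qed.

Lemma quad_diff_nome x tau : quad_diff (nome x) tau (RtoC (2 * PI * x) * Ci * nome x tau).
Proof.
  set (k := (2 * PI * Rabs x)%R). assert (k0 : (0 <= k)%R).
  { apply Rmult_le_pos. assert (X := PI_RGT_0). lra. apply Rabs_pos. }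
  assert (N0 := Cmod_ge_0 (nome x tau)). assert (E0 := exp_pos k).
  exists (Cmod (nome x tau) * (k ^ 2 * exp k / 2))%R, 1%R.
  split; [|split; [lra|]]. { apply Rmult_le_pos; auto. assert (0 <= k ^ 2)%R by apply pow2_ge_0. nra. }
  intros h Hh. set (w := RtoC (2 * PI * x) * Ci * h).
  assert (Hw : Cmod w = (k * Cmod h)%R).
  { unfold w, k. rewrite !Cmod_mult, Cmod_Ci, Cmod_R, !Rabs_mult.
    rewrite (Rabs_pos_eq 2), (Rabs_pos_eq PI) by (assert (X := PI_RGT_0); lra). ring. }
  replace (nome x (tau + h)) with (nome x tau * Cexp w).
  2:{ unfold nome, w. rewrite <- Cexp_add. f_equal. ring. }
  replace (nome x tau * Cexp w - nome x tau - RtoC (2 * PI * x) * Ci * nome x tau * h)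
    with (nome x tau * (Cexp w - 1 - w)) by (unfold w; ring).
  rewrite Cmod_mult, Rmult_assoc. apply Rmult_le_compat_l; auto.
  assert (P := Cmod_ge_0 h).
  eapply Rle_trans; [apply (Cexp_taylor2 w k)|]. rewrite Hw. nra. rewrite Hw. right. field.
Qed.

(** Replacing tau by tau + h multiplies the n-th factor by 1 + d_n, where d_n has linear part -2 pi
    i h n q^n/(1 - q^n). These linear parts add up to the divisor sum by the third form of
    [lambert_series]; the rest is of second order in h, uniformly in the number of factors. *)
Lemma quad_diff_euler tau : (0 < Im tau)%R ->
  quad_diff (fun t => euler_product (nome 1 t)) tau
    (- (2 * RtoC PI * Ci) * sigma_series 1 tau * euler_product (nome 1 tau)).
Proof.
  intros Ht. assert (Hq := nome_1_lt tau Ht). set (q := nome 1 tau) in *. set (r := Cmod q) in *.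
  assert (r0 : (0 < r)%R) by (unfold r, q; rewrite Cmod_nome; apply exp_pos).
  assert (PP := PI_RGT_0).
  (* The increment h is restricted by rho so that |q| grows at most from r to r1 < 1, since r exp(2
     pi rho) = r1. *)
  set (r1 := ((1 + r) / 2)%R). assert (Hr1 : (r < r1 < 1)%R) by (unfold r1; lra).
  set (rho := (ln (r1 / r) / (2 * PI))%R).
  assert (rr : (1 < r1 / r)%R) by (apply Rlt_div_r; lra).
  assert (rho0 : (0 < rho)%R).
  { apply Rdiv_lt_0_compat; [|lra]. rewrite <- ln_1. apply ln_increasing; lra. }
  assert (Erho : (exp (2 * PI * rho) = r1 / r)%R).
  { unfold rho. replace (2 * PI * (ln (r1 / r) / (2 * PI)))%R with (ln (r1 / r)) by (field; lra).
    apply exp_ln; lra. }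
  (* [a] will dominate d_n/h, and [b] the error of replacing d_n by its linear part, divided by
     h^2. *)
  set (a := fun n => (2 * PI / (1 - r) * (INR (S n) ^ 1 * r1 ^ n))%R).
  set (b := fun n => ((2 * PI) ^ 2 / (1 - r) * (INR (S n) ^ 2 * r1 ^ n))%R).
  assert (c0 : (0 < 2 * PI / (1 - r))%R) by (apply Rdiv_lt_0_compat; lra).
  assert (d0 : (0 < (2 * PI) ^ 2 / (1 - r))%R) by (apply Rdiv_lt_0_compat; [apply pow_lt|]; lra).
  assert (Sa : summable a) by (apply summable_scal; [lra|apply summable_pow_geom; lra]).
  assert (Sb : summable b) by (apply summable_scal; [lra|apply summable_pow_geom; lra]).
  destruct (summable_bound a Sa) as [A [A0 HA]]. destruct (summable_bound b Sb) as [B [B0 HB]].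
  set (U := (A ^ 2 * exp (A * rho) + B)%R).
  assert (U0 : (0 < U)%R).
  { assert (0 < A ^ 2 * exp (A * rho))%R by (apply Rmult_lt_0_compat; [apply pow_lt; auto|apply exp_pos]). unfold U; lra. }
  set (Pb := (1 + r ^ 1 / (1 - r) * exp (/ (1 - r)))%R).
  assert (HPb : forall N, (Cmod (Cprod (fun n => RtoC 1 - q ^ S n)%C N) <= Pb)%R).
  { intros N. assert (X := euler_partial_bound q r 0 N (Rle_refl _) ltac:(lra)). simpl Nat.add in X.
    assert (Y := Cmod_sub_ge (Cprod (fun n => RtoC 1 - q ^ S n)%C N) 1). rewrite Cmod_1 in Y. unfold Pb. lra. }
  assert (Pb0 : (0 <= Pb)%R) by (eapply Rle_trans; [apply Cmod_ge_0|apply (HPb 0%nat)]).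
  exists (Pb * U)%R, rho. split; [apply Rmult_le_pos; lra|]. split; auto.
  intros h Hh. assert (h0 := Cmod_ge_0 h).
  set (k := 2 * RtoC PI * Ci). assert (Hk : Cmod k = (2 * PI)%R).
  { unfold k. rewrite !Cmod_mult, Cmod_Ci, !Cmod_R, !Rabs_pos_eq; lra. }
  set (q' := nome 1 (tau + h)).
  assert (Eq' : q' = q * Cexp (k * h)).
  { unfold q', q, nome, k. rewrite <- Cexp_add. f_equal. rewrite !RtoC_mult. ring. }
  set (x := fun n => RtoC (INR (S n)) * (k * h)).
  assert (Hx : forall n, Cmod (x n) = (2 * PI * INR (S n) * Cmod h)%R).
  { intros n. unfold x. rewrite !Cmod_mult, Hk, Cmod_R, Rabs_pos_eq by apply pos_INR. ring. }
  assert (Hxr : forall n, (Cmod (x n) <= 2 * PI * rho * INR (S n))%R).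
  { intros n. rewrite Hx. assert (X := pos_INR (S n)).
    replace (2 * PI * rho * INR (S n))%R with (2 * PI * INR (S n) * rho)%R by ring.
    apply Rmult_le_compat_l; auto. apply Rmult_le_pos; lra. }
  assert (Er : forall n, (r ^ S n * exp (2 * PI * rho * INR (S n)) = r1 ^ S n)%R).
  { intros n. rewrite exp_mult_INR, Erho. unfold Rdiv. rewrite Rpow_mult_distr, pow_inv. field.
    apply pow_nonzero; lra. }
  assert (Er1 : forall n, (r1 ^ S n <= r1 ^ n)%R).
  { intros n. simpl. assert (0 <= r1 ^ n)%R by (apply pow_le; lra). nra. }
  assert (Nq : forall n, 1 - q ^ S n <> 0).
  { intros n. apply one_minus_neq_0. eapply Rle_lt_trans; [apply Cmod_pow_S_lt; auto|auto]. }
  assert (Lq : forall n, (Cmod (/ (1 - q ^ S n)) <= / (1 - r))%R).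
  { intros n. rewrite Cmod_inv by auto. apply Rinv_le_contravar. lra.
    assert (X := Cmod_sub_ge 1 (q ^ S n)). rewrite Cmod_1 in X. assert (Y := Cmod_pow_S_lt q n Hq). fold r in Y. lra. }
  assert (Pq : forall n, q' ^ S n = q ^ S n * Cexp (x n)).
  { intros n. rewrite Eq', Cpow_mult_l. f_equal. unfold x. rewrite Cexp_nat. auto. }
  set (d := fun n => - q ^ S n * (Cexp (x n) - 1) * / (1 - q ^ S n)).
  assert (Fac : forall n, RtoC 1 - q' ^ S n = (RtoC 1 - q ^ S n) * (RtoC 1 + d n)).
  { intros n. unfold d. rewrite Pq. field. apply Nq. }
  set (c := fun n => RtoC (INR (S n) ^ 1) * (q ^ S n / (1 - q ^ S n))).
  assert (Hd : forall n, (Cmod (d n) <= Cmod h * a n)%R).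
  { intros n. unfold d. rewrite !Cmod_mult, Cmod_opp, Cmod_pow. fold r.
    assert (T := Cexp_taylor1 (x n) _ (Hxr n)).
    assert (R0 : (0 <= r ^ S n)%R) by (apply pow_le; lra).
    apply (Rmult_le_compat_l (r ^ S n)) in T; auto.
    replace (r ^ S n * (Cmod (x n) * exp (2 * PI * rho * INR (S n))))%R with
      (Cmod (x n) * (r ^ S n * exp (2 * PI * rho * INR (S n))))%R in T by ring.
    rewrite Er, Hx in T.
    apply Rle_trans with (2 * PI * INR (S n) * Cmod h * r1 ^ n * / (1 - r))%R.
    - apply Rmult_le_compat; auto. apply Rmult_le_pos; auto; apply Cmod_ge_0. apply Cmod_ge_0.
      eapply Rle_trans; [exact T|]. apply Rmult_le_compat_l; auto.
      apply Rmult_le_pos; auto. apply Rmult_le_pos. lra. apply pos_INR.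
    - right. unfold a. field. lra. }
  assert (Hdc : forall n, (Cmod (d n + k * h * c n) <= Cmod h ^ 2 * b n)%R).
  { intros n. replace (d n + k * h * c n) with (- q ^ S n * (Cexp (x n) - 1 - x n) * / (1 - q ^ S n)).
    2:{ unfold d, c, x. rewrite pow_1. field. apply Nq. }
    rewrite !Cmod_mult, Cmod_opp, Cmod_pow. fold r.
    assert (T := Cexp_taylor2 (x n) _ (Hxr n)).
    assert (R0 : (0 <= r ^ S n)%R) by (apply pow_le; lra).
    apply (Rmult_le_compat_l (r ^ S n)) in T; auto.
    replace (r ^ S n * (Cmod (x n) ^ 2 * exp (2 * PI * rho * INR (S n)) / 2))%R with
      (Cmod (x n) ^ 2 / 2 * (r ^ S n * exp (2 * PI * rho * INR (S n))))%R in T by field.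
    rewrite Er, Hx in T.
    set (e := ((2 * PI * INR (S n) * Cmod h) ^ 2)%R) in *. assert (e0 : (0 <= e)%R) by apply pow2_ge_0.
    assert (r1n : (0 <= r1 ^ n)%R) by (apply pow_le; lra).
    apply Rle_trans with (e * r1 ^ n * / (1 - r))%R.
    - apply Rmult_le_compat; auto. apply Rmult_le_pos; auto; apply Cmod_ge_0. apply Cmod_ge_0.
      eapply Rle_trans; [exact T|]. specialize (Er1 n).
      assert (e / 2 * r1 ^ S n <= e / 2 * r1 ^ n)%R by (apply Rmult_le_compat_l; lra).
      assert (0 <= e * r1 ^ n)%R by (apply Rmult_le_pos; auto). lra.
    - right. unfold b, e. field. lra. }
  (* The product is replaced by its linear part, at the cost A^2 exp(A rho) |h|^2, and the d_n by
     their own linear parts, at the cost B |h|^2. *)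
  assert (Key : forall N, (Cmod (Cprod (fun n => RtoC 1 + d n)%C N - 1 + k * h * csum c N) <= U * Cmod h ^ 2)%R).
  { intros N.
    replace (Cprod (fun n => RtoC 1 + d n)%C N - 1 + k * h * csum c N) with
      ((Cprod (fun n => RtoC 1 + d n)%C N - 1 - csum d N) + csum (fun n => d n + k * h * c n) N).
    2:{ rewrite csum_plus, csum_scal. ring. }
    eapply Rle_trans; [apply Cmod_triangle|].
    assert (T1 := Cprod_second_order_bound d N).
    set (s := rsum (fun n => Cmod (d n)) N) in *.
    assert (s0 : (0 <= s)%R) by (apply rsum_nonneg; intros; apply Cmod_ge_0).
    assert (Hs : (s <= A * Cmod h)%R).
    { eapply Rle_trans; [apply rsum_le; intros n _; apply Hd|]. rewrite rsum_scal, Rmult_comm.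
      apply Rmult_le_compat_r; auto. }
    assert (Hs2 : (s <= A * rho)%R) by (eapply Rle_trans; [exact Hs|]; apply Rmult_le_compat_l; lra).
    assert (T2 := exp_minus_1_minus_id_le s s0).
    assert (Es : (exp s <= exp (A * rho))%R).
    { apply exp_le; auto. }
    assert (s2 : (s ^ 2 <= (A * Cmod h) ^ 2)%R) by (apply pow_incr; lra).
    assert (T3 : (s ^ 2 * exp s <= (A * Cmod h) ^ 2 * exp (A * rho))%R).
    { apply Rmult_le_compat; auto. apply pow2_ge_0. left; apply exp_pos. }
    assert (T4 : (Cmod (csum (fun n => d n + k * h * c n)%C N) <= B * Cmod h ^ 2)%R).
    { eapply Rle_trans; [apply Cmod_csum_le; intros n; apply Hdc|]. rewrite rsum_scal, Rmult_comm.
      apply Rmult_le_compat_r; auto. apply pow2_ge_0. }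
    unfold U. rewrite Rpow_mult_distr in T3. lra. }
  assert (Hq' : (Cmod q' < 1)%R).
  { rewrite Eq', Cmod_mult, Cmod_Cexp. fold r.
    assert (R : (Re (k * h) <= 2 * PI * rho)%R).
    { eapply Rle_trans; [apply Rle_abs|]. eapply Rle_trans; [apply re_le_Cmod|]. rewrite Cmod_mult, Hk.
      apply Rmult_le_compat_l; lra. }
    assert (E : (exp (Re (k * h)) <= r1 / r)%R).
    { rewrite <- Erho. apply exp_le; auto. }
    apply (Rmult_le_compat_l r) in E; [|lra]. replace (r * (r1 / r))%R with r1 in E by (field; lra). lra. }
  assert (Hc : has_sum c (sigma_series 1 tau)) by (apply (lambert_series 1 q Hq)).
  set (P := Cprod (fun n => RtoC 1 - q ^ S n)) in *.
  apply (ccv_Cmod_le (fun N => P N * (Cprod (fun n => RtoC 1 + d n) N - 1 + k * h * csum c N))).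
  - intros N. rewrite Cmod_mult, Rmult_assoc. apply Rmult_le_compat; auto; apply Cmod_ge_0.
  - apply (ccv_ext (fun N => Cprod (fun n => RtoC 1 - q' ^ S n) N - P N - (- k * csum c N * P N) * h)).
    + intros N. rewrite (Cprod_ext _ (fun n => (RtoC 1 - q ^ S n) * (RtoC 1 + d n))) by (intros; apply Fac).
      rewrite Cprod_mult. fold P. ring.
    + assert (C1 := euler_product_cv q Hq). assert (C2 := euler_product_cv q' Hq').
      apply ccv_minus. apply ccv_minus; auto. apply ccv_mult; [|apply ccv_const].
      apply ccv_mult; auto. apply ccv_scal. exact Hc.
Qed.

(** Along the segment from z to w, which stays in the half-plane by convexity, the real and
    imaginary parts of f have derivative 0. *)
Lemma quad_diff_zero_constant (f : C -> C) :
  (forall z, (0 < Im z)%R -> quad_diff f z 0) ->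
  forall z w, (0 < Im z)%R -> (0 < Im w)%R -> f z = f w.
Proof.
  intros H z w Hz Hw. set (g := fun t : R => z + RtoC t * (w - z)).
  assert (Hg : forall t, (0 <= t <= 1)%R -> (0 < Im (g t))%R).
  { intros t Ht. unfold g. destruct z as [a b], w as [c d]. unfold Im in *. simpl in *. nra. }
  assert (Part : forall p : C -> R, (forall x y : C, p (x - y)%C = p x - p y)%R -> (forall x : C, Rabs (p x) <= Cmod x)%R ->
    p (f z) = p (f w)).
  { intros p Hp1 Hp2.
    replace z with (g 0%R) by (unfold g; ring).
    replace w with (g 1%R) by (unfold g; ring).
    apply (eq_is_derive (V := R_NormedModule) (fun t => p (f (g t)))); [|lra].
    intros t Ht. apply is_derive_Reals. intros eps He.
    destruct (H (g t) (Hg t Ht)) as (K & rho & HK & Hrho & Hq).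
    set (D := Cmod (w - z)). assert (D0 : (0 <= D)%R) by apply Cmod_ge_0.
    assert (M0 : (0 < Rmin (rho / (D + 1)) (eps / (K * D ^ 2 + 1)))%R).
    { assert (0 <= K * D ^ 2)%R by (apply Rmult_le_pos; auto; apply pow2_ge_0).
      apply Rmin_glb_lt; apply Rdiv_lt_0_compat; lra. }
    exists (mkposreal _ M0). intros s Hs Hsm. simpl in Hsm.
    assert (S1 : (Rabs s < rho / (D + 1))%R) by (eapply Rlt_le_trans; [exact Hsm|apply Rmin_l]).
    assert (S2 : (Rabs s < eps / (K * D ^ 2 + 1))%R) by (eapply Rlt_le_trans; [exact Hsm|apply Rmin_r]).
    assert (A0 := Rabs_pos s). assert (A1 := Rabs_pos_lt s Hs).
    assert (KD : (0 <= K * D ^ 2)%R) by (apply Rmult_le_pos; auto; apply pow2_ge_0).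
    apply Rlt_div_r in S1; [|lra]. apply Rlt_div_r in S2; [|lra].
    set (h := RtoC s * (w - z)). assert (Hh : Cmod h = (Rabs s * D)%R) by (unfold h; rewrite Cmod_mult, Cmod_R; auto).
    specialize (Hq h ltac:(rewrite Hh; nra)).
    replace (g t + h) with (g (t + s)%R) in Hq by (unfold g, h; rewrite RtoC_plus; ring).
    replace (f (g (t + s)%R) - f (g t) - 0 * h) with (f (g (t + s)%R) - f (g t)) in Hq by ring.
    change (zero : R_NormedModule) with 0%R. rewrite Rminus_0_r.
    unfold Rdiv. rewrite Rabs_mult, Rabs_inv.
    assert (X := Hp2 (f (g (t + s)%R) - f (g t))). rewrite Hp1 in X.
    apply (Rmult_lt_reg_r (Rabs s)); auto. rewrite Rmult_assoc, Rinv_l, Rmult_1_r by lra.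
    eapply Rle_lt_trans; [exact X|]. eapply Rle_lt_trans; [exact Hq|]. rewrite Hh.
    replace (K * (Rabs s * D) ^ 2)%R with (K * D ^ 2 * Rabs s * Rabs s)%R by ring.
    apply Rmult_lt_compat_r; auto. lra. }
  assert (E1 := Part Re). assert (E2 := Part Im).
  destruct (f z) as [a b], (f w) as [c d]. simpl in E1, E2. f_equal.
  - apply E1. intros; destruct x, y; reflexivity. apply re_le_Cmod.
  - apply E2. intros; destruct x, y; reflexivity. intros x. eapply Rle_trans; [|apply Rmax_Cmod]. apply Rmax_r.
Qed.

(** The fourth power avoids the choice of a square root of tau in the inversion law and still yields
    the powers 8 and 12 by further exponentiation. *)
Lemma eta_pow_4 tau : eta tau ^ 4 = nome (/ 6) tau * euler_product (nome 1 tau) ^ 4.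
Proof.
  unfold eta. fold (euler_product (nome 1 tau)). rewrite Cpow_mult_l, nome_pow. do 2 f_equal. simpl. field.
Qed.

(* Both sides have logarithmic derivative (pi i / 3) E_2(tau), and they agree at tau = i. *)
Theorem eta4_inversion tau : (0 < Im tau)%R -> eta (- RtoC 1 / tau) ^ 4 = - tau ^ 2 * eta tau ^ 4.
Proof.
  set (a := fun t => nome (/ 6) t * (euler_product (nome 1 t) * euler_product (nome 1 t) *
     (euler_product (nome 1 t) * euler_product (nome 1 t)))).
  assert (Ea : forall t, eta t ^ 4 = a t) by (intros; rewrite eta_pow_4; unfold a; simpl; ring).
  assert (Na : forall t, (0 < Im t)%R -> a t <> 0).
  { intros t Ht. assert (X := euler_product_neq_0 _ (nome_1_lt t Ht)).
    unfold a. apply Cmult_neq_0; [apply Cexp_neq_0|]. apply Cmult_neq_0; apply Cmult_neq_0; auto. }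
  set (k := RtoC PI * Ci / 3).
  assert (T2 : RtoC 2 <> 0) by (apply RtoC_neq_0; lra).
  assert (T3 : RtoC 3 <> 0) by (apply RtoC_neq_0; lra).
  assert (Pn : RtoC PI <> 0) by (apply RtoC_neq_0; assert (X := PI_RGT_0); lra).
  assert (In := Ci_neq_0).
  assert (Da : forall t, (0 < Im t)%R -> quad_diff a t (k * E2 t * a t)).
  { intros t Ht. assert (De := quad_diff_euler t Ht).
    assert (X := quad_diff_mult _ _ _ _ _ (quad_diff_nome (/ 6) t)
      (quad_diff_mult _ _ _ _ _ (quad_diff_mult _ _ _ _ _ De De) (quad_diff_mult _ _ _ _ _ De De))).
    cbv beta in X. unfold a at 1.
    match type of X with quad_diff _ _ ?l => replace (k * E2 t * a t) with l; auto end.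
    unfold a, k, E2. rewrite !RtoC_mult, RtoC_inv by lra. field. }
  set (s := fun t => - RtoC 1 / t).
  assert (Ds : forall t : C, t <> 0 -> quad_diff s t (/ t ^ 2)).
  { intros t Ht. assert (X := quad_diff_mult _ _ _ _ _ (quad_diff_const (- RtoC 1) t) (quad_diff_inv t Ht)).
    match type of X with quad_diff _ _ ?l => replace (/ t ^ 2) with l; auto end. ring. }
  (* In the logarithmic derivative the defect of [E2] under inversion contributes (pi i/3) * 6/(pi i
     t) = 2/t, which cancels the -2/t coming from 1/t^2. *)
  set (Phi := fun t => a (s t) * (/ (t * t) * / a t)).
  assert (Const : forall z w, (0 < Im z)%R -> (0 < Im w)%R -> Phi z = Phi w).
  { apply quad_diff_zero_constant. intros t Ht. assert (N := upper_neq_0 t Ht).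
    assert (Ht' := Im_opp_inv_pos t Ht).
    assert (X := quad_diff_mult _ _ _ _ _ (quad_diff_comp a s t _ _ (Da (s t) Ht') (Ds t N))
      (quad_diff_mult _ _ _ _ _
        (quad_diff_comp Cinv (fun t => t * t) t _ _ (quad_diff_inv (t * t) ltac:(apply Cmult_neq_0; auto))
          (quad_diff_mult _ _ _ _ _ (quad_diff_id t) (quad_diff_id t)))
        (quad_diff_comp Cinv a t _ _ (quad_diff_inv (a t) (Na t Ht)) (Da t Ht)))).
    unfold Phi. match type of X with quad_diff _ _ ?l => replace (RtoC 0) with l; auto end.
    unfold s at 1 2. rewrite E2_inversion by auto. fold (s t). assert (Nt := Na t Ht).
    unfold k. field. auto. }
  intros Ht. rewrite !Ea. fold (s tau).
  assert (Hi : (0 < Im Ci)%R) by (simpl; lra).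
  (* Inversion fixes i, so the constant is 1/i^2 = -1; this is the sign in the inversion law. *)
  assert (X := Const tau Ci Ht Hi). unfold Phi in X.
  assert (Si : s Ci = Ci). { unfold s. replace (- RtoC 1) with (Ci * Ci). field; auto.
    unfold Ci, Cmult, RtoC, Copp; simpl; f_equal; ring. }
  rewrite Si in X.
  assert (N := upper_neq_0 tau Ht). assert (N1 := Na tau Ht). assert (N2 := Na Ci Hi).
  assert (Ci2 : Ci * Ci = - RtoC 1) by (unfold Ci, Cmult, RtoC, Copp; simpl; f_equal; ring).
  replace (a (s tau)) with ((a (s tau) * (/ (tau * tau) * / a tau)) * (tau * tau * a tau)) by (field; auto).
  rewrite X, Ci2. field. auto.
Qed.

(** * Expansions at the cusp and Hecke relations *)

Definition divisor_series (p : nat) (X : C) : C :=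
  CSeries (fun n => RtoC (INR (divisor_sigma p (S n))) * X ^ S n).

Lemma divisor_sigma_le p n : (INR (divisor_sigma p (S n)) <= INR (S n) ^ S p)%R.
Proof.
  unfold divisor_sigma. rewrite INR_list_sum_filter.
  apply Rle_trans with (rsum (fun _ => INR (S n) ^ p)%R (S n)).
  - apply rsum_le. intros d Hd. destruct (Nat.eqb (S n mod S d) 0).
    + rewrite pow_INR. apply pow_incr. split. apply pos_INR. apply le_INR. lia.
    + apply pow_le, pos_INR.
  - assert (E : forall (c : R) N, (rsum (fun _ => c) N = INR N * c)%R).
    { induction N. simpl. ring. cbn [rsum]. rewrite IHN, S_INR. ring. }
    rewrite E. simpl. lra.
Qed.

Lemma divisor_term_bound p (X : C) r n : (Cmod X <= r)%R -> (r < 1)%R ->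
  (Cmod (RtoC (INR (divisor_sigma p (S n))) * X ^ S n) <= INR (S n) ^ S p * r ^ n)%R.
Proof.
  intros HX Hr. assert (X0 := Cmod_ge_0 X).
  rewrite Cmod_mult, Cmod_pow, Cmod_R, Rabs_pos_eq by apply pos_INR.
  apply Rmult_le_compat. apply pos_INR. apply pow_le; auto. apply divisor_sigma_le.
  apply Rle_trans with (r ^ S n)%R. apply pow_incr; lra. simpl.
  assert (0 <= r ^ n)%R by (apply pow_le; lra). nra.
Qed.

Lemma divisor_series_has_sum p X : (Cmod X < 1)%R ->
  has_sum (fun n => RtoC (INR (divisor_sigma p (S n))) * X ^ S n) (divisor_series p X).
Proof. intros HX. apply lambert_series; auto. Qed.

Lemma divisor_series_holo p : disc_holo (divisor_series p).
Proof.
  apply disc_holo_limit. intros r Hr eps He.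
  destruct (summable_tail _ (summable_pow_geom (S p) r Hr) eps He) as [N HN].
  exists (fun X => csum (fun n => RtoC (INR (divisor_sigma p (S n))) * X ^ S n) N). split.
  - clear. induction N; cbn [csum]. apply disc_holo_const. apply disc_holo_plus; auto.
    apply disc_holo_scal. apply (disc_holo_pow (fun x => x)). apply disc_holo_poly, is_poly_id.
  - intros X HX. set (a := fun n => RtoC (INR (divisor_sigma p (S n))) * X ^ S n).
    apply (ccv_Cmod_le (fun n => csum a (N + n) - csum a N)).
    + intros n. rewrite csum_add.
      match goal with |- (Cmod ?x <= _)%R => replace x with (csum (fun k => a (N + k)%nat) n) by ring end.
      eapply Rle_trans; [|apply (HN n)]. apply Cmod_csum_le. intros k. apply divisor_term_bound; lra.
    + apply ccv_minus; [|apply ccv_const].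
      apply (ccv_subseq (csum a) _ (fun n => (N + n)%nat)). intros; lia.
      apply divisor_series_has_sum. lra.
Qed.

(** The tail is dominated using m + k + 1 <= (m + 1)(k + 1), which separates a factor depending on m
    from a summable one in k. *)
Lemma divisor_series_expansion p r m : (0 <= r < 1)%R -> exists K, (0 <= K)%R /\ forall X, (Cmod X <= r)%R ->
  (Cmod (divisor_series p X - csum (fun n => RtoC (INR (divisor_sigma p (S n))) * X ^ S n)%C m) <= K * Cmod X ^ S m)%R.
Proof.
  intros Hr.
  destruct (summable_bound _ (summable_pow_geom (S p) r Hr)) as [B [B0 HB]].
  exists (INR (S m) ^ S p * B)%R. split. { apply Rmult_le_pos; [apply pow_le, pos_INR|lra]. } intros X HX. assert (X0 := Cmod_ge_0 X).
  set (a := fun n => RtoC (INR (divisor_sigma p (S n))) * X ^ S n).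
  apply (ccv_Cmod_le (fun n => csum a (m + n) - csum a m)).
  - intros n. rewrite csum_add.
    match goal with |- (Cmod ?x <= _)%R => replace x with (csum (fun k => a (m + k)%nat) n) by ring end.
    eapply Rle_trans.
    apply (Cmod_csum_le _ (fun k => (INR (S m) ^ S p * Cmod X ^ S m) * (INR (S k) ^ S p * r ^ k))%R).
    + intros k. unfold a. rewrite Cmod_mult, Cmod_pow, Cmod_R, Rabs_pos_eq by apply pos_INR.
      replace (S (m + k))%nat with (S m + k)%nat by lia. rewrite pow_add.
      replace (INR (S m) ^ S p * Cmod X ^ S m * (INR (S k) ^ S p * r ^ k))%R with
        ((INR (S m) * INR (S k)) ^ S p * (Cmod X ^ S m * r ^ k))%R by (rewrite Rpow_mult_distr; ring).
      apply Rmult_le_compat. apply pos_INR. apply Rmult_le_pos; apply pow_le; auto.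
      * simpl Nat.add. eapply Rle_trans; [apply divisor_sigma_le|]. apply pow_incr. split. apply pos_INR.
        rewrite <- mult_INR. apply le_INR. nia.
      * apply Rmult_le_compat_l. apply pow_le; auto. apply pow_incr; lra.
    + rewrite rsum_scal. replace (INR (S m) ^ S p * B * Cmod X ^ S m)%R with ((INR (S m) ^ S p * Cmod X ^ S m) * B)%R by ring.
      apply Rmult_le_compat_l; auto. apply Rmult_le_pos; apply pow_le; auto. apply pos_INR.
  - apply ccv_minus; [|apply ccv_const].
    apply (ccv_subseq (csum a) _ (fun n => (m + n)%nat)). intros; lia.
    apply divisor_series_has_sum. lra.
Qed.

Definition e2 (X : C) : C := RtoC 1 - RtoC 24 * divisor_series 1 X.
Definition e4 (X : C) : C := RtoC 1 + RtoC 240 * divisor_series 3 X.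
Definition e6 (X : C) : C := RtoC 1 - RtoC 504 * divisor_series 5 X.

Lemma e2_holo : disc_holo e2.
Proof. apply disc_holo_minus. apply disc_holo_const. apply disc_holo_scal, divisor_series_holo. Qed.
Lemma e4_holo : disc_holo e4.
Proof. apply disc_holo_plus. apply disc_holo_const. apply disc_holo_scal, divisor_series_holo. Qed.
Lemma e6_holo : disc_holo e6.
Proof. apply disc_holo_minus. apply disc_holo_const. apply disc_holo_scal, divisor_series_holo. Qed.

Lemma disc_holo_rotate f u : (Cmod u <= 1)%R -> disc_holo f -> disc_holo (fun x => f (u * x)).
Proof.
  intros Hu Hf. apply disc_holo_comp_poly; auto.
  - apply is_poly_mult. apply is_poly_const. apply is_poly_id.
  - intros x _. rewrite Cmod_mult. assert (X := Cmod_ge_0 x). nra.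
Qed.

Lemma disc_holo_power f n : disc_holo f -> disc_holo (fun x => f (x ^ S n)).
Proof.
  intros Hf. apply (disc_holo_comp_poly f (fun x => x ^ S n)); auto.
  - induction n.
    + simpl. apply is_poly_mult. apply is_poly_id. apply is_poly_const.
    + change (is_poly (fun x => x * x ^ S n)). apply is_poly_mult; auto. apply is_poly_id.
  - intros x Hx. apply Cmod_pow_S_lt; auto.
Qed.

(** * Behaviour of [E2] under translations, inversion and division of the argument *)

Lemma E2_shift_Z tau (n : Z) : (0 < Im tau)%R -> E2 (tau + RtoC (IZR n)) = E2 tau.
Proof.
  intros H. apply periodic_IZR; auto. intros z _. unfold E2, sigma_series. rewrite nome_1_shift. auto.
Qed.

Lemma E4_shift tau : E4 (tau + RtoC 1) = E4 tau.
Proof. unfold E4, sigma_series. rewrite nome_1_shift. auto. Qed.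

Lemma E6_shift tau : E6 (tau + RtoC 1) = E6 tau.
Proof. unfold E6, sigma_series. rewrite nome_1_shift. auto. Qed.

(** The defect of [E2] under inversion is carried symbolically; in the Hecke relations and in [f1]
    and [g1] its total coefficient is 0. *)
Definition kappa : C := 6 / (RtoC PI * Ci).

Lemma E2_S tau : (0 < Im tau)%R -> E2 (- RtoC 1 / tau) = tau ^ 2 * E2 tau + kappa * tau.
Proof.
  intros H. rewrite E2_inversion by auto. f_equal. unfold kappa. field.
  split. apply Ci_neq_0. apply RtoC_neq_0. assert (X := PI_RGT_0). lra.
Qed.

Lemma Im_div_real (N : R) tau : (0 < N)%R -> Im (tau / RtoC N) = (Im tau / N)%R.
Proof.
  intros HN. unfold Cdiv. rewrite <- RtoC_inv by lra. rewrite Cmult_comm, Im_scal. unfold Rdiv. ring.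
Qed.

Lemma E2_S_multiple (N : R) tau : (0 < N)%R -> (0 < Im tau)%R ->
  E2 (RtoC N * (- RtoC 1 / tau)) = (tau / RtoC N) ^ 2 * E2 (tau / RtoC N) + kappa * (tau / RtoC N).
Proof.
  intros HN Ht. assert (N0 := RtoC_neq_0 N ltac:(lra)). assert (T0 := upper_neq_0 _ Ht).
  rewrite <- E2_S. f_equal. field. auto.
  rewrite Im_div_real by auto. apply Rdiv_lt_0_compat; auto.
Qed.

Lemma E2_S_fraction (N : R) tau : (0 < N)%R -> (0 < Im tau)%R ->
  E2 (- RtoC 1 / tau / RtoC N) = (RtoC N * tau) ^ 2 * E2 (RtoC N * tau) + kappa * (RtoC N * tau).
Proof.
  intros HN Ht. assert (N0 := RtoC_neq_0 N ltac:(lra)). assert (T0 := upper_neq_0 _ Ht).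
  rewrite <- E2_S. f_equal. field. auto.
  rewrite Im_scal. apply Rmult_lt_0_compat; auto.
Qed.

(* With z = (e - 1/tau)/N and u = (tau - e)/N one has - 1/z = - e N - 1/u when e^2 = 1. *)
Lemma E2_S_shifted (N e : Z) tau : (0 < N)%Z -> (e * e = 1)%Z -> (0 < Im tau)%R ->
  E2 ((- RtoC 1 / tau + RtoC (IZR e)) / RtoC (IZR N)) =
  tau ^ 2 * E2 ((tau - RtoC (IZR e)) / RtoC (IZR N)) + RtoC (IZR N) * kappa * tau.
Proof.
  intros HN He Ht. assert (HN' : (0 < IZR N)%R) by (apply IZR_lt; auto).
  assert (N0 := RtoC_neq_0 (IZR N) ltac:(lra)). assert (T0 := upper_neq_0 _ Ht).
  assert (Ee : RtoC (IZR e) * RtoC (IZR e) = 1) by (rewrite <- RtoC_mult, <- mult_IZR, He; auto).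
  set (eC := RtoC (IZR e)) in *. set (NC := RtoC (IZR N)) in *.
  assert (U0 : tau - eC <> 0) by (apply upper_minus_neq_0; auto).
  assert (e0 : eC <> 0).
  { intro E. apply (RtoC_neq_0 1); [lra|]. rewrite <- Ee, E. ring. }
  set (z := (- RtoC 1 / tau + eC) / NC). set (u := (tau - eC) / NC).
  assert (Iz : (0 < Im z)%R).
  { unfold z, NC. rewrite Im_div_real by auto. apply Rdiv_lt_0_compat; auto.
    unfold eC. rewrite Im_shift. apply Im_opp_inv_pos; auto. }
  assert (Iu : (0 < Im u)%R).
  { unfold u, NC. rewrite Im_div_real by auto. apply Rdiv_lt_0_compat; auto.
    unfold eC, Cminus. rewrite <- RtoC_opp, Im_shift. auto. }
  assert (Ez : z = eC * u / tau).
  { unfold z, u. replace (- RtoC 1 / tau + eC) with (eC * (tau - eC) / tau).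
    field; auto. replace (eC * (tau - eC) / tau) with ((eC * tau - eC * eC) / tau) by (field; auto).
    rewrite Ee. field; auto. }
  assert (u0 := upper_neq_0 _ Iu). assert (z0 := upper_neq_0 _ Iz).
  assert (Inv : - RtoC 1 / z = - RtoC 1 / u + RtoC (IZR (- (e * N)))).
  { rewrite opp_IZR, mult_IZR, RtoC_opp, RtoC_mult. fold eC. fold NC. rewrite Ez.
    assert (Et : tau = NC * u + eC) by (unfold u; field; auto).
    replace (- RtoC 1 / (eC * u / tau)) with (- tau / (eC * u)) by (field; auto).
    rewrite Et at 1. 
    replace (- (NC * u + eC) / (eC * u)) with (- NC / eC - RtoC 1 / u) by (field; auto).
    replace (- NC / eC) with (- NC * (eC * eC) / eC) by (rewrite Ee; field; auto). field. auto. }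
  assert (X := E2_S z Iz). rewrite Inv, E2_shift_Z, E2_S in X by (auto; apply Im_opp_inv_pos; auto).
  assert (Y : E2 z = (u ^ 2 * E2 u + kappa * u - kappa * z) / z ^ 2) by (rewrite X; field; auto).
  rewrite Y, Ez.
  replace ((eC * u / tau) ^ 2) with (u ^ 2 / tau ^ 2).
  2:{ transitivity ((eC * eC) * u ^ 2 / tau ^ 2). rewrite Ee. field; auto. field; auto. }
  replace (RtoC (IZR N)) with NC by reflexivity.
  assert (Et : tau - eC = NC * u) by (unfold u; field; auto).
  replace ((u ^ 2 * E2 u + kappa * u - kappa * (eC * u / tau)) / (u ^ 2 / tau ^ 2)) with
    (tau ^ 2 * E2 u + kappa * tau * (tau - eC) / u) by (field; auto).
  rewrite Et. field. auto.
Qed.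

(** The index ranges over pairs of a family member and a point, so a single constant K serves all
    members at once, as the vanishing theorem demands. *)
Definition bigO {I : Type} (D : I -> Prop) (x : I -> C) (n : nat) (u : I -> C) : Prop :=
  exists K, (0 <= K)%R /\ forall i, D i -> (Cmod (u i) <= K * Cmod (x i) ^ n)%R.

Lemma bigO_plus {I} (D : I -> Prop) x n u v : bigO D x n u -> bigO D x n v -> bigO D x n (fun i => u i + v i).
Proof.
  intros (K & HK & H) (K' & HK' & H'). exists (K + K')%R. split. lra. intros i Hi.
  specialize (H i Hi). specialize (H' i Hi). eapply Rle_trans; [apply Cmod_triangle|]. lra.
Qed.

Lemma bigO_mult {I} (D : I -> Prop) x n m u v : bigO D x n u -> bigO D x m v ->
  bigO D x (n + m) (fun i => u i * v i).
Proof.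
  intros (K & HK & H) (K' & HK' & H'). exists (K * K')%R. split. apply Rmult_le_pos; auto. intros i Hi.
  specialize (H i Hi). specialize (H' i Hi). rewrite Cmod_mult, pow_add.
  replace (K * K' * (Cmod (x i) ^ n * Cmod (x i) ^ m))%R with ((K * Cmod (x i) ^ n) * (K' * Cmod (x i) ^ m))%R by ring.
  apply Rmult_le_compat; auto; apply Cmod_ge_0.
Qed.

Lemma bigO_ext {I} (D : I -> Prop) x n u v : (forall i, D i -> u i = v i) -> bigO D x n u -> bigO D x n v.
Proof. intros E (K & HK & H). exists K. split; auto. intros i Hi. rewrite <- E; auto. Qed.

Lemma bigO_weaken {I} (D : I -> Prop) x n m u : (forall i, D i -> (Cmod (x i) <= 1)%R) -> (m <= n)%nat ->
  bigO D x n u -> bigO D x m u.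
Proof.
  intros Hx Hmn (K & HK & H). exists K. split; auto. intros i Hi. eapply Rle_trans; [apply H; auto|].
  apply Rmult_le_compat_l; auto. replace n with (m + (n - m))%nat by lia. rewrite pow_add.
  assert (P := Cmod_ge_0 (x i)). rewrite <- (Rmult_1_r (Cmod (x i) ^ m)) at 2.
  apply Rmult_le_compat_l. apply pow_le; auto. rewrite <- (pow1 (n - m)). apply pow_incr; auto.
Qed.

Lemma bigO_bounded {I} (D : I -> Prop) (x : I -> C) u B : (forall i, D i -> (Cmod (u i) <= B)%R) -> bigO D x 0 u.
Proof.
  intros H. exists (Rabs B). split. apply Rabs_pos. intros i Hi. simpl.
  assert (X := H i Hi). assert (Y := Rle_abs B). lra.
Qed.

Lemma bigO_const {I} (D : I -> Prop) (x : I -> C) (c : C) : bigO D x 0 (fun _ => c).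
Proof. apply (bigO_bounded _ _ _ (Cmod c)). intros; lra. Qed.

Lemma bigO_pow_var {I} (D : I -> Prop) (x : I -> C) n : bigO D x n (fun i => x i ^ n).
Proof. exists 1%R. split. lra. intros. rewrite Cmod_pow. lra. Qed.

Lemma bigO_scal {I} (D : I -> Prop) x n (c : C) u : bigO D x n u -> bigO D x n (fun i => c * u i).
Proof. intros H. exact (bigO_mult D x 0 n _ _ (bigO_const D x c) H). Qed.

Lemma bigO_divisor_series {I} (D : I -> Prop) (x c : I -> C) r p k m :
  (0 <= r < 1)%R -> (forall i, D i -> (Cmod (x i) <= r)%R) -> (forall i, D i -> (Cmod (c i) <= 1)%R) ->
  bigO D x (S k * S m) (fun i => divisor_series p (c i * x i ^ S k)
    - csum (fun n => RtoC (INR (divisor_sigma p (S n))) * (c i * x i ^ S k) ^ S n) m).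
Proof.
  intros Hr Hx Hc. destruct (divisor_series_expansion p r m Hr) as [K [K0 HK]].
  exists K. split; auto. intros i Hi. specialize (Hx i Hi). specialize (Hc i Hi).
  assert (X0 := Cmod_ge_0 (x i)). assert (C0 := Cmod_ge_0 (c i)).
  assert (Xk : (Cmod (c i * x i ^ S k) <= Cmod (x i) ^ S k)%R).
  { rewrite Cmod_mult, Cmod_pow. assert (0 <= Cmod (x i) ^ S k)%R by (apply pow_le; auto). nra. }
  assert (Xr : (Cmod (x i) ^ S k <= r)%R).
  { rewrite <- Cmod_pow. eapply Rle_trans; [apply Cmod_pow_S_lt|]; lra. }
  eapply Rle_trans; [apply HK; lra|]. rewrite pow_mult. apply Rmult_le_compat_l; auto.
  apply pow_incr. split; auto. apply Cmod_ge_0.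
Qed.

Lemma sigma_values : INR (divisor_sigma 1 1) = 1%R /\ INR (divisor_sigma 1 2) = 3%R /\
  INR (divisor_sigma 1 3) = 4%R /\ INR (divisor_sigma 3 1) = 1%R /\ INR (divisor_sigma 5 1) = 1%R.
Proof.
  repeat split; match goal with |- INR ?n = IZR ?z => replace n with (Z.to_nat z) by reflexivity end;
    rewrite INR_IZR_INZ; reflexivity.
Qed.

Section Expansions.
Context {I : Type} (D : I -> Prop) (x : I -> C) (r : R).
Context (Hr : (0 <= r < 1)%R) (Hx : forall i, D i -> (Cmod (x i) <= r)%R).

Lemma expansion_var_le_1 : forall i, D i -> (Cmod (x i) <= 1)%R.
Proof. intros i Hi. specialize (Hx i Hi). lra. Qed.

Lemma e2_order_0 (c : I -> C) k : (forall i, D i -> (Cmod (c i) <= 1)%R) ->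
  bigO D x (S k) (fun i => e2 (c i * x i ^ S k) - 1).
Proof.
  intros Hc. apply (bigO_ext _ _ _ (fun i => - (24) * (divisor_series 1 (c i * x i ^ S k)
    - csum (fun n => RtoC (INR (divisor_sigma 1 (S n))) * (c i * x i ^ S k) ^ S n) 0))).
  - intros i _. unfold e2. cbn [csum]. ring.
  - apply bigO_scal. replace (S k) with (S k * 1)%nat at 1 by lia. apply (bigO_divisor_series D x c r); auto.
Qed.

Lemma e2_order_1 (c : I -> C) : (forall i, D i -> (Cmod (c i) <= 1)%R) ->
  bigO D x 2 (fun i => e2 (c i * x i ^ 1) - (1 - 24 * (c i * x i))).
Proof.
  intros Hc. destruct sigma_values as (S1 & _).
  apply (bigO_ext _ _ _ (fun i => - (24) * (divisor_series 1 (c i * x i ^ 1)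
    - csum (fun n => RtoC (INR (divisor_sigma 1 (S n))) * (c i * x i ^ 1) ^ S n) 1))).
  - intros i _. unfold e2. cbn [csum]. rewrite S1, Cpow_1_r. cbn [Cpow]. ring.
  - apply bigO_scal. apply (bigO_divisor_series D x c r 1 0 1); auto.
Qed.

Lemma e2_order_3 (c : I -> C) : (forall i, D i -> (Cmod (c i) <= 1)%R) ->
  bigO D x 4 (fun i => e2 (c i * x i ^ 1) - (1 - 24 * (c i * x i) - 72 * (c i * x i) ^ 2 - 96 * (c i * x i) ^ 3)).
Proof.
  intros Hc. destruct sigma_values as (S1 & S2 & S3 & _).
  apply (bigO_ext _ _ _ (fun i => - (24) * (divisor_series 1 (c i * x i ^ 1)
    - csum (fun n => RtoC (INR (divisor_sigma 1 (S n))) * (c i * x i ^ 1) ^ S n) 3))).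
  - intros i _. unfold e2. cbn [csum]. rewrite S1, S2, S3, Cpow_1_r. cbn [Cpow]. ring.
  - apply bigO_scal. apply (bigO_divisor_series D x c r 1 0 3); auto.
Qed.

Lemma e2_cube_order_1 : bigO D x 6 (fun i => e2 (1 * x i ^ 3) - (1 - 24 * x i ^ 3)).
Proof.
  destruct sigma_values as (S1 & _).
  apply (bigO_ext _ _ _ (fun i => - (24) * (divisor_series 1 (1 * x i ^ 3)
    - csum (fun n => RtoC (INR (divisor_sigma 1 (S n))) * (1 * x i ^ 3) ^ S n) 1))).
  - intros i _. unfold e2. cbn [csum]. rewrite S1. cbn [Cpow]. ring.
  - apply bigO_scal. apply (bigO_divisor_series D x (fun _ => RtoC 1) r 1 2 1); auto. intros; rewrite Cmod_1; lra.
Qed.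

Lemma e4_order_0 k : bigO D x (S k) (fun i => e4 (1 * x i ^ S k) - 1).
Proof.
  apply (bigO_ext _ _ _ (fun i => 240 * (divisor_series 3 (1 * x i ^ S k)
    - csum (fun n => RtoC (INR (divisor_sigma 3 (S n))) * (1 * x i ^ S k) ^ S n) 0))).
  - intros i _. unfold e4. cbn [csum]. ring.
  - apply bigO_scal. replace (S k) with (S k * 1)%nat at 1 by lia.
    apply (bigO_divisor_series D x (fun _ => RtoC 1) r); auto. intros; rewrite Cmod_1; lra.
Qed.

Lemma e4_cube_order_1 : bigO D x 6 (fun i => e4 (1 * x i ^ 3) - (1 + 240 * x i ^ 3)).
Proof.
  destruct sigma_values as (_ & _ & _ & S1 & _).
  apply (bigO_ext _ _ _ (fun i => 240 * (divisor_series 3 (1 * x i ^ 3)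
    - csum (fun n => RtoC (INR (divisor_sigma 3 (S n))) * (1 * x i ^ 3) ^ S n) 1))).
  - intros i _. unfold e4. cbn [csum]. rewrite S1. cbn [Cpow]. ring.
  - apply bigO_scal. apply (bigO_divisor_series D x (fun _ => RtoC 1) r 3 2 1); auto. intros; rewrite Cmod_1; lra.
Qed.

Lemma e6_order_0 k : bigO D x (S k) (fun i => e6 (1 * x i ^ S k) - 1).
Proof.
  apply (bigO_ext _ _ _ (fun i => - (504) * (divisor_series 5 (1 * x i ^ S k)
    - csum (fun n => RtoC (INR (divisor_sigma 5 (S n))) * (1 * x i ^ S k) ^ S n) 0))).
  - intros i _. unfold e6. cbn [csum]. ring.
  - apply bigO_scal. replace (S k) with (S k * 1)%nat at 1 by lia.
    apply (bigO_divisor_series D x (fun _ => RtoC 1) r); auto. intros; rewrite Cmod_1; lra.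
Qed.

Lemma e6_cube_order_1 : bigO D x 6 (fun i => e6 (1 * x i ^ 3) - (1 - 504 * x i ^ 3)).
Proof.
  destruct sigma_values as (_ & _ & _ & _ & S1).
  apply (bigO_ext _ _ _ (fun i => - (504) * (divisor_series 5 (1 * x i ^ 3)
    - csum (fun n => RtoC (INR (divisor_sigma 5 (S n))) * (1 * x i ^ 3) ^ S n) 1))).
  - intros i _. unfold e6. cbn [csum]. rewrite S1. cbn [Cpow]. ring.
  - apply bigO_scal. apply (bigO_divisor_series D x (fun _ => RtoC 1) r 5 2 1); auto. intros; rewrite Cmod_1; lra.
Qed.

Lemma euler_order_0 k n : bigO D x (S k) (fun i => euler_product (1 * x i ^ S k) ^ n - 1).
Proof.
  assert (E1 : bigO D x (S k) (fun i => euler_product (1 * x i ^ S k) - 1)).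
  { destruct (euler_product_at_cusp r Hr) as [K HK]. exists (Rabs K). split. apply Rabs_pos.
    intros i Hi. specialize (Hx i Hi). assert (X0 := Cmod_ge_0 (x i)).
    rewrite Cmult_1_l, <- Cmod_pow. eapply Rle_trans; [apply HK|].
    - eapply Rle_trans; [apply Cmod_pow_S_lt|]; lra.
    - apply Rmult_le_compat_r. apply Cmod_ge_0. apply Rle_abs. }
  induction n as [|n IH].
  - apply (bigO_ext _ _ _ (fun i => 0 * (euler_product (1 * x i ^ S k) - 1))).
    intros; cbn [Cpow]; ring. apply bigO_scal; auto.
  - apply (bigO_ext _ _ _ (fun i => ((euler_product (1 * x i ^ S k) - 1)
      + (euler_product (1 * x i ^ S k) ^ n - 1)) + (euler_product (1 * x i ^ S k) - 1) * (euler_product (1 * x i ^ S k) ^ n - 1))).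
    intros; cbn [Cpow]; ring. apply bigO_plus; [apply bigO_plus; auto|].
    apply (bigO_weaken _ _ (S k + S k)). apply expansion_var_le_1. lia. apply bigO_mult; auto.
Qed.

End Expansions.

(** With PI > 3 it suffices that exp(51/40) >= 100/29, which follows from exp(x) >= (1 + x/30)^30.
    The value 29/100 is small enough for weight 6 and order 2: 8 (29/100)^2/(71/100) < 1. *)
Lemma exp_lower_bound_2 : (exp (- (17 / 20 * PI / INR 2)) <= 29 / 100)%R.
Proof.
  assert (P := PI2_3_2).
  apply Rle_trans with (exp (- (51 / 40))).
  - assert (X : (- (17 / 20 * PI / INR 2) <= - (51 / 40))%R) by (simpl; lra).
    apply exp_le; auto.
  - rewrite exp_Ropp. replace (29 / 100)%R with (/ (100 / 29))%R by lra.
    apply Rinv_le_contravar. lra.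
    replace (51 / 40)%R with (51 / 1200 * INR 30)%R by (simpl; lra). rewrite exp_mult_INR.
    apply Rle_trans with ((1 + 51 / 1200) ^ 30)%R. simpl; lra.
    apply pow_incr. split. lra. apply exp_ineq1_le.
Qed.

(** The same computation with ten factors; 45/100 suits weight 6 and order 4, since 8
    (45/100)^4/(55/100) < 1. *)
Lemma exp_lower_bound_3 : (exp (- (17 / 20 * PI / INR 3)) <= 45 / 100)%R.
Proof.
  assert (P := PI2_3_2).
  apply Rle_trans with (exp (- (17 / 20))).
  - assert (X : (- (17 / 20 * PI / INR 3) <= - (17 / 20))%R) by (simpl; lra).
    apply exp_le; auto.
  - rewrite exp_Ropp. replace (45 / 100)%R with (/ (100 / 45))%R by lra.
    apply Rinv_le_contravar. lra.
    replace (17 / 20)%R with (17 / 200 * INR 10)%R by (simpl; lra). rewrite exp_mult_INR.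
    apply Rle_trans with ((1 + 17 / 200) ^ 10)%R. simpl; lra.
    apply pow_incr. split. lra. apply exp_ineq1_le.
Qed.

Lemma nome_small N r tau : (0 < N)%nat -> (exp (- (17 / 20 * PI / INR N)) <= r)%R -> (17 / 20 <= Im tau)%R ->
  (Cmod (nome (/ INR N) tau) <= r)%R.
Proof.
  intros HN Hr Ht. assert (N0 : (0 < INR N)%R) by (apply lt_0_INR; auto). assert (P := PI_RGT_0).
  rewrite Cmod_nome. eapply Rle_trans; [|exact Hr].
  assert (X : (- (2 * PI * / INR N * Im tau) <= - (17 / 20 * PI / INR N))%R).
  { assert (0 < PI * / INR N)%R by (apply Rmult_lt_0_compat; [lra|apply Rinv_0_lt_compat; auto]).
    unfold Rdiv at 2. nra. }
  apply exp_le; auto.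
Qed.

(** All arguments k tau/N + y become powers of the one variable q^(1/N), rotated by a unit; this
    reduces every identity at level N to functions of a single disc variable. *)
Lemma nome_level (N : nat) tau k (y : R) : (0 < N)%nat ->
  nome 1 (tau * RtoC (INR k / INR N) + RtoC y) = cis (2 * PI * y) * nome (/ INR N) tau ^ k.
Proof.
  intros HN. assert (N0 : (INR N <> 0)%R) by (apply not_0_INR; lia).
  rewrite nome_shift, nome_pow, Rmult_1_r. rewrite Cmult_comm. f_equal.
  unfold nome. f_equal. rewrite !RtoC_mult, RtoC_div, RtoC_inv by auto. unfold Cdiv. ring.
Qed.

Lemma E2_level N k y u tau w : (0 < N)%nat -> w = tau * RtoC (INR k / INR N) + RtoC y -> cis (2 * PI * y) = u ->
  E2 w = e2 (u * nome (/ INR N) tau ^ k).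
Proof. intros HN -> <-. rewrite <- nome_level; auto. Qed.

Lemma E4_level N tau : (0 < N)%nat -> E4 tau = e4 (1 * nome (/ INR N) tau ^ N).
Proof.
  intros HN. rewrite nome_pow, Cmult_1_l. replace (INR N * / INR N)%R with 1%R. reflexivity.
  field. apply not_0_INR. lia.
Qed.

Lemma E6_level N tau : (0 < N)%nat -> E6 tau = e6 (1 * nome (/ INR N) tau ^ N).
Proof.
  intros HN. rewrite nome_pow, Cmult_1_l. replace (INR N * / INR N)%R with 1%R. reflexivity.
  field. apply not_0_INR. lia.
Qed.

Lemma cis_0 : cis 0 = 1.
Proof. unfold cis. rewrite Cmult_0_l. apply Cexp_0. Qed.

Lemma modular_family_vanishes_bigO (J : Type) (h F : J -> C -> C) (N v k : nat) (r : R) :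
  (0 < N)%nat -> (0 < v)%nat ->
  (forall j, disc_holo (F j)) ->
  (forall j tau, (0 < Im tau)%R -> h j tau = F j (nome (/ INR N) tau)) ->
  bigO (fun i : J * C => (17 / 20 <= Im (snd i))%R) (fun i => nome (/ INR N) (snd i)) v
    (fun i => F (fst i) (nome (/ INR N) (snd i))) ->
  (forall j tau, (0 < Im tau)%R -> exists j', h j tau = h j' (tau + RtoC 1)) ->
  (forall j tau, (0 < Im tau)%R -> exists j', h j (tau + RtoC 1) = h j' tau) ->
  (forall j tau, (0 < Im tau)%R -> exists j', h j' (- RtoC 1 / tau) = tau ^ (2 * k) * h j tau) ->
  (exp (- (17 / 20 * PI / INR N)) <= r < 1)%R -> (2 ^ k * r ^ v / (1 - r) < 1)%R ->
  forall j tau, (0 < Im tau)%R -> h j tau = 0.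
Proof.
  intros HN Hv HF HhF (K & _ & HK) HT HT' HS Hr Hth.
  apply (modular_family_vanishes J h F N v k r K); auto.
  - intros j tau Ht. rewrite HhF by lra. apply (HK (j, tau)). auto.
  - intros j tau Ht. destruct (HT j tau Ht) as [j' E]. exists j'. rewrite E. auto.
  - intros j tau Ht. destruct (HT' j tau Ht) as [j' E]. exists j'. rewrite E. auto.
  - intros j tau Ht. destruct (HS j tau Ht) as [j' E]. exists j'.
    rewrite E, Cmod_mult, Cmod_pow. ring.
Qed.

Lemma e2_rotate_power_holo u k : (Cmod u <= 1)%R -> disc_holo (fun X => e2 (u * X ^ S k)).
Proof.
  intros Hu. apply (disc_holo_power (fun x => e2 (u * x))). apply disc_holo_rotate; auto. apply e2_holo.
Qed.

Lemma e4_power_holo k : disc_holo (fun X => e4 (1 * X ^ S k)).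
Proof.
  apply (disc_holo_power (fun x => e4 (1 * x))). apply disc_holo_rotate. rewrite Cmod_1; lra. apply e4_holo.
Qed.

Lemma e6_power_holo k : disc_holo (fun X => e6 (1 * X ^ S k)).
Proof.
  apply (disc_holo_power (fun x => e6 (1 * x))). apply disc_holo_rotate. rewrite Cmod_1; lra. apply e6_holo.
Qed.

Lemma euler_power_holo k : disc_holo (fun X => euler_product (1 * X ^ S k)).
Proof.
  apply (disc_holo_power (fun x => euler_product (1 * x))). apply disc_holo_rotate. rewrite Cmod_1; lra.
  apply euler_product_holo.
Qed.

Ltac disc_holo_auto := lazymatch goal with
  | |- disc_holo (fun X => Cminus (@?f X) (@?g X)) => apply (disc_holo_minus f g); disc_holo_auto
  | |- disc_holo (fun X => Cplus (@?f X) (@?g X)) => apply (disc_holo_plus f g); disc_holo_auto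
  | |- disc_holo (fun X => Cmult (@?f X) (@?g X)) => apply (disc_holo_mult f g); disc_holo_auto
  | |- disc_holo (fun X => Cpow (@?f X) ?n) => apply (disc_holo_pow f n); disc_holo_auto
  | |- disc_holo (fun X => e2 _) => apply e2_rotate_power_holo
  | |- disc_holo (fun X => e4 _) => apply e4_power_holo
  | |- disc_holo (fun X => e6 _) => apply e6_power_holo
  | |- disc_holo (fun X => euler_product _) => apply euler_power_holo
  | |- disc_holo (fun X => X) => apply disc_holo_poly, is_poly_id
  | |- disc_holo (fun _ => ?a) => apply (disc_holo_const a)
  end.

(** * The Hecke relations for [E2] at 2 and 3 *)

Lemma two_level tau : tau / RtoC 2 = tau * RtoC (INR 1 / INR 2) + RtoC 0 /\
  (tau + RtoC 1) / RtoC 2 = tau * RtoC (INR 1 / INR 2) + RtoC (/ 2) /\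
  RtoC 2 * tau = tau * RtoC (INR 4 / INR 2) + RtoC 0 /\ tau = tau * RtoC (INR 2 / INR 2) + RtoC 0.
Proof.
  replace (INR 1 / INR 2)%R with (/ 2)%R by (simpl; field).
  replace (INR 4 / INR 2)%R with 2%R by (simpl; field).
  replace (INR 2 / INR 2)%R with 1%R by (simpl; field).
  rewrite RtoC_inv by lra. repeat split; field.
Qed.

Lemma cis_half_turn : cis (2 * PI * / 2) = - (1).
Proof. replace (2 * PI * / 2)%R with PI by field. apply cis_PI. Qed.

Lemma E2_level_2 tau : let x := nome (/ INR 2) tau in
  E2 (tau / RtoC 2) = e2 (1 * x ^ 1) /\ E2 ((tau + RtoC 1) / RtoC 2) = e2 (- (1) * x ^ 1) /\
  E2 (RtoC 2 * tau) = e2 (1 * x ^ 4) /\ E2 tau = e2 (1 * x ^ 2).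
Proof.
  intros x. destruct (two_level tau) as (A1 & A2 & A3 & A4).
  assert (Z : cis (2 * PI * 0) = 1) by (rewrite Rmult_0_r; apply cis_0).
  repeat split; [eapply (E2_level 2 1 0)|eapply (E2_level 2 1 (/2))|eapply (E2_level 2 4 0)|eapply (E2_level 2 2 0)];
    auto; apply cis_half_turn.
Qed.

Lemma Cmod_minus_1_le : (Cmod (- (1)) <= 1)%R.
Proof. rewrite Cmod_opp, Cmod_1. lra. Qed.

Lemma Cmod_1_le : (Cmod 1 <= 1)%R.
Proof. rewrite Cmod_1. lra. Qed.

(* The Hecke relation for T_2: the difference is a form of weight 2 and level 1 without constant term. *)
Theorem E2_hecke_2 tau : (0 < Im tau)%R ->
  E2 (tau / RtoC 2) + E2 ((tau + RtoC 1) / RtoC 2) + 4 * E2 (RtoC 2 * tau) = 6 * E2 tau.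
Proof.
  assert (T2 : RtoC 2 <> 0) by (apply RtoC_neq_0; lra).
  set (h := fun (_ : unit) t => 6 * E2 t - 4 * E2 (RtoC 2 * t) - E2 (t / RtoC 2) - E2 ((t + RtoC 1) / RtoC 2)).
  set (F := fun (_ : unit) X => 6 * e2 (1 * X ^ 2) - 4 * e2 (1 * X ^ 4) - e2 (1 * X ^ 1) - e2 (- (1) * X ^ 1)).
  assert (Hshift : forall j t, (0 < Im t)%R -> h j (t + RtoC 1) = h j t).
  { intros j t Ht. unfold h.
    replace (RtoC 2 * (t + RtoC 1)) with (RtoC 2 * t + RtoC (IZR 2)) by (simpl; ring).
    replace ((t + RtoC 1 + RtoC 1) / RtoC 2) with (t / RtoC 2 + RtoC (IZR 1)) by (simpl; field).
    assert (X := E2_shift_Z t 1 Ht). simpl in X. rewrite X, !E2_shift_Z. ring.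
    rewrite Im_div_real; lra. rewrite Im_scal; lra. }
  intros Ht.
  assert (V : h tt tau = 0).
  (* Level 2, order 1, weight 2: only the constant terms 6 - 4 - 1 - 1 must cancel, because 2
     (29/100)/(71/100) < 1. *)
  { apply (modular_family_vanishes_bigO unit h F 2 1 1 (29 / 100)); auto.
    - intros j. unfold F. disc_holo_auto; auto using Cmod_1_le, Cmod_minus_1_le.
    - intros j t _. unfold h, F. destruct (E2_level_2 t) as (-> & -> & -> & ->). auto.
    - set (D := fun i : unit * C => (17 / 20 <= Im (snd i))%R). set (x := fun i : unit * C => nome (/ INR 2) (snd i)).
      assert (Hx : forall i, D i -> (Cmod (x i) <= 29 / 100)%R).
      { intros i Hi. apply nome_small; auto. apply exp_lower_bound_2. }
      assert (Hr : (0 <= 29 / 100 < 1)%R) by lra.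
      apply (bigO_ext _ _ _ (fun i => 6 * (e2 (1 * x i ^ 2) - 1) + ((- (4)) * (e2 (1 * x i ^ 4) - 1)
        + ((- (1)) * (e2 (1 * x i ^ 1) - 1) + (- (1)) * (e2 (- (1) * x i ^ 1) - 1))))).
      { intros i _. unfold F, x. ring. }
      assert (L1 := expansion_var_le_1 D x (29/100) Hr Hx).
      repeat apply bigO_plus; apply bigO_scal.
      + apply (bigO_weaken _ _ 2); [auto|lia|]. apply (e2_order_0 D x _ Hr Hx (fun _ => RtoC 1)). auto using Cmod_1_le.
      + apply (bigO_weaken _ _ 4); [auto|lia|]. apply (e2_order_0 D x _ Hr Hx (fun _ => RtoC 1)). auto using Cmod_1_le.
      + apply (e2_order_0 D x _ Hr Hx (fun _ => RtoC 1)). auto using Cmod_1_le.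
      + apply (e2_order_0 D x _ Hr Hx (fun _ => - (1))). auto using Cmod_minus_1_le.
    - intros j t Hj. exists j. symmetry. auto.
    - intros j t Hj. exists j. auto.
    - intros j t Hj. exists j. unfold h.
      assert (X := E2_S_shifted 2 1 t ltac:(lia) ltac:(lia) Hj). simpl in X.
      rewrite X, E2_S, (E2_S_multiple 2), (E2_S_fraction 2) by (auto; lra).
      assert (Y : E2 ((t + RtoC 1) / RtoC 2) = E2 ((t - RtoC 1) / RtoC 2)).
      { replace ((t + RtoC 1) / RtoC 2) with ((t - RtoC 1) / RtoC 2 + RtoC (IZR 1)) by (simpl; field).
        apply E2_shift_Z. rewrite Im_div_real by lra. unfold Cminus. rewrite <- RtoC_opp, Im_shift. lra. }
      rewrite Y. simpl Nat.mul. field.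
    - split. apply exp_lower_bound_2. lra.
    - simpl. lra. }
  unfold h in V.
  replace (E2 (tau / RtoC 2) + E2 ((tau + RtoC 1) / RtoC 2) + 4 * E2 (RtoC 2 * tau)) with
    (6 * E2 tau - (6 * E2 tau - 4 * E2 (RtoC 2 * tau) - E2 (tau / RtoC 2) - E2 ((tau + RtoC 1) / RtoC 2))) by ring.
  rewrite V. ring.
Qed.

Definition omega : C := cis (2 * PI / 3).

Lemma omega_cube : omega ^ 3 = 1.
Proof.
  unfold omega. transitivity (cis (2 * PI)); [|apply cis_2PI].
  replace (2 * PI)%R with (2 * PI / 3 + (2 * PI / 3 + 2 * PI / 3))%R at 2 by field.
  rewrite !cis_add. simpl. ring.
Qed.

Lemma omega_sqr_plus : omega * omega = - (1) - omega.
Proof.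
  assert (E : (omega - 1) * (omega * omega + omega + 1) = 0).
  { transitivity (omega ^ 3 - 1). simpl; ring. rewrite omega_cube. ring. }
  assert (N : omega - 1 <> 0).
  { intro Q. assert (I : Im (omega - 1) = sin (2 * PI / 3)).
    { unfold omega, cis, Cexp, Im, Cminus, Cplus, Copp, Cmult, RtoC, Ci, Re; simpl.
      replace (2 * PI / 3 * 0 - 0 * 1)%R with 0%R by ring. rewrite exp_0.
      replace (2 * PI / 3 * 1 + 0 * 0)%R with (2 * PI / 3)%R by ring. ring. }
    rewrite Q in I. simpl in I. assert (P := PI_RGT_0).
    assert (0 < sin (2 * PI / 3))%R by (apply sin_gt_0; lra). lra. }
  replace (omega * omega) with ((omega - 1) * (omega * omega + omega + 1) / (omega - 1) - omega - 1) by (field; auto).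
  rewrite E. field. auto.
Qed.

Lemma Cmod_omega : Cmod omega = 1%R.
Proof. apply Cmod_cis. Qed.

Lemma omega_turn (n : nat) : cis (2 * PI * (INR n / 3)) = omega ^ n.
Proof.
  induction n as [|n IH].
  - simpl. replace (2 * PI * (0 / 3))%R with 0%R by field. apply cis_0.
  - rewrite S_INR. replace (2 * PI * ((INR n + 1) / 3))%R with (2 * PI / 3 + 2 * PI * (INR n / 3))%R by field.
    rewrite cis_add, IH. reflexivity.
Qed.

Lemma E2_level_3 tau : let x := nome (/ INR 3) tau in
  (forall m : nat, E2 ((tau + RtoC (INR m)) / RtoC 3) = e2 (omega ^ m * x ^ 1)) /\
  E2 (RtoC 3 * tau) = e2 (1 * x ^ 9) /\ E2 tau = e2 (1 * x ^ 3).
Proof.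
  intros x. assert (Z : cis (2 * PI * 0) = 1) by (rewrite Rmult_0_r; apply cis_0).
  assert (T3 : RtoC 3 <> 0) by (apply RtoC_neq_0; lra).
  repeat split.
  - intros m. apply (E2_level 3 1 (INR m / 3)); auto using omega_turn.
    replace (INR 1 / INR 3)%R with (/ 3)%R by (simpl; field).
    rewrite RtoC_div, RtoC_inv by lra. field.
  - apply (E2_level 3 9 0); auto.
    replace (INR 9 / INR 3)%R with 3%R by (simpl; field). ring.
  - apply (E2_level 3 3 0); auto.
    replace (INR 3 / INR 3)%R with 1%R by (simpl; field). ring.
Qed.

Lemma E2_third_shift tau (a b : Z) : (0 < Im tau)%R -> (exists k, b = a + 3 * k)%Z ->
  E2 ((tau + RtoC (IZR b)) / RtoC 3) = E2 ((tau + RtoC (IZR a)) / RtoC 3).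
Proof.
  intros Ht [k ->]. assert (T3 : RtoC 3 <> 0) by (apply RtoC_neq_0; lra).
  replace ((tau + RtoC (IZR (a + 3 * k))) / RtoC 3) with ((tau + RtoC (IZR a)) / RtoC 3 + RtoC (IZR k)).
  - apply E2_shift_Z. rewrite Im_div_real, Im_shift by lra. lra.
  - rewrite plus_IZR, mult_IZR, RtoC_plus, RtoC_mult. field.
Qed.

Lemma RtoC_minus_1 : RtoC (-1) = - RtoC 1.
Proof. rewrite <- RtoC_opp. f_equal; lra. Qed.

(** Again a combination of weight 2 invariant under both substitutions. At radius 45/100 a vanishing
    constant term is not enough, as 2 (45/100)/(55/100) > 1; the coefficient of q^(1/3) has to
    vanish as well. *)
Theorem E2_hecke_3 tau : (0 < Im tau)%R ->
  E2 ((tau + RtoC 0) / RtoC 3) + E2 ((tau + RtoC 1) / RtoC 3) + E2 ((tau + RtoC 2) / RtoC 3)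
    + 9 * E2 (RtoC 3 * tau) = 12 * E2 tau.
Proof.
  assert (T3 : RtoC 3 <> 0) by (apply RtoC_neq_0; lra).
  set (h := fun (_ : unit) t => 12 * E2 t - 9 * E2 (RtoC 3 * t) - E2 ((t + RtoC (INR 0)) / RtoC 3)
    - E2 ((t + RtoC (INR 1)) / RtoC 3) - E2 ((t + RtoC (INR 2)) / RtoC 3)).
  set (F := fun (_ : unit) X => 12 * e2 (1 * X ^ 3) - 9 * e2 (1 * X ^ 9) - e2 (omega ^ 0 * X ^ 1)
    - e2 (omega ^ 1 * X ^ 1) - e2 (omega ^ 2 * X ^ 1)).
  assert (E0 : INR 0 = IZR 0) by reflexivity. assert (E1 : INR 1 = IZR 1) by reflexivity.
  assert (E2' : INR 2 = IZR 2) by reflexivity.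
  assert (Hshift : forall j t, (0 < Im t)%R -> h j (t + RtoC 1) = h j t).
  { intros j t Ht. unfold h. rewrite E0, E1, E2'.
    replace (RtoC 3 * (t + RtoC 1)) with (RtoC 3 * t + RtoC (IZR 3)) by ring.
    replace (t + RtoC 1 + RtoC (IZR 0)) with (t + RtoC (IZR 1)) by ring.
    replace (t + RtoC 1 + RtoC (IZR 1)) with (t + RtoC (IZR 2)) by (rewrite <- !Cplus_assoc, <- RtoC_plus; do 2 f_equal; ring).
    replace (t + RtoC 1 + RtoC (IZR 2)) with (t + RtoC (IZR 3)) by (rewrite <- !Cplus_assoc, <- RtoC_plus; do 2 f_equal; ring).
    rewrite (E2_third_shift t 0 3) by (auto; exists 1%Z; lia).
    rewrite (E2_shift_Z (RtoC 3 * t)) by (rewrite Im_scal; lra).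
    rewrite (E2_shift_Z t 1) by auto. ring. }
  intros Ht.
  assert (V : h tt tau = 0).
  { apply (modular_family_vanishes_bigO unit h F 3 2 1 (45 / 100)); auto.
    - assert (W : forall n, (Cmod (omega ^ n) <= 1)%R) by (intros; rewrite Cmod_pow, Cmod_omega, pow1; lra).
      intros j. unfold F. disc_holo_auto; auto using Cmod_1_le.
    - intros j t _. unfold h, F. destruct (E2_level_3 t) as (Q & -> & ->). rewrite !Q. auto.
    - assert (W : forall n, (Cmod (omega ^ n) <= 1)%R) by (intros; rewrite Cmod_pow, Cmod_omega, pow1; lra).
      set (D := fun i : unit * C => (17 / 20 <= Im (snd i))%R). set (x := fun i : unit * C => nome (/ INR 3) (snd i)).
      assert (Hx : forall i, D i -> (Cmod (x i) <= 45 / 100)%R).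
      { intros i Hi. apply nome_small; auto. apply exp_lower_bound_3. }
      assert (Hr : (0 <= 45 / 100 < 1)%R) by lra.
      apply (bigO_ext _ _ _ (fun i => 12 * (e2 (1 * x i ^ 3) - 1) + ((- (9)) * (e2 (1 * x i ^ 9) - 1)
        + ((- (1)) * (e2 (omega ^ 0 * x i ^ 1) - (1 - 24 * (omega ^ 0 * x i)))
        + ((- (1)) * (e2 (omega ^ 1 * x i ^ 1) - (1 - 24 * (omega ^ 1 * x i)))
        + (- (1)) * (e2 (omega ^ 2 * x i ^ 1) - (1 - 24 * (omega ^ 2 * x i)))))))).
      { intros i _. unfold F, x. set (X := nome (/ INR 3) (snd i)).
        (* The coefficients of x cancel because 1 + omega + omega^2 = 0. *)
        assert (S : omega ^ 2 = - (1) - omega) by (rewrite <- omega_sqr_plus; simpl; ring).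
        generalize (e2 (omega ^ 2 * X ^ 1)). rewrite S. intros. simpl (omega ^ 0). simpl (omega ^ 1). ring. }
      assert (L1 := expansion_var_le_1 D x (45/100) Hr Hx).
      repeat apply bigO_plus; apply bigO_scal.
      + apply (bigO_weaken _ _ 3); [auto|lia|]. apply (e2_order_0 D x _ Hr Hx (fun _ => RtoC 1)). auto using Cmod_1_le.
      + apply (bigO_weaken _ _ 9); [auto|lia|]. apply (e2_order_0 D x _ Hr Hx (fun _ => RtoC 1)). auto using Cmod_1_le.
      + apply (e2_order_1 D x _ Hr Hx (fun _ => omega ^ 0)). auto.
      + apply (e2_order_1 D x _ Hr Hx (fun _ => omega ^ 1)). auto.
      + apply (e2_order_1 D x _ Hr Hx (fun _ => omega ^ 2)). auto.
    - intros j t Hj. exists j. symmetry. auto.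
    - intros j t Hj. exists j. auto.
    - intros j t Hj. exists j. unfold h. rewrite E0, E1, E2'.
      assert (Hj' := Im_opp_inv_pos t Hj).
      (* The residue 2 is represented by -1, since [E2_S_shifted] asks for e^2 = 1. *)
      rewrite (E2_third_shift (- RtoC 1 / t) (-1) 2) by (auto; exists 1%Z; lia).
      rewrite (E2_S_shifted 3 1 t), (E2_S_shifted 3 (-1) t) by (auto; lia).
      replace (- RtoC 1 / t + RtoC (IZR 0)) with (- RtoC 1 / t) by ring.
      rewrite E2_S, (E2_S_multiple 3), (E2_S_fraction 3) by (auto; lra).
      replace (t - RtoC (-1)) with (t + RtoC (IZR 1)) by (rewrite RtoC_minus_1; ring).
      replace (t - RtoC 1) with (t + RtoC (IZR (-1))) by (rewrite RtoC_minus_1; ring).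
      rewrite (E2_third_shift t (-1) 2) by (auto; exists 1%Z; lia).
      replace (t + RtoC (IZR 0)) with t by ring. simpl Nat.mul. field.
    - split. apply exp_lower_bound_3. lra.
    - simpl. lra. }
  unfold h in V. rewrite E0, E1, E2' in V.
  match type of V with ?v = _ =>
    transitivity (12 * E2 tau - v); [ring|rewrite V; ring] end.
Qed.

(** * The functions f1 *)

Lemma bigO_pow_0 {I} (D : I -> Prop) x u n : bigO D x 0 u -> bigO D x 0 (fun i => u i ^ n).
Proof.
  intros H. induction n; simpl. apply bigO_const. exact (bigO_mult D x 0 0 _ _ H IHn).
Qed.

Lemma bigO_opp {I} (D : I -> Prop) x n u : bigO D x n u -> bigO D x n (fun i => - u i).
Proof.
  intros H. apply (bigO_ext _ _ _ (fun i => - (1) * u i)). intros; ring. apply bigO_scal; auto.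
Qed.

Ltac bigO_0 := lazymatch goal with
  | |- bigO ?D ?x 0 (fun i => Cplus (@?f i) (@?g i)) => apply (bigO_plus D x 0 f g); bigO_0
  | |- bigO ?D ?x 0 (fun i => Cmult (@?f i) (@?g i)) => apply (bigO_mult D x 0 0 f g); bigO_0
  | |- bigO ?D ?x 0 (fun i => Copp (@?f i)) => apply (bigO_opp D x 0 f); bigO_0
  | |- bigO ?D ?x 0 (fun i => Cpow (@?f i) ?n) => apply (bigO_pow_0 D x f n); bigO_0
  | |- bigO ?D ?x 0 (fun _ => ?c) => apply (bigO_const D x c)
  | |- _ => idtac
  end; try assumption.

Lemma sgn_succ j : sgn (j + 1) = - sgn j.
Proof.
  unfold sgn. rewrite powerRZ_add by lra. rewrite powerRZ_1, <- RtoC_opp. f_equal. ring.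
Qed.

Lemma sgn_cases j : sgn j = RtoC 1 \/ sgn j = RtoC (-1).
Proof.
  induction j as [|j IH|j IH] using Z.peano_ind.
  - left. reflexivity.
  - rewrite <- Z.add_1_r, sgn_succ. destruct IH as [->| ->]; rewrite <- RtoC_opp; [right|left]; f_equal; lra.
  - assert (E : sgn j = - sgn (Z.pred j)).
    { rewrite <- sgn_succ. f_equal. lia. }
    replace (sgn (Z.pred j)) with (- sgn j) by (rewrite E; ring).
    destruct IH as [->| ->]; rewrite <- RtoC_opp; [right|left]; f_equal; lra.
Qed.

Lemma sgn_sqr j : sgn j * sgn j = RtoC 1.
Proof. destruct (sgn_cases j) as [->| ->]; rewrite <- RtoC_mult; f_equal; lra. Qed.

Lemma Ci_sqr : Ci * Ci = - RtoC 1.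
Proof. unfold Ci, Cmult, RtoC, Copp; simpl; f_equal; ring. Qed.

Lemma sqrt_neg_sqr a : (0 <= a)%R -> sqrt_neg a * sqrt_neg a = - RtoC a.
Proof.
  intros Ha. unfold sqrt_neg. transitivity (Ci * Ci * RtoC (sqrt a * sqrt a)).
  rewrite RtoC_mult; ring. rewrite Ci_sqr, sqrt_sqrt by auto. ring.
Qed.

Lemma sqrt_neg_1728 : sqrt_neg 1728 = 24 * sqrt_neg 3.
Proof.
  unfold sqrt_neg. replace 1728%R with (24 * 24 * 3)%R by ring.
  rewrite sqrt_mult, sqrt_square by lra. rewrite RtoC_mult. ring.
Qed.

Definition signed_root (j : Z) : C := sgn j * sqrt_neg 3.

Lemma signed_root_succ j : signed_root (j + 1) = - signed_root j.
Proof. unfold signed_root. rewrite sgn_succ. ring. Qed.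

Lemma signed_root_sqr j : signed_root j * signed_root j = - RtoC 3.
Proof.
  unfold signed_root. transitivity ((sgn j * sgn j) * (sqrt_neg 3 * sqrt_neg 3)). ring.
  rewrite sgn_sqr, sqrt_neg_sqr by lra. ring.
Qed.

Lemma Cmod_signed_root j : (Cmod (signed_root j) <= 2)%R.
Proof.
  apply Rsqr_incr_0_var; [|lra]. unfold Rsqr.
  rewrite <- Cmod_mult, signed_root_sqr, Cmod_opp, Cmod_R, Rabs_pos_eq; lra.
Qed.

Lemma f1_ext j k tau : sgn j = sgn k -> f1 j tau = f1 k tau.
Proof. intros E. unfold f1. rewrite E. auto. Qed.

Theorem f1_shift j tau : (0 < Im tau)%R -> f1 j (tau + RtoC 1) = f1 (j + 1) tau.
Proof.
  intros Ht. unfold f1. fold (signed_root j). fold (signed_root (j + 1)). rewrite signed_root_succ.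
  replace ((tau + RtoC 1 + RtoC 1) / RtoC 2) with (tau / RtoC 2 + RtoC (IZR 1)) by (simpl; field).
  assert (X := E2_shift_Z tau 1 Ht). simpl in X. rewrite X, E2_shift_Z.
  unfold Cdiv. ring. rewrite Im_div_real; lra.
Qed.

(** Inversion turns tau/2 into 2 tau and preserves (tau + 1)/2 up to translation; the Hecke relation
    rewrites E2(2 tau) by the terms of [f1], and (-3) as the square of the signed root makes the
    coefficients match. *)
Theorem f1_inversion j tau : (0 < Im tau)%R -> f1 j (- RtoC 1 / tau) =
  (- RtoC 1 - sgn j * sqrt_neg 3) / RtoC 2 * tau ^ 2 * f1 (j + 1) tau.
Proof.
  intros Ht. unfold f1. fold (signed_root j). fold (signed_root (j + 1)). rewrite signed_root_succ.
  assert (X := E2_S_shifted 2 1 tau ltac:(lia) ltac:(lia) Ht). simpl in X.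
  rewrite X, E2_S, (E2_S_fraction 2) by (auto; lra).
  replace (E2 ((tau - RtoC 1) / RtoC 2)) with (E2 ((tau + RtoC 1) / RtoC 2)).
  2:{ replace ((tau + RtoC 1) / RtoC 2) with ((tau - RtoC 1) / RtoC 2 + RtoC (IZR 1)) by (simpl; field).
      apply E2_shift_Z. rewrite Im_div_real by lra. unfold Cminus. rewrite <- RtoC_opp, Im_shift. lra. }
  assert (Hk := E2_hecke_2 tau Ht). assert (S3 := signed_root_sqr j).
  set (s := signed_root j) in *. set (a := E2 (tau / RtoC 2)) in *. set (b := E2 ((tau + RtoC 1) / RtoC 2)) in *.
  replace (E2 (RtoC 2 * tau)) with ((6 * E2 tau - a - b) / 4) by (rewrite <- Hk; field).
  set (e := E2 tau).
  transitivity (tau ^ 2 * ((- (1) - s) * e + (3 + s) / 6 * a + s / 3 * b)). field.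
  transitivity (tau ^ 2 * ((- (1) - s) * e + (3 + 2 * s - s * s) / 12 * a + (s * s + 4 * s + 3) / 12 * b)); [|field].
  rewrite S3. field.
Qed.

(** The point t0 is fixed by tau -> 1 - 1/tau. Inversion followed by translation returns [f1 j t0]
    multiplied by a factor different from 1: the difference between 1 and that factor is (3 +
    sqrt(-3))/2. *)
Lemma f1_zero_aux j (t0 : C) : sgn j = RtoC 1 -> t0 = (RtoC 1 + sqrt_neg 3) / RtoC 2 -> (0 < Im t0)%R /\ f1 j t0 = 0.
Proof.
  intros Hj Et. set (r := sqrt_neg 3) in *.
  assert (R3 : r * r = - RtoC 3) by (apply sqrt_neg_sqr; lra).
  assert (Im0 : (0 < Im t0)%R).
  { rewrite Et. rewrite Im_div_real by lra. apply Rdiv_lt_0_compat; [|lra].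
    unfold r, sqrt_neg. assert (X := sqrt_lt_R0 3 ltac:(lra)).
    unfold Im, Cplus, Cmult, RtoC, Ci; simpl. lra. }
  split; auto.
  assert (N := upper_neq_0 _ Im0).
  assert (Q : t0 * t0 = t0 - 1).
  { rewrite Et. transitivity ((1 + 2 * r + r * r) / 4). field. rewrite R3. field. }
  assert (Inv : - RtoC 1 / t0 = t0 - RtoC 1).
  { assert (Q3 : t0 * t0 * t0 = - RtoC 1).
    { rewrite Q. transitivity (t0 * t0 - t0). ring. rewrite Q. ring. }
    rewrite <- Q, <- Q3. field. auto. }
  assert (Ip : (0 < Im (t0 - RtoC 1))%R) by (unfold Cminus; rewrite <- RtoC_opp, Im_shift; auto).
  assert (A1 := f1_inversion (j + 1) t0 Im0). rewrite Inv in A1.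
  assert (A2 := f1_shift j (t0 - RtoC 1) Ip). replace (t0 - RtoC 1 + RtoC 1) with t0 in A2 by ring.
  rewrite <- A2 in A1.
  rewrite (f1_ext (j + 1 + 1) j t0) in A1 by (rewrite !sgn_succ; ring).
  rewrite sgn_succ, Hj in A1. fold r in A1.
  set (v := f1 j t0) in *.
  assert (B1 : v * (RtoC 1 - (- RtoC 1 - - RtoC 1 * r) / RtoC 2 * t0 ^ 2) = 0).
  { transitivity (v - (- RtoC 1 - - RtoC 1 * r) / RtoC 2 * t0 ^ 2 * v). ring. rewrite <- A1. ring. }
  assert (E : RtoC 1 - (- RtoC 1 - - RtoC 1 * r) / RtoC 2 * t0 ^ 2 = (3 + r) / 2).
  { transitivity (RtoC 1 - (- RtoC 1 + r) / 2 * (t0 * t0)). field. rewrite Q, Et.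
    transitivity (RtoC 1 - (1 - 2 * r + r * r) / 4). field. rewrite R3. field. }
  rewrite E in B1.
  replace v with (v * ((3 + r) / 2) * ((3 - r) / 6)).
  rewrite B1; ring.
  transitivity (v * (9 - r * r) / 12). field. rewrite R3. field.
Qed.

Theorem f1_zero j : f1 j ((sgn j + sqrt_neg 3) / RtoC 2) = RtoC 0.
Proof.
  set (t0 := (RtoC 1 + sqrt_neg 3) / RtoC 2).
  destruct (sgn_cases j) as [E|E]; rewrite E.
  - apply (f1_zero_aux j t0); auto.
  (* For odd j the point is t0 - 1, and translation carries the zero of [f1 (j - 1)] at t0 to it. *)
  - assert (E' : sgn (j - 1) = RtoC 1).
    { assert (X := sgn_succ (j - 1)). replace (j - 1 + 1)%Z with j in X by lia. rewrite E in X.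
      replace (sgn (j - 1)) with (- - sgn (j - 1)) by ring. rewrite <- X, <- RtoC_opp. f_equal; lra. }
    destruct (f1_zero_aux (j - 1) t0 E' eq_refl) as [I Z].
    assert (Ht : (0 < Im (t0 - RtoC 1))%R) by (unfold Cminus; rewrite <- RtoC_opp, Im_shift; auto).
    replace ((RtoC (-1) + sqrt_neg 3) / RtoC 2) with (t0 - RtoC 1).
    2:{ unfold t0. rewrite RtoC_minus_1. field. }
    rewrite <- Z. replace t0 with (t0 - RtoC 1 + RtoC 1) at 2 by ring.
    rewrite f1_shift by auto. f_equal. lia.
Qed.

Lemma eta_pow_12 tau : eta tau ^ 12 = nome (/ INR 2) tau * euler_product (nome 1 tau) ^ 12.
Proof.
  replace 12%nat with (4 * 3)%nat by reflexivity. rewrite !Cpow_mult_r, eta_pow_4, Cpow_mult_l, nome_pow.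
  do 2 f_equal. simpl; field.
Qed.

Lemma eta_pow_8 tau : eta tau ^ 8 = nome (/ INR 3) tau * euler_product (nome 1 tau) ^ 8.
Proof.
  replace 8%nat with (4 * 2)%nat by reflexivity. rewrite !Cpow_mult_r, eta_pow_4, Cpow_mult_l, nome_pow.
  do 2 f_equal. simpl; field.
Qed.

Lemma eta12_shift tau : eta (tau + RtoC 1) ^ 12 = - eta tau ^ 12.
Proof.
  rewrite !eta_pow_12, nome_1_shift, nome_shift.
  replace (2 * PI * / INR 2 * 1)%R with PI by (simpl; field). rewrite cis_PI. ring.
Qed.

Lemma eta8_shift tau : eta (tau + RtoC 1) ^ 8 = omega * eta tau ^ 8.
Proof.
  rewrite !eta_pow_8, nome_1_shift, nome_shift.
  replace (2 * PI * / INR 3 * 1)%R with (2 * PI / 3)%R by (simpl; field). fold omega. ring.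
Qed.

Lemma eta12_inversion tau : (0 < Im tau)%R -> eta (- RtoC 1 / tau) ^ 12 = - tau ^ 6 * eta tau ^ 12.
Proof.
  intros Ht. replace 12%nat with (4 * 3)%nat by reflexivity. rewrite !(Cpow_mult_r _ 4 3), eta4_inversion by auto. ring.
Qed.

Lemma eta8_inversion tau : (0 < Im tau)%R -> eta (- RtoC 1 / tau) ^ 8 = tau ^ 4 * eta tau ^ 8.
Proof.
  intros Ht. replace 8%nat with (4 * 2)%nat by reflexivity. rewrite !(Cpow_mult_r _ 4 2), eta4_inversion by auto. ring.
Qed.

Lemma F1_shift j tau : F1 j (tau + RtoC 1) = F1 (j + 1) tau.
Proof. unfold F1. rewrite E6_shift, eta12_shift, sgn_succ. ring. Qed.

Lemma F1_inversion j tau : (0 < Im tau)%R -> F1 j (- RtoC 1 / tau) = tau ^ 6 * F1 (j + 1) tau.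
Proof. intros Ht. unfold F1. rewrite E6_inversion, eta12_inversion, sgn_succ by auto. ring. Qed.

Definition f1_series (j : Z) (X : C) : C :=
  RtoC 2 * e2 (1 * X ^ 2) - (RtoC 3 + signed_root j) / RtoC 6 * e2 (1 * X ^ 1)
  - (RtoC 3 - signed_root j) / RtoC 6 * e2 (- (1) * X ^ 1).

Lemma f1_level j tau : f1 j tau = f1_series j (nome (/ INR 2) tau).
Proof.
  unfold f1, f1_series. fold (signed_root j). destruct (E2_level_2 tau) as (-> & -> & _ & ->). auto.
Qed.

Lemma f1_series_holo j : disc_holo (f1_series j).
Proof. unfold f1_series. disc_holo_auto; auto using Cmod_1_le, Cmod_minus_1_le. Qed.

Section LevelTwo.
Let D := fun i : Z * C => (17 / 20 <= Im (snd i))%R.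
Let x := fun i : Z * C => nome (/ INR 2) (snd i).
Let s := fun i : Z * C => signed_root (fst i).

Lemma level_two_radius : (0 <= 29 / 100 < 1)%R.
Proof. lra. Qed.

Lemma level_two_small i : D i -> (Cmod (x i) <= 29 / 100)%R.
Proof. intros Hi. apply nome_small; auto. apply exp_lower_bound_2. Qed.

Lemma level_two_x_bounded : bigO D x 0 x.
Proof.
  apply (bigO_bounded _ _ _ 1). intros i Hi. assert (X := level_two_small i Hi). lra.
Qed.

Lemma level_two_s_bounded : bigO D x 0 s.
Proof. apply (bigO_bounded _ _ _ 2). intros i _. apply Cmod_signed_root. Qed.

(** With x = q^(1/2), the two half-argument terms contribute 4 (3 + s) x - 4 (3 - s) x = 8 s x. *)
Lemma f1_expansion : bigO D x 2 (fun i => f1_series (fst i) (x i) - (1 + 8 * s i * x i)).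
Proof.
  assert (Hr := level_two_radius). assert (Hx := level_two_small). assert (S0 := level_two_s_bounded).
  apply (bigO_ext _ _ _ (fun i => RtoC 2 * (e2 (1 * x i ^ 2) - 1)
    + ((- (/ RtoC 6) * (RtoC 3 + s i)) * (e2 (1 * x i ^ 1) - (1 - 24 * (1 * x i)))
    + (- (/ RtoC 6) * (RtoC 3 + - s i)) * (e2 (- (1) * x i ^ 1) - (1 - 24 * (- (1) * x i)))))).
  - intros i _. unfold f1_series, s, Cdiv. field.
  - apply bigO_plus; [|apply bigO_plus].
    + apply bigO_scal. apply (e2_order_0 D x _ Hr Hx (fun _ => RtoC 1)). auto using Cmod_1_le.
    + apply (bigO_mult D x 0 2). bigO_0.
      apply (e2_order_1 D x _ Hr Hx (fun _ => RtoC 1)). auto using Cmod_1_le.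
    + apply (bigO_mult D x 0 2). bigO_0.
      apply (e2_order_1 D x _ Hr Hx (fun _ => - (1))). auto using Cmod_minus_1_le.
Qed.

(** The coefficient of x in the cube is 24 s, and -(-1)^(j+1) sqrt(-1728) equals 24 s as well; this
    matching sign selects the index j + 1. *)
Lemma f1_cube_expansion : bigO D x 2 (fun i => f1_series (fst i) (x i) ^ 3
   - (e6 (1 * x i ^ 2) - sgn (fst i + 1) * sqrt_neg 1728 * (x i * euler_product (1 * x i ^ 2) ^ 12))).
Proof.
  assert (Hr := level_two_radius). assert (Hx := level_two_small). assert (S0 := level_two_s_bounded).
  assert (X0 := level_two_x_bounded). assert (L1 := expansion_var_le_1 D x _ Hr Hx).
  assert (HR := f1_expansion). set (R := fun i => f1_series (fst i) (x i) - (1 + 8 * s i * x i)) in HR.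
  assert (R0 : bigO D x 0 R) by (apply (bigO_weaken _ _ 2); [auto|lia|auto]).
  assert (H6 := e6_order_0 D x _ Hr Hx 1). assert (HP := euler_order_0 D x _ Hr Hx 1 12).
  apply (bigO_ext _ _ _ (fun i => x i ^ 2 * (- RtoC 576 + - RtoC 1536 * (s i * x i))
    + (R i * (3 * (1 + 8 * s i * x i) ^ 2 + 3 * (1 + 8 * s i * x i) * R i + R i ^ 2)
    + ((- (1)) * (e6 (1 * x i ^ 2) - 1) + (- (24) * (s i * x i)) * (euler_product (1 * x i ^ 2) ^ 12 - 1))))).
  - intros i _. rewrite sgn_succ, sqrt_neg_1728.
    replace (- sgn (fst i) * (24 * sqrt_neg 3)) with (- (24) * s i) by (unfold s, signed_root; ring).
    assert (Q : s i * s i = - RtoC 3) by apply signed_root_sqr.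
    replace (f1_series (fst i) (x i)) with (1 + 8 * s i * x i + R i) by (unfold R; ring).
    set (q := s i) in *. set (y := x i). set (P := euler_product (1 * y ^ 2)). set (e := e6 (1 * y ^ 2)).
    transitivity (y ^ 2 * (192 * (q * q) + 512 * (q * q) * (q * y)) + R i * (3 * (1 + 8 * q * y) ^ 2 + 3 * (1 + 8 * q * y) * R i + R i ^ 2)
      - (e - 1) - 24 * (q * y) * (P ^ 12 - 1)). rewrite Q. ring. ring.
  - apply bigO_plus; [|apply bigO_plus; [|apply bigO_plus]].
    + apply (bigO_mult D x 2 0). apply bigO_pow_var. bigO_0.
    + apply (bigO_mult D x 2 0); auto. bigO_0.
    + apply bigO_scal; auto.
    + apply (bigO_mult D x 0 2); auto. bigO_0.
Qed.

Lemma f1_product_expansion : bigO D x 2 (fun i => f1_series (fst i) (x i) * f1_series (fst i + 1) (x i)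
   - e4 (1 * x i ^ 2)).
Proof.
  assert (Hr := level_two_radius). assert (Hx := level_two_small). assert (S0 := level_two_s_bounded).
  assert (X0 := level_two_x_bounded). assert (L1 := expansion_var_le_1 D x _ Hr Hx).
  assert (HR := f1_expansion). set (R := fun i => f1_series (fst i) (x i) - (1 + 8 * s i * x i)) in HR.
  set (R' := fun i => f1_series (fst i + 1) (x i) - (1 + - (8) * s i * x i)).
  (* The expansion is uniform in the index, so reading it at j + 1 with the opposite root costs
     nothing; (1 + 8 s x)(1 - 8 s x) then has no linear term. *)
  assert (HR' : bigO D x 2 R').
  { destruct HR as (K & HK & H). exists K. split; auto. intros i Hi.
    assert (X := H (fst i + 1, snd i)%Z Hi). unfold R, s, x in X. cbn [fst snd] in X.
    rewrite signed_root_succ in X. unfold R', s, x.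
    eapply Rle_trans; [|exact X]. right. f_equal. ring. }
  assert (R0 : bigO D x 0 R) by (apply (bigO_weaken _ _ 2); [auto|lia|auto]).
  assert (H4 := e4_order_0 D x _ Hr Hx 1).
  apply (bigO_ext _ _ _ (fun i => x i ^ 2 * RtoC 192 + (R i * (1 + - (8) * (s i * x i))
    + (R' i * (1 + 8 * (s i * x i) + R i) + (- (1)) * (e4 (1 * x i ^ 2) - 1))))).
  - intros i _. assert (Q : s i * s i = - RtoC 3) by apply signed_root_sqr.
    replace (f1_series (fst i) (x i)) with (1 + 8 * s i * x i + R i) by (unfold R; ring).
    replace (f1_series (fst i + 1) (x i)) with (1 + - (8) * s i * x i + R' i) by (unfold R'; ring).
    set (q := s i) in *. set (y := x i). set (e := e4 (1 * y ^ 2)).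
    transitivity (y ^ 2 * (- (64) * (q * q)) + R i * (1 + - (8) * (q * y)) + R' i * (1 + 8 * (q * y) + R i) - (e - 1)).
    rewrite Q. ring. ring.
  - apply bigO_plus; [|apply bigO_plus; [|apply bigO_plus]].
    + apply (bigO_mult D x 2 0). apply bigO_pow_var. bigO_0.
    + apply (bigO_mult D x 2 0); auto. bigO_0.
    + apply (bigO_mult D x 2 0); auto. bigO_0.
    + apply bigO_scal; auto.
Qed.

End LevelTwo.

Lemma euler_level N tau : (0 < N)%nat -> euler_product (nome 1 tau) = euler_product (1 * nome (/ INR N) tau ^ N).
Proof.
  intros HN. rewrite nome_pow, Cmult_1_l. replace (INR N * / INR N)%R with 1%R. reflexivity.
  field. apply not_0_INR. lia.
Qed.

Theorem f1_cube j tau : (0 < Im tau)%R -> f1 j tau ^ 3 = F1 (j + 1) tau.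
Proof.
  intros Ht.
  assert (V : (fun j t => f1 j t ^ 3 - F1 (j + 1) t) j tau = 0).
  { apply (modular_family_vanishes_bigO Z (fun j t => f1 j t ^ 3 - F1 (j + 1) t)
      (fun j X => f1_series j X ^ 3 - (e6 (1 * X ^ 2) - sgn (j + 1) * sqrt_neg 1728 * (X * euler_product (1 * X ^ 2) ^ 12)))
      2 2 3 (29 / 100)); auto.
    - intros k. apply (disc_holo_minus (fun X => f1_series k X ^ 3)).
      apply (disc_holo_pow (f1_series k)), f1_series_holo. disc_holo_auto.
    - intros k t _. rewrite f1_level. unfold F1. rewrite (E6_level 2), eta_pow_12, <- (euler_level 2) by lia. auto.
    - exact f1_cube_expansion.
    - intros k t Hk. exists (k - 1)%Z. rewrite f1_shift, F1_shift by auto.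
      replace (k - 1 + 1)%Z with k by lia. auto.
    - intros k t Hk. exists (k + 1)%Z. rewrite f1_shift, F1_shift by auto. auto.
    - intros k t Hk. exists (k - 1)%Z. rewrite f1_inversion, F1_inversion by auto.
      replace (k - 1 + 1)%Z with k by lia. fold (signed_root (k - 1)).
      assert (S3 := signed_root_sqr (k - 1)). set (q := signed_root (k - 1)) in *.
      (* The multiplier of [f1] under inversion is a cube root of unity, so it disappears from the
         cube. *)
      assert (U : ((- RtoC 1 - q) / RtoC 2) ^ 3 = 1).
      { transitivity (- (1 + 3 * q + 3 * (q * q) + (q * q) * q) / 8). field. rewrite S3. field. }
      rewrite !Cpow_mult_l, U. simpl Nat.mul. ring.
    - split. apply exp_lower_bound_2. lra.
    - simpl. lra. }
  cbv beta in V. replace (f1 j tau ^ 3) with (f1 j tau ^ 3 - F1 (j + 1) tau + F1 (j + 1) tau) by ring.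
  rewrite V. ring.
Qed.

(** The multipliers of the two factors under inversion are conjugate cube roots of unity, with
    product (1 + 3)/4 = 1. *)
Theorem f1_product j tau : (0 < Im tau)%R -> f1 j tau * f1 (j + 1) tau = E4 tau.
Proof.
  intros Ht.
  assert (V : (fun j t => f1 j t * f1 (j + 1) t - E4 t) j tau = 0).
  { apply (modular_family_vanishes_bigO Z (fun j t => f1 j t * f1 (j + 1) t - E4 t)
      (fun j X => f1_series j X * f1_series (j + 1) X - e4 (1 * X ^ 2)) 2 2 2 (29 / 100)); auto.
    - intros k. apply (disc_holo_minus (fun X => f1_series k X * f1_series (k + 1) X)).
      apply (disc_holo_mult (f1_series k)); apply f1_series_holo. disc_holo_auto.
    - intros k t _. rewrite !f1_level, (E4_level 2) by lia. auto.
    - exact f1_product_expansion.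
    - intros k t Hk. exists (k - 1)%Z. rewrite !f1_shift, E4_shift by auto.
      replace (k - 1 + 1)%Z with k by lia. auto.
    - intros k t Hk. exists (k + 1)%Z. rewrite !f1_shift, E4_shift by auto. auto.
    - intros k t Hk. exists (k - 1)%Z. rewrite !f1_inversion, E4_inversion by auto.
      replace (k - 1 + 1)%Z with k by lia.
      replace (sgn (k - 1)) with (- sgn k).
      2:{ assert (X := sgn_succ (k - 1)). replace (k - 1 + 1)%Z with k in X by lia. rewrite X. ring. }
      assert (S3 := signed_root_sqr k). unfold signed_root in S3.
      set (q := sgn k) in *. set (w := sqrt_neg 3) in *. simpl Nat.mul.
      transitivity (t ^ 4 * ((1 - q * w * (q * w)) / 4 * (f1 k t * f1 (k + 1) t) - E4 t)). field.
      rewrite S3. field.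
    - split. apply exp_lower_bound_2. lra.
    - simpl. lra. }
  cbv beta in V. replace (f1 j tau * f1 (j + 1) tau) with (f1 j tau * f1 (j + 1) tau - E4 tau + E4 tau) by ring.
  rewrite V. ring.
Qed.

(** * The functions g1 *)

(* [omega_pow j] is rho^j. *)
Definition omega_pow (j : Z) : C := cis (2 * PI * (IZR j / 3)).

Lemma omega_pow_succ j : omega_pow (j + 1) = omega_pow j * omega.
Proof.
  unfold omega_pow, omega. rewrite <- cis_add, plus_IZR. f_equal. field.
Qed.

Lemma omega_pow_nat n : omega_pow (Z.of_nat n) = omega ^ n.
Proof. unfold omega_pow. rewrite <- INR_IZR_INZ. apply omega_turn. Qed.

Lemma omega_pow_opp j : omega_pow (- j) * omega_pow j = 1.
Proof.
  unfold omega_pow. rewrite <- cis_add, opp_IZR.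
  replace (2 * PI * (- IZR j / 3) + 2 * PI * (IZR j / 3))%R with 0%R by field. apply cis_0.
Qed.

Lemma omega_pow_cube j : omega_pow j ^ 3 = 1.
Proof.
  assert (N : forall n, omega_pow (Z.of_nat n) ^ 3 = 1).
  { intros n. rewrite omega_pow_nat, <- Cpow_mult_r, Nat.mul_comm, Cpow_mult_r, omega_cube. apply Cpow_1_l. }
  destruct (Z.le_ge_cases 0 j) as [H|H].
  - rewrite <- (Z2Nat.id j) by auto. apply N.
  - assert (X := N (Z.to_nat (- j))). rewrite Z2Nat.id in X by lia.
    transitivity (omega_pow j ^ 3 * omega_pow (- j) ^ 3). rewrite X; ring.
    rewrite <- Cpow_mult_l, (Cmult_comm (omega_pow j)), omega_pow_opp. apply Cpow_1_l.
Qed.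

Lemma Cmod_omega_pow j : Cmod (omega_pow j) = 1%R.
Proof. apply Cmod_cis. Qed.

Lemma rho_omega : rho = omega.
Proof.
  unfold rho, omega, sqrt_neg, cis, Cexp.
  replace (Re (RtoC (2 * PI / 3) * Ci)) with 0%R by (unfold Re, Cmult, RtoC, Ci; simpl; ring).
  replace (Im (RtoC (2 * PI / 3) * Ci)) with (2 * (PI / 3))%R by (unfold Im, Cmult, RtoC, Ci; simpl; field).
  rewrite exp_0, cos_2PI3, sin_2PI3.
  unfold Cdiv, Cinv, Cplus, Cmult, RtoC, Ci; simpl. f_equal; field.
Qed.

Lemma CpowZ_rho j : CpowZ rho j = omega_pow j.
Proof.
  rewrite rho_omega. destruct j as [|p|p]; unfold CpowZ.
  - unfold omega_pow. replace (2 * PI * (0 / 3))%R with 0%R by field. rewrite cis_0. auto.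
  - rewrite <- omega_pow_nat, positive_nat_Z. auto.
  - rewrite <- omega_pow_nat, positive_nat_Z.
    assert (X := omega_pow_opp (Zpos p)). change (- Z.pos p)%Z with (Z.neg p) in X.
    assert (N : omega_pow (Z.pos p) <> 0).
    { intro E. apply (RtoC_neq_0 1); [lra|]. rewrite <- X, E. ring. }
    replace (omega_pow (Z.neg p)) with (omega_pow (Z.neg p) * omega_pow (Z.pos p) / omega_pow (Z.pos p)) by (field; auto).
    rewrite X. field. auto.
Qed.

Lemma mod_3_cases j : exists k, (j = 3 * k \/ j = 1 + 3 * k \/ j = 2 + 3 * k)%Z.
Proof.
  exists (j / 3)%Z. assert (H := Z.mod_pos_bound j 3 ltac:(lia)). assert (E := Z.div_mod j 3 ltac:(lia)). lia.
Qed.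

Lemma sum_n_3 (u : nat -> C) : sum_n (G := C_AbelianMonoid) u 2 = u 0%nat + u 1%nat + u 2%nat.
Proof. rewrite !sum_Sn, sum_O. reflexivity. Qed.

(* The Hecke relation at 3 trades the two terms of [g1] for the missing one. *)
Lemma g1_hecke j tau : (0 < Im tau)%R ->
  g1 j tau = E2 ((tau + RtoC (IZR j)) / RtoC 3) / 4 + 9 / 4 * E2 (RtoC 3 * tau) - 3 / 2 * E2 tau.
Proof.
  intros Ht. assert (Hk := E2_hecke_3 tau Ht). unfold g1. rewrite sum_n_3.
  change (RtoC (INR 0)) with (RtoC 0). change (RtoC (INR 1)) with (RtoC 1). change (RtoC (INR 2)) with (RtoC 2).
  set (a := E2 ((tau + RtoC 0) / RtoC 3)) in *. set (b := E2 ((tau + RtoC 1) / RtoC 3)) in *.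
  set (c := E2 ((tau + RtoC 2) / RtoC 3)) in *.
  destruct (mod_3_cases j) as [k Hj].
  assert (Z0 : Z.eqb ((Z.of_nat 0 - j) mod 3) 0 = Z.eqb (j mod 3) 0).
  { apply Bool.eq_iff_eq_true. rewrite !Z.eqb_eq. Z.div_mod_to_equations. lia. }
  assert (Z1 : Z.eqb ((Z.of_nat 1 - j) mod 3) 0 = Z.eqb (j mod 3) 1).
  { apply Bool.eq_iff_eq_true. rewrite !Z.eqb_eq. Z.div_mod_to_equations. lia. }
  assert (Z2 : Z.eqb ((Z.of_nat 2 - j) mod 3) 0 = Z.eqb (j mod 3) 2).
  { apply Bool.eq_iff_eq_true. rewrite !Z.eqb_eq. Z.div_mod_to_equations. lia. }
  rewrite Z0, Z1, Z2. clear Z0 Z1 Z2.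
  replace (E2 (RtoC 3 * tau)) with ((12 * E2 tau - a - b - c) / 9) by (rewrite <- Hk; field).
  destruct Hj as [->|[->| ->]].
  - rewrite (E2_third_shift tau 0 (3 * k)) by (auto; exists k; lia). fold a.
    replace ((3 * k) mod 3)%Z with 0%Z by (Z.div_mod_to_equations; lia). simpl Z.eqb. cbv iota. field.
  - rewrite (E2_third_shift tau 1 (1 + 3 * k)) by (auto; exists k; lia). fold b.
    replace ((1 + 3 * k) mod 3)%Z with 1%Z by (Z.div_mod_to_equations; lia). simpl Z.eqb. cbv iota. field.
  - rewrite (E2_third_shift tau 2 (2 + 3 * k)) by (auto; exists k; lia). fold c.
    replace ((2 + 3 * k) mod 3)%Z with 2%Z by (Z.div_mod_to_equations; lia). simpl Z.eqb. cbv iota. field.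
Qed.

Lemma g1_shift_Z j (n : Z) tau : (0 < Im tau)%R -> g1 j (tau + RtoC (IZR n)) = g1 (j + n) tau.
Proof.
  intros Ht. rewrite !g1_hecke by (rewrite ?Im_shift; auto).
  replace (RtoC 3 * (tau + RtoC (IZR n))) with (RtoC 3 * tau + RtoC (IZR (3 * n))) by (rewrite mult_IZR, RtoC_mult; ring).
  rewrite !E2_shift_Z by (rewrite ?Im_scal; lra).
  replace (tau + RtoC (IZR n) + RtoC (IZR j)) with (tau + RtoC (IZR (j + n))) by (rewrite plus_IZR, RtoC_plus; ring).
  auto.
Qed.

Theorem g1_shift j tau : (0 < Im tau)%R -> g1 j (tau + RtoC 1) = g1 (j + 1) tau.
Proof. apply (g1_shift_Z j 1). Qed.

(** For j divisible by 3 inversion exchanges the terms at tau/3 and 3 tau, which are weighted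
    symmetrically. Otherwise it exchanges the residues 1 and 2, and the Hecke relation expresses the
    outcome as the negative of the original combination. *)
Theorem g1_inversion j tau : (0 < Im tau)%R -> g1 j (- RtoC 1 / tau) = eps_sign j * tau ^ 2 * g1 j tau.
Proof.
  intros Ht. assert (Ht' := Im_opp_inv_pos tau Ht). rewrite !g1_hecke by auto.
  assert (Hk := E2_hecke_3 tau Ht).
  set (a := E2 ((tau + RtoC 0) / RtoC 3)) in *. set (b := E2 ((tau + RtoC 1) / RtoC 3)) in *.
  set (c := E2 ((tau + RtoC 2) / RtoC 3)) in *.
  rewrite E2_S, (E2_S_multiple 3) by (auto; lra).
  assert (Ea : E2 (tau / RtoC 3) = a) by (unfold a; do 2 f_equal; ring). rewrite Ea.
  unfold eps_sign.
  destruct (mod_3_cases j) as [k [->|[->| ->]]].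
  - rewrite !(E2_third_shift _ 0 (3 * k)) by (auto; exists k; lia). fold a.
    replace ((3 * k) mod 3)%Z with 0%Z by (Z.div_mod_to_equations; lia). simpl Z.eqb. cbv iota.
    replace (- RtoC 1 / tau + RtoC (IZR 0)) with (- RtoC 1 / tau) by ring.
    rewrite (E2_S_fraction 3) by (auto; lra). field.
  - rewrite !(E2_third_shift _ 1 (1 + 3 * k)) by (auto; exists k; lia). fold b.
    replace ((1 + 3 * k) mod 3)%Z with 1%Z by (Z.div_mod_to_equations; lia). simpl Z.eqb. cbv iota.
    rewrite (E2_S_shifted 3 1 tau) by (auto; lia).
    replace (tau - RtoC 1) with (tau + RtoC (IZR (-1))) by (rewrite RtoC_minus_1; ring).
    rewrite <- (E2_third_shift tau (-1) 2) by (auto; exists 1%Z; lia). fold c.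
    replace (E2 (RtoC 3 * tau)) with ((12 * E2 tau - a - b - c) / 9) by (rewrite <- Hk; field).
    rewrite RtoC_minus_1. field.
  - rewrite !(E2_third_shift _ 2 (2 + 3 * k)) by (auto; exists k; lia). fold c.
    replace ((2 + 3 * k) mod 3)%Z with 2%Z by (Z.div_mod_to_equations; lia). simpl Z.eqb. cbv iota.
    rewrite (E2_third_shift (- RtoC 1 / tau) (-1) 2) by (auto; exists 1%Z; lia).
    rewrite (E2_S_shifted 3 (-1) tau) by (auto; lia).
    replace (tau - RtoC (-1)) with (tau + RtoC 1) by (rewrite RtoC_minus_1; ring). fold b.
    replace (E2 (RtoC 3 * tau)) with ((12 * E2 tau - a - b - c) / 9) by (rewrite <- Hk; field).
    rewrite RtoC_minus_1. field.
Qed.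

(** Translation moves the point to i and the index to 0. As i is fixed by inversion and i^2 = -1,
    the value there equals its own negative. *)
Theorem g1_zero j : g1 j (- RtoC (IZR j) + sqrt_neg 1) = RtoC 0.
Proof.
  assert (E : sqrt_neg 1 = Ci) by (unfold sqrt_neg; rewrite sqrt_1; ring).
  assert (I : (0 < Im Ci)%R) by (simpl; lra).
  rewrite E. replace (- RtoC (IZR j) + Ci) with (Ci + RtoC (IZR (- j))) by (rewrite opp_IZR, RtoC_opp; ring).
  rewrite g1_shift_Z by auto. replace (j + - j)%Z with 0%Z by lia.
  assert (X := g1_inversion 0 Ci I).
  replace (- RtoC 1 / Ci) with Ci in X.
  2:{ rewrite <- Ci_sqr. field. apply Ci_neq_0. }
  unfold eps_sign in X. simpl Z.eqb in X. cbv iota in X.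
  replace (Ci ^ 2) with (- RtoC 1) in X by (rewrite <- Ci_sqr; simpl; ring).
  set (v := g1 0 Ci) in *. replace v with ((v + v) / 2) by field. rewrite X at 2. field.
Qed.

Lemma G1_shift j tau : G1 j (tau + RtoC 1) = G1 (j + 1) tau.
Proof. unfold G1. rewrite !CpowZ_rho, E4_shift, eta8_shift, omega_pow_succ. ring. Qed.

Lemma G1_inversion j tau : (0 < Im tau)%R -> G1 j (- RtoC 1 / tau) = tau ^ 4 * G1 j tau.
Proof. intros Ht. unfold G1. rewrite E4_inversion, eta8_inversion by auto. ring. Qed.

Lemma eps_sign_sqr j : eps_sign j ^ 2 = 1.
Proof. unfold eps_sign. destruct (Z.eqb _ _); rewrite ?RtoC_minus_1; simpl; ring. Qed.

Lemma eps_sign_product j : eps_sign j * eps_sign (j + 1) * eps_sign (j + 2) = 1.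
Proof.
  unfold eps_sign. destruct (mod_3_cases j) as [k [->|[->| ->]]].
  - replace ((3 * k) mod 3)%Z with 0%Z by (Z.div_mod_to_equations; lia).
    replace ((3 * k + 1) mod 3)%Z with 1%Z by (Z.div_mod_to_equations; lia).
    replace ((3 * k + 2) mod 3)%Z with 2%Z by (Z.div_mod_to_equations; lia).
    simpl Z.eqb. cbv iota. rewrite RtoC_minus_1. ring.
  - replace ((1 + 3 * k) mod 3)%Z with 1%Z by (Z.div_mod_to_equations; lia).
    replace ((1 + 3 * k + 1) mod 3)%Z with 2%Z by (Z.div_mod_to_equations; lia).
    replace ((1 + 3 * k + 2) mod 3)%Z with 0%Z by (Z.div_mod_to_equations; lia).
    simpl Z.eqb. cbv iota. rewrite RtoC_minus_1. ring.
  - replace ((2 + 3 * k) mod 3)%Z with 2%Z by (Z.div_mod_to_equations; lia).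
    replace ((2 + 3 * k + 1) mod 3)%Z with 0%Z by (Z.div_mod_to_equations; lia).
    replace ((2 + 3 * k + 2) mod 3)%Z with 1%Z by (Z.div_mod_to_equations; lia).
    simpl Z.eqb. cbv iota. rewrite RtoC_minus_1. ring.
Qed.

(** Modelled on [g1_hecke] and not on the definition of [g1], so that j enters through a single
    rotation. *)
Definition g1_series (j : Z) (X : C) : C :=
  / RtoC 4 * e2 (omega_pow j * X ^ 1) + 9 / 4 * e2 (1 * X ^ 9) - 3 / 2 * e2 (1 * X ^ 3).

Lemma g1_level j tau : (0 < Im tau)%R -> g1 j tau = g1_series j (nome (/ INR 3) tau).
Proof.
  intros Ht. rewrite g1_hecke by auto. unfold g1_series. destruct (E2_level_3 tau) as (_ & -> & ->).
  assert (T3 : RtoC 3 <> 0) by (apply RtoC_neq_0; lra).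
  rewrite (E2_level 3 1 (IZR j / 3) (omega_pow j) tau ((tau + RtoC (IZR j)) / RtoC 3)); auto.
  unfold Cdiv. ring.
  replace (INR 1 / INR 3)%R with (/ 3)%R by (simpl; field).
  rewrite RtoC_div, RtoC_inv by lra. field.
Qed.

Lemma g1_series_holo j : disc_holo (g1_series j).
Proof. unfold g1_series. disc_holo_auto; auto using Cmod_1_le. rewrite Cmod_omega_pow. lra. Qed.

(* The factorisation of A^3 + B^3 + C^3 - 3ABC over the cube roots of unity. *)
Lemma cubic_norm (a b c w : C) : w * w = - (1) - w ->
  (a + b + c) * (a + w * b + w ^ 2 * c) * (a + w ^ 2 * b + w ^ 4 * c) = a ^ 3 + b ^ 3 + c ^ 3 - 3 * a * b * c.
Proof.
  intros H. assert (H2 : w ^ 2 = - (1) - w) by (rewrite <- H; simpl; ring).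
  assert (H4 : w ^ 4 = w).
  { transitivity (w ^ 2 * w ^ 2). simpl; ring. rewrite H2. transitivity (1 + 2 * w + w * w). ring. rewrite H. ring. }
  rewrite H4, H2.
  assert (P : w * (- (1) - w) = 1).
  { transitivity (- w - w * w). ring. rewrite H. ring. }
  transitivity ((a + b + c) * (a * a + (b * b + c * c) * (w * (- (1) - w)) - a * (b + c) + b * c * (1 - 2 * (w * (- (1) - w))))).
  ring. rewrite P. ring.
Qed.

Section LevelThree.
Let D := fun i : Z * C => (17 / 20 <= Im (snd i))%R.
Let x := fun i : Z * C => nome (/ INR 3) (snd i).

Lemma level_three_radius : (0 <= 45 / 100 < 1)%R.
Proof. lra. Qed.

Lemma level_three_small i : D i -> (Cmod (x i) <= 45 / 100)%R.
Proof. intros Hi. apply nome_small; auto. apply exp_lower_bound_3. Qed.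

Lemma level_three_x_bounded : bigO D x 0 x.
Proof.
  apply (bigO_bounded _ _ _ 1). intros i Hi. assert (X := level_three_small i Hi). lra.
Qed.

Lemma omega_pow_bounded (a : Z) : bigO D x 0 (fun i => omega_pow (fst i + a)).
Proof. apply (bigO_bounded _ _ _ 1). intros i _. rewrite Cmod_omega_pow. lra. Qed.

(** The expansion of [g1 j] through degree 3 at t = rho^j q^(1/3). As t^3 = q, the term E2(tau)
    joins the cubic coefficient: -24 + 36 = 12. *)
Definition g1_head (t : C) : C := 1 + - (6) * t + - (18) * t ^ 2 + 12 * t ^ 3.

Lemma g1_expansion (a : Z) :
  bigO D x 4 (fun i => g1_series (fst i + a) (x i) - g1_head (omega_pow (fst i + a) * x i)).
Proof.
  assert (Hr := level_three_radius). assert (Hx := level_three_small).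
  assert (L1 := expansion_var_le_1 D x _ Hr Hx).
  set (c := fun i : Z * C => omega_pow (fst i + a)).
  apply (bigO_ext _ _ _ (fun i => / RtoC 4 * (e2 (c i * x i ^ 1)
      - (1 - 24 * (c i * x i) - 72 * (c i * x i) ^ 2 - 96 * (c i * x i) ^ 3))
    + (9 / 4 * (e2 (1 * x i ^ 9) - 1) + (- (3 / 2)) * (e2 (1 * x i ^ 3) - (1 - 24 * x i ^ 3))))).
  - intros i _. unfold g1_series, g1_head. fold (c i).
    assert (Q : (c i * x i) ^ 3 = x i ^ 3) by (rewrite Cpow_mult_l; unfold c; rewrite omega_pow_cube; ring).
    rewrite Q. field.
  - apply bigO_plus; [|apply bigO_plus]; apply bigO_scal.
    + apply (e2_order_3 D x _ Hr Hx c). intros i _. unfold c. rewrite Cmod_omega_pow. lra.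
    + apply (bigO_weaken _ _ 9); [auto|lia|]. apply (e2_order_0 D x _ Hr Hx (fun _ => RtoC 1)). auto using Cmod_1_le.
    + apply (bigO_weaken _ _ 6); [auto|lia|]. apply (e2_cube_order_1 D x _ Hr Hx).
Qed.

(** The square of the head begins 1 - 12 t + 0 t^2 + 240 t^3, in agreement with E4 - 12 rho^j eta^8
    below degree 4. *)
Lemma g1_square_expansion : bigO D x 4 (fun i => g1_series (fst i) (x i) ^ 2
   - (e4 (1 * x i ^ 3) - RtoC 12 * omega_pow (fst i) * (x i * euler_product (1 * x i ^ 3) ^ 8))).
Proof.
  assert (Hr := level_three_radius). assert (Hx := level_three_small). assert (X0 := level_three_x_bounded).
  assert (L1 := expansion_var_le_1 D x _ Hr Hx).
  set (c := fun i : Z * C => omega_pow (fst i)).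
  assert (C0 : bigO D x 0 c) by (apply (bigO_bounded _ _ _ 1); intros i _; unfold c; rewrite Cmod_omega_pow; lra).
  assert (HR := g1_expansion 0).
  set (R := fun i => g1_series (fst i) (x i) - g1_head (c i * x i)).
  assert (R4 : bigO D x 4 R).
  { eapply bigO_ext; [|exact HR]. intros i _. unfold R, c. rewrite Z.add_0_r. auto. }
  assert (R0 : bigO D x 0 R) by (apply (bigO_weaken _ _ 4); [auto|lia|auto]).
  assert (H4 := e4_cube_order_1 D x _ Hr Hx). assert (HP := euler_order_0 D x _ Hr Hx 2 8).
  apply (bigO_ext _ _ _ (fun i => x i ^ 4 * (c i ^ 4 * (180 + - (432) * (c i * x i) + 144 * (c i * x i) ^ 2))
    + (R i * (2 * (1 + - (6) * (c i * x i) + - (18) * (c i * x i) ^ 2 + 12 * (c i * x i) ^ 3) + R i)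
    + ((- (1)) * (e4 (1 * x i ^ 3) - (1 + 240 * x i ^ 3))
    + (12 * c i) * (x i ^ 1 * (euler_product (1 * x i ^ 3) ^ 8 - 1)))))).
  - intros i _. fold (c i).
    replace (g1_series (fst i) (x i)) with (g1_head (c i * x i) + R i) by (unfold R; ring).
    (* Powers of omega have cube 1, so x^3 can be read as the cube of c x, the variable of
       [g1_head]. *)
    assert (Q : x i ^ 3 = c i ^ 3 * x i ^ 3) by (unfold c; rewrite omega_pow_cube; ring).
    set (P := euler_product (1 * x i ^ 3)). set (e := e4 (1 * x i ^ 3)).
    rewrite Q. unfold g1_head. ring.
  - apply bigO_plus; [|apply bigO_plus; [|apply bigO_plus]].
    + apply (bigO_mult D x 4 0). apply bigO_pow_var. bigO_0.
    + apply (bigO_mult D x 4 0); auto. bigO_0.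
    + apply bigO_scal. apply (bigO_weaken _ _ 6); [auto|lia|auto].
    + apply (bigO_mult D x 0 4). bigO_0. apply (bigO_mult D x 1 3); auto. apply bigO_pow_var.
Qed.

(** The three heads are the conjugates of (1 + 12 t^3) - 6 t - 18 t^2 under t -> omega t, and
    [cubic_norm] multiplies them: the coefficient of t^3 is 36 - 216 - 324 = -504. *)
Lemma g1_product_expansion : bigO D x 4 (fun i =>
  g1_series (fst i) (x i) * g1_series (fst i + 1) (x i) * g1_series (fst i + 2) (x i) - e6 (1 * x i ^ 3)).
Proof.
  assert (Hr := level_three_radius). assert (Hx := level_three_small). assert (X0 := level_three_x_bounded).
  assert (L1 := expansion_var_le_1 D x _ Hr Hx).
  set (g := fun (a : Z) (i : Z * C) => g1_series (fst i + a) (x i)).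
  set (p := fun (a : Z) (i : Z * C) => g1_head (omega_pow (fst i + a) * x i)).
  set (R := fun (a : Z) (i : Z * C) => g a i - p a i).
  assert (R4 : forall a, bigO D x 4 (R a)) by (intros a; exact (g1_expansion a)).
  assert (R0 : forall a, bigO D x 0 (R a)) by (intros a; apply (bigO_weaken _ _ 4); [auto|lia|auto]).
  assert (P0 : forall a, bigO D x 0 (p a)).
  { intros a. unfold p, g1_head. assert (W := omega_pow_bounded a). bigO_0. }
  assert (R00 := R0 0%Z). assert (R01 := R0 1%Z). assert (R02 := R0 2%Z).
  assert (P00 := P0 0%Z). assert (P01 := P0 1%Z). assert (P02 := P0 2%Z).
  set (R_0 := R 0%Z) in *. set (R_1 := R 1%Z) in *. set (R_2 := R 2%Z) in *.
  set (p_0 := p 0%Z) in *. set (p_1 := p 1%Z) in *. set (p_2 := p 2%Z) in *.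
  assert (H6 := e6_cube_order_1 D x _ Hr Hx).
  apply (bigO_ext _ _ _ (fun i => x i ^ 6 * (- (9288) + 1728 * x i ^ 3)
    + (R_0 i * ((p_1 i + R_1 i) * (p_2 i + R_2 i)) + (R_1 i * (p_0 i * (p_2 i + R_2 i))
    + (R_2 i * (p_0 i * p_1 i) + (- (1)) * (e6 (1 * x i ^ 3) - (1 - 504 * x i ^ 3))))))).
  - intros i _.
    assert (G : forall a, g1_series (fst i + a) (x i) = p a i + R a i) by (intros a; unfold R, g; ring).
    replace (g1_series (fst i) (x i)) with (p_0 i + R_0 i) by (unfold p_0, R_0; rewrite <- G, Z.add_0_r; auto).
    rewrite !G. fold p_1 p_2 R_1 R_2.
    assert (Key : p_0 i * p_1 i * p_2 i = 1 - 504 * x i ^ 3 + x i ^ 6 * (- (9288) + 1728 * x i ^ 3)).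
    { set (t := omega_pow (fst i) * x i).
      assert (T3 : x i ^ 3 = t ^ 3) by (unfold t; rewrite Cpow_mult_l, omega_pow_cube; ring).
      assert (E0 : p_0 i = (1 + 12 * t ^ 3) + - (6) * t + - (18) * t ^ 2).
      { unfold p_0, p, g1_head. rewrite Z.add_0_r. fold t. ring. }
      assert (E1 : p_1 i = (1 + 12 * t ^ 3) + omega * (- (6) * t) + omega ^ 2 * (- (18) * t ^ 2)).
      { unfold p_1, p, g1_head. rewrite omega_pow_succ.
        replace (omega_pow (fst i) * omega * x i) with (omega * t) by (unfold t; ring).
        rewrite (Cpow_mult_l omega t 3), omega_cube, Cpow_mult_l. ring. }
      assert (E2 : p_2 i = (1 + 12 * t ^ 3) + omega ^ 2 * (- (6) * t) + omega ^ 4 * (- (18) * t ^ 2)).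
      { unfold p_2, p, g1_head. replace (fst i + 2)%Z with (fst i + 1 + 1)%Z by lia. rewrite !omega_pow_succ.
        replace (omega_pow (fst i) * omega * omega * x i) with (omega ^ 2 * t) by (unfold t; simpl; ring).
        assert (W : (omega ^ 2) ^ 3 = 1) by (transitivity (omega ^ 3 * omega ^ 3); [ring|rewrite omega_cube; ring]).
        rewrite (Cpow_mult_l (omega ^ 2) t 3), W. ring. }
      rewrite E0, E1, E2, cubic_norm by apply omega_sqr_plus.
      replace (x i ^ 6) with (x i ^ 3 * x i ^ 3) by (simpl; ring). rewrite T3. ring. }
    set (e := e6 (1 * x i ^ 3)).
    transitivity (p_0 i * p_1 i * p_2 i - (1 - 504 * x i ^ 3) + (R_0 i * ((p_1 i + R_1 i) * (p_2 i + R_2 i))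
      + (R_1 i * (p_0 i * (p_2 i + R_2 i)) + (R_2 i * (p_0 i * p_1 i) + (- (1)) * (e - (1 - 504 * x i ^ 3)))))).
    rewrite Key. ring. ring.
  - apply bigO_plus; [|apply bigO_plus; [|apply bigO_plus; [|apply bigO_plus]]].
    + apply (bigO_weaken _ _ 6); [auto|lia|]. apply (bigO_mult D x 6 0). apply bigO_pow_var. bigO_0.
    + apply (bigO_mult D x 4 0). apply R4. bigO_0.
    + apply (bigO_mult D x 4 0). apply R4. bigO_0.
    + apply (bigO_mult D x 4 0). apply R4. bigO_0.
    + apply bigO_scal. apply (bigO_weaken _ _ 6); [auto|lia|auto].
Qed.

End LevelThree.

Theorem g1_square j tau : (0 < Im tau)%R -> g1 j tau ^ 2 = G1 j tau.
Proof.
  intros Ht.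
  assert (V : (fun j t => g1 j t ^ 2 - G1 j t) j tau = 0).
  { apply (modular_family_vanishes_bigO Z (fun j t => g1 j t ^ 2 - G1 j t)
      (fun j X => g1_series j X ^ 2 - (e4 (1 * X ^ 3) - RtoC 12 * omega_pow j * (X * euler_product (1 * X ^ 3) ^ 8)))
      3 4 2 (45 / 100)); auto; try lia.
    - intros k. apply (disc_holo_minus (fun X => g1_series k X ^ 2)).
      apply (disc_holo_pow (g1_series k)), g1_series_holo. disc_holo_auto.
    - intros k t Hk. rewrite g1_level by auto. unfold G1.
      rewrite CpowZ_rho, (E4_level 3), eta_pow_8, <- (euler_level 3) by lia. auto.
    - exact g1_square_expansion.
    - intros k t Hk. exists (k - 1)%Z. rewrite g1_shift, G1_shift by auto.
      replace (k - 1 + 1)%Z with k by lia. auto.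
    - intros k t Hk. exists (k + 1)%Z. rewrite g1_shift, G1_shift by auto. auto.
    - intros k t Hk. exists k. rewrite g1_inversion, G1_inversion by auto.
      rewrite !Cpow_mult_l, eps_sign_sqr. simpl Nat.mul. ring.
    - split. apply exp_lower_bound_3. lra.
    - simpl. lra. }
  cbv beta in V. replace (g1 j tau ^ 2) with (g1 j tau ^ 2 - G1 j tau + G1 j tau) by ring.
  rewrite V. ring.
Qed.

Theorem g1_product j tau : (0 < Im tau)%R -> g1 j tau * g1 (j + 1) tau * g1 (j + 2) tau = E6 tau.
Proof.
  intros Ht.
  assert (V : (fun j t => g1 j t * g1 (j + 1) t * g1 (j + 2) t - E6 t) j tau = 0).
  (* Weight 6 at level 3 is the case that forces order 4: with order 3 the quantity 8
     (45/100)^3/(55/100) would exceed 1. *)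
  { apply (modular_family_vanishes_bigO Z (fun j t => g1 j t * g1 (j + 1) t * g1 (j + 2) t - E6 t)
      (fun j X => g1_series j X * g1_series (j + 1) X * g1_series (j + 2) X - e6 (1 * X ^ 3)) 3 4 3 (45 / 100)); auto; try lia.
    - intros k. apply (disc_holo_minus (fun X => g1_series k X * g1_series (k + 1) X * g1_series (k + 2) X)).
      apply (disc_holo_mult (fun X => g1_series k X * g1_series (k + 1) X)).
      apply (disc_holo_mult (g1_series k)); apply g1_series_holo. apply g1_series_holo. disc_holo_auto.
    - intros k t Hk. rewrite !g1_level, (E6_level 3) by (auto; lia). auto.
    - exact g1_product_expansion.
    - intros k t Hk. exists (k - 1)%Z. rewrite !g1_shift, E6_shift by auto.
      replace (k - 1 + 1)%Z with k by lia. replace (k - 1 + 2 + 1)%Z with (k + 2)%Z by lia. auto.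
    - intros k t Hk. exists (k + 1)%Z. rewrite !g1_shift, E6_shift by auto.
      replace (k + 2 + 1)%Z with (k + 1 + 2)%Z by lia. auto.
    - intros k t Hk. exists k. rewrite !g1_inversion, E6_inversion by auto. simpl Nat.mul.
      transitivity (t ^ 6 * ((eps_sign k * eps_sign (k + 1) * eps_sign (k + 2)) * (g1 k t * g1 (k + 1) t * g1 (k + 2) t) - E6 t)).
      ring. rewrite eps_sign_product. ring.
    - split. apply exp_lower_bound_3. lra.
    - simpl. lra. }
  cbv beta in V.
  replace (g1 j tau * g1 (j + 1) tau * g1 (j + 2) tau) with
    (g1 j tau * g1 (j + 1) tau * g1 (j + 2) tau - E6 tau + E6 tau) by ring.
  rewrite V. ring.
Qed.

(* The cube of [f1 j] is [F1 (j + 1)], not [F1 j]: at q^(1/2) the coefficient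
   of the cube is 24 (-1)^j sqrt(-3) and that of [F1 j] is the opposite. *)
Theorem mainTheorem2 :
  (forall (j : Z) (tau : C), (0 < Im tau)%R ->
     f1 j tau ^ 3 = F1 (j + 1) tau /\
     f1 j tau * f1 (j + 1) tau = E4 tau /\
     f1 j ((sgn j + sqrt_neg 3) / RtoC 2) = RtoC 0 /\
     f1 j (tau + RtoC 1) = f1 (j + 1) tau /\
     f1 j (- RtoC 1 / tau) =
       (- RtoC 1 - sgn j * sqrt_neg 3) / RtoC 2 * tau ^ 2 * f1 (j + 1) tau) /\
  (forall (j : Z) (tau : C), (0 < Im tau)%R ->
     g1 j tau ^ 2 = G1 j tau /\
     g1 j tau * g1 (j + 1) tau * g1 (j + 2) tau = E6 tau /\
     g1 j (- RtoC (IZR j) + sqrt_neg 1) = RtoC 0 /\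
     g1 j (tau + RtoC 1) = g1 (j + 1) tau /\
     g1 j (- RtoC 1 / tau) = eps_sign j * tau ^ 2 * g1 j tau).
Proof.
  split; intros j tau Ht.
  - repeat split; auto using f1_cube, f1_product, f1_zero, f1_shift, f1_inversion.
  - repeat split; auto using g1_square, g1_product, g1_zero, g1_shift, g1_inversion.
Qed.
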